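(* Let $(T_\omega)_{\omega\in\Omega}$ be a random family of piecewise hyperbolic maps of $X$ in $X_\epsilon$, over the ergodic invertible system $(\Omega,\mathcal F,\mathbb P,\sigma)$, as described in the context, let $(\mu_\omega)_{\omega\in\Omega}$ be the associated equivariant family of probability measures, and let $g$ be an observable satisfying the regularity, boundedness and fiberwise centering conditions of the context. Assume that the non-random variance $\Sigma^2$ satisfies $\Sigma^2>0$. Then, for every bounded and continuous function $\phi\colon\mathbb R\to\mathbb R$ and $\mathbb P$-a.e. $\omega\in\Omega$, $$\lim_{n\to\infty}\int_X\phi\Big(\frac{S_ng(\omega,x)}{\sqrt n}\Big)\,d\mu_\omega(x)=\int\phi\,d\mathcal N(0,\Sigma^2),$$ where $\mathcal N(0,\Sigma^2)$ is the centered normal distribution with variance $\Sigma^2$.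
   Context: Piecewise hyperbolic maps (in the sense of Demers–Liverani). $X$ is a two-dimensional compact Riemannian manifold, possibly with boundary and not necessarily connected. There are finitely many pairwise disjoint open regions $X_i^+$ with piecewise $C^1$ boundary curves of finite length, $\bigcup_i\overline{X_i^+}=X$; $X_i^-=T(X_i^+)$ and $\bigcup_i\overline{X_i^-}=X$. $\mathcal S^\pm=X\setminus\bigcup_iX_i^\pm$. $T$ is a $C^2$ diffeomorphism from $X\setminus\mathcal S^+$ onto $X\setminus\mathcal S^-$ with a $C^2$ extension to each $\overline{X_i^+}$. There are two continuous strictly $DT$-invariant cone families $C^s,C^u$ on $X\setminus(\mathcal S^+\cup\partial X)$ with $\lambda=\inf_{x\notin\mathcal S^+}\inf_{v\in C^u}\|DTv\|/\|v\|>1$, $\mu_T=\inf_{x\notin\mathcal S^+}\inf_{v\in C^s}\|DTv\|/\|v\|<1$, $\mu_+^{-1}=\inf_{x\notin\mathcal S^-}\inf_{v\in C^s}\|DT^{-1}v\|/\|v\|>1$. Vectors tangent to the curves of $\mathcal S^-$ are bounded away from $C^s$. With $M(n)$ the maximal number of singularity curves of $T^{-n}$ (the curves of $\mathcal S_n^-$) meeting at a point, there are $\alpha_0>0$ and an integer $n_0>0$ with $\lambda\mu_T^{\alpha_0}>1$ and $(\lambda\mu_T^{\alpha_0})^{n_0}>M(n_0)$. Admissible leaves. Fix a finite atlas of $C^2$ charts $\chi_i:R_i\to X$, $R_i\subset(-r_i,r_i)^2$ ($R_i$ equal to this square, or, near $\partial X$, the part of it on one side of a boundary curve), such that the $\chi_i(R_i\cap(-r_i/2,r_i/2)^2)$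 cover $X$, the $C^2$ norms of $\chi_i^{\pm1}$ are close to $1$, and the horizontal direction lies in the stable cone, with cones around it mapped compatibly with $C^s$. Fix small $r_0>0$, small slope bound $\tau_0$ (so that graphs are tangent to the stable cones) and a curvature bound $B_0$; for $r\le r_0$ and $I_r=[-r,r]$, consider $F\in C^2(I_r,\mathbb R)$ with $F(0)=0$, $|F|_{C^1}\le\tau_0$, $|F|_{C^2}\le B_0$, and put $G_F(t)=\chi_i(x+(t,F(t)))$, where $x\in R_i\cap(-r_i/2,r_i/2)^2$ and $x+(t,F(t))\in R_i$. $\Sigma_{\rm leaf}$ is the set of all leaves $W=G_F(I_r)$. For leaves $W_1,W_2$ with data $(i_k,x_k,r_k,F_k)$, $d_\Sigma(W_1,W_2)=|x_1-x_2|+|F_1-F_2|_{C^1(I_{r_1})}$ if $i_1=i_2$, $r_1=r_2$, and $=\infty$ otherwise; for functions $\varphi_k$ on $W_k$, $d_q(\varphi_1,\varphi_2)=|\varphi_1\circ G_{F_1}-\varphi_2\circ G_{F_2}|_{C^q(I_{r_1},\mathbb C)}$. Norms. Fix $\alpha,\beta,q<1$ with $0<\beta\le\alpha\le1-q\le\alpha_0$, and small $b,\varepsilon_0>0$. $|W|$ is the length of $W$, $m$ the induced Riemannian measure on leaves, and $|\varphi|_{W,\alpha,q}=|W|^\alpha|\varphi|_{C^q(W,\mathbb C)}$. For $h\in C^1(X,\mathbb C)$: $|h|_w=\sup_W\sup_{|\varphi|_{C^1(W)}\le1}|\int_Wh\varphi\,dm|$; $\|h\|_s=\sup_W\sup_{\varphi\in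 C^1(W,\mathbb C),|\varphi|_{W,\alpha,q}\le1}|\int_Wh\varphi\,dm|$; $\|h\|_u=\sup_{\varepsilon\le\varepsilon_0}\sup_{d_\Sigma(W_1,W_2)\le\varepsilon}\sup_{|\varphi_k|_{C^1(W_k)}\le1,\,d_q(\varphi_1,\varphi_2)\le\varepsilon}\varepsilon^{-\beta}|\int_{W_1}h\varphi_1\,dm-\int_{W_2}h\varphi_2\,dm|$; $\|h\|=\|h\|_s+b\|h\|_u$. $\mathcal B$, $\mathcal B_w$ are the completions of $C^1(X,\mathbb C)$ for $\|\cdot\|$, $|\cdot|_w$. Elements of $\mathcal B$ are distributions, $|h(\varphi)|\le C|h|_w|\varphi|_{C^1}$, $h(\varphi)=\int_Xh\varphi$ for $h\in C^1$; $h\ge0$ means $h(\varphi)\ge0$ for all $C^1$ functions $\varphi\ge0$. For $f\in C^1(X,\mathbb C)$, $f\cdot h\in\mathcal B$ is the continuous extension of multiplication. The transfer operator of a piecewise hyperbolic map $S$ is $(\mathcal L_Sh)(\varphi)=h(\varphi\circ S)$, $\mathcal L_Sh=(h/|\det DS|)\circ S^{-1}$ for functions $h$. Cocycle. $T$ is a piecewise hyperbolic map whose transfer operator is quasicompact on $\mathcal B$ with $1$ a simple eigenvalue and no other eigenvalue of modulus $1$. $X_\epsilon$ is the $\epsilon$-neighbourhood of $T$ (Demers–Liverani) in the class of piecewise hyperbolic maps with uniform hyperbolicity and complexity constants and second derivatives bounded by a fixed $B_*$: maps whose singularity sets are $\epsilon$-close to those of $T$ and which are $\epsilon$-close to $T$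 away from $\epsilon$-neighbourhoods of the singularity sets. $\Omega$ is a Borel subset of a complete separable metric space, $\mathcal F$ its Borel $\sigma$-algebra, $\mathbb P$ a probability, $\sigma:\Omega\to\Omega$ an ergodic $\mathbb P$-preserving homeomorphism; $\omega\mapsto T_\omega\in X_\epsilon$ is measurable with countable range. $\mathcal L_\omega=\mathcal L_{T_\omega}$, $\mathcal L^{(n)}_\omega=\mathcal L_{\sigma^{n-1}\omega}\circ\cdots\circ\mathcal L_\omega$, $T^{(n)}_\omega=T_{\sigma^{n-1}\omega}\circ\cdots\circ T_\omega$. Throughout $\epsilon$ is fixed small enough that the unit ball of $\mathcal B$ is relatively compact in $\mathcal B_w$ and, for some $D,\lambda',B>0$, $a\in(0,1)$ and all $\omega,n$, $h\in\mathcal B$: $\|\mathcal L_\omega^{(n)}h\|\le De^{-\lambda' n}\|h\|$ if $h(1)=0$; $|\mathcal L_\omega^{(n)}h|_w\le B|h|_w$; $\|\mathcal L_\omega^{(n)}h\|\le Ba^n\|h\|+B|h|_w$. $(h^0_\omega)$ is the unique measurable family in $\mathcal B$ with $\mathcal L_\omega h^0_\omega=h^0_{\sigma\omega}$, $h^0_\omega\ge0$, $h^0_\omega(1)=1$ a.e., $\operatorname{ess\,sup}\|h^0_\omega\|<\infty$; $h^0_\omega$ is a probability measure on $X$, denoted $\mu_\omega$. $\mu(A\times B)=\int_A\mu_\omega(B)\,d\mathbb P(\omega)$; $\tau(\omega,x)=(\sigma\omega,T_\omega x)$. Observable. $g:\Omega\times X\to\mathbb R$ is measurable, $g(\omega,\cdot)\in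 C^1$, $\operatorname{ess\,sup}_\omega\|g(\omega,\cdot)\|_{C^1}<\infty$, and $h_\omega^0(g(\omega,\cdot))=0$ for a.e. $\omega$. $S_ng(\omega,x)=\sum_{i=0}^{n-1}g(\sigma^i\omega,T^{(i)}_\omega x)$. $\Sigma^2=\int g^2\,d\mu+2\sum_{n\ge1}\int g\cdot(g\circ\tau^n)\,d\mu$. *)

(* Defs.v *)
From HB Require Import structures.
From mathcomp Require Import all_boot all_order all_algebra.
From mathcomp Require Import all_classical all_reals all_analysis.
From mathcomp Require Import complex.

Set Implicit Arguments.
Unset Strict Implicit.
Unset Printing Implicit Defensive.

Import Order.TTheory GRing.Theory Num.Theory.
Import numFieldNormedType.Exports.

#[global] Open Scope classical_set_scope.
#[global] Open Scope ring_scope.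
#[global] Open Scope complex_scope.

Notation borel T := (g_sigma_algebraType (@open T)).

Section Calculus.
Context {R : realType}.

(* [f] is differentiable at [p] relatively to [A], with derivative [L]; at a
   boundary point of [A] this is the one-sided derivative. *)
Definition is_dwithin (V W : normedModType R) (A : set V) (f : V -> W) (p : V)
    (L : V -> W) : Prop :=
  forall e : R, 0 < e ->
    \forall q \near within A (nbhs p), `|f q - f p - L (q - p)| <= e * `|q - p|.

Definition lin2 (W : normedModType R) (J : W * W) (u : R * R) : W :=
  u.1 *: J.1 + u.2 *: J.2.

Definition jac (W : normedModType R) (A : set (R * R)) (f : R * R -> W)
    (p : R * R) : W * W :=
  xget (0, 0) [set J | is_dwithin A f p (lin2 J)].

(* Meant for sets [A] on which derivatives are unique, such as relatively open
   subsets of a half-plane or of one side of a regular curve. *)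
Fixpoint Ck (k : nat) (W : normedModType R) (A : set (R * R))
    (f : R * R -> W) : Prop :=
  if k is k'.+1 then
    [/\ forall p, A p -> is_dwithin A f p (lin2 (jac A f p)),
        Ck k' A (fun p => (jac A f p).1) & Ck k' A (fun p => (jac A f p).2)]
  else {within A, continuous f}.

Definition der (W : normedModType R) (I : set R) (f : R -> W) (t : R) : W :=
  xget 0 [set d | is_dwithin I f t (fun s => s *: d)].

Fixpoint CkI (k : nat) (W : normedModType R) (I : set R) (f : R -> W) : Prop :=
  if k is k'.+1 then
    (forall t, I t -> is_dwithin I f t (fun s => s *: der I f t)) /\
    CkI k' I (der I f)
  else {within I, continuous f}.

Definition det2 (J : (R * R) * (R * R)) : R :=
  J.1.1 * J.2.2 - J.1.2 * J.2.1.

Definition enorm (u : R * R) : R := Num.sqrt (u.1 ^+ 2 + u.2 ^+ 2).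

Definition halfplane : set (R * R) := [set p | 0 <= p.2].

(* A triple (E, F, G) stands for the quadratic form E du^2 + 2F du dv + G dv^2. *)
Definition qform (m : R * R * R) (u : R * R) : R :=
  m.1.1 * u.1 ^+ 2 + 2 * m.1.2 * u.1 * u.2 + m.2 * u.2 ^+ 2.

Definition qdet (m : R * R * R) : R := m.1.1 * m.2 - m.1.2 ^+ 2.

Definition supn (T : Type) (A : set T) (f : T -> R) : \bar R :=
  ereal_sup [set (f t)%:E | t in A].

Definition cabs (z : R[i]) : R := complex.Re `|z|.

Definition cRe (T : Type) (f : T -> R[i]) (x : T) : R := complex.Re (f x).
Definition cIm (T : Type) (f : T -> R[i]) (x : T) : R := complex.Im (f x).
Definition r2c (T : Type) (f : T -> R) (x : T) : R[i] := (f x)%:C.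

Definition cint d (T : measurableType d) (mu : {measure set T -> \bar R})
    (D : set T) (f : T -> R[i]) : R[i] :=
  (\int[mu]_(x in D) cRe f x) +i* (\int[mu]_(x in D) cIm f x).

End Calculus.

(* A compact smooth Riemannian surface with (possibly empty) boundary, given by
   an atlas of charts with values in the closed upper half-plane; [icrd i] is
   the inverse of [crd i] and [met i] the metric in the coordinates [crd i].
   [chart_at x] selects a chart around [x]: it is used to write tangent vectors
   at [x] as elements of R * R. *)
Record surface (R : realType) := Surface {
  scarrier :> ptopologicalType;
  chidx : Type;
  dom : chidx -> set scarrier;
  crd : chidx -> scarrier -> R * R;
  icrd : chidx -> R * R -> scarrier;
  chart_at : scarrier -> chidx;
  met : chidx -> R * R -> R * R * R;
  surface_compact : compact [set: scarrier];
  surface_hausdorff : hausdorff_space scarrier;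
  dom_open : forall i, open (dom i);
  chart_atP : forall x, dom (chart_at x) x;
  crd_image : forall i, exists2 U : set (R * R), open U &
    crd i @` dom i = U `&` halfplane;
  crdK : forall i x, dom i x -> icrd i (crd i x) = x;
  crd_continuous : forall i, {within dom i, continuous (crd i)};
  icrd_continuous : forall i, {within crd i @` dom i, continuous (icrd i)};
  crd_smooth : forall i j k,
    Ck k (crd i @` (dom i `&` dom j)) (crd j \o icrd i);
  met_smooth : forall i k, Ck k (crd i @` dom i) (met i);
  met_pos : forall i p, (crd i @` dom i) p ->
    0 < (met i p).1.1 /\ 0 < qdet (met i p);
  met_compat : forall i j x (v : R * R), dom i x -> dom j x ->
    qform (met i (crd i x)) v =
    qform (met j (crd j x))
      (lin2 (jac (crd i @` (dom i `&` dom j)) (crd j \o icrd i) (crd i x)) v)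
}.

Section Geometry.
Context {R : realType} (X : surface R).
Implicit Types (x y : X) (i j : chidx X) (gam : R -> X).

Definition bd : set X := [set x | exists2 i, dom i x & (crd i x).2 = 0].

Definition gmet x := met (chart_at x) (crd (chart_at x) x).

Definition gnorm x (v : R * R) : R := Num.sqrt (qform (gmet x) v).

(* The vector [v] of T_x X, rewritten in the chart [i]. *)
Definition tvec x i (v : R * R) : R * R :=
  let j := chart_at x in
  lin2 (jac (crd j @` (dom j `&` dom i)) (crd i \o icrd j) (crd j x)) v.

Definition jacX (A : set X) (f : X -> X) x : (R * R) * (R * R) :=
  let i := chart_at x in let j := chart_at (f x) in
  jac (crd i @` (A `&` dom i `&` f @^-1` dom j)) (crd j \o f \o icrd i)
      (crd i x).

Definition DX (A : set X) (f : X -> X) x (v : R * R) : R * R :=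
  lin2 (jacX A f x) v.

(* Jacobian with respect to the Riemannian area. *)
Definition detX (A : set X) (f : X -> X) x : R :=
  `|det2 (jacX A f x)| * Num.sqrt (qdet (gmet (f x))) / Num.sqrt (qdet (gmet x)).

Definition C2map (A : set X) (f : X -> X) : Prop :=
  {within A, continuous f} /\
  forall i j, Ck 2 (crd i @` (A `&` dom i `&` f @^-1` dom j))
                   (crd j \o f \o icrd i).

(* [f] is of class C^2 on the closed set [A]: near each point of [A] it is, in
   coordinates, the restriction of a C^2 map. *)
Definition C2ext (A : set X) (f : X -> X) : Prop :=
  forall x, A x -> forall i j, dom i x -> dom j (f x) ->
    exists (U : set (R * R)) (F : R * R -> R * R),
      [/\ open U, U (crd i x), Ck 2 (U `&` halfplane) F &
          forall y, A y -> dom i y -> U (crd i y) ->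
            dom j (f y) /\ crd j (f y) = F (crd i y)].

Definition C1fun (f : X -> R) : Prop :=
  forall i, Ck 1 (crd i @` dom i) (f \o icrd i).

Definition dfun (f : X -> R) x (v : R * R) : R :=
  let i := chart_at x in
  lin2 (jac (crd i @` dom i) (f \o icrd i) (crd i x)) v.

Definition C1c (f : X -> R[i]) : Prop := C1fun (cRe f) /\ C1fun (cIm f).

Definition C1norm (f : X -> R[i]) : \bar R :=
  (supn [set: X] (fun x => cabs (f x)) +
   supn [set xv : X * (R * R) | xv.2 <> 0%R]
     (fun xv => (cabs (dfun (cRe f) xv.1 xv.2 +i* dfun (cIm f) xv.1 xv.2)
                / gnorm xv.1 xv.2)%R))%E.

Definition curveC1 (I : set R) gam : Prop :=
  forall t, I t -> forall i, dom i (gam t) ->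
    exists U : set R, [/\ open U, U t,
      forall s, I s -> U s -> dom i (gam s) &
      CkI 1 (I `&` U) (crd i \o gam)].

Definition vel (I : set R) gam (t : R) : R * R :=
  der I (crd (chart_at (gam t)) \o gam) t.

Definition speed (I : set R) gam (t : R) : R := gnorm (gam t) (vel I gam t).

Definition curve_length (I : set R) gam : \bar R :=
  (\int[lebesgue_measure]_(t in I) (speed I gam t)%:E)%E.

(* Riemannian distance, +oo between different components. *)
Definition rdist x y : \bar R :=
  ereal_inf [set curve_length `[0, 1] gam | gam in
    [set gam | [/\ curveC1 `[0, 1] gam, gam 0 = x & gam 1 = y]]].

Definition enbhd (e : R) (A : set X) : set X :=
  [set x | exists2 y, A y & (rdist x y < e%:E)%E].

(* Regular C^1 arcs of finite length; no C^1 regularity is imposed at the end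
   points. *)
Definition regular_arc gam : Prop :=
  [/\ {within `[0, 1], continuous gam}, curveC1 `]0, 1[ gam,
      forall t, t \in `]0, 1[ -> vel `]0, 1[ gam t <> 0 &
      (curve_length `]0%R, 1%R[ gam < +oo)%E].

Definition is_area (vol : {measure set (borel X) -> \bar R}) : Prop :=
  forall i (B : set X), measurable (B : set (borel X)) -> B `<=` dom i ->
    vol B = (\int[lebesgue_measure \x lebesgue_measure]_(p in crd i @` B)
              (Num.sqrt (qdet (met i p)))%:E)%E.

End Geometry.

(* A piecewise smooth map: [pm_reg] are the open regions X_i^+, [pm_arc] the
   curves of S^-, and [pm_inv] is the inverse of [pm_fun] off the singularity
   sets. The values of [pm_fun] on S^+ and of [pm_inv] on S^- are irrelevant. *)
Record pwmap (R : realType) (X : surface R) := PwMap {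
  pm_fun :> X -> X;
  pm_inv : X -> X;
  pm_k : nat;
  pm_reg : 'I_pm_k -> set X;
  pm_m : nat;
  pm_arc : 'I_pm_m -> R -> X
}.

Section PiecewiseMaps.
Context {R : realType} {X : surface R}.
Implicit Types (S : pwmap X) (x y : X) (C Cs Cu : X -> set (R * R)).

Definition Splus S : set X := ~` \bigcup_(i in [set: 'I_(pm_k S)]) pm_reg i.
Definition Sminus S : set X :=
  ~` \bigcup_(i in [set: 'I_(pm_k S)]) (S @` pm_reg i).

Definition piecewise_smooth S : Prop :=
  (forall i, open (pm_reg (p := S) i)) /\
  (forall i j, i != j -> pm_reg (p := S) i `&` pm_reg j = set0) /\
  (forall i, exists (m : nat) (c : 'I_m -> R -> X),
    (forall k, regular_arc (c k)) /\
    closure (pm_reg (p := S) i) `\` pm_reg i =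
    \bigcup_(k in [set: 'I_m]) (c k @` `[0, 1])) /\
  \bigcup_(i in [set: 'I_(pm_k S)]) closure (pm_reg i) = setT /\
  \bigcup_(i in [set: 'I_(pm_k S)]) closure (S @` pm_reg i) = setT /\
  (forall k, regular_arc (pm_arc (p := S) k)) /\
  Sminus S = \bigcup_(k in [set: 'I_(pm_m S)]) (pm_arc k @` `[0, 1]) /\
  (forall x, (~` Splus S) x -> (~` Sminus S) (S x) /\ pm_inv S (S x) = x) /\
  (forall y, (~` Sminus S) y ->
    (~` Splus S) (pm_inv S y) /\ S (pm_inv S y) = y) /\
  C2map (~` Splus S) S /\
  C2map (~` Sminus S) (pm_inv S) /\
  (forall i, exists F : X -> X, C2ext (closure (pm_reg (p := S) i)) F /\
    forall x, pm_reg (p := S) i x -> F x = S x) /\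
  measurable_fun [set: borel X] (S : borel X -> borel X).

Definition regular S : set X := ~` (Splus S `|` @bd R X).

Definition DS S x : R * R -> R * R := DX (~` Splus S) S x.
Definition DSinv S x : R * R -> R * R := DX (~` Sminus S) (pm_inv S) x.
Definition detDS S x : R := detX (~` Splus S) S x.

(* A cone is a double sector {s a + t b | s t >= 0} bounded by two distinct
   lines; continuity means that, in coordinates, the lines can be spanned by
   continuous vector fields. *)
Definition cone_field (A : set X) C : Prop :=
  forall x0, A x0 -> exists a b : X -> R * R,
    [/\ a @ within A (nbhs x0) --> a x0, b @ within A (nbhs x0) --> b x0 &
     \forall x \near within A (nbhs x0),
       det2 (a x, b x) != 0 /\
       forall v, C x v <->
         exists s t : R, 0 <= s * t /\
           tvec x (chart_at x0) v = s *: a x + t *: b x].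

Definition cones_invariant S Cs Cu : Prop :=
  forall x, regular S x -> regular S (S x) ->
    (forall v, Cu x v -> v <> 0 -> interior (Cu (S x)) (DS S x v)) /\
    (forall v, Cs (S x) v -> v <> 0 -> interior (Cs x) (DSinv S (S x) v)).

Definition lambda S Cu : R :=
  inf [set gnorm (S xv.1) (DS S xv.1 xv.2) / gnorm xv.1 xv.2 | xv in
    [set xv : X * (R * R) | [/\ regular S xv.1, Cu xv.1 xv.2 & xv.2 <> 0]]].

Definition mu_stable S Cs : R :=
  inf [set gnorm (S xv.1) (DS S xv.1 xv.2) / gnorm xv.1 xv.2 | xv in
    [set xv : X * (R * R) | [/\ regular S xv.1, Cs xv.1 xv.2 & xv.2 <> 0]]].

(* 1 / mu_+ *)
Definition inv_mu_plus S Cs : R :=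
  inf [set gnorm (pm_inv S xv.1) (DSinv S xv.1 xv.2) / gnorm xv.1 xv.2 | xv in
    [set xv : X * (R * R) | [/\ regular S xv.1, ~ Sminus S xv.1,
                                Cs xv.1 xv.2 & xv.2 <> 0]]].

Definition singularities_transverse S Cs : Prop :=
  exists2 del : R, 0 < del &
    forall (k : 'I_(pm_m S)) (t : R) w, t \in `]0, 1[ ->
      let x := pm_arc k t in let v := vel `]0, 1[ (pm_arc k) t in
      regular S x -> Cs x w -> del * gnorm x v <= gnorm x (v - w).

Definition Splus_n S (n : nat) : set X :=
  [set x | exists2 k, (k < n)%N & Splus S (iter k S x)].

(* The curves of S_n^-: the images under S^k, k < n, of the curves of S^-, cut
   where S^k is undefined. *)
Definition Sminus_n_curves S (n : nat) : set (set X) :=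
  [set c | exists (k : nat) (j : 'I_(pm_m S)) (t : R),
    let A := `[0, 1] `\` (pm_arc j @^-1` Splus_n S k) in
    [/\ (k < n)%N, A t &
     c = closure (iter k S @` (pm_arc j @` connected_component A t))]].

(* The maximal number of curves of S_n^- through a point. *)
Definition complexity S (n : nat) : \bar R :=
  ereal_sup [set m%:R%:E | m in [set m : nat |
    exists (x : X) (c : 'I_m -> set X), injective c /\
      forall k, Sminus_n_curves S n (c k) /\ c k x]].

Definition piecewise_hyperbolic (al0 : R) (n0 : nat) S Cs Cu : Prop :=
  [/\ piecewise_smooth S,
      [/\ cone_field (regular S) Cs, cone_field (regular S) Cu &
          cones_invariant S Cs Cu],
      [/\ 1 < lambda S Cu, mu_stable S Cs < 1 & 1 < inv_mu_plus S Cs],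
      singularities_transverse S Cs &
      [/\ 0 < al0, (0 < n0)%N, 1 < lambda S Cu * mu_stable S Cs `^ al0 &
          (complexity S n0 <
            ((lambda S Cu * mu_stable S Cs `^ al0) ^+ n0)%:E)%E]].

End PiecewiseMaps.

(* Charts R_i -> X with inverse [linv]; [lrad] is r_i. *)
Record lchart (R : realType) (X : surface R) := LChart {
  lrad : R;
  ldom : set (R * R);
  lmap : R * R -> X;
  linv : X -> R * R
}.

Record leaf_data (R : realType) (X : surface R) := LeafData {
  ld_n : nat;
  ld_chart : 'I_ld_n -> lchart X;
  ld_kappa : R;
  ld_r0 : R;
  ld_tau0 : R;
  ld_B0 : R
}.

Section Leaves.
Context {R : realType} {X : surface R}.
Implicit Types (D : leaf_data X) (Cs : X -> set (R * R)) (c : lchart X).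

Definition square (r : R) : set (R * R) :=
  [set p | `|p.1| < r /\ `|p.2| < r].

Definition limage c : set X := lmap c @` ldom c.

Definition lchart_dom c : Prop :=
  ldom c = square (lrad c) \/
  exists rho : R * R -> R,
    [/\ Ck 2 (square (lrad c)) rho,
        connected (square (lrad c) `&` [set p | rho p = 0]),
        forall p, square (lrad c) p -> rho p = 0 ->
          jac (square (lrad c)) rho p <> 0,
        ldom c = square (lrad c) `&` [set p | 0 <= rho p] &
        forall p, ldom c p -> (bd (lmap c p) <-> rho p = 0)].

Definition Dlmap c (p u : R * R) : R * R :=
  let j := chart_at (lmap c p) in
  lin2 (jac (ldom c `&` lmap c @^-1` dom j) (crd j \o lmap c) p) u.

Definition second_bounded (K : R) (A : set (R * R)) (f : R * R -> R * R)
    : Prop :=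
  forall p, A p ->
    [/\ `|(jac A (fun q => (jac A f q).1) p).1| <= K,
        `|(jac A (fun q => (jac A f q).1) p).2| <= K,
        `|(jac A (fun q => (jac A f q).2) p).1| <= K &
        `|(jac A (fun q => (jac A f q).2) p).2| <= K].

Definition is_lchart (kappa : R) c : Prop :=
  0 < lrad c /\ lchart_dom c /\
  (forall p, ldom c p -> linv c (lmap c p) = p) /\ open (limage c) /\
  {within ldom c, continuous (lmap c)} /\
  {within limage c, continuous (linv c)} /\
  (forall j : chidx X,
     Ck 2 (ldom c `&` lmap c @^-1` dom j) (crd j \o lmap c) /\
     Ck 2 (crd j @` (dom j `&` limage c)) (linv c \o icrd j)) /\
  (exists (j : chidx X) (K : R), closure (limage c) `<=` dom j /\
     second_bounded K (ldom c) (crd j \o lmap c) /\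
     second_bounded K (crd j @` limage c) (linv c \o icrd j)) /\
  (forall p u, ldom c p ->
     enorm u / (1 + kappa) <= gnorm (lmap c p) (Dlmap c p u) <=
     (1 + kappa) * enorm u).

(* The smallness parameters [kappa] (closeness of the charts to isometries),
   r_0, tau_0, B_0 are arbitrary, subject to the compatibility of the cones
   |u_2| <= c |u_1|, c >= tau_0, with the stable cones. *)
Definition admissible_leaf_data D (S : pwmap X) Cs : Prop :=
  [/\ [/\ 0 < ld_kappa D, 0 < ld_r0 D, 0 < ld_tau0 D & 0 < ld_B0 D],
      forall i, is_lchart (ld_kappa D) (ld_chart (l := D) i),
      forall x : X, exists i p, let c := ld_chart (l := D) i in
        [/\ ldom c p, square (lrad c / 2) p & lmap c p = x] &
      forall i, let c := ld_chart (l := D) i in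
        exists2 a : R, ld_tau0 D <= a & forall p u, ldom c p ->
          regular S (lmap c p) -> `|u.2| <= a * `|u.1| ->
          Cs (lmap c p) (Dlmap c p u)].

Record leaf D := Leaf {
  lf_i : 'I_(ld_n D);
  lf_x : R * R;
  lf_r : R;
  lf_F : R -> R
}.

Section OneLeaf.
Context {D : leaf_data X}.
Implicit Types (W : leaf D) (phi : R -> R[i]).

Definition lf_I W : set R := `[- lf_r W, lf_r W].
Definition lf_chart W : lchart X := ld_chart (lf_i W).
Definition lf_graph W (t : R) : R * R :=
  ((lf_x W).1 + t, (lf_x W).2 + lf_F W t).
Definition lf_G W (t : R) : X := lmap (lf_chart W) (lf_graph W t).

Definition C1normI (I : set R) (F : R -> R) : \bar R :=
  (supn I (fun t => `|F t|%R) + supn I (fun t => `|der I F t|%R))%E.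

Definition C2normI (I : set R) (F : R -> R) : \bar R :=
  (C1normI I F + supn I (fun t => `|der I (der I F) t|%R))%E.

Definition is_leaf W : Prop :=
  [/\ 0 < lf_r W <= ld_r0 D,
      ldom (lf_chart W) (lf_x W) /\ square (lrad (lf_chart W) / 2) (lf_x W),
      forall t, lf_I W t -> ldom (lf_chart W) (lf_graph W t),
      CkI 2 (lf_I W) (lf_F W) &
      [/\ lf_F W 0 = 0, (C1normI (lf_I W) (lf_F W) <= (ld_tau0 D)%:E)%E &
          (C2normI (lf_I W) (lf_F W) <= (ld_B0 D)%:E)%E]].

Definition lf_speed W : R -> R := speed (lf_I W) (lf_G W).

Definition lf_length W : R := \int[lebesgue_measure]_(t in lf_I W) lf_speed W t.

(* Distance along the leaf between the points of parameters s and t. *)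
Definition lf_dist W (s t : R) : R :=
  \int[lebesgue_measure]_(u in `[Num.min s t, Num.max s t]) lf_speed W u.

(* Functions on a leaf W are represented by their pull-back to the parameter
   interval by G_F. *)
Definition C1I (I : set R) phi : Prop := CkI 1 I (cRe phi) /\ CkI 1 I (cIm phi).

Definition derc (I : set R) phi (t : R) : R[i] :=
  der I (cRe phi) t +i* der I (cIm phi) t.

Definition lf_C1norm W phi : \bar R :=
  (supn (lf_I W) (fun t => cabs (phi t)) +
   supn (lf_I W) (fun t => (cabs (derc (lf_I W) phi t) / lf_speed W t)%R))%E.

Definition holder (q : R) (I : set R) (d : R -> R -> R) phi : \bar R :=
  (supn I (fun t => cabs (phi t)) +
   supn [set st : R * R | [/\ I st.1, I st.2 & st.1 <> st.2]]
     (fun st => (cabs (phi st.1 - phi st.2) / d st.1 st.2 `^ q)%R))%E.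

Definition lf_Cqnorm (q : R) W phi : \bar R := holder q (lf_I W) (lf_dist W) phi.

Definition d_leaf W1 W2 : \bar R :=
  if `[< lf_i W1 = lf_i W2 /\ lf_r W1 = lf_r W2 >] then
    ((enorm (lf_x W1 - lf_x W2))%:E +
     C1normI (lf_I W1) (fun t => lf_F W1 t - lf_F W2 t)%R)%E
  else +oo%E.

Definition d_test (q : R) W1 phi1 phi2 : \bar R :=
  holder q (lf_I W1) (fun s t => `|s - t|) (fun t => phi1 t - phi2 t).

(* The number \int_W h phi dm. *)
Definition leaf_int (h : X -> R[i]) W phi : R[i] :=
  cint lebesgue_measure (lf_I W)
    (fun t => h (lf_G W t) * phi t * (lf_speed W t)%:C).

End OneLeaf.

Record probe D := Probe {
  pb_leaf : leaf D;
  pb_fun : R -> R[i];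
  pb_leafP : is_leaf pb_leaf;
  pb_funP : C1I (lf_I pb_leaf) pb_fun
}.

End Leaves.

Record norm_params (R : realType) := NormParams {
  np_al : R; np_be : R; np_q : R; np_b : R; np_eps0 : R
}.

Definition admissible_params (R : realType) (al0 : R) (N : norm_params R)
    : Prop :=
  [/\ [/\ np_al N < 1, np_be N < 1 & 0 < np_q N < 1],
      [/\ 0 < np_be N, np_be N <= np_al N, np_al N <= 1 - np_q N &
          1 - np_q N <= al0] &
      0 < np_b N /\ 0 < np_eps0 N].

(* A C^1 function h is identified with the family of numbers \int_W h phi dm,
   indexed by the pairs (W, phi), on which all the norms depend. The completions
   B and B_w are the closures of C^1(X, C) in the spaces of families of finite
   norm. *)
Section Norms.
Context {R : realType} {X : surface R} (D : leaf_data X) (N : norm_params R).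

Definition fam : Type := probe D -> R[i].
Implicit Types (H K : fam) (L : fam -> fam).

Definition emb (h : X -> R[i]) : fam :=
  fun p => leaf_int h (pb_leaf p) (pb_fun p).

Definition fadd H K : fam := fun p => H p + K p.
Definition fsub H K : fam := fun p => H p - K p.
Definition fscale (c : R[i]) H : fam := fun p => c * H p.

Definition wnorm H : \bar R :=
  supn [set p : probe D | (lf_C1norm (pb_leaf p) (pb_fun p) <= 1)%E]
       (fun p => cabs (H p)).

Definition snorm H : \bar R :=
  supn [set p : probe D | ((lf_length (pb_leaf p) `^ np_al N)%:E *
          lf_Cqnorm (np_q N) (pb_leaf p) (pb_fun p) <= 1)%E]
       (fun p => cabs (H p)).

Definition unorm H : \bar R :=
  supn [set z : R * (probe D * probe D) |
          let e := z.1 in let p := z.2.1 in let p' := z.2.2 in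
          [/\ 0 < e <= np_eps0 N,
              (d_leaf (pb_leaf p) (pb_leaf p') <= e%:E)%E,
              (lf_C1norm (pb_leaf p) (pb_fun p) <= 1)%E,
              (lf_C1norm (pb_leaf p') (pb_fun p') <= 1)%E &
              (d_test (np_q N) (pb_leaf p) (pb_fun p) (pb_fun p') <= e%:E)%E]]
       (fun z => z.1 `^ (- np_be N) * cabs (H z.2.1 - H z.2.2)).

Definition bnorm H : \bar R := (snorm H + (np_b N)%:E * unorm H)%E.

Definition inB H : Prop :=
  forall e : R, 0 < e -> exists2 f, C1c f & (bnorm (fsub H (emb f)) <= e%:E)%E.

Definition inBw H : Prop :=
  forall e : R, 0 < e -> exists2 f, C1c f & (wnorm (fsub H (emb f)) <= e%:E)%E.

(* [pr h phi] is h(phi). *)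
Definition is_pairing (vol : {measure set (borel X) -> \bar R})
    (pr : fam -> (X -> R[i]) -> R[i]) : Prop :=
  [/\ forall f phi, C1c f -> C1c phi ->
        pr (emb f) phi = cint vol setT (fun x => f x * phi x),
      forall H K phi, inB H -> inB K -> C1c phi ->
        pr (fadd H K) phi = pr H phi + pr K phi,
      forall c H phi, inB H -> C1c phi -> pr (fscale c H) phi = c * pr H phi &
      exists C : R, forall H phi, inB H -> C1c phi ->
        ((cabs (pr H phi))%:E <= C%:E * wnorm H * C1norm phi)%E].

Definition represents (pr : fam -> (X -> R[i]) -> R[i]) H
    (nu : {measure set (borel X) -> \bar R}) : Prop :=
  forall phi, C1c phi -> pr H phi = cint nu setT phi.

Definition bounded_operator L : Prop :=
  [/\ forall H, inB H -> inB (L H),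
      forall H K, inB H -> inB K -> L (fadd H K) = fadd (L H) (L K),
      forall c H, inB H -> L (fscale c H) = fscale c (L H) &
      exists C : R, forall H, inB H -> (bnorm (L H) <= C%:E * bnorm H)%E].

(* For f in C^1, L f is the function (f / |det DS|) \o S^-1, which is defined off
   S^-. The duality (L h)(phi) = h(phi \o S) is required whenever h is a finite
   measure, so that the right-hand side makes sense although phi \o S is not
   C^1; this contains the case of C^1 functions h. *)
Definition is_transfer_operator (pr : fam -> (X -> R[i]) -> R[i])
    (S : pwmap X) L : Prop :=
  [/\ bounded_operator L,
      forall f p, C1c f ->
        lebesgue_measure (lf_I (pb_leaf p) `&`
                          lf_G (pb_leaf p) @^-1` Sminus S) = 0%E ->
        L (emb f) p =
        emb (fun y => f (pm_inv S y) / (detDS S (pm_inv S y))%:C) p &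
      forall H (nu : {finite_measure set (borel X) -> \bar R}) phi,
        inB H -> represents pr H nu -> C1c phi ->
        pr (L H) phi = cint nu setT (phi \o S)].

Definition spectral_radius L : R :=
  limn (fun n => fine (ereal_sup [set bnorm (iter n L H) | H in
    [set H | inB H /\ (bnorm H <= 1)%E]]) `^ (n%:R^-1)).

Definition subspaceB (F : set fam) : Prop :=
  [/\ F `<=` inB, F (fun=> 0), forall H K, F H -> F K -> F (fadd H K) &
      forall c H, F H -> F (fscale c H)].

Definition closedB (F : set fam) : Prop :=
  forall H, inB H ->
    (forall e : R, 0 < e -> exists2 K, F K & (bnorm (fsub H K) <= e%:E)%E) -> F H.

(* B = F (+) G, both closed and invariant, F of finite dimension carrying the
   eigenvalues of maximal modulus, and smaller spectral radius on G. *)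
Definition quasicompact L : Prop :=
  exists F G : set fam,
    [/\ [/\ subspaceB F, subspaceB G & closedB G],
        (forall H, F H -> F (L H)) /\ (forall H, G H -> G (L H)),
        (forall H, inB H -> exists K1 K2, [/\ F K1, G K2 & H = fadd K1 K2]) /\
        (forall H, F H -> G H -> H = fun=> 0),
        (exists (m : nat) (e : 'I_m -> fam), forall H, F H ->
           exists a : 'I_m -> R[i], H = fun p => \sum_(k < m) a k * e k p) /\
        (forall z H, F H -> H <> (fun=> 0) -> L H = fscale z H ->
           cabs z = spectral_radius L) &
        exists rho C : R, 0 <= rho < spectral_radius L /\
          forall n H, G H -> (bnorm (iter n L H) <= (C * rho ^+ n)%:E * bnorm H)%E].

(* 1 is an algebraically simple eigenvalue, and the only one of modulus 1. *)
Definition one_simple_dominant L : Prop :=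
  (exists H0, [/\ inB H0, H0 <> (fun=> 0), L H0 = H0 &
     forall H n, inB H -> iter n (fun K => fsub (L K) K) H = (fun=> 0) ->
       exists c, H = fscale c H0]) /\
  (forall z H, cabs z = 1 -> inB H -> H <> (fun=> 0) -> L H = fscale z H ->
     z = 1).

Definition unit_ball_relatively_compact : Prop :=
  forall u : nat -> fam, (forall n, inB (u n) /\ (bnorm (u n) <= 1)%E) ->
    exists (s : nat -> nat) (H : fam),
      [/\ forall n, (s n < s n.+1)%N, inBw H &
          wnorm (fsub (u (s n)) H) @[n --> \oo] --> 0%E].

Definition openB (U : set fam) : Prop :=
  forall H, inB H -> U H -> exists2 r : R, 0 < r &
    forall K, inB K -> (bnorm (fsub K H) < r%:E)%E -> U K.

Definition nonneg (pr : fam -> (X -> R[i]) -> R[i]) H : Prop :=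
  forall phi : X -> R, C1fun phi -> (forall x, 0 <= phi x) ->
    0 <= pr H (r2c phi).

End Norms.

Record class_consts (R : realType) := ClassConsts {
  cc_lambda : R; cc_mu : R; cc_inv_mu_plus : R; cc_B : R
}.

Section Perturbations.
Context {R : realType} {X : surface R} (D : leaf_data X).
Context (al0 : R) (n0 : nat) (U : class_consts R).

(* |D^2 S| <= B_*, measured in the charts chi_i. *)
Definition D2_bounded (S : pwmap X) : Prop :=
  forall i j : 'I_(ld_n D),
    let c := ld_chart i in let c' := ld_chart j in
    second_bounded (cc_B U)
      (ldom c `&` lmap c @^-1` (~` Splus S `&` S @^-1` limage c'))
      (linv c' \o S \o lmap c).

Definition in_class (S : pwmap X) (Cs Cu : X -> set (R * R)) : Prop :=
  [/\ piecewise_hyperbolic al0 n0 S Cs Cu,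
      [/\ 1 < cc_lambda U, 0 < cc_mu U, 1 < cc_inv_mu_plus U &
          1 < cc_lambda U * cc_mu U `^ al0],
      [/\ cc_lambda U <= lambda S Cu, cc_mu U <= mu_stable S Cs &
          cc_inv_mu_plus U <= inv_mu_plus S Cs],
      (complexity S n0 < ((cc_lambda U * cc_mu U `^ al0) ^+ n0)%:E)%E &
      D2_bounded S].

Definition X_eps (T : pwmap X) (eps : R) (S : pwmap X) : Prop :=
  [/\ exists Cs Cu, in_class S Cs Cu,
      Splus S `<=` enbhd eps (Splus T) /\ Splus T `<=` enbhd eps (Splus S),
      Sminus S `<=` enbhd eps (Sminus T) /\ Sminus T `<=` enbhd eps (Sminus S) &
      forall x, ~ enbhd eps (Splus T `|` Splus S) x ->
        (rdist (T x) (S x) < eps%:E)%E].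

End Perturbations.

Section Base.
Context {R : realType}.

(* [Om] is (homeomorphic to) a Borel subset of a complete separable metric
   space. *)
Definition borel_subset_of_polish (Om : ptopologicalType) : Prop :=
  exists (E : metricType R) (j : Om -> E),
    [/\ forall F : set_system E, ProperFilter F -> cauchy F ->
          exists l : E, F --> l,
        exists2 Q : set E, countable Q & dense Q,
        injective j,
        forall V : set Om, open V <-> exists2 V', open V' & V = j @^-1` V' &
        <<s @open E >> (range j)].

Definition homeomorphism (Om : ptopologicalType) (sg : Om -> Om) : Prop :=
  exists sg' : Om -> Om,
    [/\ cancel sg sg', cancel sg' sg, continuous sg & continuous sg'].

Definition ergodic_pmp (Om : ptopologicalType) (P : probability (borel Om) R)
    (sg : Om -> Om) : Prop :=
  (forall A : set (borel Om), measurable A -> P (sg @^-1` A) = P A) /\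
  (forall A : set (borel Om), measurable A -> sg @^-1` A = A ->
     P A = 0%E \/ P A = 1%E).

End Base.

Section Cocycle.
Context {Om Y : Type} (sg : Om -> Om).

(* [cocycle f n w] is f_(sg^(n-1) w) o ... o f_w. *)
Fixpoint cocycle (f : Om -> Y -> Y) (n : nat) (w : Om) (y : Y) : Y :=
  if n is k.+1 then f (iter k sg w) (cocycle f k w y) else y.

Definition skew (f : Om -> Y -> Y) (z : Om * Y) : Om * Y :=
  (sg z.1, f z.1 z.2).

End Cocycle.

Section RandomSystem.
Context {R : realType} {X : surface R} (D : leaf_data X) (N : norm_params R).
Context {Om : ptopologicalType} (P : probability (borel Om) R).
Context (sg : Om -> Om).
Context (pr : fam D -> (X -> R[i]) -> R[i]) (LL : Om -> fam D -> fam D).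

Definition uniform_estimates : Prop :=
  exists (Dc lam' Bc a : R),
    [/\ 0 < Dc, 0 < lam', 0 < Bc, 0 < a < 1 &
     forall (w : Om) (n : nat) (H : fam D), inB N H ->
       [/\ pr H (fun=> 1) = 0 ->
             (bnorm N (cocycle sg LL n w H) <=
               (Dc * expR (- lam' * n%:R))%:E * bnorm N H)%E,
           (wnorm (cocycle sg LL n w H) <= Bc%:E * wnorm H)%E &
           (bnorm N (cocycle sg LL n w H) <=
             (Bc * a ^+ n)%:E * bnorm N H + Bc%:E * wnorm H)%E]].

Definition equivariant_family (h0 : Om -> fam D) : Prop :=
  [/\ forall w, inB N (h0 w),
      forall V : set (fam D), openB N V ->
        measurable (h0 @^-1` V : set (borel Om)),
      {ae P, forall w : borel Om, LL w (h0 w) = h0 (sg w)},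
      {ae P, forall w : borel Om,
        nonneg pr (h0 w) /\ pr (h0 w) (fun=> 1) = 1} &
      exists K : R, {ae P, forall w : borel Om, (bnorm N (h0 w) <= K%:E)%E}].

Definition observable (h0 : Om -> fam D) (g : Om -> X -> R) : Prop :=
  [/\ measurable_fun [set: borel Om * borel X]
        (fun z : borel Om * borel X => g z.1 z.2 : R),
      forall w, C1fun (g w),
      exists K : R, {ae P, forall w : borel Om, (C1norm (r2c (g w)) <= K%:E)%E} &
      {ae P, forall w : borel Om, pr (h0 w) (r2c (g w)) = 0}].

End RandomSystem.

Definition birkhoff (R : realType) (Om Y : Type) (sg : Om -> Om)
    (f : Om -> Y -> Y) (g : Om -> Y -> R) (n : nat) (w : Om) (y : Y) : R :=
  \sum_(0 <= i < n) g (iter i sg w) (cocycle sg f i w y).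

Definition asymptotic_variance (R : realType) (Om Y : ptopologicalType)
    (mu : probability (borel Om * borel Y)%type R) (sg : Om -> Om)
    (f : Om -> Y -> Y) (g : Om -> Y -> R) : R :=
  let g' (z : borel Om * borel Y) := g z.1 z.2 in
  \int[mu]_z (g' z ^+ 2) +
  2 * limn (fun n => \sum_(1 <= k < n)
        \int[mu]_z (g' z * g' (iter k (skew sg f) z))).

(* Main.v *)
(* Nagaev-Guivarc'h perturbation along a fixed fibre, with the multiplication operators reduced to
   multiplication by C^1 functions on B.  For a leaf family H in B and f of class C^1, f.H is defined by
   absorbing f into the test functions; the closed unit balls of test functions are only
   quasi-invariant under this operation, and comparing f on two nearby leaves requires the leaf
   charts to be quasi-convex and uniformly Lipschitz.

   For small th, u_n = L(e^{i th g} u_{n-1}), u_0 = h_w, satisfies pr u_n 1 = int e^{i th S_n} dmu_w =: c_n.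
   Writing u_n = c_n h_n + i th c_n y_n + O(th^2), where y_n represents S_n mu_w, the decay of the
   cocycle on elements of zero mass gives c_{n+1} - c_n = - th^2 c_n b_n + O(th^3), with
   2 (b_0 + ... + b_{n-1}) = int S_n^2 dmu_w; no spectral theory is needed.  With th = t / sqrt n this
   recursion yields c_n -> e^{-t^2 s / 2} as soon as (int S_n^2 dmu_w) / n -> s.

   The exponential decay of correlations, Birkhoff's theorem applied to each of the fibrewise
   correlations C_m(w), and the disintegration of mu identify the limit s with Sigma^2 for almost
   every w.  The convergence of characteristic functions is turned into weak convergence by
   approximating phi by Bernstein polynomials in trigonometric functions.

   On a fibre, phi o T is not C^1, so that identities are transported to the measure mu_w by
   representing elements of B by combinations of images of finite measures F mu_w, F >= 0. *)
Require Import Defs.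
From HB Require Import structures.
From mathcomp Require Import all_boot all_order all_algebra.
From mathcomp Require Import all_classical all_reals all_analysis.
From mathcomp Require Import complex.
From mathcomp Require Import measurable_realfun.
From mathcomp Require Import ring lra.
Import Order.TTheory GRing.Theory Num.Theory.
Import numFieldNormedType.Exports.

Set Implicit Arguments.
Unset Strict Implicit.
Unset Printing Implicit Defensive.
Local Notation gnorm := Defs.gnorm.
Local Open Scope ring_scope.


(** The norm sees a family only on unit balls of test functions, and elsewhere its values are
    arbitrary. Linearity in the test function is therefore recovered by density for [hat], the
    homogeneous extension from small multiples, and an identity such as 1.H = H holds up to norm 0
    only. Tangent vectors are read in charts selected pointwise by [chart_at], which may jump, so
    regularity is proved in a fixed chart. Near the boundary the domain of a leaf chart is one side
    of a curve and need not be convex; the mean value inequality is then run along three segments.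
    The condition beta <= 1 - q matters because two leaves at distance eps make a C^1 function
    differ by O(eps) in supremum but only by O(1) in Lipschitz norm, hence by O(eps^(1-q)) in
    Hoelder norm.

    In the recursion, u_n - c_n h_n and u_n - c_n h_n - i th c_n y_n have mass 0 and are driven by
    increments of mass 0, of order th and th^2. The contraction sums these geometrically, so the
    error th^3 per step is uniform in n, and n steps with th of order n^(-1/2) lose only
    O(n^(-1/2)). *)

Module RelativeDerivativeTheory.

(** * Calculus of derivatives relative to a set *)

Section Dwithin.
Context {R : realType}.
Implicit Types (U V W : normedModType R).

Lemma within_nearP V (A : set V) (p : V) (P : set V) :
  (\forall q \near within A (nbhs p), P q) <->
  exists2 d : R, 0 < d & forall q, A q -> `|q - p| < d -> P q.
Proof.
rewrite near_withinE; split.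
  move=> /nbhs_ballP[d d0 h]; exists d => // q Aq qp.
  by apply: h => //; rewrite -ball_normE /= distrC.
move=> [d d0 h]; apply/nbhs_ballP; exists d => // q.
by rewrite -ball_normE /= distrC => qp Aq; exact: h.
Qed.

Lemma is_dwithinP V W (A : set V) (f : V -> W) p L :
  is_dwithin A f p L <-> forall e : R, 0 < e -> exists2 d : R, 0 < d &
    forall q, A q -> `|q - p| < d -> `|f q - f p - L (q - p)| <= e * `|q - p|.
Proof.
by split=> h e e0; [exact/within_nearP/h|exact/within_nearP/h].
Qed.

Lemma within_continuousP V W (A : set V) (f : V -> W) :
  {within A, continuous f} <-> forall p, A p -> forall e : R, 0 < e ->
    exists2 d : R, 0 < d & forall q, A q -> `|q - p| < d -> `|f q - f p| < e.
Proof.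
split=> [/subspace_continuousP h p Ap e e0|h].
  have /cvgrPdist_lt /(_ _ e0) := h p Ap.
  by move=> /within_nearP[d d0 k]; exists d => // q Aq qp; rewrite distrC; exact: k.
apply/subspace_continuousP => p Ap; apply/cvgrPdist_lt => e e0.
apply/within_nearP; have [d d0 k] := h p Ap e e0; exists d => // q Aq qp.
by rewrite distrC; exact: k.
Qed.

Lemma within_continuousS V W (A B : set V) (f : V -> W) :
  B `<=` A -> {within A, continuous f} -> {within B, continuous f}.
Proof.
move=> BA /within_continuousP h; apply/within_continuousP => p Bp e e0.
have [d d0 k] := h p (BA _ Bp) e e0; exists d => // q Bq; apply: k; exact: BA.
Qed.

(** Only the germ at [p] matters. This is the tool for passing between two charts, or between two
    domains, that show the same function near [p]. *)
Lemma is_dwithin_local V W (A B : set V) (f g : V -> W) p L :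
  (exists2 d : R, 0 < d &
     forall q, B q -> `|q - p| < d -> A q /\ f q = g q) -> f p = g p ->
  is_dwithin A f p L -> is_dwithin B g p L.
Proof.
move=> [d d0 h] fgp /is_dwithinP k; apply/is_dwithinP => e e0.
have [d' d'0 k'] := k e e0; exists (Num.min d d'); first by rewrite lt_min d0.
move=> q Bq; rewrite lt_min => /andP[qd qd']; have [Aq fgq] := h q Bq qd.
by rewrite -fgq -fgp; exact: k'.
Qed.

Lemma is_dwithinS V W (A B : set V) (f : V -> W) p L :
  B `<=` A -> is_dwithin A f p L -> is_dwithin B f p L.
Proof.
by move=> BA; apply: is_dwithin_local => //; exists 1 => // q Bq _; split => //; exact: BA.
Qed.

Lemma is_dwithin_eq V W (A : set V) (f : V -> W) p L L' :
  L =1 L' -> is_dwithin A f p L -> is_dwithin A f p L'.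
Proof. by move=> /funext <-. Qed.

(* The increments of [f] at [p] are of order |q - p|. *)
Lemma is_dwithin_lip V W (A : set V) (f : V -> W) p L (M : R) :
  0 <= M -> (forall u, `|L u| <= M * `|u|) -> is_dwithin A f p L ->
  exists2 d : R, 0 < d &
    forall q, A q -> `|q - p| < d -> `|f q - f p| <= (M + 1) * `|q - p|.
Proof.
move=> M0 LM /is_dwithinP/(_ _ ltr01)[d d0 h]; exists d => // q Aq qp.
rewrite -[f q - f p](subrK (L (q - p))) (le_trans (ler_normD _ _))//.
by rewrite mulrDl addrC lerD//; exact: h.
Qed.

Lemma is_dwithin_continuous V W (A : set V) (f : V -> W) p L (M : R) :
  0 <= M -> (forall u, `|L u| <= M * `|u|) -> is_dwithin A f p L ->
  forall e : R, 0 < e ->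
  exists2 d : R, 0 < d & forall q, A q -> `|q - p| < d -> `|f q - f p| < e.
Proof.
move=> M0 LM h e e0; have [d d0 k] := is_dwithin_lip M0 LM h.
have M1 : 0 < M + 1 by lra.
exists (Num.min d (e / (M + 1))); first by rewrite lt_min d0 divr_gt0.
move=> q Aq; rewrite lt_min => /andP[qd qe]; rewrite (le_lt_trans (k q Aq qd))//.
by rewrite mulrC -ltr_pdivlMr.
Qed.

Lemma lin2D W (J : W * W) u v : lin2 J (u + v) = lin2 J u + lin2 J v.
Proof. by rewrite /lin2 /= !scalerDl addrACA. Qed.

Lemma lin2Z W (J : W * W) (a : R) u : lin2 J (a *: u) = a *: lin2 J u.
Proof. by rewrite /lin2 /= scalerDr !scalerA. Qed.

Lemma lin2N W (J : W * W) u : lin2 J (- u) = - lin2 J u.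
Proof. by rewrite -scaleN1r lin2Z scaleN1r. Qed.

Lemma lin2B W (J : W * W) u v : lin2 J (u - v) = lin2 J u - lin2 J v.
Proof. by rewrite lin2D lin2N. Qed.

Lemma lin2_le W (J : W * W) u : `|lin2 J u| <= (`|J.1| + `|J.2|) * `|u|.
Proof.
rewrite /lin2 (le_trans (ler_normD _ _))// !normrZ mulrDl.
rewrite [`|u|]prod_normE.
by rewrite lerD// mulrC ler_wpM2l// le_max lexx ?orbT.
Qed.

Lemma lin2_bound_ge0 W (J : W * W) : 0 <= `|J.1| + `|J.2|.
Proof. by rewrite addr_ge0. Qed.

Lemma scale_le W (c : W) (s : R) : `|s *: c| <= `|c| * `|s|.
Proof. by rewrite normrZ mulrC. Qed.

(** The error splits into the error of [f] at [z s] and the image by [K] of the error of [z]. The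
    maps [L] and [K] are bare functions with a linear bound, [K] being compatible with subtraction,
    so that one chain rule serves curves, planar maps and scalar functions. *)
Lemma is_dwithin_comp U V W (A : set V) (I : set U) (z : U -> V) (f : V -> W)
    (t : U) (L : U -> V) (K : V -> W) (M N : R) :
  0 <= M -> (forall u, `|L u| <= M * `|u|) ->
  0 <= N -> (forall v, `|K v| <= N * `|v|) -> (forall u v, K (u - v) = K u - K v) ->
  (exists2 d : R, 0 < d & forall s, I s -> `|s - t| < d -> A (z s)) ->
  is_dwithin I z t L -> is_dwithin A f (z t) K ->
  is_dwithin I (f \o z) t (K \o L).
Proof.
move=> M0 LM N0 KN KB [d0 d0_0 zA] hz hf; apply/is_dwithinP => e e0.
have M1 : 0 < M + 1 by lra. have N1 : 0 < N + 1 by lra.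
have [d1 d1_0 h1] := is_dwithin_lip M0 LM hz.
have /is_dwithinP/(_ (e / 2 / (N + 1))) [|d2 d2_0 h2] := hz.
  by rewrite !divr_gt0.
have /is_dwithinP/(_ (e / 2 / (M + 1))) [|d3 d3_0 h3] := hf.
  by rewrite !divr_gt0.
exists (Num.min (Num.min d0 d1) (Num.min d2 (d3 / (M + 1)))).
  by rewrite !lt_min d0_0 d1_0 d2_0 divr_gt0.
move=> s Is; rewrite !lt_min => /andP[/andP[s0 s1] /andP[s2 s3]] /=.
have z1 := h1 s Is s1; have z2 := h2 s Is s2.
have z3 : `|z s - z t| < d3.
  by rewrite (le_lt_trans z1)// mulrC -ltr_pdivlMr.
have z4 := h3 _ (zA _ Is s0) z3.
have -> : f (z s) - f (z t) - K (L (s - t)) =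
    (f (z s) - f (z t) - K (z s - z t)) + K (z s - z t - L (s - t)).
  by rewrite !KB; set a := K _ - K _; rewrite [RHS]addrA subrK.
rewrite (le_trans (ler_normD _ _))//.
have -> : e * `|s - t| = e / 2 * `|s - t| + e / 2 * `|s - t| by lra.
rewrite lerD//.
  rewrite (le_trans z4)// (le_trans (ler_wpM2l _ z1))//.
    by rewrite !divr_ge0 ?ltW.
  by rewrite mulrA divfK// gt_eqF.
rewrite (le_trans (KN _))// (le_trans (ler_wpM2l N0 z2))//.
rewrite mulrA ler_wpM2r// mulrCA ger_pMr ?divr_gt0//.
by rewrite ler_pdivrMr// mul1r lerDl.
Qed.

Lemma is_dwithin_curve W (A : set (R * R)) (I : set R) (z : R -> R * R)
    (f : R * R -> W) (t : R) (d : R * R) (J : W * W) :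
  (exists2 e : R, 0 < e & forall s, I s -> `|s - t| < e -> A (z s)) ->
  is_dwithin I z t (fun s : R => s *: d) -> is_dwithin A f (z t) (lin2 J) ->
  is_dwithin I (f \o z) t (fun s : R => s *: lin2 J d).
Proof.
move=> zA hz hf.
have := is_dwithin_comp (normr_ge0 d) (@scale_le _ d) (lin2_bound_ge0 J)
  (@lin2_le _ J) (@lin2B _ J) zA hz hf.
by apply: is_dwithin_eq => s /=; rewrite lin2Z.
Qed.

(** Both derivatives are compared with the same increment at a point [s] of [I] different from [t];
    the first premise supplies such points arbitrarily close to [t]. *)
Lemma is_dwithin_uniq W (I : set R) (f : R -> W) (t : R) d1 d2 :
  (forall e : R, 0 < e -> exists s, [/\ I s, s != t & `|s - t| < e]) ->
  is_dwithin I f t (fun s : R => s *: d1) -> is_dwithin I f t (fun s : R => s *: d2) ->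
  d1 = d2.
Proof.
move=> hI /is_dwithinP h1 /is_dwithinP h2; apply/eqP; rewrite -subr_eq0 -normr_eq0.
apply/eqP/le_anti; rewrite normr_ge0 andbT; apply/ler_addgt0Pl => e e0; rewrite addr0.
have [|a a0 k1] := h1 (e / 2); first lra.
have [|b b0 k2] := h2 (e / 2); first lra.
have [|s [Is st]] := hI (Num.min a b); first by rewrite lt_min a0.
rewrite lt_min => /andP[sa sb].
have := k1 s Is sa; have := k2 s Is sb.
move=> H2 H1; have up : 0 < `|s - t| by rewrite normr_gt0 subr_eq0.
move: (f s - f t) H1 H2 => v H1 H2.
rewrite -(ler_pM2r up).
rewrite [X in X <= _]mulrC -normrZ scalerBr.
have -> : (s - t) *: d1 - (s - t) *: d2 = (v - (s - t) *: d2) - (v - (s-t) *: d1).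
  by rewrite opprB [RHS]addrC addrA subrK.
rewrite (le_trans (ler_normB _ _))// (le_trans (lerD H2 H1))//.
by rewrite -mulrDl ler_wpM2r//; lra.
Qed.

End Dwithin.

End RelativeDerivativeTheory.
Import RelativeDerivativeTheory.

(** * Calculus on closed intervals, end points included *)

Module OneDimensionTheory.

Section OneDim.
Context {R : realType}.
Implicit Types (W : normedModType R) (a b t : R).

Lemma itvE a b t : [set` `[a, b]] t <-> a <= t <= b.
Proof. by rewrite /= in_itv. Qed.

(** Feeds [is_dwithin_uniq]; at the right end point the approach is from the left. *)
Lemma itv_accumulation a b t : a < b -> a <= t <= b ->
  forall e : R, 0 < e -> exists s, [/\ a <= s <= b, s != t & `|s - t| < e].
Proof.
move=> ab /andP[at_ tb] e e0.
have [tb'|tb'] := ltP t b.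
  have m0 : 0 < Num.min (e / 2) (b - t) by rewrite lt_min; lra.
  have m1 : Num.min (e / 2) (b - t) <= e / 2 by rewrite ge_min lexx.
  have m2 : Num.min (e / 2) (b - t) <= b - t by rewrite ge_min lexx orbT.
  exists (t + Num.min (e / 2) (b - t)); split.
  - by lra.
  - by rewrite gt_eqF//; lra.
  - by rewrite addrAC subrr add0r gtr0_norm//; lra.
have {}tb' : t = b by lra.
have m0 : 0 < Num.min (e / 2) (t - a) by rewrite lt_min; lra.
have m1 : Num.min (e / 2) (t - a) <= e / 2 by rewrite ge_min lexx.
have m2 : Num.min (e / 2) (t - a) <= t - a by rewrite ge_min lexx orbT.
exists (t - Num.min (e / 2) (t - a)); split.
- by lra.
- by rewrite lt_eqF//; lra.
- by rewrite addrAC subrr add0r normrN gtr0_norm//; lra.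
Qed.

Lemma derE W (f : R -> W) a b t d : a < b -> a <= t <= b ->
  is_dwithin `[a, b] f t (fun s => s *: d) -> der `[a, b] f t = d.
Proof.
move=> ab tI h; have hx := @xgetPex W 0
  [set d | is_dwithin `[a, b] f t (fun s => s *: d)] (ex_intro _ d h).
apply: is_dwithin_uniq hx h => e e0; have [s [sI st se]] := itv_accumulation ab tI e0.
by exists s; split => //; rewrite itvE.
Qed.

(** Bridge to the two-sided derivative of the library, at interior points. This suffices for the
    mean value theorem, which asks only continuity at the end points. *)
Lemma is_dwithin_is_derive (f : R -> R) a b t d : a < t < b ->
  is_dwithin `[a, b] f t (fun s => s *: d) -> is_derive t 1 f d.
Proof.
move=> /andP[at_ tb] /is_dwithinP h.
have key : (fun k => k^-1 *: (f (k *: (1:R) + t) - f t)) @ 0^' --> d.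
  apply/cvgrPdist_le => e e0; have [r r0 k] := h e e0.
  have m0 : 0 < Num.min r (Num.min (t - a) (b - t)) by rewrite !lt_min r0; lra.
  rewrite near_withinE; apply/nbhs_ballP; exists (Num.min r (Num.min (t - a) (b - t))) => //= s.
  rewrite -ball_normE /= sub0r normrN !lt_min => /and3P[sr sa sb] s0.
  have sI : a <= s *: 1 + t <= b.
    rewrite scaler1; move: sa sb; rewrite !ltr_norml; lra.
  move/itvE in sI; have := k _ sI; rewrite addrK scaler1 => /(_ sr).
  have sn : 0 < `|s| by rewrite normr_gt0.
  rewrite -(ler_pM2l (_ : 0 < `|s^-1%R|)) ?normr_gt0 ?invr_neq0//.
  rewrite -normrM mulrCA -normrM mulVf// normr1 mulr1 mulrBr.
  by rewrite /GRing.scale /= mulrA mulVf// mul1r distrC.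
apply: DeriveDef; first by apply/cvg_ex; exists d; exact: key.
by rewrite /derive; exact: (cvg_lim (@norm_hausdorff _ _) key).
Qed.

Lemma mean_value (f df : R -> R) a b :
  (forall t, a <= t <= b -> is_dwithin `[a, b] f t (fun s => s *: df t)) ->
  forall s t, a <= s <= b -> a <= t <= b -> s <= t ->
    exists2 c, s <= c <= t & f t - f s = df c * (t - s).
Proof.
move=> h s t sI tI st.
have fc : {within `[a, b], continuous f}.
  apply/within_continuousP => p /itvE pI e e0.
  exact: (is_dwithin_continuous (normr_ge0 (df p)) (@scale_le _ _ (df p)) (h p pI)).
have := @MVT_segment R f df s t st; case.
- move=> x; rewrite in_itv /= => /andP[sx xt].
  by apply: (@is_dwithin_is_derive f a b x (df x)); [lra|apply: h; lra].
- apply: within_continuousS fc => x /itvE ?; apply/itvE; lra.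
- by move=> c; rewrite in_itv /= => cI e; exists c.
Qed.

Lemma mean_value_le (f df : R -> R) a b (M : R) :
  (forall t, a <= t <= b -> is_dwithin `[a, b] f t (fun s => s *: df t)) ->
  (forall t, a <= t <= b -> `|df t| <= M) ->
  forall s t, a <= s <= b -> a <= t <= b -> `|f s - f t| <= M * `|s - t|.
Proof.
move=> h hM.
have H s t : a <= s <= b -> a <= t <= b -> s <= t -> `|f s - f t| <= M * `|s - t|.
  move=> sI tI st; have [c cst e] := mean_value h sI tI st.
  rewrite distrC e normrM distrC ler_wpM2r//.
  by apply: hM; lra.
move=> s t sI tI; have [|ts] := leP s t; first exact: H.
by rewrite distrC (distrC s); apply: H => //; exact: ltW.
Qed.

(** Since [der] is chosen by [xget], a computed derivative [df] becomes usable only after uniqueness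
    has identified it with [der]. *)
Lemma CkI1I W (f df : R -> W) a b : a < b ->
  (forall t, a <= t <= b -> is_dwithin `[a, b] f t (fun s => s *: df t)) ->
  {within `[a, b], continuous df} -> CkI 1 `[a, b] f.
Proof.
move=> ab h c; have e t : a <= t <= b -> der `[a, b] f t = df t.
  by move=> tI; apply: derE => //; exact: h.
split; first by move=> t /itvE tI; rewrite e//; exact: h.
apply/within_continuousP => p /itvE pI r r0.
have /within_continuousP/(_ p _ r r0)[|d d0 k] := c; first exact/itvE.
by exists d => // q /itvE qI; rewrite !e//; apply: k; exact/itvE.
Qed.

End OneDim.

Section Algebra.
Context {R : realType}.
Implicit Types (V W : normedModType R).

Lemma is_dwithin_cst V W (A : set V) (c : W) p : is_dwithin A (fun=> c) p (fun=> 0).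
Proof.
by apply/is_dwithinP => e e0; exists 1 => // q _ _; rewrite !subrr normr0 mulr_ge0// ltW.
Qed.

Lemma is_dwithinD V W (A : set V) (f g : V -> W) p L K :
  is_dwithin A f p L -> is_dwithin A g p K ->
  is_dwithin A (fun x => f x + g x) p (fun u => L u + K u).
Proof.
move=> /is_dwithinP hf /is_dwithinP hg; apply/is_dwithinP => e e0.
have e2 : 0 < e / 2 by lra.
have [d d0 h1] := hf _ e2; have [d' d'0 h2] := hg _ e2.
exists (Num.min d d'); first by rewrite lt_min d0.
move=> q Aq; rewrite lt_min => /andP[qd qd'].
have := lerD (h1 q Aq qd) (h2 q Aq qd'); rewrite -mulrDl (_ : e / 2 + e / 2 = e); last lra.
apply: le_trans; rewrite (_ : _ - _ = (f q - f p - L (q - p)) + (g q - g p - K (q - p))).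
  exact: ler_normD.
by rewrite (opprD (f p)) (addrACA (f q)) (opprD (L _)) [LHS]addrACA.
Qed.

Lemma is_dwithinZ V W (A : set V) (f : V -> W) p L (c : R) :
  is_dwithin A f p L -> is_dwithin A (fun x => c *: f x) p (fun u => c *: L u).
Proof.
move=> /is_dwithinP hf; apply/is_dwithinP => e e0.
have c1 : 0 < `|c| + 1 by rewrite ltr_wpDl.
have [d d0 h] := hf _ (divr_gt0 e0 c1); exists d => // q Aq qd.
rewrite -!scalerBr normrZ (le_trans (ler_wpM2l (normr_ge0 c) (h q Aq qd)))//.
rewrite mulrA ler_wpM2r// mulrCA ger_pMr// ler_pdivrMr// mul1r; lra.
Qed.

Lemma is_dwithinM V (A : set V) (f g : V -> R) p L K (M N : R) :
  0 <= M -> (forall u, `|L u| <= M * `|u|) ->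
  0 <= N -> (forall u, `|K u| <= N * `|u|) ->
  is_dwithin A f p L -> is_dwithin A g p K ->
  is_dwithin A (fun x => f x * g x) p (fun u => f p * K u + g p * L u).
Proof.
move=> M0 LM N0 KN hf hg.
have := is_dwithinD (is_dwithinZ (f p) hg) (is_dwithinZ (g p) hf).
move=> /is_dwithinP h; apply/is_dwithinP => e e0.
have e2 : 0 < e / 2 by lra.
have [d d0 h1] := h _ e2.
have [d1 d1_0 k1] := is_dwithin_lip M0 LM hf.
have [d2 d2_0 k2] := is_dwithin_lip N0 KN hg.
have MN : 0 < (M + 1) * (N + 1) by rewrite mulr_gt0//; lra.
exists (Num.min (Num.min d d1) (Num.min d2 (e / 2 / ((M + 1) * (N + 1))))).
  by rewrite !lt_min d0 d1_0 d2_0 divr_gt0.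
move=> q Aq; rewrite !lt_min => /andP[/andP[qd q1] /andP[q2 q3]].
have H1 := h1 q Aq qd; have H2 := k1 q Aq q1; have H3 := k2 q Aq q2.
rewrite ltr_pdivlMr// in q3.
have -> : f q * g q - f p * g p - (f p * K (q - p) + g p * L (q - p)) =
  (f p *: g q + g p *: f q - (f p *: g p + g p *: f p)
     - (f p *: K (q - p) + g p *: L (q - p))) + (f q - f p) * (g q - g p).
  by rewrite /GRing.scale /=; ring.
rewrite (le_trans (ler_normD _ _))// normrM.
have -> : e * `|q - p| = e / 2 * `|q - p| + e / 2 * `|q - p| by lra.
rewrite lerD// (le_trans (ler_pM (normr_ge0 _) (normr_ge0 _) H2 H3))//.
by rewrite mulrACA mulrA ler_wpM2r// mulrC ltW.
Qed.

End Algebra.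

End OneDimensionTheory.
Import OneDimensionTheory.

(** * Jacobians on relatively open subsets of the half-plane *)

Module RelativelyOpenTheory.

Section RelativelyOpen.
Context {R : realType}.
Implicit Types (W : normedModType R) (A : set (R * R)) (p w : R * R).

Definition relopen A := A `<=` halfplane /\
  forall p, A p -> exists2 r : R, 0 < r &
    forall q, halfplane q -> `|q - p| < r -> A q.

Lemma open_relopen (U : set (R * R)) : open U -> relopen (U `&` halfplane).
Proof.
move=> oU; split; first by move=> p [].
move=> p [Up _]; have /nbhs_ballP[r /= r0 h] := open_nbhs_nbhs (conj oU Up).
exists r => // q Hq qp; split => //; apply: h.
by rewrite -ball_normE /= distrC.
Qed.

Lemma is_dwithin_line W (I : set R) (a w : W) t :
  is_dwithin I (fun s : R => a + s *: w) t (fun s => s *: w).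
Proof.
apply/is_dwithinP => e e0; exists 1 => // q _ _.
by rewrite opprD addrACA subrr add0r -scalerBl subrr normr0 mulr_ge0// ltW.
Qed.

(** At a point of the boundary line only rays that do not point downwards stay in [A], whence the
    sign condition on [w.2]. *)
Lemma relopen_ray A p w : relopen A -> A p -> 0 <= w.2 ->
  exists2 r : R, 0 < r & forall s, 0 <= s <= r -> A (p + s *: w).
Proof.
move=> [AH h] Ap w0; have [r r0 k] := h p Ap.
have w1 : 0 < `|w| + 1 by rewrite ltr_wpDl.
exists (r / 2 / (`|w| + 1)); first by rewrite !divr_gt0.
move=> s /andP[s0 sr]; apply: k.
  by rewrite /halfplane /= addr_ge0 ?mulr_ge0//; exact: AH.
rewrite addrAC subrr add0r normrZ ger0_norm//.
rewrite (le_lt_trans (ler_wpM2r (normr_ge0 w) sr))//.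
apply: (@le_lt_trans _ _ (r / 2)); last lra.
rewrite -(mulrA (r / 2)).
by rewrite ger_pMr ?divr_gt0// mulrC ler_pdivrMr// mul1r lerDl.
Qed.

Lemma relopen_dir_uniq W A (f : R * R -> W) p w L1 L2 : relopen A -> A p ->
  0 <= w.2 -> is_dwithin A f p (lin2 L1) -> is_dwithin A f p (lin2 L2) ->
  lin2 L1 w = lin2 L2 w.
Proof.
move=> oA Ap w0 h1 h2; have [r r0 k] := relopen_ray oA Ap w0.
have zA : exists2 e : R, 0 < e & forall s, `[0, r]%classic s -> `|s - 0| < e -> A (p + s *: w).
  by exists 1 => // s /itvE sr _; exact: k.
have p0 : p + (0 : R) *: w = p by rewrite scale0r addr0.
have d1 := is_dwithin_curve zA (is_dwithin_line _ _ _ _) (J := L1) (f := f).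
have d2 := is_dwithin_curve zA (is_dwithin_line _ _ _ _) (J := L2) (f := f).
rewrite p0 in d1 d2; apply: is_dwithin_uniq (d1 h1) (d2 h2) => e e0.
have [|s [sI st se]] := itv_accumulation r0 (t := 0) _ e0; first by rewrite lexx ltW.
by exists s; split => //; exact/itvE.
Qed.

Lemma jacP W A (f : R * R -> W) p J :
  is_dwithin A f p (lin2 J) -> is_dwithin A f p (lin2 (jac A f p)).
Proof.
by move=> h; exact: (@xgetPex _ (0, 0) [set J | is_dwithin A f p (lin2 J)] (ex_intro _ J h)).
Qed.

(** The directions (1, 0) and (0, 1) both satisfy the sign condition of [relopen_ray], so both
    columns of a Jacobian are determined even at boundary points. *)
Lemma jacE W A (f : R * R -> W) p J : relopen A -> A p ->
  is_dwithin A f p (lin2 J) -> jac A f p = J.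
Proof.
move=> oA Ap h.
have e1 := @relopen_dir_uniq W A f p (1, 0) _ _ oA Ap (lexx _) (jacP h) h.
have e2 := @relopen_dir_uniq W A f p (0, 1) _ _ oA Ap ler01 (jacP h) h.
move: e1 e2; rewrite /lin2 /= !scale1r !scale0r !addr0 !add0r.
by case: (jac A f p) J {h} => [a b] [c d] /= -> ->.
Qed.

Lemma Ck1I W A (f : R * R -> W) (J : R * R -> W * W) : relopen A ->
  (forall p, A p -> is_dwithin A f p (lin2 (J p))) ->
  {within A, continuous (fun p => (J p).1)} ->
  {within A, continuous (fun p => (J p).2)} -> Ck 1 A f.
Proof.
move=> oA h c1 c2; have e p : A p -> jac A f p = J p.
  by move=> Ap; apply: jacE => //; exact: h.
split; first by move=> p Ap; rewrite e//; exact: h.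
- apply/within_continuousP => p Ap r r0.
  have /within_continuousP/(_ p Ap r r0)[d d0 k] := c1.
  by exists d => // q Aq; rewrite !e//; exact: k.
- apply/within_continuousP => p Ap r r0.
  have /within_continuousP/(_ p Ap r r0)[d d0 k] := c2.
  by exists d => // q Aq; rewrite !e//; exact: k.
Qed.

Lemma Ck1_continuous W A (f : R * R -> W) : Ck 1 A f -> {within A, continuous f}.
Proof.
move=> [h _ _]; apply/within_continuousP => p Ap e e0.
exact: (is_dwithin_continuous (lin2_bound_ge0 _) (@lin2_le _ _ _) (h p Ap)).
Qed.

Lemma CkS k W A (f : R * R -> W) : Ck k.+1 A f -> Ck k A f.
Proof.
elim: k A f => [|k IH] A f; first exact: Ck1_continuous.
by move=> [h1 h2 h3]; split => //; apply: IH.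
Qed.

Lemma Ck1M A (f g : R * R -> R) : relopen A -> Ck 1 A f -> Ck 1 A g ->
  Ck 1 A (fun p => f p * g p).
Proof.
move=> oA hf hg.
have cf := Ck1_continuous hf; have cg := Ck1_continuous hg.
move: hf hg => [f1 f2 f3] [g1 g2 g3].
apply: (@Ck1I _ _ _ (fun p => (f p * (jac A g p).1 + g p * (jac A f p).1,
                              f p * (jac A g p).2 + g p * (jac A f p).2))) => //=.
- move=> p Ap; have := is_dwithinM (lin2_bound_ge0 _) (@lin2_le _ _ _)
   (lin2_bound_ge0 _) (@lin2_le _ _ _) (f1 p Ap) (g1 p Ap).
  by apply: is_dwithin_eq => u; rewrite /lin2 /= /GRing.scale /=; ring.
- by move=> x; apply: cvgD; apply: cvgM; [exact: cf|exact: g2|exact: cg|exact: f2].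
- by move=> x; apply: cvgD; apply: cvgM; [exact: cf|exact: g3|exact: cg|exact: f3].
Qed.

Lemma Ck1D A (f g : R * R -> R) : relopen A -> Ck 1 A f -> Ck 1 A g ->
  Ck 1 A (fun p => f p + g p).
Proof.
move=> oA [f1 f2 f3] [g1 g2 g3].
apply: (@Ck1I _ _ _ (fun p => ((jac A f p).1 + (jac A g p).1,
                              (jac A f p).2 + (jac A g p).2))) => //=.
- move=> p Ap; have := is_dwithinD (f1 p Ap) (g1 p Ap).
  by apply: is_dwithin_eq => u; rewrite /lin2 /= /GRing.scale /=; ring.
- by move=> x; apply: cvgD; [exact: f2|exact: g2].
- by move=> x; apply: cvgD; [exact: f3|exact: g3].
Qed.

Lemma is_derive_is_dwithin (F : R -> R) (t d : R) : is_derive t 1 F d ->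
  is_dwithin [set: R] F t (fun s => s *: d).
Proof.
move=> [/cvg_ex[l hl] dv]; rewrite /derive (cvg_lim (@norm_hausdorff _ _) hl) in dv.
rewrite {}dv {l} in hl; apply/is_dwithinP => e e0.
move/cvgrPdist_le : hl => /(_ e e0); rewrite near_withinE => /nbhs_ballP[r /= r0 h].
exists r => // q _ qt; have [->|qnt] := eqVneq q t.
  by rewrite !subrr scale0r subrr normr0 mulr0.
have q0 : q - t != 0 by rewrite subr_eq0.
have := h (q - t); rewrite -ball_normE /= sub0r normrN => /(_ qt q0).
rewrite scaler1 subrK distrC => k.
have -> : F q - F t - (q - t) *: d = (q - t) * ((q - t)^-1 *: (F q - F t) - d).
  by rewrite mulrBr /GRing.scale /= mulrA mulfV// mul1r.
by rewrite normrM mulrC ler_wpM2r.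
Qed.

Lemma is_dwithin_post (A : set (R * R)) (g : R * R -> R) p (J : R * R) (F : R -> R) (d : R) :
  is_derive (g p) 1 F d -> is_dwithin A g p (lin2 J) ->
  is_dwithin A (F \o g) p (lin2 (d * J.1, d * J.2)).
Proof.
move=> /is_derive_is_dwithin hF hg.
have KB (u v : R) : (u - v) *: d = u *: d - v *: d by rewrite scalerBl.
have zA : exists2 e : R, 0 < e & forall s, A s -> `|s - p| < e -> (setT : set R) (g s) by exists 1.
have := is_dwithin_comp (lin2_bound_ge0 _) (@lin2_le _ _ _) (normr_ge0 d)
  (@scale_le _ _ d) KB zA hg hF.
by apply: is_dwithin_eq => u; rewrite /lin2 /= /GRing.scale /=; ring.
Qed.

Lemma Ck1_post A (g : R * R -> R) (F F' : R -> R) : relopen A -> Ck 1 A g ->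
  (forall x : R, is_derive x 1 F (F' x)) -> continuous F' -> Ck 1 A (F \o g).
Proof.
move=> oA hg hF cF'; have cg := Ck1_continuous hg; move: hg => [g1 g2 g3].
apply: (@Ck1I _ _ _ (fun p => (F' (g p) * (jac A g p).1, F' (g p) * (jac A g p).2))) => //=.
- by move=> p Ap; exact: is_dwithin_post (hF (g p)) (g1 p Ap).
- by move=> x; apply: cvgM; [apply: continuous_comp; [exact: cg|exact: cF']|exact: g2].
- by move=> x; apply: cvgM; [apply: continuous_comp; [exact: cg|exact: cF']|exact: g3].
Qed.

End RelativelyOpen.

End RelativelyOpenTheory.
Import RelativelyOpenTheory.

(** * Complex modulus and extended-valued suprema *)

Module ModulusTheory.

Section ComplexModulus.
Context {R : realType}.
Implicit Types (z w : R[i]) (a b : R).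

Lemma cabsE z : cabs z = Num.sqrt (complex.Re z ^+ 2 + complex.Im z ^+ 2).
Proof. by rewrite /cabs normc_def. Qed.

Lemma cabs_normE z : (cabs z)%:C = `|z|.
Proof. by rewrite cabsE normc_def. Qed.

Lemma cabs_ge0 z : 0 <= cabs z. Proof. by rewrite cabsE sqrtr_ge0. Qed.

Lemma cabs0 : cabs (0 : R[i]) = 0 :> R.
Proof. by rewrite cabsE /= expr0n addr0 sqrtr0. Qed.

Lemma cabsM z w : cabs (z * w) = cabs z * cabs w.
Proof. by apply: (@complexI R); rewrite rmorphM !cabs_normE normrM. Qed.

Lemma cabsD z w : cabs (z + w) <= cabs z + cabs w.
Proof. by rewrite -lecR rmorphD !cabs_normE ler_normD. Qed.

Lemma cabsN z : cabs (- z) = cabs z.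
Proof. by apply: (@complexI R); rewrite !cabs_normE normrN. Qed.

Lemma cabsB z w : cabs (z - w) <= cabs z + cabs w.
Proof. by rewrite -(cabsN w) cabsD. Qed.

Lemma cabs_distrC z w : cabs (z - w) = cabs (w - z).
Proof. by rewrite -cabsN opprB. Qed.

Lemma cabs_real a : cabs a%:C = `|a|.
Proof. by rewrite cabsE /= expr0n addr0 sqrtr_sqr. Qed.

Lemma cabs1 : cabs (1 : R[i]) = 1 :> R.
Proof. by rewrite (_ : 1 = (1 : R)%:C)// cabs_real normr1. Qed.

Lemma cabs_i : cabs ('i : R[i]) = 1 :> R.
Proof. by rewrite cabsE /= expr0n add0r expr1n sqrtr1. Qed.

Lemma cabs_eq0 z : cabs z = 0 -> z = 0.
Proof. by move=> h; apply/eqP; rewrite -normr_eq0 -cabs_normE h. Qed.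

Lemma Re_le_cabs z : `|complex.Re z| <= cabs z.
Proof. by rewrite cabsE -sqrtr_sqr ler_sqrt ?lerDl ?addr_ge0 ?sqr_ge0. Qed.

Lemma Im_le_cabs z : `|complex.Im z| <= cabs z.
Proof. by rewrite cabsE -sqrtr_sqr ler_sqrt ?lerDr ?addr_ge0 ?sqr_ge0. Qed.

Lemma complexRI z : z = (complex.Re z)%:C + 'i * (complex.Im z)%:C.
Proof. exact: complexE. Qed.

Lemma cabs_le z : cabs z <= `|complex.Re z| + `|complex.Im z|.
Proof.
rewrite {1}[z]complexRI (le_trans (cabsD _ _))// cabsM cabs_i mul1r.
by rewrite !cabs_real.
Qed.

Lemma ReM z w : complex.Re (z * w) =
  complex.Re z * complex.Re w - complex.Im z * complex.Im w.
Proof. by case: z w => [a b] [c d]. Qed.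

Lemma ImM z w : complex.Im (z * w) =
  complex.Re z * complex.Im w + complex.Im z * complex.Re w.
Proof. by case: z w => [a b] [c d]. Qed.

Lemma ReD z w : complex.Re (z + w) = complex.Re z + complex.Re w.
Proof. by case: z w => [a b] [c d]. Qed.

Lemma ImD z w : complex.Im (z + w) = complex.Im z + complex.Im w.
Proof. by case: z w => [a b] [c d]. Qed.

Lemma ReN z : complex.Re (- z) = - complex.Re z.
Proof. by case: z. Qed.

Lemma ImN z : complex.Im (- z) = - complex.Im z.
Proof. by case: z. Qed.

End ComplexModulus.

Section SupN.
Context {R : realType}.

Lemma supn_le (T : Type) (A : set T) (f : T -> R) (M : R) :
  (forall x, A x -> f x <= M) -> (supn A f <= M%:E)%E.
Proof. by move=> h; apply: ge_ereal_sup => _ [x Ax <-]; rewrite lee_fin h. Qed.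

Lemma supn_ge (T : Type) (A : set T) (f : T -> R) (x : T) :
  A x -> ((f x)%:E <= supn A f)%E.
Proof. by move=> Ax; apply: ereal_sup_ubound; exists x. Qed.

Lemma supn_leE (T : Type) (A : set T) (f : T -> R) (M : R) :
  (supn A f <= M%:E)%E -> forall x, A x -> f x <= M.
Proof. by move=> h x Ax; rewrite -lee_fin (le_trans _ h)// supn_ge. Qed.

Lemma supn_ge0 (T : Type) (A : set T) (f : T -> R) :
  A !=set0 -> (forall x, A x -> 0 <= f x) -> (0 <= supn A f)%E.
Proof.
by move=> [x Ax] f0; rewrite (le_trans _ (supn_ge f Ax))// lee_fin f0.
Qed.

Lemma adde_le_l (a b : \bar R) (M : R) : (0 <= a)%E -> (0 <= b)%E ->
  (a + b <= M%:E)%E -> (a <= M%:E)%E.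
Proof. by move=> a0 b0; apply: le_trans; rewrite leeDl. Qed.

Lemma adde_le_r (a b : \bar R) (M : R) : (0 <= a)%E -> (0 <= b)%E ->
  (a + b <= M%:E)%E -> (b <= M%:E)%E.
Proof. by move=> a0 b0; apply: le_trans; rewrite leeDr. Qed.

End SupN.

End ModulusTheory.
Import ModulusTheory.

(** * Charts of the surface and C^1 functions *)

Module ChartTheory.

Section SurfaceCharts.
Context {R : realType} {X : surface R}.
Implicit Types (i j : chidx X) (x : X) (v w : R * R).

(** Continuity of the inverse chart on the image of the chart domain sends a small half-disc around
    [crd i x] back into [B]. *)
Lemma relopen_crd i (B : set X) : open B -> relopen (crd i @` (dom i `&` B)).
Proof.
move=> oB; have [U oU eU] := crd_image i.
have [_ h] := open_relopen oU.
have AH : crd i @` (dom i `&` B) `<=` U `&` halfplane.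
  by rewrite -eU => _ [x [ix Bx] <-]; exists x.
split; first by move=> p /AH[].
move=> _ [x [ix Bx] <-]; have Ax : (U `&` halfplane) (crd i x) by rewrite -eU; exists x.
have [r r0 k] := h _ Ax.
have /subspace_continuousP/(_ (crd i x)) := @icrd_continuous R X i.
have ix' : (crd i @` dom i) (crd i x) by exists x.
have nB : nbhs (icrd i (crd i x)) B by rewrite crdK//; exact: (open_nbhs_nbhs (conj oB Bx)).
move=> /(_ ix') /(_ B nB).
move=> /within_nearP[d d0 k']; exists (Num.min r d); first by rewrite lt_min r0.
move=> q Hq; rewrite lt_min => /andP[qr qd].
have Aq := k q Hq qr; rewrite -eU in Aq; have := k' q Aq qd; case: Aq => y iy <-.
move=> By; have {}By : B (icrd i (crd i y)) by []. by rewrite crdK// in By; exists y.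
Qed.

Lemma relopen_dom i : relopen (crd i @` dom i : set (R * R)).
Proof. by have := relopen_crd i openT; rewrite setIT. Qed.

Lemma icrdK i (q : R * R) : (crd i @` dom i) q ->
  dom i (icrd i q) /\ crd i (icrd i q) = q.
Proof. by move=> [x ix <-]; rewrite crdK. Qed.

(** The direction opposite to [tvec]: [w] is read in the chart [j], the result in the chart selected
    at [x]. *)
Definition vtrans j x w : R * R :=
  lin2 (jac (crd j @` (dom j `&` dom (chart_at x))) (crd (chart_at x) \o icrd j)
            (crd j x)) w.

Lemma gnorm_vtrans j x w : dom j x ->
  gnorm x (vtrans j x w) = Num.sqrt (qform (met j (crd j x)) w).
Proof. by move=> jx; rewrite /gnorm /gmet /vtrans -met_compat//; exact: chart_atP. Qed.

Lemma transition_derivative i j x : dom i x -> dom j x ->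
  let A := crd j @` (dom j `&` dom i) in let f := crd i \o icrd j in
  is_dwithin A f (crd j x) (lin2 (jac A f (crd j x))).
Proof.
move=> ix jx A f; have [h _ _] := @crd_smooth R X j i 1%N.
by apply: h; exists x.
Qed.

Lemma curve_in_dom i j (I : set R) (y : R -> R * R) (t : R) w :
  (forall s, I s -> (crd j @` dom j) (y s)) -> I t -> dom i (icrd j (y t)) ->
  is_dwithin I y t (fun s => s *: w) ->
  exists2 e : R, 0 < e &
    forall s, I s -> `|s - t| < e -> (crd j @` (dom j `&` dom i)) (y s).
Proof.
move=> yD It iyt dy; have [_ h] := relopen_crd j (@dom_open R X i).
have [jyt cyt] := icrdK (yD t It).
have [|r r0 k] := h (y t); first by exists (icrd j (y t)).
have [d d0 k'] := is_dwithin_continuous (normr_ge0 w) (@scale_le _ _ w) dy r0.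
exists d => // s Is st; apply: k; last exact: k'.
by have [DH _] := relopen_dom j; apply/DH/yD.
Qed.

Lemma crd_curve i j (I : set R) (y : R -> R * R) (t : R) w :
  (forall s, I s -> (crd j @` dom j) (y s)) -> I t -> dom i (icrd j (y t)) ->
  is_dwithin I y t (fun s => s *: w) ->
  is_dwithin I (crd i \o icrd j \o y) t
    (fun s => s *: lin2 (jac (crd j @` (dom j `&` dom i)) (crd i \o icrd j) (y t)) w).
Proof.
move=> yD It iyt dy; have [jyt cyt] := icrdK (yD t It).
have := transition_derivative iyt jyt; rewrite cyt /=.
exact: is_dwithin_curve (curve_in_dom yD It iyt dy) dy.
Qed.

(** The curve is given in the chart [j], but [dfun] exists only in the chart selected at the point;
    the chain rule goes through that selected chart and back. *)
Lemma C1fun_curve (f : X -> R) j (I : set R) (y : R -> R * R) (t : R) w : C1fun f ->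
  (forall s, I s -> (crd j @` dom j) (y s)) -> I t ->
  is_dwithin I y t (fun s => s *: w) ->
  is_dwithin I (f \o icrd j \o y) t
    (fun s => s *: dfun f (icrd j (y t)) (vtrans j (icrd j (y t)) w)).
Proof.
move=> fC yD It dy; set x := icrd j (y t); set i := chart_at x.
have ix : dom i x by exact: chart_atP.
have [jx cx] := icrdK (yD t It).
have dc := crd_curve yD It ix dy.
have [fd _ _] := fC i.
have hf := fd (crd i x) (ex_intro2 _ _ x ix erefl).
have [e e0 he] := curve_in_dom yD It ix dy.
have zA : exists2 e : R, 0 < e &
    forall s, I s -> `|s - t| < e -> (crd i @` dom i) ((crd i \o icrd j \o y) s).
  exists e => // s Is se /=; have [z [jz iz] <-] := he s Is se.
  by exists z => //=; rewrite crdK.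
have := is_dwithin_curve zA dc hf; rewrite /vtrans -/i cx.
apply: is_dwithin_local; last by rewrite /= crdK.
by exists e => // s Is se; split => //=; last have [z [jz iz] <-] := he s Is se; rewrite !crdK.
Qed.

(** Complete the square after multiplying the form by [m.1.1]; the case [v.2 = 0] is the only one
    where the determinant does not help. *)
Lemma qform_gt0 (m : R * R * R) v : 0 < m.1.1 -> 0 < qdet m -> v <> 0 ->
  0 < qform m v.
Proof.
move=> m0 d0 v0; rewrite -(pmulr_rgt0 _ m0) /qform.
have -> : m.1.1 * (m.1.1 * v.1 ^+ 2 + 2 * m.1.2 * v.1 * v.2 + m.2 * v.2 ^+ 2) =
  (m.1.1 * v.1 + m.1.2 * v.2) ^+ 2 + qdet m * v.2 ^+ 2 by rewrite /qdet; ring.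
have [v2|v2] := eqVneq v.2 0.
  have v1 : v.1 != 0 by apply/eqP => v1; apply: v0; rewrite [v]surjective_pairing v1 v2.
  by rewrite v2 mulr0 addr0 expr0n mulr0 addr0 exprn_even_gt0//= mulf_neq0// gt_eqF.
by rewrite ltr_wpDl ?sqr_ge0// mulr_gt0// exprn_even_gt0.
Qed.

Lemma gnorm_gt0 x v : v <> 0 -> 0 < gnorm x v.
Proof.
move=> v0; rewrite sqrtr_gt0; have [|h1 h2] := @met_pos R X (chart_at x) (crd (chart_at x) x).
  by exists x => //; exact: chart_atP.
exact: qform_gt0.
Qed.

Lemma gnorm_ge0 x v : 0 <= gnorm x v. Proof. exact: sqrtr_ge0. Qed.

(** The supremum defining the norm skips zero vectors, for which the second inequality is checked
    separately; it then holds for all [v], which spares later case distinctions. *)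
Lemma C1norm_ge (f : X -> R[i]) (A : R) : (C1norm f <= A%:E)%E ->
  (forall x, cabs (f x) <= A) /\
  (forall x v, cabs (dfun (cRe f) x v +i* dfun (cIm f) x v) <= A * gnorm x v).
Proof.
have n1 : (0 <= supn [set: X] (fun x => cabs (f x)))%E.
  by apply: supn_ge0 => [|x _]; [exists point|exact: cabs_ge0].
have n2 : (0 <= supn [set xv : X * (R * R) | xv.2 <> 0%R]
     (fun xv => (cabs (dfun (cRe f) xv.1 xv.2 +i* dfun (cIm f) xv.1 xv.2)
                / gnorm xv.1 xv.2)%R))%E.
  apply: supn_ge0 => [|x _]; last by rewrite divr_ge0 ?cabs_ge0 ?gnorm_ge0.
  by exists (point, (1, 0)) => /= -[/eqP]; rewrite oner_eq0.
move=> h; have /supn_leE h1 := adde_le_l n1 n2 h; have /supn_leE h2 := adde_le_r n1 n2 h.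
split; first by move=> x; exact: h1.
move=> x v; have [->|/eqP v0] := eqVneq v 0.
  by rewrite /dfun /lin2 /= !scale0r !addr0 cabs0 mulr_ge0 ?gnorm_ge0// (le_trans _ (h1 x I)) ?cabs_ge0.
by have := h2 (x, v) v0; rewrite /= ler_pdivrMr ?gnorm_gt0.
Qed.

Lemma C1norm_le (f : X -> R[i]) (a b : R) : (forall x, cabs (f x) <= a) ->
  (forall x v, cabs (dfun (cRe f) x v +i* dfun (cIm f) x v) <= b * gnorm x v) ->
  (C1norm f <= (a + b)%:E)%E.
Proof.
move=> h1 h2; rewrite EFinD leeD//; apply: supn_le => //.
by move=> [x v] /= v0; rewrite ler_pdivrMr ?gnorm_gt0.
Qed.

Lemma C1funM (f g : X -> R) : C1fun f -> C1fun g -> C1fun (fun x => f x * g x).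
Proof. by move=> hf hg i; apply: (Ck1M (relopen_dom i) (hf i) (hg i)). Qed.

Lemma C1funD (f g : X -> R) : C1fun f -> C1fun g -> C1fun (fun x => f x + g x).
Proof. by move=> hf hg i; apply: (Ck1D (relopen_dom i) (hf i) (hg i)). Qed.

Lemma Ck1_cst (A : set (R * R)) (c : R) : relopen A -> Ck 1 A (fun=> c).
Proof.
move=> oA; apply: (@Ck1I _ _ _ _ (fun=> (0, 0))) => //.
- move=> p _; apply: is_dwithin_eq (is_dwithin_cst _ _ _) => u.
  by rewrite /lin2 /= !scaler0 addr0.
- by move=> x; exact: cvg_cst.
- by move=> x; exact: cvg_cst.
Qed.

Lemma C1fun_cst (c : R) : C1fun (fun=> c : R) (X := X).
Proof. by move=> i; exact: Ck1_cst (relopen_dom i). Qed.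

Lemma C1funZ (c : R) (f : X -> R) : C1fun f -> C1fun (fun x => c * f x).
Proof. by move=> hf; apply: C1funM => //; exact: C1fun_cst. Qed.

Lemma C1fun_post (f : X -> R) (F F' : R -> R) : C1fun f ->
  (forall x : R, is_derive x 1 F (F' x)) -> continuous F' -> C1fun (F \o f).
Proof. by move=> hf hF cF i; exact: (Ck1_post (relopen_dom i) (hf i) hF cF). Qed.

Lemma dfun_post (f : X -> R) (F : R -> R) (d : R) x v : C1fun f ->
  is_derive (f x) 1 F d -> dfun (F \o f) x v = d * dfun f x v.
Proof.
move=> hf hF; rewrite /dfun; set i := chart_at x.
have ix : dom i x by exact: chart_atP.
have Ax : (crd i @` dom i) (crd i x) by exists x.
have [h _ _] := hf i.
have := is_dwithin_post (p := crd i x) (g := f \o icrd i) (A := crd i @` dom i)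
  (J := jac (crd i @` dom i) (f \o icrd i) (crd i x)) (F := F) (d := d).
rewrite /= crdK// => /(_ hF (h _ Ax)) k.
have -> := jacE (relopen_dom i) Ax k.
by rewrite /lin2 /= /GRing.scale /=; ring.
Qed.

Lemma C1fun_continuous (f : X -> R) : C1fun f -> continuous f.
Proof.
move=> hf x; set i := chart_at x; have ix : dom i x by exact: chart_atP.
have /Ck1_continuous/within_continuousP cf := hf i.
have /subspace_continuousP/(_ x ix) cc := @crd_continuous R X i.
apply/cvgrPdist_lt => e e0.
have [d d0 k] := cf (crd i x) (ex_intro2 _ _ x ix erefl) e e0.
move/cvgrPdist_lt : cc => /(_ d d0); rewrite near_withinE => cc.
have : nbhs x (dom i) by exact: (open_nbhs_nbhs (conj (@dom_open R X i) ix)).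
move: cc; apply: filter_app2; near=> y => h iy.
have := k (crd i y) (ex_intro2 _ _ y iy erefl); rewrite /= !crdK// => k'.
by rewrite distrC; apply: k'; rewrite distrC; exact: h.
Unshelve. all: by end_near. Qed.

End SurfaceCharts.

End ChartTheory.
Import ChartTheory.

(** * Comparison of the metric with the coordinate norm *)

Module MetricBoundTheory.

Section WithinPairs.
Context {R : realType} {V W1 W2 : normedModType R}.

Lemma within_fst (A : set V) (f : V -> W1 * W2) : {within A, continuous f} ->
  {within A, continuous (fun x => (f x).1)}.
Proof.
move=> /within_continuousP h; apply/within_continuousP => p Ap e e0.
have [d d0 k] := h p Ap e e0; exists d => // q Aq qd.
by rewrite (le_lt_trans _ (k q Aq qd))// prod_normE le_max lexx.
Qed.

Lemma within_snd (A : set V) (f : V -> W1 * W2) : {within A, continuous f} ->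
  {within A, continuous (fun x => (f x).2)}.
Proof.
move=> /within_continuousP h; apply/within_continuousP => p Ap e e0.
have [d d0 k] := h p Ap e e0; exists d => // q Aq qd.
by rewrite (le_lt_trans _ (k q Aq qd))// prod_normE le_max lexx orbT.
Qed.

End WithinPairs.

Section Plane.
Context {R : realType}.
Implicit Types (p u v w : R * R) (J : (R * R) * (R * R)).

Lemma plane_normE p : `|p| = Num.max `|p.1| `|p.2|.
Proof. by rewrite prod_normE. Qed.

Lemma plane_norm_le p (M : R) : (`|p| <= M) = (`|p.1| <= M) && (`|p.2| <= M).
Proof. by rewrite plane_normE ge_max. Qed.

Lemma plane_norm_lt p (M : R) : (`|p| < M) = (`|p.1| < M) && (`|p.2| < M).
Proof. by rewrite plane_normE gt_max. Qed.

Lemma plane_norm1 p : `|p.1| <= `|p|.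
Proof. by rewrite plane_normE le_max lexx. Qed.

Lemma plane_norm2 p : `|p.2| <= `|p|.
Proof. by rewrite plane_normE le_max lexx orbT. Qed.

Lemma sqr_norm_le (x y : R) : `|x| <= y -> x ^+ 2 <= y ^+ 2.
Proof.
move=> h; rewrite -(real_normK (num_real x)) ler_pXn2r ?nnegrE//.
exact: le_trans h.
Qed.

Lemma enorm_le p : enorm p <= 2 * `|p|.
Proof.
rewrite -[leRHS]ger0_norm ?mulr_ge0// -sqrtr_sqr ler_sqrt ?sqr_ge0//.
have := sqr_norm_le (plane_norm1 p); have := sqr_norm_le (plane_norm2 p).
by rewrite exprMn; have := sqr_ge0 `|p|; lra.
Qed.

Lemma enorm_ge p : `|p| <= enorm p.
Proof.
by rewrite plane_norm_le -!sqrtr_sqr !ler_sqrt ?addr_ge0 ?sqr_ge0// lerDl lerDr !sqr_ge0.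
Qed.

Lemma is_dwithin_fst (V : normedModType R) (A : set V) (f : V -> R * R) t L :
  is_dwithin A f t L -> is_dwithin A (fun s => (f s).1) t (fun s => (L s).1).
Proof.
move=> h e e0; apply: filterS (h e e0) => q.
by rewrite plane_norm_le => /andP[].
Qed.

Lemma is_dwithin_snd (V : normedModType R) (A : set V) (f : V -> R * R) t L :
  is_dwithin A f t L -> is_dwithin A (fun s => (f s).2) t (fun s => (L s).2).
Proof.
move=> h e e0; apply: filterS (h e e0) => q.
by rewrite plane_norm_le => /andP[].
Qed.

Lemma plane_mean_value_le (f df : R -> R * R) (a b M : R) :
  (forall t, a <= t <= b -> is_dwithin `[a, b] f t (fun s => s *: df t)) ->
  (forall t, a <= t <= b -> `|df t| <= M) ->
  forall s t, a <= s <= b -> a <= t <= b -> `|f s - f t| <= M * `|s - t|.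
Proof.
move=> h hM s t sI tI; rewrite plane_norm_le; apply/andP; split.
- apply: (@mean_value_le _ (fun s => (f s).1) (fun s => (df s).1) a b) => // x xI.
    by have := is_dwithin_fst (h x xI).
  exact: (le_trans (plane_norm1 _) (hM x xI)).
- apply: (@mean_value_le _ (fun s => (f s).2) (fun s => (df s).2) a b) => // x xI.
    by have := is_dwithin_snd (h x xI).
  exact: (le_trans (plane_norm2 _) (hM x xI)).
Qed.

(** The vector [(J.2.1, - J.1.1)] is sent to 0 in the first coordinate by antisymmetry and in the
    second by assumption. Injectivity gives [J.1.1 = 0], and then (1, 0) is in the kernel. *)
Lemma lin2_degenerate J : (forall w, (lin2 J w).2 = 0) ->
  (forall w, lin2 J w = 0 -> w = 0) -> False.
Proof.
move=> h inj; have h1 := h (1, 0); have h2 := h (0, 1).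
rewrite /lin2 /= !scale1r !scale0r ?addr0 ?add0r in h1 h2.
have k0 : (J.2.1, - J.1.1) = 0 :> R * R.
  apply: inj; rewrite /lin2 /=; apply/pair_equal_spec; split; rewrite /= /GRing.scale /=.
    by ring.
  by rewrite h1 h2 !mulr0 addr0.
move: k0 => [a0 b0]; have : (1, 0) = 0 :> R * R.
  apply: inj; rewrite /lin2 /= scale1r scale0r addr0 [LHS]surjective_pairing h1.
  by congr pair; lra.
by move=> [/eqP]; rewrite oner_eq0.
Qed.

(** Cramer's rule, once injectivity has excluded a zero determinant. *)
Lemma lin2_surj J : (forall w, lin2 J w = 0 -> w = 0) -> forall v, exists w, lin2 J w = v.
Proof.
move=> inj v; have [d0|d0] := eqVneq (det2 J) 0.
  have e1 : (J.2.2, - J.1.2) = 0 :> R * R.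
    apply: inj; apply/pair_equal_spec; split; rewrite /= /GRing.scale /=.
      by rewrite -d0 /det2; ring.
    by ring.
  have e2 : (J.2.1, - J.1.1) = 0 :> R * R.
    apply: inj; apply/pair_equal_spec; split; rewrite /= /GRing.scale /=.
      by ring.
    by rewrite -oppr0 -d0 /det2; ring.
  exfalso; move: e1 e2 => [a b] [c d]; have : (1, 0) = 0 :> R * R.
    apply: inj; rewrite /lin2 /= scale1r scale0r addr0 [LHS]surjective_pairing.
    by congr pair; lra.
  by move=> [/eqP]; rewrite oner_eq0.
exists ((J.2.2 * v.1 - J.2.1 * v.2) / det2 J, (J.1.1 * v.2 - J.1.2 * v.1) / det2 J).
rewrite /lin2 [RHS]surjective_pairing; apply/pair_equal_spec; split;
  rewrite /= /GRing.scale /=; move: d0; rewrite /det2 => d0; field; exact: d0.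
Qed.

Lemma derivative_at_min (g : R -> R) (r d : R) : 0 < r ->
  (forall s, - r <= s <= r -> g 0 <= g s) ->
  is_dwithin `[- r, r] g 0 (fun s => s *: d) -> d = 0.
Proof.
move=> r0 h /is_dwithinP hd; apply/eqP; rewrite -normr_eq0.
apply/eqP/le_anti; rewrite normr_ge0 andbT; apply/ler_addgt0Pl => e e0; rewrite addr0.
have [a a0 k] := hd e e0.
set s := Num.min (a / 2) r.
have s0 : 0 < s by rewrite lt_min r0 divr_gt0.
have sa : s < a by rewrite (@le_lt_trans _ _ (a / 2)) ?ge_min ?lexx//; lra.
have sr : s <= r by rewrite ge_min lexx orbT.
have k1 := k s; have k2 := k (- s).
move: k1 k2; rewrite !itvE !subr0 normrN (gtr0_norm s0) => k1 k2.
have {k1}: `|g s - g 0 - s *: d| <= e * s by apply: k1 => //; lra.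
have {k2}: `|g (- s) - g 0 - (- s) *: d| <= e * s by apply: k2 => //; lra.
have := h s; have := h (- s); rewrite /GRing.scale /= !ler_norml => h1 h2.
have {}h1 : g 0 <= g (- s) by apply: h1; lra.
have {}h2 : g 0 <= g s by apply: h2; lra.
by move=> k1 k2; apply/andP; split; rewrite -(ler_pM2l s0); lra.
Qed.

Lemma qform_le (m : R * R * R) (B : R) w : `|m.1.1| <= B -> `|m.1.2| <= B -> `|m.2| <= B ->
  qform m w <= 4 * B * `|w| ^+ 2.
Proof.
move=> h1 h2 h3; have a := plane_norm1 w; have b := plane_norm2 w.
have B0 : 0 <= B by apply: le_trans h1.
have key (x y z : R) : `|x| <= B -> `|y| <= `|w| -> `|z| <= `|w| -> x * y * z <= B * `|w| ^+ 2.
  move=> hx hy hz; apply: (le_trans (ler_norm _)); rewrite !normrM expr2 mulrA.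
  by rewrite !ler_pM ?mulr_ge0.
rewrite /qform; have := key _ _ _ h1 a a; have := key _ _ _ h2 a b; have := key _ _ _ h3 b b.
rewrite !expr2; lra.
Qed.

(** Multiplying the form by one diagonal coefficient produces a square plus the determinant times
    the square of the other coordinate, so each coordinate is bounded in turn. *)
Lemma qform_ge (m : R * R * R) (B : R) w : 0 < m.1.1 -> 0 < qdet m -> 0 < B ->
  `|m.1.1| <= B -> `|m.2| <= B -> (qdet m)^-1 <= B -> `|w| ^+ 2 <= B ^+ 2 * qform m w.
Proof.
move=> m0 d0 B0 h1 h2 h3.
have G0 : 0 <= m.2.
  rewrite -(pmulr_rge0 _ m0); move: d0; rewrite /qdet => d0.
  by have := sqr_ge0 m.1.2; lra.
have e1 : m.1.1 * qform m w = (m.1.1 * w.1 + m.1.2 * w.2) ^+ 2 + qdet m * w.2 ^+ 2.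
  by rewrite /qform /qdet; ring.
have e2 : m.2 * qform m w = (m.1.2 * w.1 + m.2 * w.2) ^+ 2 + qdet m * w.1 ^+ 2.
  by rewrite /qform /qdet; ring.
have q0 : 0 <= qform m w.
  by rewrite -(pmulr_rge0 _ m0) e1 addr_ge0 ?sqr_ge0// mulr_ge0 ?sqr_ge0// ltW.
have key (x y : R) : 0 <= x -> `|x| <= B -> qdet m * y ^+ 2 <= x * qform m w ->
    y ^+ 2 <= B ^+ 2 * qform m w.
  move=> x0 xB hy.
  have : y ^+ 2 <= (qdet m)^-1 * (x * qform m w).
    by rewrite mulrC ler_pdivlMr// mulrC.
  move=> /le_trans; apply; rewrite expr2 -mulrA.
  have i0 : 0 <= (qdet m)^-1 by rewrite invr_ge0 ltW.
  have i1 : 0 <= x * qform m w by exact: mulr_ge0.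
  have i2 : x * qform m w <= B * qform m w by apply: ler_wpM2r => //; rewrite -(ger0_norm x0).
  exact: ler_pM.
rewrite plane_normE; have [_|_] := leP `|w.1| `|w.2|; rewrite real_normK ?num_real//.
  by apply: (key m.1.1) => //; [exact: ltW|rewrite e1 lerDr sqr_ge0].
by apply: (key m.2) => //; rewrite e2 lerDr sqr_ge0.
Qed.

Lemma compact_bounded_fun (T : topologicalType) (K : set T) (f : T -> R) :
  compact K -> {within K, continuous f} -> exists2 M : R, 0 < M & forall x, K x -> `|f x| <= M.
Proof.
move=> cK cf; have := continuous_compact cf cK.
move=> /compact_bounded[N [_ /(_ (`|N| + 1))]]; rewrite (le_lt_trans (ler_norm _)) ?ltrDl// => /(_ isT) h.
exists (`|N| + 1); first by rewrite ltr_wpDl.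
by move=> x Kx; apply: h; exists x.
Qed.

End Plane.

Section MetricBounds.
Context {R : realType} {X : surface R}.
Implicit Types (i j : chidx X) (x : X) (v w : R * R).

Lemma continuous_crd_comp (W : normedModType R) j (g : R * R -> W) (K : set X) : K `<=` dom j ->
  {within crd j @` dom j, continuous g} -> {within K, continuous (g \o crd j)}.
Proof.
move=> Kj /within_continuousP cg; apply/subspace_continuousP => x Kx.
have jx := Kj _ Kx.
have /subspace_continuousP/(_ x jx) cc := @crd_continuous R X j.
apply/cvgrPdist_lt => e e0.
have [d d0 k] := cg (crd j x) (ex_intro2 _ _ x jx erefl) e e0.
move/cvgrPdist_lt : cc => /(_ d d0); rewrite !near_withinE.
apply: filterS => y h Ky /=; rewrite distrC; apply: k; first by exists y => //; exact: Kj.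
by rewrite distrC; apply: h; exact: Kj.
Qed.

(** On the compact closure of [K] the coefficients of the metric and the inverse of its determinant
    are continuous, hence bounded; [qform_le] and [qform_ge] turn these bounds into the two
    inequalities. *)
Lemma metric_bounds j (K : set X) : closure K `<=` dom j -> exists2 B : R, 1 <= B &
  forall x w, K x -> `|w| <= B * Num.sqrt (qform (met j (crd j x)) w) /\
    Num.sqrt (qform (met j (crd j x)) w) <= B * `|w|.
Proof.
move=> Kj; have cK : compact (closure K).
  apply: (subclosed_compact (@closed_closure _ _) (@surface_compact R X)) => //.
have cm : {within crd j @` dom j, continuous (@met R X j)} by exact: (@met_smooth R X j 0%N).
have c11 : {within crd j @` dom j, continuous (fun p => (@met R X j p).1.1)}.
  exact: (within_fst (within_fst cm)).
have c12 : {within crd j @` dom j, continuous (fun p => (@met R X j p).1.2)}.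
  exact: (within_snd (within_fst cm)).
have c22 : {within crd j @` dom j, continuous (fun p => (@met R X j p).2)}.
  exact: (within_snd cm).
have cd : {within closure K, continuous ((fun p => qdet (@met R X j p)) \o crd j)}.
  apply: (continuous_crd_comp Kj) => x; rewrite /qdet; apply: cvgB.
    by apply: cvgM; [exact: c11|exact: c22].
  by rewrite expr2; apply: cvgM; exact: c12.
have dpos x : closure K x -> 0 < qdet (met j (crd j x)).
  by move=> Kx; have [|_ //] := @met_pos R X j (crd j x); exists x => //; exact: Kj.
have cdV : {within closure K, continuous (fun x => (qdet (met j (crd j x)))^-1)}.
  apply/subspace_continuousP => x Kx; apply: cvgV; first by rewrite gt_eqF// dpos.
  by move/subspace_continuousP : cd; apply.
have [B1 B1_0 h1] := compact_bounded_fun cK (continuous_crd_comp Kj c11).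
have [B2 B2_0 h2] := compact_bounded_fun cK (continuous_crd_comp Kj c12).
have [B3 B3_0 h3] := compact_bounded_fun cK (continuous_crd_comp Kj c22).
have [B4 B4_0 h4] := compact_bounded_fun cK cdV.
set B := 1 + B1 + B2 + B3 + B4.
have B0 : 0 < B by rewrite /B; lra.
exists (4 * B); first by rewrite /B; lra.
move=> x w /(@subset_closure _ K) Kx.
have jx : (crd j @` dom j) (crd j x) by exists x => //; exact: Kj.
have [E0 _] := met_pos jx; have D0 := dpos x Kx.
have b1 := h1 x Kx; have b2 := h2 x Kx; have b3 := h3 x Kx; have b4 := h4 x Kx.
rewrite /= in b1 b2 b3 b4.
have U := @qform_le R (met j (crd j x)) B w _ _ _.
have L := @qform_ge R (met j (crd j x)) B w E0 D0 B0 _ _ _.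
have {}U : qform (met j (crd j x)) w <= 4 * B * `|w| ^+ 2 by apply: U; rewrite /B; lra.
have {}L : `|w| ^+ 2 <= B ^+ 2 * qform (met j (crd j x)) w.
  by apply: L; rewrite /B; move: (ler_norm (qdet (met j (crd j x)))^-1); lra.
have q0 : 0 <= qform (met j (crd j x)) w.
  by rewrite -(pmulr_rge0 _ (exprn_gt0 2 B0)) (le_trans _ L)// sqr_ge0.
split.
  rewrite (@le_trans _ _ (B * Num.sqrt (qform (met j (crd j x)) w)))//; last first.
    by rewrite ler_wpM2r ?sqrtr_ge0//; lra.
  rewrite -(ler_pXn2r (n := 2))// ?nnegrE ?mulr_ge0 ?sqrtr_ge0//; last lra.
  by rewrite exprMn sqr_sqrtr.
rewrite -(ler_pXn2r (n := 2))// ?nnegrE ?mulr_ge0 ?sqrtr_ge0//; last lra.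
rewrite sqr_sqrtr// exprMn (le_trans U)// ler_wpM2r ?sqr_ge0// expr2 ler_peMl//; last first.
  by rewrite /B; lra.
by rewrite mulr_ge0// ltW.
Qed.

(** Otherwise [crd j x] is an interior point of the half-plane at which the second coordinate of the
    transition map is minimal, so the derivative of the transition takes only horizontal values.
    This contradicts its injectivity, which follows from the compatibility of the metrics. *)
Lemma bd_chart i j x : dom i x -> dom j x -> (crd i x).2 = 0 -> (crd j x).2 = 0.
Proof.
move=> ix jx b0; have [DH _] := relopen_dom j.
have : halfplane (crd j x) by apply: DH; exists x.
rewrite /halfplane /= le_eqVlt => /predU1P[->//|v0]; exfalso.
set A := crd j @` (dom j `&` dom i); set J := jac A (crd i \o icrd j) (crd j x).
have dJ := transition_derivative ix jx; rewrite /= -/A -/J in dJ.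
have oA : relopen A := relopen_crd j (@dom_open R X i).
have Ax : A (crd j x) by exists x.
apply: (@lin2_degenerate R J); last first.
  move=> w w0; apply: contrapT => wn; have := @met_compat R X j i x w jx ix.
  rewrite -/A -/J w0 => e; have [|h1 h2] := @met_pos R X j (crd j x); first by exists x.
  by have := qform_gt0 h1 h2 wn; rewrite e /qform /= !expr0n /= !mulr0 !addr0 ltxx.
move=> w; have [_ h] := oA; have [r r0 k] := h _ Ax.
(* [s0] keeps the line within the radius [r] and, thanks to half the height of the base point,
   inside the half-plane. *)
set s0 := Num.min (r / 2) ((crd j x).2 / 2) / (`|w| + 1).
have w1 : 0 < `|w| + 1 by rewrite ltr_wpDl.
have s00 : 0 < s0 by rewrite divr_gt0// lt_min !divr_gt0.
have lineA s : - s0 <= s <= s0 -> A (crd j x + s *: w).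
  rewrite -ler_norml => sw.
  have nw : `|s *: w| <= Num.min (r / 2) ((crd j x).2 / 2).
    rewrite normrZ (le_trans (ler_wpM2r (normr_ge0 w) sw))// /s0 -mulrA ler_piMr//.
      by rewrite le_min !divr_ge0// ltW.
    by rewrite mulrC ler_pdivrMr// mul1r lerDl.
  move: nw; rewrite le_min => /andP[n1 n2]; apply: k.
    have := plane_norm2 (s *: w); rewrite /halfplane /= => n3.
    by have := le_trans n3 n2; rewrite ler_norml; lra.
  by rewrite addrAC subrr add0r (le_lt_trans n1)//; lra.
have zA : exists2 e : R, 0 < e & forall s, `[- s0, s0]%classic s -> `|s - 0| < e -> A (crd j x + s *: w).
  by exists 1 => // s /itvE hs _; exact: lineA.
have d := is_dwithin_curve zA (is_dwithin_line _ _ _ _) (J := J) (f := crd i \o icrd j).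
rewrite scale0r addr0 in d; have {}d := is_dwithin_snd (d dJ).
have := @derivative_at_min R (fun s => (crd i (icrd j (crd j x + s *: w))).2) s0 (lin2 J w).2 s00.
apply=> //= s hs; rewrite scale0r addr0 crdK// b0.
have [y [jy iy] <-] := lineA s hs; rewrite crdK//.
by have [H _] := relopen_dom i; apply: H; exists y.
Qed.

End MetricBounds.

End MetricBoundTheory.
Import MetricBoundTheory.

(** * Leaf charts read in a fixed chart of the surface *)

Module LeafChartTheory.

Lemma bounds_chain (R : realType) (B k q x y : R) : 1 <= B -> 1 <= k -> 0 <= x -> 0 <= y ->
  y <= k * q -> q <= k * 2 * y -> x <= B * q -> q <= B * x ->
  [/\ x <= B * k * 2 * y, y <= B * k * 2 * x & q <= B * k * 2 * x].
Proof.
move=> B1 k1 x0 y0 h1 h2 h3 h4; have B0 : 0 <= B by lra. have k0 : 0 <= k by lra.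
have Bx := mulr_ge0 B0 x0; have kBx := mulr_ge0 k0 Bx.
split.
- by rewrite (le_trans h3)// -!mulrA ler_wpM2l// mulrA.
- rewrite (le_trans h1)// (le_trans (ler_wpM2l k0 h4))//; lra.
- rewrite (le_trans h4)//; have := ler_peMl Bx k1; lra.
Qed.

Section LChart.
Context {R : realType} {X : surface R} (c : lchart X) (kappa : R).
Context (hk : 0 < kappa) (hc : is_lchart kappa c).
Context (j : chidx X) (K : R) (hj : closure (limage c) `<=` dom j).
Context (hK : second_bounded K (crd j @` limage c) (linv c \o icrd j)).

Local Notation a := (lrad c).
Local Notation Y := (crd j @` limage c).
Local Notation Psi := (crd j \o lmap c).
Local Notation Phi := (linv c \o icrd j).
Local Notation DP y := (jac (crd j @` limage c) (linv c \o icrd j) y).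

Lemma limage_dom : limage c `<=` dom j.
Proof. by move=> x /(@subset_closure _ _) /hj. Qed.

Lemma setI_dom_limage : dom j `&` limage c = limage c.
Proof. by apply/setIidPr; exact: limage_dom. Qed.

Lemma lchart_relopen : relopen Y.
Proof.
by have [_ [_ [_ [op _]]]] := hc; have := relopen_crd j op; rewrite setI_dom_limage.
Qed.

Lemma Phi_ldom y : Y y -> ldom c (Phi y) /\ Psi (Phi y) = y.
Proof.
move=> [x [p pD ex] ey]; rewrite -ey -ex /=; have [_ [_ [h _]]] := hc.
by rewrite crdK ?h//; apply: limage_dom; exists p.
Qed.

Lemma Psi_image p : ldom c p -> Y (Psi p) /\ Phi (Psi p) = p.
Proof.
move=> pD; have [_ [_ [h _]]] := hc; split; first by exists (lmap c p) => //; exists p.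
by rewrite /= crdK ?h//; apply: limage_dom; exists p.
Qed.

Lemma lmap_dom p : ldom c p -> dom j (lmap c p).
Proof. by move=> pD; apply: limage_dom; exists p. Qed.

Lemma icrd_lchart y : Y y -> icrd j y = lmap c (Phi y).
Proof.
move=> [x [p pD ex] ey]; rewrite -ey -ex /=; have [_ [_ [h _]]] := hc.
by rewrite crdK ?h//; apply: limage_dom; exists p.
Qed.

Lemma ldom_square p : ldom c p -> `|p| < a.
Proof.
have [_ [[->|[rho [_ _ _ -> _]]] _]] := hc.
  by rewrite plane_norm_lt => -[-> ->].
by move=> [[h1 h2] _]; rewrite plane_norm_lt h1 h2.
Qed.

Lemma Phi_deriv y : Y y -> is_dwithin Y Phi y (lin2 (DP y)).
Proof.
move=> yY; have [_ [_ [_ [_ [_ [_ [h _]]]]]]] := hc.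
have [_ h2] := h j; rewrite setI_dom_limage in h2; case: h2 => h2 _ _.
exact: h2 yY.
Qed.

Lemma DPhi_C1 : Ck 1 Y (fun y => (DP y).1) /\ Ck 1 Y (fun y => (DP y).2).
Proof.
have [_ [_ [_ [_ [_ [_ [h _]]]]]]] := hc.
have [_ h2] := h j; rewrite setI_dom_limage in h2; case: h2 => _ h2 h3.
by split; [exact: h2|exact: h3].
Qed.

Lemma preimage_dom : ldom c `&` lmap c @^-1` dom j = ldom c.
Proof. by apply/setIidPl => p; exact: lmap_dom. Qed.

Lemma Psi_C2 : Ck 2 (ldom c) Psi.
Proof.
have [_ [_ [_ [_ [_ [_ [h _]]]]]]] := hc.
have [h2 _] := h j; rewrite preimage_dom in h2; exact: h2.
Qed.

Lemma Dlmap_curve (l r t : R) (p : R -> R * R) (u : R * R) : l < r -> l <= t <= r ->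
  (forall s, l <= s <= r -> ldom c (p s)) ->
  is_dwithin `[l, r] p t (fun s => s *: u) ->
  is_dwithin `[l, r] (crd (chart_at (lmap c (p t))) \o lmap c \o p) t
    (fun s => s *: Dlmap c (p t) u).
Proof.
move=> lr tI pD dp; have [_ [_ [_ [_ [cl [_ [h _]]]]]]] := hc.
set i := chart_at (lmap c (p t)); have [[hi _ _] _] := h i.
have ix : dom i (lmap c (p t)) by exact: chart_atP.
have pt := pD t tI.
have dl := hi (p t) (conj pt ix).
have zA : exists2 e : R, 0 < e & forall s, `[l, r]%classic s -> `|s - t| < e ->
    (ldom c `&` lmap c @^-1` dom i) (p s).
  have /subspace_continuousP/(_ (p t) pt) := cl.
  move=> /(_ (dom i) (open_nbhs_nbhs (conj (@dom_open R X i) ix))).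
  move=> /within_nearP[d d0 k].
  have [e e0 k'] := is_dwithin_continuous (normr_ge0 u) (@scale_le _ _ u) dp d0.
  exists e => // s sI st; have ps : ldom c (p s) by apply: pD; exact/itvE.
  by split => //; exact: (k _ ps (k' s sI st)).
exact: is_dwithin_curve zA dp dl.
Qed.

(** [Dlmap] is a Jacobian relative to [ldom c], for which uniqueness has not been proved. Comparing
    velocities of a curve on an interval, where the derivative is unique, avoids the question. *)
Lemma Dlmap_vtrans (l r t : R) (p : R -> R * R) (u w : R * R) : l < r -> l <= t <= r ->
  (forall s, l <= s <= r -> ldom c (p s)) ->
  is_dwithin `[l, r] p t (fun s => s *: u) ->
  is_dwithin `[l, r] (Psi \o p) t (fun s => s *: w) ->
  Dlmap c (p t) u = vtrans j (lmap c (p t)) w.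
Proof.
move=> lr tI pD dp dy; set i := chart_at (lmap c (p t)).
have ix : dom i (lmap c (p t)) by exact: chart_atP.
have d1 := Dlmap_curve lr tI pD dp.
have yD s : `[l, r]%classic s -> (crd j @` dom j) ((Psi \o p) s).
  by move=> /itvE sI; exists (lmap c (p s)) => //; exact/lmap_dom/pD.
have ptx : icrd j ((Psi \o p) t) = lmap c (p t) by rewrite /= crdK//; exact/lmap_dom/pD.
have iyt : dom i (icrd j ((Psi \o p) t)) by rewrite ptx.
have tI' : [set` `[l, r]] t by exact/itvE.
have d2 := crd_curve yD tI' iyt dy.
have acc e : 0 < e -> exists s, [/\ `[l, r]%classic s, s != t & `|s - t| < e].
  move=> e0; have [s [sI st se]] := itv_accumulation lr tI e0.
  by exists s; split => //; exact/itvE.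
have d3 : is_dwithin `[l, r] (crd i \o lmap c \o p) t
    (fun s => s *: vtrans j (lmap c (p t)) w).
  apply: is_dwithin_local d2; last by rewrite /= crdK//; exact/lmap_dom/pD.
  exists 1 => // s sI _; split => //=; rewrite crdK//; apply/lmap_dom/pD; exact/itvE.
exact: (is_dwithin_uniq acc d1 d3).
Qed.

Lemma Dlmap_bounds p u : ldom c p ->
  `|u| <= (1 + kappa) * gnorm (lmap c p) (Dlmap c p u) /\
  gnorm (lmap c p) (Dlmap c p u) <= (1 + kappa) * 2 * `|u|.
Proof.
move=> pD; have [_ [_ [_ [_ [_ [_ [_ [_ h]]]]]]]] := hc.
have /andP[h1 h2] := h p u pD; have k1 : 0 < 1 + kappa by rewrite addr_gt0.
rewrite ler_pdivrMr// mulrC in h1; split; first exact: (le_trans (enorm_ge _) h1).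
by rewrite (le_trans h2)// -mulrA ler_wpM2l ?enorm_le// ltW.
Qed.

Lemma DPhi_bounds : exists2 C : R, 1 <= C & forall y, Y y -> forall w,
  [/\ `|w| <= C * `|lin2 (DP y) w|, `|lin2 (DP y) w| <= C * `|w| &
   Num.sqrt (qform (met j y) w) <= C * `|w|].
Proof.
have [B B1 hB] := metric_bounds hj.
exists (B * (1 + kappa) * 2).
  by move: hk => hk0; rewrite -mulrA mulr_ege1//; lra.
have main y w : Y y -> 0 <= w.2 ->
   [/\ `|w| <= B * (1 + kappa) * 2 * `|lin2 (DP y) w|,
       `|lin2 (DP y) w| <= B * (1 + kappa) * 2 * `|w| &
       Num.sqrt (qform (met j y) w) <= B * (1 + kappa) * 2 * `|w|].
  move=> yY w0; have [r r0 hr] := relopen_ray lchart_relopen yY w0.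
  have [pD py] := Phi_ldom yY.
  set u := lin2 (DP y) w.
  have [p pE] : exists p : R -> R * R, p = fun s => Phi (y + s *: w) by exists (fun s => Phi (y + s *: w)).
  have y0 : y + (0 : R) *: w = y by rewrite scale0r addr0.
  have p0 : p 0 = Phi y by rewrite pE y0.
  have zA : exists2 e : R, 0 < e & forall s, `[0, r]%classic s -> `|s - 0| < e -> Y (y + s *: w).
    by exists 1 => // s /itvE hs _; exact: hr.
  have dp : is_dwithin `[0, r] p 0 (fun s => s *: u).
    have := is_dwithin_curve zA (is_dwithin_line _ _ _ _) (J := DP y) (f := Phi).
    by rewrite y0 pE; apply; exact: Phi_deriv.
  have dy : is_dwithin `[0, r] (Psi \o p) 0 (fun s => s *: w).
    have := is_dwithin_line `[0, r] y w 0; apply: is_dwithin_local.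
      exists 1 => // s /itvE sI _; split; first exact/itvE.
      by have [_ /= e] := Phi_ldom (hr s sI); rewrite pE /= e.
    by have [_ /= e] := Phi_ldom yY; rewrite pE /= y0 e.
  have pD' s : 0 <= s <= r -> ldom c (p s).
    by move=> sI; rewrite pE; have [] := Phi_ldom (hr s sI).
  have r00 : 0 <= (0 : R) <= r by rewrite lexx ltW.
  have e := Dlmap_vtrans r0 r00 pD' dp dy.
  rewrite p0 in e; have [h1 h2] := Dlmap_bounds u pD.
  rewrite e gnorm_vtrans in h1 h2; try exact: lmap_dom.
  rewrite -/(Psi (Phi y)) py in h1 h2.
  have := hB (lmap c (Phi y)) w _; rewrite -/(Psi (Phi y)) py => /(_ _)[|h3 h4].
    by exists (Phi y).
  have k1 : 1 <= 1 + kappa by move: hk => hk0; lra.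
  exact: bounds_chain B1 k1 (normr_ge0 w) (normr_ge0 u) h1 h2 h3 h4.
move=> y yY w; have [w0|/ltW w0] := leP 0 w.2; first exact: main.
have := main y (- w) yY; rewrite lin2N !normrN /= oppr_ge0 => /(_ w0).
by rewrite (_ : qform _ (- w) = qform (met j y) w)// /qform /= !sqrrN; ring.
Qed.

End LChart.

End LeafChartTheory.
Import LeafChartTheory.

(** * Mean value estimates along segments and their continuation *)

Module SegmentTheory.

Lemma plane_cauchy_cvg (R : realType) (F : nat -> R * R) :
  (forall e : R, 0 < e -> exists N, forall n m, (N <= n)%N -> (N <= m)%N -> `|F n - F m| <= e) ->
  exists l : R * R, F n @[n --> \oo] --> l.
Proof.
move=> h; have key (u : nat -> R) : (forall n m, `|u n - u m| <= `|F n - F m|) ->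
    exists l : R, u n @[n --> \oo] --> l.
  move=> uF; suff : cvg (u n @[n --> \oo]) by move=> /cvg_ex.
  apply: cauchy_cvg; apply: cauchy_exP => e e0.
  have [|N hN] := h (e / 2); first lra.
  exists (u N); exists N => // n /= Nn; rewrite -ball_normE /=.
  rewrite (le_lt_trans (uF _ _))// (le_lt_trans (hN _ _ _ Nn))//; lra.
have [l1 h1] := key (fun n => (F n).1) (fun n m => plane_norm1 (F n - F m)).
have [l2 h2] := key (fun n => (F n).2) (fun n m => plane_norm2 (F n - F m)).
exists (l1, l2); rewrite (_ : F = fun n => ((F n).1, (F n).2)); first exact: (cvg_pair h1 h2).
by apply/funext => n; rewrite -surjective_pairing.
Qed.

Lemma unit_itv01 (R : realType) : 0 <= (0 : R) <= 1 /\ 0 <= (1 : R) <= 1.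
Proof. by rewrite !lexx ler01. Qed.

Section Segments.
Context {R : realType} {X : surface R} (c : lchart X) (kappa : R).
Context (hk : 0 < kappa) (hc : is_lchart kappa c).
Context (j : chidx X) (K : R) (hj : closure (limage c) `<=` dom j).
Context (hK : second_bounded K (crd j @` limage c) (linv c \o icrd j)).

Local Notation a := (lrad c).
Local Notation Y := (crd j @` limage c).
Local Notation Psi := (crd j \o lmap c).
Local Notation Phi := (linv c \o icrd j).
Local Notation DP y := (jac (crd j @` limage c) (linv c \o icrd j) y).

Local Notation lchart_relopen := (LeafChartTheory.lchart_relopen hc hj).
Local Notation Phi_ldom := (LeafChartTheory.Phi_ldom hc hj).
Local Notation Psi_image := (LeafChartTheory.Psi_image hc hj).
Local Notation Phi_deriv := (LeafChartTheory.Phi_deriv hc hj).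
Local Notation DPhi_C1 := (LeafChartTheory.DPhi_C1 hc hj).
Local Notation Psi_C2 := (LeafChartTheory.Psi_C2 hc hj).
Local Notation DPhi_bounds := (LeafChartTheory.DPhi_bounds hk hc hj).

Definition seg (y w : R * R) := forall s : R, 0 <= s <= 1 -> Y (y + s *: w).

Lemma seg_rev y w : seg y w -> seg (y + w) (- w).
Proof.
move=> h s sI; have -> : y + w + s *: - w = y + (1 - s) *: w.
  by rewrite scalerN scalerBl scale1r addrA.
by apply: h; lra.
Qed.

Lemma seg_sub y w (s t : R) : 0 <= s <= 1 -> 0 <= t <= 1 -> seg y w ->
  seg (y + s *: w) ((t - s) *: w).
Proof.
move=> sI tI h x xI; rewrite -addrA scalerA -scalerDl; apply: h.
by move: sI tI xI => /andP[? ?] /andP[? ?] /andP[? ?]; apply/andP; split; nra.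
Qed.

Lemma seg_start y w : seg y w -> Y y.
Proof. by move=> /(_ 0); rewrite scale0r addr0; apply; rewrite lexx ler01. Qed.

Lemma seg_end y w : seg y w -> Y (y + w).
Proof. by move=> /(_ 1); rewrite scale1r; apply; rewrite lexx ler01. Qed.

Lemma seg_curve_deriv (W : normedModType R) (f : R * R -> W) y w :
  (forall z, Y z -> is_dwithin Y f z (lin2 (jac Y f z))) -> seg y w ->
  forall s : R, 0 <= s <= 1 -> is_dwithin `[(0 : R), 1] (fun s : R => f (y + s *: w)) s
    (fun s' : R => s' *: lin2 (jac Y f (y + s *: w)) w).
Proof.
move=> hf h s sI.
have zA : exists2 e : R, 0 < e & forall x, `[(0 : R), 1]%classic x -> `|x - s| < e -> Y (y + x *: w).
  by exists 1 => // x /itvE xI _; exact: h.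
exact: (is_dwithin_curve zA (is_dwithin_line _ _ _ _) (hf _ (h s sI))).
Qed.

(** Each column of the Jacobian is Lipschitz with constant [2 * K], one [K] per partial derivative;
    applying the two columns to [u] doubles this. *)
Lemma DPhi_lip y w u : seg y w ->
  `|lin2 (DP (y + w)) u - lin2 (DP y) u| <= 4 * K * `|w| * `|u|.
Proof.
move=> h; have [[c1 _ _] [c2 _ _]] := DPhi_C1; have [i0 i1] := unit_itv01 R.
have l1 : `|(DP (y + w)).1 - (DP y).1| <= 2 * K * `|w|.
  have H s : 0 <= s <= 1 -> `|lin2 (jac Y (fun y => (DP y).1) (y + s *: w)) w| <= 2 * K * `|w|.
    move=> sI; have [k1 k2 _ _] := hK (h s sI).
    rewrite (le_trans (lin2_le _ _))// ler_wpM2r//; lra.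
  have := plane_mean_value_le (seg_curve_deriv c1 h) H i1 i0.
  by rewrite scale1r scale0r addr0 subr0 normr1 mulr1.
have l2 : `|(DP (y + w)).2 - (DP y).2| <= 2 * K * `|w|.
  have H s : 0 <= s <= 1 -> `|lin2 (jac Y (fun y => (DP y).2) (y + s *: w)) w| <= 2 * K * `|w|.
    move=> sI; have [_ _ k1 k2] := hK (h s sI).
    rewrite (le_trans (lin2_le _ _))// ler_wpM2r//; lra.
  have := plane_mean_value_le (seg_curve_deriv c2 h) H i1 i0.
  by rewrite scale1r scale0r addr0 subr0 normr1 mulr1.
have -> : lin2 (DP (y + w)) u - lin2 (DP y) u =
  lin2 ((DP (y + w)).1 - (DP y).1, (DP (y + w)).2 - (DP y).2) u.
  by rewrite /lin2 /= !scalerBr opprD addrACA.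
rewrite (le_trans (lin2_le _ _))//= ler_wpM2r//; lra.
Qed.

Lemma K_ge0 y : Y y -> 0 <= K.
Proof. by move=> yY; have [h _ _ _] := hK yY; exact: le_trans h. Qed.

Lemma Phi_lip (C : R) y w : (forall z, Y z -> `|lin2 (DP z) w| <= C * `|w|) -> seg y w ->
  `|Phi (y + w) - Phi y| <= C * `|w|.
Proof.
move=> hC h; have [i0 i1] := unit_itv01 R.
have H s : 0 <= s <= 1 -> `|lin2 (DP (y + s *: w)) w| <= C * `|w| by move=> /h /hC.
have := plane_mean_value_le (seg_curve_deriv Phi_deriv h) H i1 i0.
by rewrite scale1r scale0r addr0 subr0 normr1 mulr1.
Qed.

(** The mean value inequality is applied along the segment to [Phi] minus its linear part, whose
    derivative [DPhi_lip] controls. *)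
Lemma Phi_taylor y w : seg y w ->
  `|Phi (y + w) - Phi y - lin2 (DP y) w| <= 4 * K * `|w| ^+ 2.
Proof.
move=> h; have [i0 i1] := unit_itv01 R; have K0 := K_ge0 (seg_start h).
have := @plane_mean_value_le R (fun s => Phi (y + s *: w) + (-1) *: (0 + s *: lin2 (DP y) w))
  (fun s => lin2 (DP (y + s *: w)) w - lin2 (DP y) w) 0 1 (4 * K * `|w| ^+ 2).
move=> /(_ _ _ 1 0 i1 i0); rewrite !scale1r !scale0r !addr0 subr0 normr1 mulr1.
rewrite scaler0 addr0 add0r scaleN1r addrAC; apply.
- move=> s sI; have := is_dwithinD (seg_curve_deriv Phi_deriv h sI)
    (is_dwithinZ (-1) (is_dwithin_line `[(0 : R), 1] 0 (lin2 (DP y) w) s)).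
  by apply: is_dwithin_eq => x; rewrite scalerBr scaleN1r.
- move=> s sI; have := DPhi_lip w (seg_sub i0 sI h).
  rewrite scale0r addr0 subr0 => /le_trans; apply.
  rewrite normrZ expr2 -!mulrA ler_wpM2l// ler_wpM2l// mulrA ler_wpM2r// ler_piMl//.
  by rewrite ger0_norm; lra.
Qed.

(** Inside the open square the domain is either everything or the set [0 <= rho], which is
    relatively closed by continuity of [rho]. *)
Lemma ldom_closed (p : R * R) : `|p| < a ->
  (forall e : R, 0 < e -> exists2 q, ldom c q & `|q - p| < e) -> ldom c p.
Proof.
move=> pa h; have sp : square a p by move: pa; rewrite plane_norm_lt => /andP[].
have [_ [[->//|[rho [cr _ _ e _]]] _]] := hc.
rewrite e; split => //=; rewrite leNgt; apply/negP => rp.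
have /within_continuousP/(_ p sp (- rho p)) := Ck1_continuous (CkS cr).
rewrite oppr_gt0 => /(_ rp)[d d0 k].
have [q] := h d d0; rewrite e => -[sq /= q0] qd.
by have := k q sq qd; rewrite ltr_norml; lra.
Qed.

(* A segment of the half-plane starting in [Y] cannot leave [Y] as long as its image stays away from
   the sides of the square. *)
Lemma seg_extend y w (rho0 : R) : rho0 < a -> Y y -> 0 <= (y + w).2 ->
  (forall s : R, 0 <= s <= 1 -> seg y (s *: w) -> `|Phi (y + s *: w)| <= rho0) -> seg y w.
Proof.
move=> ra yY w0 hr; have [C C1 hC] := DPhi_bounds; have [i0 i1] := unit_itv01 R.
have [YH oY] := lchart_relopen.
have y0 : 0 <= y.2 by exact: YH.
(* Continuity method. [S] holds the parameters up to which the segment stays in [Y]. Its supremum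
   belongs to it, because [Phi] is Lipschitz along the segment and its limit stays in [ldom c], away
   from the sides; it equals 1 because [Y] is relatively open. *)
pose S : set R := [set s : R | 0 <= s <= 1 /\ forall t : R, 0 <= t <= s -> Y (y + t *: w)]%classic.
have segS s : S s -> seg y (s *: w).
  move=> [sI h] t tI; rewrite scalerA; apply: h.
  by move: sI tI => /andP[? ?] /andP[? ?]; apply/andP; split; nra.
have S0 : S 0.
  split=> // t /andP[t0 t1]; have -> : t = 0 by lra.
  by rewrite scale0r addr0.
have supS : has_sup S by split; [exists 0|exists 1 => s [/andP[]]].
set s := sup S.
have s01 : 0 <= s <= 1.
  by rewrite sup_upper_bound//=; apply: ge_sup => //; [exists 0|move=> x [/andP[]]].
have belowS t : 0 <= t -> t < s -> S t.
  move=> t0 ts; have e0 : 0 < s - t by lra.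
  have [x [xI hx] tx] := sup_adherent e0 supS; rewrite -/s in tx.
  split; first by move: xI s01; lra.
  by move=> z zI; apply: hx; lra.
have HH t : 0 <= t <= 1 -> halfplane (y + t *: w).
  move=> /andP[t0 t1]; rewrite /halfplane /= /GRing.scale /=.
  by move: w0; rewrite /= => w0; nra.
have Ys : Y (y + s *: w).
  have [s0|/eqP s0] := eqVneq s 0; first by rewrite s0 scale0r addr0.
  have {}s0 : 0 < s by lra.
  have tailP e : 0 < e -> exists d : R, 0 < d /\ forall t t', 0 <= t < s -> 0 <= t' < s -> s - d < t ->
     s - d < t' -> `|Phi (y + t *: w) - Phi (y + t' *: w)| <= e.
    move=> e0; have w1 : 0 < `|w| + 1 by rewrite ltr_wpDl.
    have [d d0 hd] : exists2 d : R, 0 < d & C * (d * `|w|) <= e.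
      have Cw0 : 0 < C * (`|w| + 1) by rewrite mulr_gt0//; lra.
      exists (e / (C * (`|w| + 1))); first by rewrite divr_gt0.
      rewrite mulrCA mulrAC ler_pdivrMr// ler_wpM2l ?ler_wpM2l ?lerDl//; lra.
    exists d; split => //.
    have H t t' : 0 <= t <= t' -> t' < s -> s - d < t ->
        `|Phi (y + t *: w) - Phi (y + t' *: w)| <= e.
      move=> tt ts st; have S1 : 0 <= t' by lra.
      have le0 : 0 <= t' - t by lra.
      have le1 : t' - t <= d by lra.
      have S' := belowS t' S1 ts.
      have sg2 : seg (y + t *: w) ((t' - t) *: w).
        move=> z zI; rewrite -addrA scalerA -scalerDl.
        have [_] := S'; apply.
        by move: zI tt => /andP[? ?] /andP[? ?]; apply/andP; split; nra.
      rewrite distrC; have := Phi_lip (fun z zY => let: And3 _ h _ := hC z zY ((t' - t) *: w) in h) sg2.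
      rewrite -addrA -scalerDl addrCA subrr addr0 => /le_trans; apply.
      apply: le_trans hd; rewrite normrZ ler_wpM2l//; first exact: le_trans C1.
      by rewrite ler_wpM2r// ger0_norm.
    move=> t t' tI t'I st st'; have [tt|tt] := leP t t'; first by apply: H => //; lra.
    by rewrite distrC; apply: H => //; lra.
  (* With denominators starting at 2, all parameters lie in [0, s[ and increase to [s]. *)
  pose F := (fun n : nat => Phi (y + (s - s / n.+2%:R) *: w)).
  have tn n : 0 <= s - s / n.+2%:R < s.
    have n0 : 0 < n.+2%:R :> R by [].
    have n2 : 1 <= n.+2%:R :> R by rewrite ler1n.
    apply/andP; split; last by rewrite gtrBl; exact: divr_gt0.
    by rewrite subr_ge0 ler_pdivrMr//; exact: (ler_peMr (ltW s0) n2).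
  have tncvg (d : R) : 0 < d -> exists N, forall n, (N <= n)%N -> s - d < s - s / n.+2%:R.
    move=> d0; exists (Num.truncn (s / d)).+1 => n Nn.
    rewrite ltrD2l ltrN2 ltr_pdivrMr// -ltr_pdivrMl// mulrC.
    rewrite (lt_le_trans (truncnS_gt _))// ler_nat (leq_trans Nn)//.
    by rewrite -addn2 leq_addr.
  have [pl hl] : exists pl : R * R, F n @[n --> \oo] --> pl.
    apply: plane_cauchy_cvg => e /tailP[d [d0 hd]]; have [N hN] := tncvg d d0.
    by exists N => n m Nn Nm; exact: (hd _ _ (tn _) (tn _) (hN _ Nn) (hN _ Nm)).
  have Fr n : `|F n| <= rho0.
    have /andP[t0 ts] := tn n; apply: hr.
      by have /andP[_ ?] := s01; rewrite t0 (le_trans (ltW ts)).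
    by apply: segS; exact: belowS.
  have plr : `|pl| <= rho0.
    apply/ler_addgt0Pl => e e0; move/cvgrPdist_lt : (hl) => /(_ e e0)[N _ /(_ N (leqnn N)) /= h].
    rewrite -(subrK (F N) pl) (le_trans (ler_normD _ _))// lerD// ltW//.
  have pD : ldom c pl.
    apply: ldom_closed; first exact: le_lt_trans ra.
    move=> e e0; move/cvgrPdist_lt : (hl) => /(_ e e0)[N _ /(_ N (leqnn N)) /= h].
    exists (F N); last by rewrite distrC.
    have /andP[t0 ts] := tn N; have [_ /(_ (s - s / N.+2%:R))] := belowS _ t0 ts.
    by rewrite t0 lexx => /(_ isT) /Phi_ldom[].
  have [YP _] := Psi_image pD.
  suff -> : y + s *: w = Psi pl by [].
  apply/eqP; rewrite -subr_eq0 -normr_eq0; apply/eqP/le_anti; rewrite normr_ge0 andbT.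
  apply/ler_addgt0Pl => e e0; rewrite addr0.
  have /within_continuousP/(_ pl pD (e / 2)) := Ck1_continuous (CkS Psi_C2).
  rewrite divr_gt0// => /(_ isT)[d d0 k].
  have w1 : 0 < `|w| + 1 by rewrite ltr_wpDl.
  have [|N1 hN1] := tncvg (e / 2 / (`|w| + 1)); first by rewrite !divr_gt0.
  move/cvgrPdist_lt : (hl) => /(_ d d0)[N2 _ hN2].
  set n := maxn N1 N2; have h2 := hN2 n (leq_maxr _ _); have h1 := hN1 n (leq_maxl _ _).
  rewrite /= distrC in h2; have /andP[t0 ts] := tn n.
  have [_ /(_ (s - s / n.+2%:R))] := belowS _ t0 ts; rewrite t0 lexx => /(_ isT) Yn.
  have [Dn en] := Phi_ldom Yn; have := k (F n) Dn h2; rewrite /F en => h3.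
  rewrite -(subrK (y + (s - s / n.+2%:R) *: w) (y + s *: w)) -addrA.
  rewrite (le_trans (ler_normD _ _))//.
  have -> : e = e / 2 + e / 2 by lra.
  rewrite lerD//; last exact: ltW.
  rewrite opprD addrACA subrr add0r -scalerBl normrZ opprB addrCA subrr addr0.
  have : s / n.+2%:R <= e / 2 / (`|w| + 1) by move: h1; rewrite ltrD2l ltrN2 => /ltW.
  rewrite ler_pdivlMr// => h4; apply: le_trans h4.
  have q0 : 0 <= s / n.+2%:R by rewrite divr_ge0// ltW.
  by rewrite (ger0_norm q0) ler_wpM2l// lerDl.
have Ss : S s.
  split=> // t /andP[t0 ts]; move: ts; rewrite le_eqVlt => /predU1P[->//|ts].
  by have [_ /(_ t)] := belowS t t0 ts; apply; rewrite t0 lexx.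
suff s1 : s = 1 by move: (segS s Ss); rewrite s1 scale1r.
apply/eqP; rewrite eq_le; have /andP[_ ->] := s01; rewrite /= leNgt; apply/negP => s1.
have [r r0 k] := oY _ Ys.
have w1 : 0 < `|w| + 1 by rewrite ltr_wpDl.
set d := Num.min (1 - s) (r / 2 / (`|w| + 1)).
have d0 : 0 < d by rewrite lt_min !divr_gt0 ?andbT//; lra.
have d1 : d <= 1 - s by rewrite ge_min lexx.
have d2 : d <= r / 2 / (`|w| + 1) by rewrite ge_min lexx orbT.
suff : S (s + d).
  by move=> /(sup_upper_bound supS); rewrite -/s; lra.
split; first lra.
move=> t tI; have [ts|ts] := leP t s; first by have [_] := Ss; apply; lra.
apply: k; first by apply: HH; lra.
rewrite opprD addrACA subrr add0r -scalerBl normrZ ger0_norm; last lra.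
rewrite (@le_lt_trans _ _ (r / 2))//; last lra.
rewrite ler_pdivlMr// in d2; apply: le_trans d2; apply: ler_pM => //; lra.
Qed.

End Segments.

End SegmentTheory.
Import SegmentTheory.

(** * Quasi-convexity of the image of a leaf chart *)

Module QuasiConvexityTheory.

Lemma plane_eq (R : realType) (p q : R * R) : p.1 = q.1 -> p.2 = q.2 -> p = q.
Proof. by case: p q => [? ?] [? ?] /= -> ->. Qed.

Lemma room_for_chord (R : realType) (x y c : R) : x <= y - 3 * c -> 0 < c -> x + c < y.
Proof. lra. Qed.

Lemma both_small (R : realType) (t u s d : R) : - d <= u - t -> u - t <= d -> 0 <= d ->
  t < s \/ u < s -> t <= s + d /\ u <= s + d.
Proof. by move=> h1 h2 h3 [h|h]; lra. Qed.

Section QuasiConvexity.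
Context {R : realType} {X : surface R} (c : lchart X) (kappa : R).
Context (hk : 0 < kappa) (hc : is_lchart kappa c).
Context (j : chidx X) (K : R) (hj : closure (limage c) `<=` dom j).
Context (hK : second_bounded K (crd j @` limage c) (linv c \o icrd j)).

Local Notation a := (lrad c).
Local Notation Y := (crd j @` limage c).
Local Notation Psi := (crd j \o lmap c).
Local Notation Phi := (linv c \o icrd j).
Local Notation DP y := (jac (crd j @` limage c) (linv c \o icrd j) y).

Local Notation lmap_dom := (LeafChartTheory.lmap_dom hj).
Local Notation lchart_relopen := (LeafChartTheory.lchart_relopen hc hj).
Local Notation Phi_ldom := (LeafChartTheory.Phi_ldom hc hj).
Local Notation Psi_image := (LeafChartTheory.Psi_image hc hj).
Local Notation ldom_square := (LeafChartTheory.ldom_square hc).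
Local Notation Psi_C2 := (LeafChartTheory.Psi_C2 hc hj).
Local Notation Dlmap_vtrans := (LeafChartTheory.Dlmap_vtrans hc hj).
Local Notation Dlmap_bounds := (LeafChartTheory.Dlmap_bounds hk hc).
Local Notation DPhi_bounds := (LeafChartTheory.DPhi_bounds hk hc hj).
Local Notation seg := (SegmentTheory.seg c j).
Local Notation seg_rev := (SegmentTheory.seg_rev (c := c) (j := j)).
Local Notation seg_end := (SegmentTheory.seg_end (c := c) (j := j)).
Local Notation Phi_lip := (SegmentTheory.Phi_lip hc hj).
Local Notation K_ge0 := (SegmentTheory.K_ge0 hK).
Local Notation Phi_taylor := (SegmentTheory.Phi_taylor hc hj hK).
Local Notation seg_extend := (SegmentTheory.seg_extend hk hc hj).

Lemma lrad_gt0 : 0 < a. Proof. by case: hc. Qed.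

(** A boundary point would make the second coordinate of [Psi] minimal at an interior point of the
    square. The derivative of [Psi] would then be horizontal in every direction, against the lower
    bound in [Dlmap_bounds]. *)
Lemma interior_off_boundary p : ldom c = square a -> ldom c p -> (Psi p).2 <> 0.
Proof.
move=> eD pD p0; have pa := ldom_square pD.
have inD q : `|q| < a -> ldom c q by rewrite eD plane_norm_lt => /andP[].
set J := jac (ldom c) Psi p.
have dJ : is_dwithin (ldom c) Psi p (lin2 J) by have [h _ _] := Psi_C2; exact: h.
have lines u : exists2 r : R, 0 < r & forall s, - r <= s <= r -> ldom c (p + s *: u).
  have u1 : 0 < `|u| + 1 by rewrite ltr_wpDl.
  exists ((a - `|p|) / 2 / (`|u| + 1)); first by rewrite !divr_gt0// subr_gt0.
  move=> s; rewrite -ler_norml ler_pdivlMr// mulrDr mulr1 => h; apply: inD.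
  rewrite (le_lt_trans (ler_normD _ _))// normrZ.
  by have := normr_ge0 s; lra.
have dline u r : 0 < r -> (forall s, - r <= s <= r -> ldom c (p + s *: u)) ->
    is_dwithin `[- r, r] (Psi \o (fun s : R => p + s *: u)) 0 (fun s => s *: lin2 J u).
  move=> r0 h; have zA : exists2 e : R, 0 < e & forall s, `[- r, r]%classic s -> `|s - 0| < e ->
      ldom c (p + s *: u) by exists 1 => // s /itvE hs _; exact: h.
  have := is_dwithin_curve zA (is_dwithin_line _ _ _ _) (J := J) (f := Psi).
  by rewrite scale0r addr0; exact.
have v0 q : ldom c q -> 0 <= (Psi q).2.
  by move=> /Psi_image[qY _]; have [H _] := lchart_relopen; exact: H qY.
apply: (@lin2_degenerate R J).
  move=> u; have [r r0 h] := lines u.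
  apply: (derivative_at_min r0 _ (is_dwithin_snd (dline u r r0 h))) => s sI.
  by have := v0 _ (h s sI); rewrite /= scale0r addr0 => h0; rewrite /= in p0; rewrite p0.
move=> u u0; have [r r0 h] := lines u.
have rr : - r < r by lra.
have rI : - r <= (0 : R) <= r by lra.
have := Dlmap_vtrans rr rI h (is_dwithin_line _ _ _ _) (dline u r r0 h).
rewrite scale0r addr0 u0 => e; have [h1 _] := Dlmap_bounds u pD.
move: h1; rewrite e gnorm_vtrans; last exact: lmap_dom.
rewrite /qform /= !expr0n /= !mulr0 !addr0 sqrtr0 mulr0 normr_le0.
by move/eqP.
Qed.

(** The zero set of [rho] is connected and [Psi] sends it into the line of second coordinate 0. A
    connected subset of a line is an interval, so it contains the chord between any two of its
    points. *)
Lemma boundary_seg y1 y2 : Y y1 -> Y y2 -> y1.2 = 0 -> y2.2 = 0 -> seg y1 (y2 - y1).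
Proof.
move=> Y1 Y2 b1 b2; have [D1 e1] := Phi_ldom Y1; have [D2 e2] := Phi_ldom Y2.
have [_ [[eD|[rho [cr co _ eD hb]]] _]] := hc.
  by have := interior_off_boundary eD D1; rewrite e1.
pose B := square a `&` [set p | rho p = 0].
have Bpsi p : B p -> ldom c p /\ (Psi p).2 = 0.
  move=> [sp rp]; have pD : ldom c p by rewrite eD; split => //=; rewrite rp.
  split => //; have [_ /(_ rp)[i ix bx]] := hb p pD.
  exact: (bd_chart ix (lmap_dom pD) bx).
have psiB p : ldom c p -> (Psi p).2 = 0 -> B p.
  move=> pD p0; have [+ _] := hb p pD => hp; split; last first.
    by apply: hp; exists j => //; exact: lmap_dom.
  by move: pD; rewrite eD => -[].
have cB : {within B, continuous (fun p => (Psi p).1)}.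
  apply: within_continuousS (within_fst (Ck1_continuous (CkS Psi_C2))).
  by move=> p /Bpsi[].
have /connected_intervalP itv := connected_continuous_connected co cB.
have I1 : [set (Psi p).1 | p in B]%classic y1.1.
  by exists (Phi y1); [apply: psiB => //; rewrite e1|rewrite e1].
have I2 : [set (Psi p).1 | p in B]%classic y2.1.
  by exists (Phi y2); [apply: psiB => //; rewrite e2|rewrite e2].
have sub x : Num.min y1.1 y2.1 <= x <= Num.max y1.1 y2.1 -> Y (x, 0).
  move=> xI; have [p /Bpsi[pD p0] px] : [set (Psi p).1 | p in B]%classic x.
    by move: xI; have [_ xI|_ xI] := leP y1.1 y2.1; exact: (itv _ _ _ _ _ xI).
  have -> : (x, 0) = Psi p by rewrite [RHS]surjective_pairing p0 px.
  by have [] := Psi_image pD.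
move=> s /andP[s0 s1]; have -> : y1 + s *: (y2 - y1) = (y1.1 + s * (y2.1 - y1.1), 0).
  by rewrite [LHS]surjective_pairing /= /GRing.scale /= b1 b2 subrr mulr0 addr0.
apply: sub; have [h|/ltW h] := leP y1.1 y2.1; apply/andP; split; nra.
Qed.

(* Moving towards the centre of the square increases the distance to its sides. *)
Lemma push_inward (C : R) y n e (s s0 : R) :
  (forall y, Y y -> forall w, `|lin2 (DP y) w| <= C * `|w|) ->
  Y y -> `|e| <= C * a -> `|Phi y - n| <= a / 16 -> `|lin2 (DP y) e + n| <= a / 8 ->
  a / 2 <= `|n| -> 0 <= s <= s0 -> s0 <= 1 -> 4 * K * s0 * (C * a) ^+ 2 <= a / 16 ->
  0 <= (y + s *: e).2 ->
  seg y (s *: e) /\ `|Phi (y + s *: e)| <= a - s * (3 * a / 16).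
Proof.
move=> hC yY eC pn en n0 /andP[s0' ss] s01 hs0 H.
have a0 := lrad_gt0; have K0 := K_ge0 yY; have [yD _] := Phi_ldom yY.
have pa := ldom_square yD.
(* The rate [3 * a / 16] is what [7 * a / 16 <= |Phi y|] leaves after the errors [a / 16] of [n],
   [a / 8] of the direction [e] and [a / 16] of the Taylor remainder. *)
have est (x : R) : 0 <= x <= s -> seg y (x *: e) ->
    `|Phi (y + x *: e)| <= `|Phi y| - x * (3 * a / 16).
  move=> /andP[x0 xs] sg; have T := Phi_taylor sg.
  rewrite lin2Z in T; set r := Phi (y + x *: e) - _ - _ in T.
  have -> : Phi (y + x *: e) = (1 - x) *: Phi y + x *: (Phi y - n) + x *: (lin2 (DP y) e + n) + r.
    rewrite /r; apply: plane_eq; rewrite /= /GRing.scale /=; ring.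
  have T' : `|r| <= x * (a / 16).
    rewrite (le_trans T)// normrZ (ger0_norm x0) exprMn expr2.
    have : `|e| ^+ 2 <= (C * a) ^+ 2 by rewrite ler_pXn2r ?nnegrE ?(le_trans _ eC).
    have K4 : 0 <= 4 * K * x by rewrite !mulr_ge0.
    move=> /(ler_wpM2l K4); have : x * (4 * K * x * (C * a) ^+ 2) <= x * (a / 16).
      apply: ler_wpM2l => //; apply: le_trans hs0; rewrite ler_wpM2r ?sqr_ge0// ler_wpM2l ?mulr_ge0//.
      exact: le_trans ss.
    move=> h1 /(ler_wpM2l x0); lra.
  have np : `|n| - a / 16 <= `|Phi y|.
    by have := ler_normB (Phi y) (Phi y - n); rewrite opprB addrCA subrr addr0; lra.
  have t1 : `|(1 - x) *: Phi y| = (1 - x) * `|Phi y| by rewrite normrZ ger0_norm//; lra.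
  have t2 : `|x *: (Phi y - n)| <= x * (a / 16) by rewrite normrZ (ger0_norm x0) ler_wpM2l.
  have t3 : `|x *: (lin2 (DP y) e + n)| <= x * (a / 8) by rewrite normrZ (ger0_norm x0) ler_wpM2l.
  have t4 : x * (7 * a / 16) <= x * `|Phi y| by apply: ler_wpM2l => //; lra.
  apply: (le_trans (ler_normD _ _)); apply: (le_trans (lerD (ler_normD _ _) T')).
  apply: (le_trans (lerD (lerD (ler_normD _ _) t3) (lexx _))).
  by rewrite t1; lra.
suff sg : seg y (s *: e).
  by split => //; rewrite (le_trans (est s _ sg)) ?s0' ?lexx// lerD2r ltW.
apply: (seg_extend pa yY H) => x /andP[x0 x1]; rewrite scalerA => sg.
apply: (le_trans (est _ _ sg)); first by apply/andP; split; nra.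
by rewrite gerBl; apply: mulr_ge0; [exact: mulr_ge0|lra].
Qed.

(** Along the chord [Phi] moves by at most [C * |w|], so it keeps away from the sides and
    [seg_extend] applies. *)
Lemma join_seg (C : R) y w : 1 <= C -> (forall y, Y y -> forall w, `|lin2 (DP y) w| <= C * `|w|) ->
  Y y -> 0 <= (y + w).2 -> `|Phi y| + C * `|w| < a -> seg y w.
Proof.
move=> C1 hC yY H h; apply: (seg_extend h yY H) => s /andP[s0 s1] sg.
have := Phi_lip (fun z zY => hC z zY (s *: w)) sg; rewrite normrZ ger0_norm// => L.
rewrite -(subrK (Phi y) (Phi (y + s *: w))) (le_trans (ler_normD _ _))// addrC lerD2l.
apply: (le_trans L); rewrite ler_wpM2l ?ler_piMl//; lra.
Qed.

(** By [seg_extend] a chord can leave [Y] only where its image reaches the sides of the square. From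
    the half square the chord itself works. Otherwise both ends are pushed along one vector [e]
    whose image by the derivative is close to [- Phi y1], that is, towards the centre, for a time
    proportional to their distance, and are then joined. If a push would cross the boundary of the
    surface, both ends are stopped on it and joined by [boundary_seg]. *)
Lemma quasi_convex : (exists y, Y y) -> exists eta CQ : R, [/\ 0 < eta, 1 <= CQ &
  forall y1 y2, Y y1 -> Y y2 -> `|y2 - y1| <= eta -> `|Phi y2 - Phi y1| <= eta ->
   (forall u, `|lin2 (DP y2) u - lin2 (DP y1) u| <= eta * `|u|) ->
  exists z1 z2, [/\ seg y1 (z1 - y1), seg z1 (z2 - z1), seg z2 (y2 - z2) &
   [/\ `|z1 - y1| <= CQ * `|y2 - y1|, `|z2 - z1| <= CQ * `|y2 - y1| &
       `|y2 - z2| <= CQ * `|y2 - y1|]]].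
Proof.
move=> [y0 Y0]; have [C C1 hC] := DPhi_bounds; have a0 := lrad_gt0; have K0 := K_ge0 Y0.
have C0 : 0 < C by lra.
have aa : 0 <= a / 16 by lra.
have a168 : a / 16 <= a / 8 by lra.
have hC2 y : Y y -> forall w, `|lin2 (DP y) w| <= C * `|w|.
  by move=> yY w; have [] := hC y yY w.
(* Up to the time [s0] the quadratic Taylor error of a push, per unit of time, is at most
   [a / 16]. *)
have [s0 [s0_0 s01 hs0]] : exists s0 : R, [/\ 0 < s0, s0 <= 1 & 4 * K * s0 * (C * a) ^+ 2 <= a / 16].
  set q := 4 * K * (C * a) ^+ 2; have q0 : 0 <= q by apply: mulr_ge0; [exact: mulr_ge0|exact: sqr_ge0].
  exists (Num.min 1 (a / 16 / (q + 1))); split.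
  - by rewrite lt_min ltr01 !divr_gt0// ltr_wpDl.
  - by rewrite ge_min lexx.
  - have h : Num.min 1 (a / 16 / (q + 1)) <= a / 16 / (q + 1) by rewrite ge_min lexx orbT.
    rewrite ler_pdivlMr ?ltr_wpDl// in h.
    have m0 : 0 <= Num.min 1 (a / 16 / (q + 1)) by rewrite le_min ler01 !divr_ge0// ?addr_ge0// ltW.
    by move: h m0; rewrite /q; move: (Num.min _ _) => m h m0; lra.
have [c0 c0_0 c0E] : exists2 c0 : R, 0 < c0 & C * c0 = a / 16.
  exists (a / (16 * C)); first by rewrite divr_gt0// mulr_gt0.
  by field; rewrite gt_eqF.
have [ic [ic0 icE icL]] : exists ic : R, [/\ 0 < ic, ic * c0 = 1 & forall x, c0 <= x -> x^-1 <= ic].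
  exists (c0^-1); split; rewrite ?invr_gt0 ?mulVf ?gt_eqF//.
  by move=> x cx; rewrite lef_pV2 ?posrE//; exact: lt_le_trans cx.
(* After a push of duration [M * |w|] the distance to the sides is at least [3 * C * |w|], room
   enough for a chord of length [|w|]. *)
have [M M0 ME] : exists2 M : R, 0 < M & M * (3 * a / 16) = 3 * C.
  exists (16 * C / a); first by rewrite divr_gt0// mulr_gt0.
  by field; rewrite gt_eqF.
have Mc : 0 < M + ic by rewrite addr_gt0.
have [L L0 LE] : exists2 L : R, 0 < L & L = (M + ic) * (C * a).
  by exists ((M + ic) * (C * a)); rewrite // !mulr_gt0.
have [eta [eta0 eta1 eta2 eta3 eta4]] : exists eta : R, [/\ 0 < eta, eta <= a / 16,
    (M + ic) * eta <= s0, C * eta <= a / 8 & eta * (C * a) <= a / 16].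
  have C8 : 0 < 8 * C by rewrite mulr_gt0.
  have Ca : 0 < C * a by rewrite mulr_gt0.
  exists (Num.min (Num.min (a / 16) (s0 / (M + ic))) (Num.min (a / (8 * C)) (a / 16 / (C * a)))).
  split; first by rewrite !lt_min !divr_gt0.
  - by rewrite !ge_min lexx.
  - by rewrite mulrC -ler_pdivlMr// !ge_min lexx !orbT.
  - have -> : a / 8 = C * (a / (8 * C)) by field; rewrite gt_eqF.
    by rewrite ler_pM2l// !ge_min lexx !orbT.
  - by rewrite -ler_pdivlMr// !ge_min lexx !orbT.
exists eta, (1 + 2 * L); split => //; first lra.
move=> y1 y2 Y1 Y2; set w := y2 - y1 => wE pE dE.
have y2E : y2 = y1 + w by rewrite addrC subrK.
have [YH _] := lchart_relopen.
have h1 : 0 <= y1.2 := YH _ Y1. have h2 : 0 <= y2.2 := YH _ Y2.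
have [w0|wn0] := eqVneq w 0.
  have e : y2 = y1 by rewrite y2E w0 addr0.
  have sg0 : seg y1 0 by move=> s _; rewrite scaler0 addr0.
  by exists y1, y1; rewrite e subrr w0 !normr0 !mulr0; split.
have wp : 0 < `|w| by rewrite normr_gt0.
have Lw : 0 <= L * `|w| by rewrite mulr_ge0// ltW.
have CQE : (1 + 2 * L) * `|w| = `|w| + (L * `|w| + L * `|w|) by ring.
have CQ1 : `|w| <= (1 + 2 * L) * `|w| by rewrite CQE lerDl addr_ge0.
have CQ2 : L * `|w| <= (1 + 2 * L) * `|w| by rewrite CQE -addrCA lerDl addr_ge0.
have CQ3 u v : `|u| <= L * `|w| -> `|v| <= L * `|w| -> `|w + u - v| <= (1 + 2 * L) * `|w|.
  move=> hu hv; rewrite CQE -addrA (le_trans (ler_normD _ _))// lerD2l.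
  by rewrite (le_trans (ler_normB _ _))// lerD.
have [psmall|pbig] := leP `|Phi y1| (a / 2).
  have sg : seg y1 w.
    apply: (join_seg C1 hC2 Y1); first by rewrite -y2E.
    have : C * `|w| <= C * eta by rewrite ler_pM2l.
    lra.
  have sg0 : seg y1 0 by move=> s _; rewrite scaler0 addr0.
  exists y1, y1; rewrite subrr -/w !normr0; split => //.
  have z0 : 0 <= (1 + 2 * L) * `|w| by apply: le_trans CQ2.
  by split.
set n := Phi y1.
have [v vE] : exists v, lin2 (DP y1) v = - n.
  apply: lin2_surj => u u0; have [h _ _] := hC y1 Y1 u.
  by move: h; rewrite u0 normr0 mulr0 normr_le0 => /eqP.
have na : `|n| < a by have [+ _] := Phi_ldom Y1; exact: ldom_square.
have vC : `|v| <= C * a.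
  have [h _ _] := hC y1 Y1 v; rewrite vE normrN in h.
  by rewrite (le_trans h)// ler_wpM2l// ltW.
(* A vertical component of size at most [c0] is dropped, at the cost [C * c0 = a / 16]. A vector
   that still points downwards then descends at speed at least [c0], which makes the times at which
   the two ends reach the boundary comparable. *)
have [e [eC eN ee]] : exists e : R * R, [/\ `|e| <= C * a, `|lin2 (DP y1) e + n| <= a / 16 &
    0 <= e.2 \/ e.2 <= - c0].
  have [v2|v2] := leP `|v.2| c0.
    exists (v.1, 0); split; last by left.
    - by rewrite plane_norm_le /= normr0 (le_trans (plane_norm1 _) vC) mulr_ge0 ?ltW.
    - have -> : lin2 (DP y1) (v.1, 0) + n = - lin2 (DP y1) (0, v.2).
        rewrite -[n]opprK -vE -lin2B -lin2N; congr lin2.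
        by apply: plane_eq; rewrite /= ?subrr ?sub0r ?oppr0.
      rewrite normrN (le_trans (hC2 y1 Y1 _))//.
      have : `|(0, v.2) : R * R| <= c0 by rewrite plane_norm_le /= normr0 v2 ltW.
      move=> /(ler_wpM2l (ltW C0)) => /le_trans; apply.
      by rewrite c0E.
  exists v; split => //.
    by rewrite vE addrC subrr normr0 divr_ge0// ltW.
  by move: v2; rewrite ltr_normr => /orP[] h; [left|right]; lra.
have Ca : 0 < C * a by rewrite mulr_gt0.
have eN2 : `|lin2 (DP y2) e + n| <= a / 8.
  have -> : lin2 (DP y2) e + n = (lin2 (DP y2) e - lin2 (DP y1) e) + (lin2 (DP y1) e + n).
    by rewrite addrA subrK.
  rewrite (le_trans (ler_normD _ _))//; have := dE e.
  have : eta * `|e| <= eta * (C * a) by rewrite ler_pM2l.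
  lra.
have push y (s : R) : y = y1 \/ y = y2 -> 0 <= s <= s0 -> 0 <= (y + s *: e).2 ->
    seg y (s *: e) /\ `|Phi (y + s *: e)| <= a - s * (3 * a / 16).
  move=> yy sI H; have pb := ltW pbig.
  case: yy H => -> H.
    apply: (push_inward hC2 Y1 eC _ _ pb sI s01 hs0 H); first by rewrite subrr normr0.
    exact: le_trans eN a168.
  by apply: (push_inward hC2 Y2 eC _ eN2 pb sI s01 hs0 H); exact: le_trans pE eta1.
have [s1 s1_0 s1E] : exists2 s1 : R, 0 < s1 & s1 = M * `|w| by exists (M * `|w|); rewrite // mulr_gt0.
have ws : (M + ic) * `|w| <= s0.
  by apply: le_trans eta2; rewrite ler_pM2l.
have s1s0 : s1 <= s0 by rewrite (le_trans _ ws)// s1E ler_wpM2r// lerDl ltW.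
have len s : 0 <= s -> s <= (M + ic) * `|w| -> `|s *: e| <= L * `|w|.
  move=> s_0 sL; rewrite normrZ ger0_norm//.
  have -> : L * `|w| = (M + ic) * `|w| * (C * a) by rewrite LE; ring.
  exact: ler_pM.
have s1L : s1 <= (M + ic) * `|w| by rewrite s1E ler_wpM2r// lerDl ltW.
have [good|bad] : (0 <= (y1 + s1 *: e).2 /\ 0 <= (y2 + s1 *: e).2) \/
    ((y1 + s1 *: e).2 < 0 \/ (y2 + s1 *: e).2 < 0).
  have [p1|p1] := leP 0 (y1 + s1 *: e).2; last by right; left.
  by have [p2|p2] := leP 0 (y2 + s1 *: e).2; [left|right; right].
  have s1I : 0 <= s1 <= s0 by rewrite s1s0 ltW.
  have [sg1 b1] := push y1 s1 (or_introl erefl) s1I good.1.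
  have [sg2 b2] := push y2 s1 (or_intror erefl) s1I good.2.
  have ez : y2 + s1 *: e - (y1 + s1 *: e) = w by rewrite opprD addrACA subrr addr0.
  have sg3 : seg (y1 + s1 *: e) w.
    apply: (join_seg C1 hC2 (seg_end sg1)).
      by rewrite -ez addrC subrK; exact: good.2.
    have e3 : s1 * (3 * a / 16) = 3 * (C * `|w|) by rewrite s1E mulrAC ME; ring.
    by rewrite e3 in b1; apply: room_for_chord b1 _; rewrite mulr_gt0.
  exists (y1 + s1 *: e), (y2 + s1 *: e); rewrite ez.
  have e1 : y1 + s1 *: e - y1 = s1 *: e by rewrite addrC addKr.
  have e2 : y2 - (y2 + s1 *: e) = - (s1 *: e) by rewrite opprD addNKr.
  rewrite e1 e2 normrN -/w; split => //; first exact: seg_rev.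
  have := len _ (ltW s1_0) s1L.
  by move=> /le_trans/(_ CQ2) hl; split.
have {}ee : e.2 <= - c0.
  case: ee => // e2; exfalso; have se := mulr_ge0 (ltW s1_0) e2.
  by case: bad; rewrite /= /GRing.scale /= ltNge addr_ge0.
have c0e : c0 <= - e.2 by rewrite lerNr.
have e20 : 0 < - e.2 by exact: lt_le_trans c0e.
have hit y : 0 <= y.2 -> (y + (y.2 / (- e.2)) *: e).2 = 0.
  by move=> _; rewrite /= /GRing.scale /=; field; rewrite lt_eqF// -oppr_gt0.
have t1_0 : 0 <= y1.2 / (- e.2) by rewrite divr_ge0// ltW.
have t2_0 : 0 <= y2.2 / (- e.2) by rewrite divr_ge0// ltW.
have tdist : `|y2.2 / (- e.2) - y1.2 / (- e.2)| <= ic * `|w|.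
  rewrite -mulrBl normrM mulrC ler_pM//; last exact: (plane_norm2 w).
  by rewrite normfV gtr0_norm//; exact: icL.
have short y : (y + s1 *: e).2 < 0 -> y.2 / (- e.2) < s1.
  by rewrite /= /GRing.scale /= => h; rewrite ltr_pdivrMr// mulrN -subr_lt0 opprK.
(* One hitting time is below [s1], and the two differ by at most [ic * |w|]; hence both stay below
   [s1 + ic * |w|]. *)
have [T1 T2] : y1.2 / (- e.2) <= (M + ic) * `|w| /\ y2.2 / (- e.2) <= (M + ic) * `|w|.
  have : 0 <= ic * `|w| by rewrite mulr_ge0// ltW.
  move: tdist; rewrite ler_norml mulrDl -s1E => /andP[d1 d2] cw.
  by apply: both_small d1 d2 cw _; case: bad => /short; [left|right].
set t1 := y1.2 / (- e.2) in t1_0 T1 tdist *; set t2 := y2.2 / (- e.2) in t2_0 T2 tdist *.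
have z1 := hit y1 h1; have z2 := hit y2 h2; rewrite -/t1 in z1; rewrite -/t2 in z2.
have t1I : 0 <= t1 <= s0 by rewrite t1_0 (le_trans T1).
have t2I : 0 <= t2 <= s0 by rewrite t2_0 (le_trans T2).
have [sg1 _] := push y1 t1 (or_introl erefl) t1I (eq_ind_r (fun x => 0 <= x) (lexx _) z1).
have [sg2 _] := push y2 t2 (or_intror erefl) t2I (eq_ind_r (fun x => 0 <= x) (lexx _) z2).
have sg3 := boundary_seg (seg_end sg1) (seg_end sg2) z1 z2.
exists (y1 + t1 *: e), (y2 + t2 *: e).
have e1 : y1 + t1 *: e - y1 = t1 *: e by rewrite addrC addKr.
have e2 : y2 - (y2 + t2 *: e) = - (t2 *: e) by rewrite opprD addNKr.
have l1 := len _ t1_0 T1; have l2 := len _ t2_0 T2.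
split => //; [by rewrite e1|by rewrite e2; exact: seg_rev|].
rewrite e1 e2 normrN.
have e3 : y2 + t2 *: e - (y1 + t1 *: e) = w + t2 *: e - t1 *: e.
  by rewrite /w opprD addrA (addrAC y2).
by rewrite e3; split; [exact: le_trans CQ2|exact: CQ3|exact: le_trans CQ2].
Qed.

End QuasiConvexity.

End QuasiConvexityTheory.
Import QuasiConvexityTheory.

(** * Bi-Lipschitz control of leaf charts *)

Module LeafComparisonTheory.

Lemma quadratic_absorb (R : realType) (c x : R) :
  x * (x * (2 * c + 1)) <= x * 1 -> c * x ^+ 2 <= x / 2.
Proof. by have := sqr_ge0 x; rewrite expr2; lra. Qed.

Lemma absorbed_bound (R : realType) (x c p e : R) :
  x <= c * (p + e * x ^+ 2) -> c * e * x ^+ 2 <= x / 2 -> x <= 2 * c * p.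
Proof. lra. Qed.

Lemma telescope3 (R : realType) (p0 p1 p2 p3 u1 u2 u3 v2 v3 : R * R) :
  p3 - p0 - (u1 + u2 + u3) =
  ((p1 - p0 - u1) + (p2 - p1 - v2) + (p3 - p2 - v3)) + ((v2 - u2) + (v3 - u3)).
Proof. by apply: plane_eq => /=; ring. Qed.

Section LeafComparison.
Context {R : realType} {X : surface R} (c : lchart X) (kappa : R).
Context (hk : 0 < kappa) (hc : is_lchart kappa c).
Context (j : chidx X) (K : R) (hj : closure (limage c) `<=` dom j).
Context (hK : second_bounded K (crd j @` limage c) (linv c \o icrd j)).

Local Notation a := (lrad c).
Local Notation Y := (crd j @` limage c).
Local Notation Psi := (crd j \o lmap c).
Local Notation Phi := (linv c \o icrd j).
Local Notation DP y := (jac (crd j @` limage c) (linv c \o icrd j) y).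

Local Notation limage_dom := (LeafChartTheory.limage_dom hj).
Local Notation DPhi_bounds := (LeafChartTheory.DPhi_bounds hk hc hj).
Local Notation seg := (SegmentTheory.seg c j).
Local Notation DPhi_lip := (SegmentTheory.DPhi_lip hc hj hK).
Local Notation K_ge0 := (SegmentTheory.K_ge0 hK).
Local Notation Phi_taylor := (SegmentTheory.Phi_taylor hc hj hK).
Local Notation quasi_convex := (QuasiConvexityTheory.quasi_convex hk hc hj hK).

Lemma C1fun_seg (C A : R) (f : X -> R) y w :
  (forall y, Y y -> forall w, Num.sqrt (qform (met j y) w) <= C * `|w|) -> 0 <= A ->
  C1fun f -> (forall x v, `|dfun f x v| <= A * gnorm x v) -> seg y w ->
  `|f (icrd j (y + w)) - f (icrd j y)| <= A * C * `|w|.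
Proof.
move=> hC A0 fC fA sg; have [i0 i1] := unit_itv01 R.
have yD s : `[(0 : R), 1]%classic s -> (crd j @` dom j) (y + s *: w).
  by move=> /itvE /sg[x xI <-]; exists x => //; exact: limage_dom.
have H1 s : 0 <= s <= 1 -> is_dwithin `[(0 : R), 1] (f \o icrd j \o (fun s : R => y + s *: w)) s
    (fun s' => s' *: dfun f (icrd j (y + s *: w)) (vtrans j (icrd j (y + s *: w)) w)).
  move=> sI; have sI' : [set` `[(0 : R), 1]] s by exact/itvE.
  exact: (C1fun_curve fC yD sI' (is_dwithin_line _ _ _ _)).
have H2 s : 0 <= s <= 1 ->
    `|dfun f (icrd j (y + s *: w)) (vtrans j (icrd j (y + s *: w)) w)| <= A * C * `|w|.
  move=> sI; rewrite (le_trans (fA _ _))// -mulrA ler_wpM2l//.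
  have [yj e] := icrdK (yD s (iffRL (itvE _ _ _) sI)).
  by rewrite gnorm_vtrans// e; apply: hC; exact: sg.
have := mean_value_le H1 H2 i1 i0.
by rewrite /= scale1r scale0r addr0 subr0 normr1 mulr1.
Qed.

(** Along the three segments Taylor's formula gives Phi y2 - Phi y1 = DPhi y1 w + O(|w|^2). The
    derivative is bounded below, so for small [w] the quadratic term is absorbed and [|w|] is
    bounded by the distance of the images. Derivatives and C^1 functions are then compared along the
    same path. *)
Lemma chart_lipschitz : (exists y, Y y) -> exists eta C : R, [/\ 0 < eta, 1 <= C &
  forall y1 y2, Y y1 -> Y y2 -> `|y2 - y1| <= eta -> `|Phi y2 - Phi y1| <= eta ->
   (forall u, `|lin2 (DP y2) u - lin2 (DP y1) u| <= eta * `|u|) ->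
  [/\ `|y2 - y1| <= C * `|Phi y2 - Phi y1|,
      forall u, `|lin2 (DP y2) u - lin2 (DP y1) u| <= C * `|Phi y2 - Phi y1| * `|u| &
      forall f A, 0 <= A -> C1fun f -> (forall x v, `|dfun f x v| <= A * gnorm x v) ->
        `|f (icrd j y2) - f (icrd j y1)| <= A * (C * `|Phi y2 - Phi y1|)]].
Proof.
move=> [y0 Y0]; have K0 := K_ge0 Y0; have [C C1 hC] := DPhi_bounds.
have [eta [Q [eta0 Q1 hQ]]] := quasi_convex (ex_intro _ y0 Y0).
have C0 : 0 <= C by lra. have Q0 : 0 <= Q by lra.
(* In units of K Q^2 |w|^2: three Taylor errors of size 4, then 4 and 8 for replacing the
   derivatives at [z1] and [z2] by the one at [y1]. *)
set E := 24 * K * Q ^+ 2.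
have E0 : 0 <= E by rewrite /E mulr_ge0 ?sqr_ge0// mulr_ge0.
have KQ : 0 <= K * Q by rewrite mulr_ge0.
have CE : 0 <= C * E by rewrite mulr_ge0.
set C' := 1 + 2 * C + 24 * (K * Q) * C + 6 * (C * C) * Q.
have t1 : 0 <= 24 * (K * Q) * C by rewrite mulr_ge0// mulr_ge0.
have t2 : 0 <= 6 * (C * C) * Q by rewrite !mulr_ge0.
have [c1 c2 c3] : [/\ 2 * C <= C', 24 * (K * Q) * C <= C' & 6 * (C * C) * Q <= C'].
  by rewrite /C'; split; lra.
have k12 : 0 <= 12 * (K * Q) by lra.
have c0 : 1 <= C' by rewrite /C'; lra.
clearbody C'.
exists (Num.min eta (2 * (C * E) + 1)^-1), C'; split => //.
  by rewrite lt_min eta0 invr_gt0 ltr_wpDl// mulr_ge0.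
move=> y1 y2 Y1 Y2; rewrite !le_min => /andP[w1 w2] /andP[p1 p2] hD.
have {}hD u : `|lin2 (DP y2) u - lin2 (DP y1) u| <= eta * `|u|.
  by rewrite (le_trans (hD u))// ler_wpM2r// ge_min lexx.
have [z1 [z2 [sg1 sg2 sg3 [l1 l2 l3]]]] := hQ y1 y2 Y1 Y2 w1 p1 hD.
set w := y2 - y1 in w1 w2 l1 l2 l3 *.
have e1 : y1 + (z1 - y1) = z1 by rewrite addrC subrK.
have e2 : z1 + (z2 - z1) = z2 by rewrite addrC subrK.
have e3 : z2 + (y2 - z2) = y2 by rewrite addrC subrK.
have Dbound a b u : seg a b -> `|b| <= Q * `|w| ->
    `|lin2 (DP (a + b)) u - lin2 (DP a) u| <= 4 * (K * Q) * `|w| * `|u|.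
  move=> sg lb; rewrite (le_trans (DPhi_lip u sg))// ler_wpM2r//.
  have -> : 4 * (K * Q) * `|w| = 4 * K * (Q * `|w|) by ring.
  by rewrite ler_wpM2l// mulr_ge0.
have D1 u := Dbound _ _ u sg1 l1; have D2 u := Dbound _ _ u sg2 l2; have D3 u := Dbound _ _ u sg3 l3.
rewrite e1 in D1; rewrite e2 in D2; rewrite e3 in D3.
have D12 u : `|lin2 (DP z2) u - lin2 (DP y1) u| <= 8 * (K * Q) * `|w| * `|u|.
  rewrite -(subrK (lin2 (DP z1) u) (lin2 (DP z2) u)) -addrA (le_trans (ler_normD _ _))//.
  have -> : 8 * (K * Q) * `|w| * `|u| = 4 * (K * Q) * `|w| * `|u| + 4 * (K * Q) * `|w| * `|u| by ring.
  exact: (lerD (D2 u) (D1 u)).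
have D123 u : `|lin2 (DP y2) u - lin2 (DP y1) u| <= 12 * (K * Q) * `|w| * `|u|.
  rewrite -(subrK (lin2 (DP z2) u) (lin2 (DP y2) u)) -addrA (le_trans (ler_normD _ _))//.
  have -> : 12 * (K * Q) * `|w| * `|u| = 4 * (K * Q) * `|w| * `|u| + 8 * (K * Q) * `|w| * `|u| by ring.
  exact: (lerD (D3 u) (D12 u)).
have Tbound a b : seg a b -> `|b| <= Q * `|w| ->
    `|Phi (a + b) - Phi a - lin2 (DP a) b| <= 4 * K * Q ^+ 2 * `|w| ^+ 2.
  move=> sg lb; rewrite (le_trans (Phi_taylor sg))// -(mulrA (4 * K)) -exprMn ler_wpM2l ?mulr_ge0//.
  by rewrite ler_pXn2r ?nnegrE ?mulr_ge0.
have T1 := Tbound _ _ sg1 l1; have T2 := Tbound _ _ sg2 l2; have T3 := Tbound _ _ sg3 l3.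
rewrite e1 in T1; rewrite e2 in T2; rewrite e3 in T3.
have main : `|Phi y2 - Phi y1 - lin2 (DP y1) w| <= E * `|w| ^+ 2.
  have s2 : `|lin2 (DP z1) (z2 - z1) - lin2 (DP y1) (z2 - z1)| <= 4 * K * Q ^+ 2 * `|w| ^+ 2.
    rewrite (le_trans (D1 _))//.
    have -> : 4 * K * Q ^+ 2 * `|w| ^+ 2 = 4 * (K * Q) * `|w| * (Q * `|w|) by ring.
    by rewrite ler_wpM2l// !mulr_ge0.
  have s3 : `|lin2 (DP z2) (y2 - z2) - lin2 (DP y1) (y2 - z2)| <= 8 * K * Q ^+ 2 * `|w| ^+ 2.
    rewrite (le_trans (D12 _))//.
    have -> : 8 * K * Q ^+ 2 * `|w| ^+ 2 = 8 * (K * Q) * `|w| * (Q * `|w|) by ring.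
    by rewrite ler_wpM2l// !mulr_ge0.
  have wsum : lin2 (DP y1) w = lin2 (DP y1) (z1 - y1) + lin2 (DP y1) (z2 - z1) +
      lin2 (DP y1) (y2 - z2).
    by rewrite -!lin2D; congr lin2; rewrite /w; apply: plane_eq => /=; ring.
  rewrite {}wsum.
  set u1 := lin2 (DP y1) (z1 - y1) in T1 *.
  set u2 := lin2 (DP y1) (z2 - z1) in s2 *; set u3 := lin2 (DP y1) (y2 - z2) in s3 *.
  set v2 := lin2 (DP z1) (z2 - z1) in T2 s2 *; set v3 := lin2 (DP z2) (y2 - z2) in T3 s3 *.
  have -> : Phi y2 - Phi y1 - (u1 + u2 + u3) = ((Phi z1 - Phi y1 - u1) + (Phi z2 - Phi z1 - v2) +
     (Phi y2 - Phi z2 - v3)) + ((v2 - u2) + (v3 - u3)).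
    exact: telescope3.
  have := lerD (lerD (lerD T1 T2) T3) (lerD s2 s3).
  have -> : 4 * K * Q ^+ 2 * `|w| ^+ 2 + 4 * K * Q ^+ 2 * `|w| ^+ 2 + 4 * K * Q ^+ 2 * `|w| ^+ 2 +
    (4 * K * Q ^+ 2 * `|w| ^+ 2 + 8 * K * Q ^+ 2 * `|w| ^+ 2) = E * `|w| ^+ 2 by rewrite /E; ring.
  apply: le_trans; rewrite (le_trans (ler_normD _ _))// lerD ?ler_normD//.
  by rewrite (le_trans (ler_normD _ _))// lerD2r ler_normD.
have wle : `|w| <= 2 * C * `|Phi y2 - Phi y1|.
  have [h _ _] := hC y1 Y1 w.
  have h1 : `|lin2 (DP y1) w| <= `|Phi y2 - Phi y1| + E * `|w| ^+ 2.
    have hB := ler_normB (Phi y2 - Phi y1) (Phi y2 - Phi y1 - lin2 (DP y1) w).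
    rewrite opprB addrCA subrr addr0 in hB.
    by rewrite (le_trans hB)// lerD2l.
  have h2 : C * E * `|w| ^+ 2 <= `|w| / 2.
    have := w2; rewrite -[X in _ <= X]div1r ler_pdivlMr; last by rewrite ltr_wpDl// mulr_ge0.
    move=> h3; have : `|w| * (`|w| * (2 * (C * E) + 1)) <= `|w| * 1 by rewrite ler_wpM2l.
    exact: quadratic_absorb.
  exact: absorbed_bound (le_trans h (ler_wpM2l C0 h1)) h2.
have P0 := normr_ge0 (Phi y2 - Phi y1).
split.
- by rewrite (le_trans wle)// ler_wpM2r// c1.
- move=> u; rewrite (le_trans (D123 u))// ler_wpM2r//.
  rewrite (le_trans (ler_wpM2l k12 wle))// (mulrA (12 * (K * Q)) (2 * C)) ler_wpM2r// (le_trans _ c2)//.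
  by have -> : 12 * (K * Q) * (2 * C) = 24 * (K * Q) * C by ring.
- move=> f A A0 fC fA.
  have hC3 y : Y y -> forall w, Num.sqrt (qform (met j y) w) <= C * `|w|.
    by move=> yY v; have [] := hC y yY v.
  have F1 := C1fun_seg hC3 A0 fC fA sg1; have F2 := C1fun_seg hC3 A0 fC fA sg2.
  have F3 := C1fun_seg hC3 A0 fC fA sg3; rewrite e1 in F1; rewrite e2 in F2; rewrite e3 in F3.
  have AC : 0 <= A * C by rewrite mulr_ge0.
  have {}F1 := le_trans F1 (ler_wpM2l AC l1).
  have {}F2 := le_trans F2 (ler_wpM2l AC l2).
  have {}F3 := le_trans F3 (ler_wpM2l AC l3).
  have -> : f (icrd j y2) - f (icrd j y1) = (f (icrd j y2) - f (icrd j z2)) +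
    (f (icrd j z2) - f (icrd j z1)) + (f (icrd j z1) - f (icrd j y1)) by ring.
  rewrite (le_trans (ler_normD _ _))// (le_trans (lerD (ler_normD _ _) F1))//.
  rewrite (le_trans (lerD (lerD F3 F2) (lexx _)))//.
  have ACQ : 0 <= 3 * (A * C * Q) by rewrite mulr_ge0// mulr_ge0.
  have F := ler_wpM2l ACQ wle.
  have G : 3 * (A * C * Q) * (2 * C * `|Phi y2 - Phi y1|) <= A * (C' * `|Phi y2 - Phi y1|).
    have -> : 3 * (A * C * Q) * (2 * C * `|Phi y2 - Phi y1|) = A * (6 * (C * C) * Q * `|Phi y2 - Phi y1|) by ring.
    by rewrite ler_wpM2l// ler_wpM2r// c3.
  apply: le_trans (le_trans F G); rewrite le_eqVlt; apply/orP; left; apply/eqP; ring.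
Qed.

End LeafComparison.

End LeafComparisonTheory.
Import LeafComparisonTheory.

(** * Comparison of a function on two nearby leaves *)

Module LeafPairTheory.

Lemma three_thirds (R : realType) (x y z e : R) : x < e / 3 -> y < e / 3 -> z < e / 3 ->
  x + (y + z) <= e.
Proof. lra. Qed.

Lemma itv_sub_right (R : realType) (r t x : R) : 0 < r -> - r <= t <= r ->
  0 <= x <= t -> - r <= x <= r.
Proof. lra. Qed.

Lemma itv_sub_left (R : realType) (r t x : R) : 0 < r -> - r <= t <= r ->
  t <= x <= 0 -> - r <= x <= r.
Proof. lra. Qed.

Lemma below_three_quarters (R : realType) (e x : R) : 0 < e -> x <= e / 2 -> x <= 3 / 4 * e.
Proof. lra. Qed.

Lemma above_three_quarters (R : realType) (e x : R) : 0 < e -> e < x -> 3 / 4 * e <= x.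
Proof. lra. Qed.

Lemma above_three_quarters_le (R : realType) (e : R) : 0 < e -> 3 / 4 * e <= e.
Proof. lra. Qed.

Lemma three_quarters_half (R : realType) (e : R) : 0 < e -> 3 / 4 * e <= e / 2 -> False.
Proof. lra. Qed.

Lemma addends_le (R : realType) (x y e : R) : 0 <= x -> 0 <= y -> x + y <= e -> x <= e /\ y <= e.
Proof. lra. Qed.

Lemma three_sixths (R : realType) (x e : R) : x <= e / 6 -> x + (x + x) <= e / 2.
Proof. lra. Qed.

Lemma lin2_10 (R : realType) (W : normedModType R) (J : W * W) : lin2 J (1, 0) = J.1.
Proof. by rewrite /lin2 /= scale1r scale0r addr0. Qed.

Lemma lin2_01 (R : realType) (W : normedModType R) (J : W * W) : lin2 J (0, 1) = J.2.
Proof. by rewrite /lin2 /= scale1r scale0r add0r. Qed.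

Lemma within_continuous_comp (R : realType) (U V W : normedModType R) (A : set U) (B : set V)
    (f : U -> V) (g : V -> W) : {within A, continuous f} -> {within B, continuous g} ->
  (forall x, A x -> B (f x)) -> {within A, continuous (g \o f)}.
Proof.
move=> /within_continuousP cf /within_continuousP cg AB.
apply/within_continuousP => p Ap e e0; have [d d0 k] := cg _ (AB p Ap) e e0.
have [d' d'0 k'] := cf p Ap d d0; exists d' => // q Aq qd.
by apply: k; [exact: AB|exact: k'].
Qed.

Lemma uniform_continuity_compact (R : realType) (V W : normedModType R) (Q : set V) (f : V -> W)
    (e : R) : compact Q -> {within Q, continuous f} -> 0 < e ->
  exists2 d : R, 0 < d & forall p q, Q p -> Q q -> `|q - p| < d -> `|f q - f p| < e.
Proof.
move=> /compact_near_coveringP cQ /within_continuousP cf e0.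
have e2 : 0 < e / 2 by lra.
have := cQ R (0 : R)^'+ (fun d p => Q p -> forall q, Q q -> `|q - p| < d -> `|f q - f p| < e) _.
have main x : Q x -> \forall x' \near x & d \near (0 : R)^'+,
    (Q x' -> forall q, Q q -> `|q - x'| < d -> `|f q - f x'| < e).
  move=> Qx; have [r r0 k] := cf x Qx _ e2.
  have r2 : 0 < r / 2 by lra.
  exists (ball x (r / 2), [set d : R | d < r / 2]%classic) => /=.
    by split; [exact: nbhsx_ballx|exact: nbhs_right_lt].
  move=> [x' d] /= []; rewrite -ball_normE /= => xx' dr Qx' q Qq qd.
  have h1 : `|f x' - f x| < e / 2 by apply: k => //; rewrite distrC; lra.
  have h2 : `|f q - f x| < e / 2.
    apply: k => //; rewrite -(subrK x' q) -addrA (le_lt_trans (ler_normD _ _))//.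
    by rewrite (distrC x'); lra.
  by rewrite -(subrK (f x) (f q)) -addrA (le_lt_trans (ler_normD _ _))// (distrC (f x)); lra.
move=> /(_ _ main) near_d.
have [d [d0 hd]] := @filter_ex _ _ _ _ (filterI (nbhs_right_gt (0 : R)) near_d).
by exists d => // p q Qp Qq; exact: hd.
Qed.

Section LeafPairs.
Context {R : realType} {X : surface R} (c : lchart X) (kappa : R).
Context (hk : 0 < kappa) (hc : is_lchart kappa c).
Context (j : chidx X) (K : R) (hj : closure (limage c) `<=` dom j).
Context (hK : second_bounded K (crd j @` limage c) (linv c \o icrd j)).

Local Notation a := (lrad c).
Local Notation Y := (crd j @` limage c).
Local Notation Psi := (crd j \o lmap c).
Local Notation Phi := (linv c \o icrd j).
Local Notation DP y := (jac (crd j @` limage c) (linv c \o icrd j) y).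

Local Notation Psi_image := (LeafChartTheory.Psi_image hc hj).
Local Notation icrd_lchart := (LeafChartTheory.icrd_lchart hc hj).
Local Notation DPhi_C1 := (LeafChartTheory.DPhi_C1 hc hj).
Local Notation Psi_C2 := (LeafChartTheory.Psi_C2 hc hj).
Local Notation lrad_gt0 := (QuasiConvexityTheory.lrad_gt0 hc).
Local Notation ldom_closed := (SegmentTheory.ldom_closed hc).
Local Notation chart_lipschitz := (LeafComparisonTheory.chart_lipschitz hk hc hj hK).

Lemma half_square_compact : compact [set p | ldom c p /\ `|p| <= a / 2].
Proof.
have a0 := lrad_gt0.
apply: (@subclosed_compact _ _ (`[- (a / 2), a / 2]%classic `*` `[- (a / 2), a / 2]%classic)).
- move=> p pc.
  have approx e : 0 < e -> exists2 q, ldom c q /\ `|q| <= a / 2 & `|q - p| < e.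
    move=> e0; have [q [[qD qa] qe]] := pc (ball p e) (nbhsx_ballx p e e0).
    by exists q => //; move: qe; rewrite -ball_normE /= distrC.
  have pa : `|p| <= a / 2.
    apply/ler_addgt0Pl => e /approx[q [_ qa] qe].
    rewrite -(subrK q p) (le_trans (ler_normD _ _))// lerD// distrC ltW//.
  split => //; apply: ldom_closed; first by rewrite (le_lt_trans pa)//; lra.
  by move=> e /approx[q [qD _] qe]; exists q.
- by apply: compact_setX; exact: segment_compact.
- move=> p [_]; rewrite plane_norm_le => /andP[h1 h2].
  by split; apply/itvE; rewrite -ler_norml.
Qed.

(** The compactness of the part of the domain over the closed half square turns closeness in the
    leaf chart into closeness of points and derivatives in the chart of the surface. It provides the
    initial condition for the continuation along a leaf. *)
Lemma leaf_start (eta : R) : 0 < eta -> exists2 d : R, 0 < d &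
  forall p1 p2, ldom c p1 -> ldom c p2 -> `|p1| <= a / 2 -> `|p2| <= a / 2 -> `|p2 - p1| < d ->
    [/\ `|Psi p2 - Psi p1| < eta, `|(DP (Psi p2)).1 - (DP (Psi p1)).1| < eta &
        `|(DP (Psi p2)).2 - (DP (Psi p1)).2| < eta].
Proof.
move=> eta0; set Q := [set p | ldom c p /\ `|p| <= a / 2]%classic.
have cP : {within ldom c, continuous Psi} := Ck1_continuous (CkS Psi_C2).
have cQ : {within Q, continuous Psi} by apply: within_continuousS cP => p [].
have [hc1 hc2] := DPhi_C1.
have cD (g : R * R -> R * R) : {within Y, continuous g} -> {within Q, continuous (g \o Psi)}.
  move=> /within_continuousP cg; apply/within_continuousP => p Qp e e0.
  have [YP _] := Psi_image Qp.1; have [d d0 k] := cg _ YP e e0.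
  have /within_continuousP/(_ p Qp d d0)[d' d'0 k'] := cQ.
  exists d' => // q Qq qd; apply: k; last exact: k'.
  by have [] := Psi_image Qq.1.
have [d1 d1_0 h1] := uniform_continuity_compact half_square_compact cQ eta0.
have [d2 d2_0 h2] := uniform_continuity_compact half_square_compact (cD _ (Ck1_continuous hc1)) eta0.
have [d3 d3_0 h3] := uniform_continuity_compact half_square_compact (cD _ (Ck1_continuous hc2)) eta0.
exists (Num.min d1 (Num.min d2 d3)); first by rewrite !lt_min d1_0 d2_0.
move=> p1 p2 D1 D2 a1 a2; rewrite !lt_min => /and3P[e1 e2 e3].
by split; [exact: h1|exact: h2|exact: h3].
Qed.

(* The estimate of [chart_lipschitz] propagates along the leaf from its centre, which lies in the
   half square, by connectedness. *)
Lemma leaf_comparison : (exists y, Y y) -> exists2 C : R, 0 < C &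
  forall (r eps : R) (p1 p2 : R -> R * R), 0 < r -> 0 < eps ->
    {within `[- r, r], continuous p1} -> {within `[- r, r], continuous p2} ->
    (forall t, - r <= t <= r -> ldom c (p1 t)) -> (forall t, - r <= t <= r -> ldom c (p2 t)) ->
    `|p1 0| <= a / 2 -> `|p2 0| <= a / 2 ->
    (forall t, - r <= t <= r -> `|p2 t - p1 t| <= eps) ->
    forall f A, 0 <= A -> C1fun f -> (forall x, `|f x| <= A) ->
      (forall x v, `|dfun f x v| <= A * gnorm x v) ->
    forall t, - r <= t <= r -> `|f (lmap c (p2 t)) - f (lmap c (p1 t))| <= C * A * eps.
Proof.
move=> yY; have [eta [C [eta0 C1 hC]]] := chart_lipschitz yY.
have C0 : 0 < C by lra.
have eta3 : 0 < eta / 3 by lra.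
have [d d0 hd] := leaf_start eta3.
set es := Num.min (d / 2) (eta / (6 * C)).
have es0 : 0 < es by rewrite lt_min !divr_gt0// mulr_gt0.
have es1 : es <= d / 2 by rewrite ge_min lexx.
have es2 : es <= eta / (6 * C) by rewrite ge_min lexx orbT.
have es3 : C * es <= eta / 6.
  have : C * es <= C * (eta / (6 * C)) by rewrite ler_pM2l.
  by rewrite (_ : C * (eta / (6 * C)) = eta / 6)//; field; rewrite gt_eqF.
(* The term [2 / es] takes care of leaves more than [es] apart, for which the trivial bound [2 * A]
   on the difference is enough. *)
exists (C + 2 / es); first by rewrite addr_gt0// divr_gt0.
move=> r eps p1 p2 r0 eps0 c1 c2 D1 D2 s1 s2 pe f A A0 fC fA dfA t tI.
have [big|small] := ltP es eps.
  have h1 : `|f (lmap c (p2 t)) - f (lmap c (p1 t))| <= 2 * A.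
    rewrite (le_trans (ler_normB _ _))//.
    by have := fA (lmap c (p2 t)); have := fA (lmap c (p1 t)); lra.
  have q0 : 0 <= 2 * A / es by apply: divr_ge0; [exact: mulr_ge0|exact: ltW].
  have h2 := ler_wpM2l q0 (ltW big); rewrite divfK ?gt_eqF// in h2.
  have -> : (C + 2 / es) * A * eps = C * A * eps + 2 * A / es * eps by ring.
  rewrite (le_trans h1)// (le_trans h2)// lerDr; apply: mulr_ge0; last exact: ltW.
  by apply: mulr_ge0 => //; exact: ltW.
have eps_d : eps < d by lra.
have Ceps : C * eps <= eta / 6 by apply: le_trans es3; rewrite ler_pM2l.
have eps_eta : eps <= eta.
  have : eps <= C * eps by rewrite ler_peMl// ltW.
  lra.
set Dd := fun t => lin2 (DP (Psi (p2 t))).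
pose y1 t := Psi (p1 t); pose y2 t := Psi (p2 t).
(* Wherever [h] is at most [eta], [chart_lipschitz] applies and makes it at most [eta / 2]. Being
   continuous and at most [eta] at 0, it cannot take the value [3 / 4 * eta], so it never exceeds
   [eta]. *)
pose h t := `|y2 t - y1 t| + (`|(DP (y2 t)).1 - (DP (y1 t)).1| + `|(DP (y2 t)).2 - (DP (y1 t)).2|).
have cy (p : R -> R * R) : {within `[- r, r], continuous p} ->
    (forall t, - r <= t <= r -> ldom c (p t)) ->
    {within `[- r, r], continuous (Psi \o p)} /\
    forall g : R * R -> R * R, {within Y, continuous g} -> {within `[- r, r], continuous (g \o (Psi \o p))}.
  move=> cp Dp.
  have cPp : {within `[- r, r], continuous (Psi \o p)}.
    apply: (within_continuous_comp cp (Ck1_continuous (CkS Psi_C2))) => x /itvE; exact: Dp.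
  split => // g cg; apply: (within_continuous_comp cPp cg) => x /itvE xI.
  by have [] := Psi_image (Dp x xI).
have [cy1 cg1] := cy p1 c1 D1; have [cy2 cg2] := cy p2 c2 D2.
have [hc1 hc2] := DPhi_C1.
have ch : {within `[- r, r], continuous h}.
  move=> x; apply: cvgD; first by apply: cvg_norm; apply: cvgB; [exact: cy2|exact: cy1].
  apply: cvgD; apply: cvg_norm; apply: cvgB.
  - exact: (cg2 _ (Ck1_continuous hc1)).
  - exact: (cg1 _ (Ck1_continuous hc1)).
  - exact: (cg2 _ (Ck1_continuous hc2)).
  - exact: (cg1 _ (Ck1_continuous hc2)).
have use t' : - r <= t' <= r -> h t' <= eta ->
    [/\ `|y2 t' - y1 t'| <= C * eps,
      forall u, `|lin2 (DP (y2 t')) u - lin2 (DP (y1 t')) u| <= C * eps * `|u| &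
      `|f (lmap c (p2 t')) - f (lmap c (p1 t'))| <= A * (C * eps)].
  move=> t'I ht'; have [Y1 e1] := Psi_image (D1 t' t'I); have [Y2 e2] := Psi_image (D2 t' t'I).
  have n0 := normr_ge0 (y2 t' - y1 t').
  have n1 := normr_ge0 ((DP (y2 t')).1 - (DP (y1 t')).1).
  have n2 := normr_ge0 ((DP (y2 t')).2 - (DP (y1 t')).2).
  have [a1 a2] : `|y2 t' - y1 t'| <= eta /\
     `|(DP (y2 t')).1 - (DP (y1 t')).1| + `|(DP (y2 t')).2 - (DP (y1 t')).2| <= eta.
    exact: (addends_le n0 (addr_ge0 n1 n2) ht').
  have pp : `|Phi (y2 t') - Phi (y1 t')| <= eps by rewrite /y1 /y2 e1 e2 pe.
  have Du u : `|lin2 (DP (y2 t')) u - lin2 (DP (y1 t')) u| <= eta * `|u|.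
    have -> : lin2 (DP (y2 t')) u - lin2 (DP (y1 t')) u =
      lin2 ((DP (y2 t')).1 - (DP (y1 t')).1, (DP (y2 t')).2 - (DP (y1 t')).2) u.
      by rewrite /lin2 /= !scalerBr opprD addrACA.
    by rewrite (le_trans (lin2_le _ _))//= ler_wpM2r.
  have [b1 b2 b3] := hC _ _ Y1 Y2 a1 (le_trans pp eps_eta) Du.
  have Cp : C * `|Phi (y2 t') - Phi (y1 t')| <= C * eps by rewrite ler_pM2l.
  split; first exact: le_trans Cp.
    by move=> u; rewrite (le_trans (b2 u))// ler_wpM2r.
  have := b3 f A A0 fC dfA; rewrite !icrd_lchart// e1 e2 => /le_trans; apply.
  by rewrite ler_wpM2l// ler_pM2l//; exact: pe.
have half t' : - r <= t' <= r -> h t' <= eta -> h t' <= eta / 2.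
  move=> t'I ht'; have [b1 b2 _] := use t' t'I ht'.
  have b3 := b2 (1, 0); have b4 := b2 (0, 1).
  have n10 : `|(1, 0) : R * R| = 1 by rewrite plane_normE /= normr1 normr0 max_l.
  have n01 : `|(0, 1) : R * R| = 1 by rewrite plane_normE /= normr1 normr0 max_r.
  rewrite n10 mulr1 !lin2_10 in b3.
  rewrite n01 mulr1 !lin2_01 in b4.
  exact: le_trans (lerD b1 (lerD b3 b4)) (three_sixths Ceps).
have rI : - r <= (0 : R) <= r by rewrite oppr_le0 ltW.
have h0 : h 0 <= eta.
  have [b1 b2 b3] := hd _ _ (D1 0 rI) (D2 0 rI) s1 s2 (le_lt_trans (pe 0 rI) eps_d).
  by rewrite /h /y1 /y2; apply: three_thirds.
suff ht : h t <= eta.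
  have [_ _ b] := use t tI ht; apply: (le_trans b).
  have -> : A * (C * eps) = C * A * eps by ring.
  apply: ler_wpM2r; first exact: ltW.
  by apply: ler_wpM2r => //; rewrite lerDl divr_ge0// ltW.
clearbody h; rewrite leNgt; apply/negP => hgt.
have [x xI hx] : exists2 x, - r <= x <= r & h x = 3 / 4 * eta.
  have h02 := half 0 rI h0.
  have v0 : h 0 <= 3 / 4 * eta := below_three_quarters eta0 h02.
  have vt : 3 / 4 * eta <= h t := above_three_quarters eta0 hgt.
  have [t0|/ltW t0] := leP 0 t.
    have cs : {within `[0, t], continuous h}.
      by apply: within_continuousS ch => x /itvE xI; apply/itvE; exact: itv_sub_right r0 tI xI.
    have [|x xI hx] := IVT t0 cs (v := 3 / 4 * eta); first by rewrite ge_min v0 le_max vt orbT.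
    by exists x => //; rewrite in_itv /= in xI; exact: itv_sub_right r0 tI xI.
  have cs : {within `[t, 0], continuous h}.
    by apply: within_continuousS ch => x /itvE xI; apply/itvE; exact: itv_sub_left r0 tI xI.
  have [|x xI hx] := IVT t0 cs (v := 3 / 4 * eta); first by rewrite ge_min v0 orbT le_max vt.
  by exists x => //; rewrite in_itv /= in xI; exact: itv_sub_left r0 tI xI.
have := half x xI; rewrite hx => /(_ (above_three_quarters_le eta0)).
exact: three_quarters_half.
Qed.

End LeafPairs.

End LeafPairTheory.
Import LeafPairTheory.

(** * Velocity and speed of leaves *)

Module LeafCurveTheory.

Section Sharpen.
Context {R : realType}.

Lemma within_lin2 (W : normedModType R) (I : set R) (J1 J2 : R -> W) (u : R -> R * R) :
  {within I, continuous J1} -> {within I, continuous J2} -> {within I, continuous u} ->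
  {within I, continuous (fun t => lin2 (J1 t, J2 t) (u t))}.
Proof.
move=> h1 h2 hu x; rewrite /lin2 /=; apply: cvgD; apply: cvgZ.
- exact: (within_fst hu). - exact: h1. - exact: (within_snd hu). - exact: h2.
Qed.

Lemma within_qform (I : set R) (m : R -> R * R * R) (w : R -> R * R) :
  {within I, continuous m} -> {within I, continuous w} ->
  {within I, continuous (fun t => Num.sqrt (qform (m t) (w t)))}.
Proof.
move=> hm hw; have m1 := within_fst (within_fst hm); have m2 := within_snd (within_fst hm).
have m3 := within_snd hm; have w1 := within_fst hw; have w2 := within_snd hw.
have q : {within I, continuous (fun t => qform (m t) (w t))}.
  move=> x; rewrite /qform; apply: cvgD; first apply: cvgD.
  - by apply: cvgM; [exact: m1|rewrite expr2; apply: cvgM; exact: w1].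
  - by apply: cvgM; [apply: cvgM; [apply: cvgM; [exact: cvg_cst|exact: m2]|exact: w1]|exact: w2].
  - by apply: cvgM; [exact: m3|rewrite expr2; apply: cvgM; exact: w2].
by move=> x; apply: (continuous_comp (q x)); exact: sqrt_continuous.
Qed.

End Sharpen.

Section LeafCurves.
Context {R : realType} {X : surface R} (c : lchart X) (kappa : R).
Context (hk : 0 < kappa) (hc : is_lchart kappa c).
Context (j : chidx X) (K : R) (hj : closure (limage c) `<=` dom j).
Context (hK : second_bounded K (crd j @` limage c) (linv c \o icrd j)).

Local Notation a := (lrad c).
Local Notation Y := (crd j @` limage c).
Local Notation Psi := (crd j \o lmap c).
Local Notation Phi := (linv c \o icrd j).
Local Notation DP y := (jac (crd j @` limage c) (linv c \o icrd j) y).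

Local Notation lmap_dom := (LeafChartTheory.lmap_dom hj).
Local Notation Psi_C2 := (LeafChartTheory.Psi_C2 hc hj).
Local Notation Dlmap_vtrans := (LeafChartTheory.Dlmap_vtrans hc hj).
Local Notation Dlmap_bounds := (LeafChartTheory.Dlmap_bounds hk hc).

Section Curve.
Context (r : R) (p dp : R -> R * R) (r0 : 0 < r).
Context (pD : forall t, - r <= t <= r -> ldom c (p t)).
Context (hp : forall t, - r <= t <= r -> is_dwithin `[- r, r] p t (fun s => s *: dp t)).
Context (cdp : {within `[- r, r], continuous dp}).

Local Notation G := (fun t => lmap c (p t)).
Local Notation I := (`[- r, r]%classic : set R).

Lemma sym_itv_lt : - r < r. Proof. by rewrite gtrN. Qed.

Lemma curve_vel t : - r <= t <= r -> vel I G t = Dlmap c (p t) (dp t).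
Proof.
move=> tI; apply: (derE sym_itv_lt tI).
exact: (LeafChartTheory.Dlmap_curve hc sym_itv_lt tI pD (hp tI)).
Qed.

Lemma curve_continuous : {within I, continuous p}.
Proof.
apply/within_continuousP => t /itvE tI e e0.
exact: (is_dwithin_continuous (normr_ge0 _) (@scale_le _ _ _) (hp tI)).
Qed.

Definition Psi_vel (t : R) : R * R := lin2 (jac (ldom c) Psi (p t)) (dp t).

Lemma Psi_curve t : - r <= t <= r ->
  is_dwithin I (Psi \o p) t (fun s => s *: Psi_vel t).
Proof.
move=> tI; have [h _ _] := Psi_C2.
have zA : exists2 e : R, 0 < e & forall s, I s -> `|s - t| < e -> ldom c (p s).
  by exists 1 => // s /itvE sI _; exact: pD.
exact: is_dwithin_curve zA (hp tI) (h _ (pD tI)).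
Qed.

Lemma Psi_vel_continuous : {within I, continuous Psi_vel}.
Proof.
have [_ c1 c2] := Psi_C2.
have pI x : I x -> ldom c (p x) by move=> /itvE /pD.
have h1 := within_continuous_comp curve_continuous (Ck1_continuous c1) pI.
have h2 := within_continuous_comp curve_continuous (Ck1_continuous c2) pI.
have := within_lin2 h1 h2 cdp.
suff -> : Psi_vel = fun t => lin2 (((fun p => (jac (ldom c) Psi p).1) \o p) t,
  ((fun p => (jac (ldom c) Psi p).2) \o p) t) (dp t) by [].
by apply/funext.
Qed.

Lemma curve_vel_vtrans t : - r <= t <= r -> vel I G t = vtrans j (G t) (Psi_vel t).
Proof.
move=> tI; rewrite (curve_vel tI).
exact: (Dlmap_vtrans sym_itv_lt tI pD (hp tI) (Psi_curve tI)).
Qed.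

(** [speed] reads each velocity in the chart selected at its base point, which may jump along the
    curve. In the fixed chart [j] the same number is a continuous expression, and this is how
    continuity of the speed is obtained. *)
Lemma curve_speedE t : - r <= t <= r ->
  speed I G t = Num.sqrt (qform (met j (Psi (p t))) (Psi_vel t)).
Proof.
by move=> tI; rewrite /speed (curve_vel_vtrans tI) gnorm_vtrans//; exact/lmap_dom/pD.
Qed.

Lemma Psi_p_dom t : - r <= t <= r -> (crd j @` dom j) ((Psi \o p) t).
Proof. by move=> /pD/lmap_dom h; exists (lmap c (p t)). Qed.

Lemma Psi_p_continuous : {within I, continuous (Psi \o p)}.
Proof.
apply: (within_continuous_comp curve_continuous (Ck1_continuous (CkS Psi_C2))).
by move=> x /itvE /pD.
Qed.

Lemma curve_speed_continuous : {within I, continuous (speed I G)}.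
Proof.
have cm : {within crd j @` dom j, continuous (@met R X j)} by exact: (@met_smooth R X j 0%N).
have := within_qform (within_continuous_comp Psi_p_continuous cm _) Psi_vel_continuous.
move=> /(_ (fun x xI => Psi_p_dom (iffLR (itvE _ _ _) xI))) /within_continuousP h.
apply/within_continuousP => t tI e e0; have [d d0 k] := h t tI e e0.
exists d => // s sI sd; have /itvE sI' := sI; have /itvE tI' := tI.
by rewrite !curve_speedE//; exact: k.
Qed.

Lemma curve_speed_bounds t : - r <= t <= r ->
  `|dp t| <= (1 + kappa) * speed I G t /\ speed I G t <= (1 + kappa) * 2 * `|dp t|.
Proof.
by move=> tI; rewrite /speed (curve_vel tI); exact: (Dlmap_bounds (dp t) (pD tI)).
Qed.

Lemma C1fun_leaf (f : X -> R) : C1fun f -> CkI 1 I (f \o G) /\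
  forall t, - r <= t <= r -> der I (f \o G) t = dfun f (G t) (vel I G t).
Proof.
move=> fC; have [h1 h2 h3] := fC j.
have yD s : I s -> (crd j @` dom j) ((Psi \o p) s) by move=> /itvE; exact: Psi_p_dom.
have fG s : - r <= s <= r -> (f \o icrd j) ((Psi \o p) s) = (f \o G) s.
  by move=> sI; rewrite /= crdK//; exact/lmap_dom/pD.
pose df t := lin2 (jac (crd j @` dom j) (f \o icrd j) ((Psi \o p) t)) (Psi_vel t).
have zA t : exists2 e : R, 0 < e & forall s, I s -> `|s - t| < e -> (crd j @` dom j) ((Psi \o p) s).
  by exists 1 => // s sI _; exact: yD.
have d1 t : - r <= t <= r -> is_dwithin I (f \o G) t (fun s => s *: df t).
  move=> tI; have tI' : I t by exact/itvE.
  have := is_dwithin_curve (zA t) (Psi_curve tI) (h1 _ (yD t tI')).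
  apply: is_dwithin_local; last exact: fG.
  by exists 1 => // s /itvE sI _; split; [exact/itvE|exact: fG].
split.
  apply: (CkI1I sym_itv_lt d1).
  have k1 := within_continuous_comp Psi_p_continuous h2 yD.
  have k2 := within_continuous_comp Psi_p_continuous h3 yD.
  exact: (within_lin2 k1 k2 Psi_vel_continuous).
move=> t tI; apply: (derE sym_itv_lt tI); have tI' : I t by exact/itvE.
have := C1fun_curve fC yD tI' (Psi_curve tI).
have -> : icrd j ((Psi \o p) t) = G t by rewrite /= crdK//; exact/lmap_dom/pD.
rewrite -curve_vel_vtrans//; apply: is_dwithin_local; last exact: fG.
by exists 1 => // s /itvE sI _; split; [exact/itvE|exact: fG].
Qed.

End Curve.
End LeafCurves.

End LeafCurveTheory.
Import LeafCurveTheory.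

(** * Complex integrals and integrals over intervals *)

Module IntervalIntegralTheory.

Section ComplexIntegral.
Context {d : measure_display} {T : measurableType d} {R : realType}.
Context (m : {measure set T -> \bar R}) (A : set T) (mA : measurable A).
Implicit Types f g : T -> R[i].

Definition cintegrable f := m.-integrable A (EFin \o cRe f) /\ m.-integrable A (EFin \o cIm f).

Lemma eq_cint f g : (forall x, A x -> f x = g x) -> cint m A f = cint m A g.
Proof.
move=> h; rewrite /cint; congr (_ +i* _); apply: eq_Rintegral => x /set_mem Ax;
  by rewrite /cRe /cIm h.
Qed.

Lemma cintD f g : cintegrable f -> cintegrable g ->
  cint m A (fun x => f x + g x) = cint m A f + cint m A g.
Proof.
move=> [f1 f2] [g1 g2]; rewrite /cint.
have -> : \int[m]_(x in A) cRe (fun x => f x + g x) x =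
    \int[m]_(x in A) (cRe f x + cRe g x) by apply: eq_Rintegral => x _; rewrite /cRe ReD.
have -> : \int[m]_(x in A) cIm (fun x => f x + g x) x =
    \int[m]_(x in A) (cIm f x + cIm g x) by apply: eq_Rintegral => x _; rewrite /cIm ImD.
by rewrite !RintegralD.
Qed.

Lemma Rintegral_lin (u v : T -> R) (a b : R) : m.-integrable A (EFin \o u) ->
  m.-integrable A (EFin \o v) ->
  \int[m]_(x in A) (a * u x + b * v x) = a * \int[m]_(x in A) u x + b * \int[m]_(x in A) v x.
Proof.
move=> hu hv; rewrite RintegralD//; first by rewrite !RintegralZl.
- by apply: eq_integrable (integrableZl mA a hu) => // x _ /=; rewrite EFinM.
- by apply: eq_integrable (integrableZl mA b hv) => // x _ /=; rewrite EFinM.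
Qed.

Lemma cintZ (c : R[i]) f : cintegrable f -> cint m A (fun x => c * f x) = c * cint m A f.
Proof.
move=> [f1 f2]; rewrite /cint.
have -> : \int[m]_(x in A) cRe (fun x => c * f x) x =
    \int[m]_(x in A) (complex.Re c * cRe f x + (- complex.Im c) * cIm f x).
  by apply: eq_Rintegral => x _; rewrite /cRe ReM mulNr.
have -> : \int[m]_(x in A) cIm (fun x => c * f x) x =
    \int[m]_(x in A) (complex.Re c * cIm f x + complex.Im c * cRe f x).
  by apply: eq_Rintegral => x _; rewrite /cIm ImM.
rewrite !Rintegral_lin//; case: c => a b; apply/eqP; rewrite eq_complex /=.
by apply/andP; split; apply/eqP; ring.
Qed.

End ComplexIntegral.

Section IntervalIntegral.
Context {R : realType}.
Notation mu := (@lebesgue_measure R).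

Lemma within_integrable (f : R -> R) (a b : R) : {within `[a, b], continuous f} ->
  mu.-integrable `[a, b] (EFin \o f).
Proof. by move=> cf; apply: continuous_compact_integrable => //; exact: segment_compact. Qed.

Lemma itv_integral_bounds (f : R -> R) (a b lo hi : R) : a <= b ->
  {within `[a, b], continuous f} -> (forall t, a <= t <= b -> lo <= f t <= hi) ->
  lo * (b - a) <= \int[mu]_(t in `[a, b]) f t <= hi * (b - a).
Proof.
move=> ab cf h; have mi := within_integrable cf.
have cst (k : R) : \int[mu]_(t in `[a, b]) k = k * (b - a).
  rewrite Rintegral_cst//= lebesgue_measure_itv /= lte_fin.
  by move: ab; rewrite le_eqVlt => /predU1P[->|->] //=; rewrite ltxx subrr.
have mc (k : R) : mu.-integrable `[a, b] (EFin \o (fun=> k)).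
  by apply: within_integrable => x; exact: cvg_cst.
rewrite -!cst; apply/andP; split; apply: le_Rintegral => //= x xI.
- by have /andP[] := h x (iffLR (itvE _ _ _) xI).
- by have /andP[] := h x (iffLR (itvE _ _ _) xI).
Qed.

End IntervalIntegral.

End IntervalIntegralTheory.
Import IntervalIntegralTheory.

(** * Test functions and the geometry of leaves *)

Module TestFunctionTheory.

Section TestFunctions.
Context {R : realType} (a b : R) (ab : a < b).
Local Notation I := (`[a, b]%classic : set R).

Lemma CkI1_deriv (f : R -> R) t : CkI 1 I f -> a <= t <= b ->
  is_dwithin I f t (fun s => s *: der I f t).
Proof. by move=> [h _] tI; apply: h; exact/itvE. Qed.

Lemma CkI1_continuous (f : R -> R) : CkI 1 I f -> {within I, continuous f}.
Proof.
move=> [h _]; apply/within_continuousP => t tI e e0.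
exact: (is_dwithin_continuous (normr_ge0 _) (@scale_le _ _ _) (h t tI)).
Qed.

Lemma CkI1M (f g : R -> R) : CkI 1 I f -> CkI 1 I g ->
  CkI 1 I (fun t => f t * g t) /\ forall t, a <= t <= b ->
    der I (fun t => f t * g t) t = f t * der I g t + g t * der I f t.
Proof.
move=> hf hg; have cf := CkI1_continuous hf; have cg := CkI1_continuous hg.
have d t : a <= t <= b -> is_dwithin I (fun t => f t * g t) t
    (fun s => s *: (f t * der I g t + g t * der I f t)).
  move=> tI; have := is_dwithinM (normr_ge0 _) (@scale_le _ _ _) (normr_ge0 _)
    (@scale_le _ _ _) (CkI1_deriv hf tI) (CkI1_deriv hg tI).
  by apply: is_dwithin_eq => u; rewrite /GRing.scale /=; ring.
split; last by move=> t tI; apply: derE => //; exact: d.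
apply: (CkI1I ab d); move: hf hg => [_ hf] [_ hg] x.
by apply: cvgD; apply: cvgM; [exact: cf|exact: hg|exact: cg|exact: hf].
Qed.

Lemma CkI1_lin (f g : R -> R) (k l : R) : CkI 1 I f -> CkI 1 I g ->
  CkI 1 I (fun t => k * f t + l * g t) /\ forall t, a <= t <= b ->
    der I (fun t => k * f t + l * g t) t = k * der I f t + l * der I g t.
Proof.
move=> hf hg.
have d t : a <= t <= b -> is_dwithin I (fun t => k * f t + l * g t) t
    (fun s => s *: (k * der I f t + l * der I g t)).
  move=> tI; have := is_dwithinD (is_dwithinZ k (CkI1_deriv hf tI)) (is_dwithinZ l (CkI1_deriv hg tI)).
  by apply: is_dwithin_eq => u; rewrite /GRing.scale /=; ring.
split; last by move=> t tI; apply: derE => //; exact: d.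
apply: (CkI1I ab d); move: hf hg => [_ hf] [_ hg] x.
by apply: cvgD; apply: cvgM; [exact: cvg_cst|exact: hf|exact: cvg_cst|exact: hg].
Qed.

Implicit Types phi psi : R -> R[i].

Lemma C1I_mul phi psi : C1I I phi -> C1I I psi ->
  C1I I (fun t => phi t * psi t) /\ forall t, a <= t <= b ->
    derc I (fun t => phi t * psi t) t = phi t * derc I psi t + psi t * derc I phi t.
Proof.
move=> [f1 f2] [g1 g2].
have [a1 b1] := CkI1M f1 g1; have [a2 b2] := CkI1M f2 g2.
have [a3 b3] := CkI1M f1 g2; have [a4 b4] := CkI1M f2 g1.
have [c1 d1] := CkI1_lin 1 (-1) a1 a2; have [c2 d2] := CkI1_lin 1 1 a3 a4.
have re : cRe (fun t => phi t * psi t) =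
    fun t => 1 * (cRe phi t * cRe psi t) + -1 * (cIm phi t * cIm psi t).
  by apply/funext => t; rewrite /cRe /cIm ReM; ring.
have im : cIm (fun t => phi t * psi t) =
    fun t => 1 * (cRe phi t * cIm psi t) + 1 * (cIm phi t * cRe psi t).
  by apply/funext => t; rewrite /cRe /cIm ImM; ring.
split; first by rewrite /C1I re im; split; [exact: c1|exact: c2].
move=> t tI; rewrite /derc re im d1// d2// b1// b2// b3// b4//.
rewrite /cRe /cIm; case: (phi t) (psi t) => [x y] [z w]; apply/eqP; rewrite eq_complex /=.
by apply/andP; split; apply/eqP; ring.
Qed.

Lemma C1I_add phi psi : C1I I phi -> C1I I psi ->
  C1I I (fun t => phi t + psi t) /\ forall t, a <= t <= b ->
    derc I (fun t => phi t + psi t) t = derc I phi t + derc I psi t.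
Proof.
move=> [f1 f2] [g1 g2].
have [c1 d1] := CkI1_lin 1 1 f1 g1; have [c2 d2] := CkI1_lin 1 1 f2 g2.
have re : cRe (fun t => phi t + psi t) = fun t => 1 * cRe phi t + 1 * cRe psi t.
  by apply/funext => t; rewrite /cRe ReD !mul1r.
have im : cIm (fun t => phi t + psi t) = fun t => 1 * cIm phi t + 1 * cIm psi t.
  by apply/funext => t; rewrite /cIm ImD !mul1r.
split; first by rewrite /C1I re im.
by move=> t tI; rewrite /derc re im d1// d2// !mul1r.
Qed.

Lemma C1I_cst (z : R[i]) : C1I I (fun=> z) /\ forall t, a <= t <= b -> derc I (fun=> z) t = 0.
Proof.
have d (k : R) t : a <= t <= b -> is_dwithin I (fun=> k) t (fun s => s *: (0 : R)).
  by move=> _; apply: is_dwithin_eq (is_dwithin_cst _ _ _) => u; rewrite scaler0.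
split; first by split; apply: (CkI1I ab (d _)) => x; exact: cvg_cst.
move=> t tI; rewrite /derc (_ : cRe _ = fun=> complex.Re z)// (_ : cIm _ = fun=> complex.Im z)//.
by rewrite !(derE ab tI (d _ t tI)).
Qed.

Lemma C1I_scale (z : R[i]) phi : C1I I phi ->
  C1I I (fun t => z * phi t) /\ forall t, a <= t <= b ->
    derc I (fun t => z * phi t) t = z * derc I phi t.
Proof.
move=> h; have [c1 c2] := C1I_cst z; have [k1 k2] := C1I_mul c1 h.
by split => // t tI; rewrite k2// c2// mulr0 addr0.
Qed.

(** The factor 2 comes from applying the mean value theorem to the real and imaginary parts
    separately. *)
Lemma C1I_lip phi (M : R) : C1I I phi -> (forall t, a <= t <= b -> cabs (derc I phi t) <= M) ->
  forall s t, a <= s <= b -> a <= t <= b -> cabs (phi s - phi t) <= 2 * M * `|s - t|.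
Proof.
move=> [h1 h2] hM s t sI tI; rewrite (le_trans (cabs_le _))// !(ReD, ImD, ReN, ImN).
have -> : 2 * M * `|s - t| = M * `|s - t| + M * `|s - t| by ring.
apply: lerD.
- apply: (mean_value_le (f := cRe phi) (df := der I (cRe phi)) (a := a) (b := b)) => //.
    by move=> x; exact: CkI1_deriv.
  by move=> x xI; rewrite (le_trans _ (hM x xI))// (Re_le_cabs (derc I phi x)).
- apply: (mean_value_le (f := cIm phi) (df := der I (cIm phi)) (a := a) (b := b)) => //.
    by move=> x; exact: CkI1_deriv.
  by move=> x xI; rewrite (le_trans _ (hM x xI))// (Im_le_cabs (derc I phi x)).
Qed.

Lemma C1I_bounded phi : C1I I phi -> exists2 M : R, 0 < M & forall t, a <= t <= b ->
  cabs (phi t) <= M /\ cabs (derc I phi t) <= M.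
Proof.
move=> [h1 h2]; have c1 := CkI1_continuous h1; have c2 := CkI1_continuous h2.
move: h1 h2 => [_ c3] [_ c4].
have bd (f : R -> R) : {within I, continuous f} ->
    exists2 M : R, 0 < M & forall x, a <= x <= b -> `|f x| <= M.
  move=> cf; have [M M0 hM] := compact_bounded_fun (@segment_compact R a b) cf.
  by exists M => // x xI; apply: hM; exact/itvE.
have [M1 M10 k1] := bd _ c1; have [M2 M20 k2] := bd _ c2.
have [M3 M30 k3] := bd _ c3; have [M4 M40 k4] := bd _ c4.
exists (M1 + M2 + M3 + M4); first by rewrite !addr_gt0.
move=> t tI; split; rewrite (le_trans (cabs_le _))//.
- by have := lerD (k1 t tI) (k2 t tI); rewrite /cRe /cIm; lra.
- by have := lerD (k3 t tI) (k4 t tI); rewrite /derc /=; lra.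
Qed.

End TestFunctions.

Section LeafFacts.
Context {R : realType} {X : surface R} (D : leaf_data X).
Context (hk : 0 < ld_kappa D) (hr0 : 0 < ld_r0 D) (htau : 0 < ld_tau0 D).
Context (hD : forall i, is_lchart (ld_kappa D) (ld_chart (l := D) i)).
Implicit Types W : leaf D.

Lemma within_pair (V W1 W2 : normedModType R) (A : set V) (f : V -> W1) (g : V -> W2) :
  {within A, continuous f} -> {within A, continuous g} ->
  {within A, continuous (fun x => (f x, g x))}.
Proof.
move=> /within_continuousP hf /within_continuousP hg; apply/within_continuousP => p Ap e e0.
have [d1 d10 k1] := hf p Ap e e0; have [d2 d20 k2] := hg p Ap e e0.
exists (Num.min d1 d2); first by rewrite lt_min d10.
move=> q Aq; rewrite lt_min => /andP[q1 q2].
by rewrite prod_normE /= gt_max (k1 q Aq q1) (k2 q Aq q2).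
Qed.

Lemma lf_r_gt0 W : is_leaf W -> 0 < lf_r W.
Proof. by move=> [/andP[]]. Qed.

Lemma lf_r_lt W : is_leaf W -> - lf_r W < lf_r W.
Proof. by move=> /lf_r_gt0 r0; rewrite gtrN. Qed.

Lemma lf_graph_dom W t : is_leaf W -> - lf_r W <= t <= lf_r W ->
  ldom (lf_chart W) (lf_graph W t).
Proof. by move=> [_ _ h _ _] tI; apply: h; exact/itvE. Qed.

Lemma lf_F_C1 W : is_leaf W -> CkI 1 (lf_I W) (lf_F W).
Proof.
move=> [_ _ _ [h1 [h2 h3]] _]; split => //.
apply/within_continuousP => t tI e e0.
exact: (is_dwithin_continuous (normr_ge0 _) (@scale_le _ _ _) (h2 t tI)).
Qed.

Definition graph_vel W (t : R) : R * R := (1, der (lf_I W) (lf_F W) t).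

Lemma lf_graph_deriv W t : is_leaf W -> - lf_r W <= t <= lf_r W ->
  is_dwithin (lf_I W) (lf_graph W) t (fun s => s *: graph_vel W t).
Proof.
move=> hW tI; have /is_dwithinP h := CkI1_deriv (lf_F_C1 hW) tI.
apply/is_dwithinP => e e0; have [d d0 k] := h e e0; exists d => // s sI sd.
rewrite plane_norm_le /lf_graph /= /GRing.scale /= mulr1; apply/andP; split.
  rewrite [X in `|X|](_ : _ = 0); last by ring.
  by rewrite normr0 mulr_ge0// ltW.
rewrite [X in `|X|](_ : _ = lf_F W s - lf_F W t - (s - t) *: der (lf_I W) (lf_F W) t).
  exact: k.
by rewrite /GRing.scale /=; ring.
Qed.

Lemma graph_vel_continuous W : is_leaf W -> {within lf_I W, continuous (graph_vel W)}.
Proof.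
move=> hW; apply: within_pair; first by move=> x; exact: cvg_cst.
by have [_] := lf_F_C1 hW.
Qed.

Lemma C1normI_ge (r : R) (F : R -> R) (M : R) : 0 <= r ->
  (C1normI `[(- r)%R, r] F <= M%:E)%E -> forall t, - r <= t <= r ->
  `|F t| <= M /\ `|der `[- r, r] F t| <= M.
Proof.
move=> r0 h t tI; have i0 : [set` `[- r, r]] (0 : R) by apply/itvE; rewrite oppr_le0 r0.
have n1 : (0 <= supn `[(- r)%R, r] (fun t => `|F t|%R))%E.
  by apply: supn_ge0 => //; exists 0.
have n2 : (0 <= supn `[(- r)%R, r] (fun t => `|der `[(- r)%R, r] F t|%R))%E.
  by apply: supn_ge0 => //; exists 0.
split.
- by apply: (supn_leE (adde_le_l n1 n2 h)); exact/itvE.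
- by apply: (supn_leE (adde_le_r n1 n2 h)); exact/itvE.
Qed.

Lemma graph_vel_bounds W t : is_leaf W -> - lf_r W <= t <= lf_r W ->
  1 <= `|graph_vel W t| <= 1 + ld_tau0 D.
Proof.
move=> hW tI; have r0 := lf_r_gt0 hW; have [_ _ _ _ [_ h _]] := hW.
have [_ k] := C1normI_ge (ltW r0) h tI.
rewrite plane_normE /= normr1 le_max lexx /= ge_max lerDl ltW//=.
by rewrite (le_trans k)// lerDr.
Qed.

(** Speeds of leaves are comparable to 1: the charts are isometric up to [1 + ld_kappa D], the
    graphs have slope at most [ld_tau0 D], and the factor 2 in [speed_hi] compares the Euclidean
    norm with the maximum norm. *)
Definition speed_lo := (1 + ld_kappa D)^-1.
Definition speed_hi := (1 + ld_kappa D) * 2 * (1 + ld_tau0 D).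

Lemma speed_lo_gt0 : 0 < speed_lo.
Proof. by rewrite invr_gt0 addr_gt0. Qed.

Lemma speed_hi_gt0 : 0 < speed_hi.
Proof. by rewrite !mulr_gt0// addr_gt0. Qed.

Lemma lf_speed_bounds W t : is_leaf W -> - lf_r W <= t <= lf_r W ->
  speed_lo <= lf_speed W t <= speed_hi.
Proof.
move=> hW tI; have k1 : 0 < 1 + ld_kappa D by rewrite addr_gt0.
have [h1 h2] := curve_speed_bounds hk (hD (lf_i W)) (lf_r_gt0 hW)
  (fun t => @lf_graph_dom W t hW) (fun t => @lf_graph_deriv W t hW) tI.
have /andP[b1 b2] := graph_vel_bounds hW tI.
rewrite -[speed _ _ _]/(lf_speed W t) in h1 h2.
apply/andP; split.
  rewrite /speed_lo -[leLHS]mul1r ler_pdivrMr// mulrC; exact: le_trans h1.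
by rewrite (le_trans h2)// /speed_hi ler_pM2l// mulr_gt0.
Qed.

Lemma lf_speed_gt0 W t : is_leaf W -> - lf_r W <= t <= lf_r W -> 0 < lf_speed W t.
Proof.
move=> hW tI; have /andP[h _] := lf_speed_bounds hW tI; exact: lt_le_trans speed_lo_gt0 h.
Qed.

Lemma lf_speed_continuous W : is_leaf W -> {within lf_I W, continuous (lf_speed W)}.
Proof.
move=> hW; have := hD (lf_i W) => hc; have [_ [_ [_ [_ [_ [_ [_ [[j [K [hj [_ _]]]] _]]]]]]]] := hc.
exact: (curve_speed_continuous hc hj (lf_r_gt0 hW) (fun t => @lf_graph_dom W t hW)
  (fun t => @lf_graph_deriv W t hW) (graph_vel_continuous hW)).
Qed.

Lemma lf_length_bounds W : is_leaf W -> 0 < lf_length W <= speed_hi * (2 * ld_r0 D).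
Proof.
move=> hW; have r0 := lf_r_gt0 hW; have [/andP[_ rr] _ _ _ _] := hW.
have rI : - lf_r W <= lf_r W by rewrite ltW// lf_r_lt.
have /andP[h1 h2] := itv_integral_bounds rI (lf_speed_continuous hW)
  (fun t => @lf_speed_bounds W t hW).
rewrite opprK in h1 h2; apply/andP; split.
  by apply: lt_le_trans h1; rewrite mulr_gt0 ?speed_lo_gt0// addr_gt0.
rewrite (le_trans h2)// ler_pM2l ?speed_hi_gt0//; lra.
Qed.

(** Makes Hoelder norms in arc length and in the parameter equivalent, uniformly over all leaves. *)
Lemma lf_dist_bounds W s t : is_leaf W -> - lf_r W <= s <= lf_r W -> - lf_r W <= t <= lf_r W ->
  speed_lo * `|s - t| <= lf_dist W s t <= speed_hi * `|s - t|.
Proof.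
move=> hW sI tI; rewrite /lf_dist.
have -> : `|s - t| = Num.max s t - Num.min s t.
  by have [st|st] := leP s t; [rewrite ler0_norm ?opprB// subr_le0|rewrite gtr0_norm// subr_gt0].
have sub x : Num.min s t <= x <= Num.max s t -> - lf_r W <= x <= lf_r W.
  by move: sI tI; case: (leP s t) => _; lra.
apply: itv_integral_bounds.
- by rewrite ge_min !le_max !lexx.
- by apply: within_continuousS (lf_speed_continuous hW) => x /itvE xI; apply/itvE; exact: sub.
- by move=> x xI; apply: lf_speed_bounds => //; exact: sub.
Qed.

Lemma C1fun_lf W (f : X -> R) : is_leaf W -> C1fun f -> CkI 1 (lf_I W) (f \o lf_G W) /\
  forall t, - lf_r W <= t <= lf_r W ->
    der (lf_I W) (f \o lf_G W) t = dfun f (lf_G W t) (vel (lf_I W) (lf_G W) t).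
Proof.
move=> hW fC; have := hD (lf_i W) => hc; have [_ [_ [_ [_ [_ [_ [_ [[j [K [hj [_ _]]]] _]]]]]]]] := hc.
exact: (C1fun_leaf hc hj (lf_r_gt0 hW) (fun t => @lf_graph_dom W t hW)
  (fun t => @lf_graph_deriv W t hW) (graph_vel_continuous hW)).
Qed.

Lemma C1c_lf W (f : X -> R[i]) : is_leaf W -> C1c f -> C1I (lf_I W) (f \o lf_G W).
Proof.
move=> hW [h1 h2]; have [k1 _] := C1fun_lf hW h1; have [k2 _] := C1fun_lf hW h2.
exact: conj k1 k2.
Qed.

Lemma C1c_lf_bounds W (f : X -> R[i]) (A : R) : is_leaf W -> C1c f -> (C1norm f <= A%:E)%E ->
  forall t, - lf_r W <= t <= lf_r W -> cabs (f (lf_G W t)) <= A /\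
    cabs (derc (lf_I W) (f \o lf_G W) t) <= A * lf_speed W t.
Proof.
move=> hW [f1 f2] fA t tI; have [h1 h2] := C1norm_ge fA.
have [_ d1] := C1fun_lf hW f1; have [_ d2] := C1fun_lf hW f2.
split => //; rewrite /derc (_ : cRe (f \o lf_G W) = cRe f \o lf_G W)//.
by rewrite (_ : cIm (f \o lf_G W) = cIm f \o lf_G W)// d1// d2//; exact: h2.
Qed.

End LeafFacts.

End TestFunctionTheory.
Import TestFunctionTheory.

(** * Norms of test functions as pointwise inequalities *)

Module ProbeNormTheory.

Section Powers.
Context {R : realType}.

(** Geometric interpolation: one of the two bounds will be Lipschitz, the other uniform, and the
    result is of Hoelder type. *)
Lemma interpolate (q d x y : R) : 0 <= q <= 1 -> 0 <= d -> d <= x -> d <= y ->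
  d <= x `^ q * y `^ (1 - q).
Proof.
move=> /andP[q0 q1] d0 dx dy; have := dx; have := dy.
rewrite le_eqVlt in d0; case/predU1P : d0 => [<-|d0].
  by move=> _ _; rewrite mulr_ge0// powR_ge0.
move=> _ _; have {1}-> : d = d `^ q * d `^ (1 - q).
  rewrite mulrC -powRD; first by rewrite subrK powRr1// ltW.
  by apply/implyP; rewrite subrK oner_eq0.
apply: ler_pM; rewrite ?powR_ge0//; apply: ge0_ler_powR; rewrite ?nnegrE//; lra.
Qed.

Lemma powR_split (q x : R) : 0 <= x -> x = x `^ (1 - q) * x `^ q.
Proof.
rewrite le_eqVlt => /predU1P[<-|x0].
  by have [->|q0] := eqVneq q 0; rewrite ?subr0 ?powRr1 ?mul0r// (powR0 q0) mulr0.
rewrite -powRD; first by rewrite subrK powRr1// ltW.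
by apply/implyP; rewrite subrK oner_eq0.
Qed.

Lemma lip_holder (q x M : R) : 0 <= q <= 1 -> 0 <= x <= M -> x <= M `^ (1 - q) * x `^ q.
Proof.
move=> /andP[q0 q1] /andP[x0 xM]; rewrite {1}(powR_split q x0) ler_wpM2r ?powR_ge0//.
by apply: ge0_ler_powR; rewrite ?nnegrE//; lra.
Qed.

End Powers.

Section ProbeNorms.
Context {R : realType} {X : surface R} (D : leaf_data X).
Context (hk : 0 < ld_kappa D) (hr0 : 0 < ld_r0 D) (htau : 0 < ld_tau0 D).
Context (hD : forall i, is_lchart (ld_kappa D) (ld_chart (l := D) i)).
Context (q al : R) (hq : 0 < q < 1) (hal : 0 < al).
Implicit Types (W : leaf D) (phi psi : R -> R[i]).
Local Notation speed_lo := (TestFunctionTheory.speed_lo D).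
Local Notation speed_hi := (TestFunctionTheory.speed_hi D).
Local Notation speed_lo_gt0 := (TestFunctionTheory.speed_lo_gt0 hk).
Local Notation speed_hi_gt0 := (TestFunctionTheory.speed_hi_gt0 hk htau).
Local Notation lf_speed_bounds := (TestFunctionTheory.lf_speed_bounds hk htau hD).
Local Notation lf_length_bounds := (TestFunctionTheory.lf_length_bounds hk htau hD).
Local Notation lf_dist_bounds := (TestFunctionTheory.lf_dist_bounds hk htau hD).
Local Notation lf_speed_gt0 := (TestFunctionTheory.lf_speed_gt0 hk htau hD).

Local Notation "W '_itv' t" := (- lf_r W <= t <= lf_r W) (at level 10).

Lemma q01 : 0 <= q <= 1. Proof. by case/andP : hq => h1 h2; rewrite !ltW. Qed.

Lemma lf_itv0 W : is_leaf W -> W _itv (0 : R).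
Proof. by move=> /lf_r_gt0 r0; rewrite oppr_le0 ltW//= ltW. Qed.

Lemma lf_itv_dist W (s t : R) : is_leaf W -> W _itv s -> W _itv t -> `|s - t| <= 2 * ld_r0 D.
Proof.
move=> hW sI tI; have [/andP[r0 rr] _ _ _ _] := hW; rewrite ler_norml; lra.
Qed.

(** Extended-valued norms are traded for real inequalities in the parameter: lemmas ending in [_ge]
    extract them, those ending in [_le] rebuild the norm from them. *)
Lemma lf_C1norm_ge W phi (A : R) : is_leaf W -> (lf_C1norm W phi <= A%:E)%E ->
  forall t, W _itv t -> cabs (phi t) <= A /\ cabs (derc (lf_I W) phi t) <= A * speed_hi.
Proof.
move=> hW h t tI; have i0 : lf_I W (0 : R) by apply/itvE; exact: lf_itv0.
have n1 : (0 <= supn (lf_I W) (fun t => cabs (phi t)))%E.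
  by apply: supn_ge0 => [|x _]; [exists 0|exact: cabs_ge0].
have n2 : (0 <= supn (lf_I W) (fun t => (cabs (derc (lf_I W) phi t) / lf_speed W t)%R))%E.
  apply: supn_ge0 => [|x /itvE xI]; first by exists 0.
  by rewrite divr_ge0 ?cabs_ge0// ltW// lf_speed_gt0.
have tI' : lf_I W t by exact/itvE.
have h1 := supn_leE (adde_le_l n1 n2 h) tI'; have h2 := supn_leE (adde_le_r n1 n2 h) tI'.
split => //; rewrite ler_pdivrMr ?lf_speed_gt0// in h2; apply: (le_trans h2).
rewrite ler_wpM2l//; first exact: le_trans (cabs_ge0 _) h1.
by case/andP : (lf_speed_bounds hW tI).
Qed.

Lemma lf_C1norm_le W phi (a b : R) : is_leaf W -> 0 <= b ->
  (forall t, W _itv t -> cabs (phi t) <= a) ->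
  (forall t, W _itv t -> cabs (derc (lf_I W) phi t) <= b) ->
  (lf_C1norm W phi <= (a + b / speed_lo)%:E)%E.
Proof.
move=> hW b0 h1 h2; rewrite EFinD leeD//; apply: supn_le => t /itvE tI; first exact: h1.
have /andP[l _] := lf_speed_bounds hW tI.
apply: ler_pM; [exact: cabs_ge0| |exact: h2|].
  by rewrite invr_ge0 ltW// lf_speed_gt0.
by rewrite lef_pV2 ?posrE ?speed_lo_gt0 ?lf_speed_gt0.
Qed.

Lemma holder_ge (I : set R) (dd : R -> R -> R) phi (A : R) : I !=set0 ->
  (exists st : R * R, [/\ I st.1, I st.2 & st.1 <> st.2]) ->
  (holder q I dd phi <= A%:E)%E ->
  (forall t, I t -> cabs (phi t) <= A) /\
  forall s t, I s -> I t -> s <> t -> cabs (phi s - phi t) / dd s t `^ q <= A.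
Proof.
move=> I0 I2 h.
have n1 : (0 <= supn I (fun t => cabs (phi t)))%E.
  by apply: supn_ge0 => // x _; exact: cabs_ge0.
have n2 : (0 <= supn [set st : R * R | [/\ I st.1, I st.2 & st.1 <> st.2]]
     (fun st => (cabs (phi st.1 - phi st.2) / dd st.1 st.2 `^ q)%R))%E.
  by apply: supn_ge0 => // x _; rewrite divr_ge0 ?cabs_ge0 ?powR_ge0.
split; first by move=> t It; exact: (supn_leE (adde_le_l n1 n2 h)).
by move=> s t Is It st; exact: (supn_leE (adde_le_r n1 n2 h) (x := (s, t))).
Qed.

Lemma lf_I_pair W : is_leaf W ->
  exists st : R * R, [/\ lf_I W st.1, lf_I W st.2 & st.1 <> st.2].
Proof.
move=> hW; have r0 := lf_r_gt0 hW; exists (0, lf_r W); split => /=.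
- by apply/itvE; exact: lf_itv0.
- by apply/itvE; rewrite lexx andbT ltW// lf_r_lt.
- by move=> e; move: r0; rewrite -e ltxx.
Qed.

Lemma lf_I_nonempty W : is_leaf W -> lf_I W !=set0.
Proof. by move=> hW; exists 0; apply/itvE; exact: lf_itv0. Qed.

Lemma lf_Cqnorm_ge W phi (A : R) : is_leaf W -> (lf_Cqnorm q W phi <= A%:E)%E ->
  (forall t, W _itv t -> cabs (phi t) <= A) /\
  forall s t, W _itv s -> W _itv t ->
    cabs (phi s - phi t) <= A * speed_hi `^ q * `|s - t| `^ q.
Proof.
move=> hW /(holder_ge (lf_I_nonempty hW) (lf_I_pair hW))[h1 h2]; split.
  by move=> t tI; apply: h1; exact/itvE.
move=> s t sI tI; have A0 : 0 <= A by rewrite (le_trans (cabs_ge0 _) (h1 0 _))//; exact/itvE/lf_itv0.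
have [->|st] := eqVneq s t.
  by rewrite subrr cabs0 !mulr_ge0 ?powR_ge0.
have /andP[d1 d2] := lf_dist_bounds hW sI tI.
have st0 : 0 < `|s - t| by rewrite normr_gt0 subr_eq0.
have dd0 : 0 < lf_dist W s t by apply: lt_le_trans d1; rewrite mulr_gt0// speed_lo_gt0.
have := h2 s t (iffRL (itvE _ _ _) sI) (iffRL (itvE _ _ _) tI) (elimN eqP st).
rewrite ler_pdivrMr ?powR_gt0// => /le_trans; apply.
rewrite -mulrA ler_wpM2l// -powRM ?normr_ge0//; last exact: ltW speed_hi_gt0.
apply: ge0_ler_powR; rewrite ?nnegrE//; first by case/andP : q01.
- exact: ltW.
- by rewrite mulr_ge0// ltW// speed_hi_gt0.
Qed.

Lemma lf_Cqnorm_le W phi (a b : R) : is_leaf W -> 0 <= b ->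
  (forall t, W _itv t -> cabs (phi t) <= a) ->
  (forall s t, W _itv s -> W _itv t -> cabs (phi s - phi t) <= b * `|s - t| `^ q) ->
  (lf_Cqnorm q W phi <= (a + b / speed_lo `^ q)%:E)%E.
Proof.
move=> hW b0 h1 h2; rewrite EFinD leeD//.
  by apply: supn_le => t /itvE; exact: h1.
apply: supn_le => -[s t] /= [/itvE sI /itvE tI /eqP st].
have /andP[d1 d2] := lf_dist_bounds hW sI tI.
have st0 : 0 < `|s - t| by rewrite normr_gt0 subr_eq0.
have dd0 : 0 < lf_dist W s t by apply: lt_le_trans d1; rewrite mulr_gt0// speed_lo_gt0.
rewrite ler_pdivrMr ?powR_gt0// (le_trans (h2 s t sI tI))//.
rewrite -mulrA ler_wpM2l// mulrC ler_pdivlMr ?powR_gt0 ?speed_lo_gt0//.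
rewrite -powRM ?normr_ge0//; last exact: ltW speed_lo_gt0.
rewrite mulrC in d1; apply: ge0_ler_powR; rewrite ?nnegrE//; first by case/andP : q01.
- by rewrite mulr_ge0// ltW// speed_lo_gt0.
- exact: ltW.
Qed.

Lemma d_test_ge W phi psi (e : R) : is_leaf W -> (d_test q W phi psi <= e%:E)%E ->
  (forall t, W _itv t -> cabs (phi t - psi t) <= e) /\
  forall s t, W _itv s -> W _itv t ->
    cabs ((phi s - psi s) - (phi t - psi t)) <= e * `|s - t| `^ q.
Proof.
move=> hW /(holder_ge (lf_I_nonempty hW) (lf_I_pair hW))[h1 h2]; split.
  by move=> t tI; apply: h1; exact/itvE.
move=> s t sI tI; have e0 : 0 <= e by rewrite (le_trans (cabs_ge0 _) (h1 0 _))//; exact/itvE/lf_itv0.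
have [->|st] := eqVneq s t.
  by rewrite subrr cabs0 mulr_ge0 ?powR_ge0.
have st0 : 0 < `|s - t| by rewrite normr_gt0 subr_eq0.
have := h2 s t (iffRL (itvE _ _ _) sI) (iffRL (itvE _ _ _) tI) (elimN eqP st).
by rewrite ler_pdivrMr ?powR_gt0.
Qed.

Lemma d_test_le W phi psi (a b : R) : 0 <= b ->
  (forall t, W _itv t -> cabs (phi t - psi t) <= a) ->
  (forall s t, W _itv s -> W _itv t ->
    cabs ((phi s - psi s) - (phi t - psi t)) <= b * `|s - t| `^ q) ->
  (d_test q W phi psi <= (a + b)%:E)%E.
Proof.
move=> b0 h1 h2; rewrite EFinD leeD//.
  by apply: supn_le => t /itvE; exact: h1.
apply: supn_le => -[s t] /= [/itvE sI /itvE tI /eqP st].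
have st0 : 0 < `|s - t| by rewrite normr_gt0 subr_eq0.
by rewrite ler_pdivrMr ?powR_gt0// h2.
Qed.

Definition wlen W := lf_length W `^ al.
Definition max_wlen := (speed_hi * (2 * ld_r0 D)) `^ al.

Lemma wlen_gt0 W : is_leaf W -> 0 < wlen W.
Proof. by move=> hW; rewrite powR_gt0//; case/andP : (lf_length_bounds hW). Qed.

Lemma wlen_le W : is_leaf W -> wlen W <= max_wlen.
Proof.
move=> hW; have /andP[h1 h2] := lf_length_bounds hW.
apply: ge0_ler_powR; rewrite ?nnegrE ?(ltW hal) ?(ltW h1)//.
by rewrite (le_trans _ h2)// ltW.
Qed.

Lemma max_wlen_gt0 : 0 < max_wlen.
Proof. by apply: powR_gt0; apply: mulr_gt0; [exact: speed_hi_gt0|exact: mulr_gt0]. Qed.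

Lemma snorm_ball_ge W phi (A : R) : is_leaf W ->
  ((wlen W)%:E * lf_Cqnorm q W phi <= A%:E)%E ->
  (forall t, W _itv t -> cabs (phi t) <= A / wlen W) /\
  forall s t, W _itv s -> W _itv t ->
    cabs (phi s - phi t) <= A / wlen W * speed_hi `^ q * `|s - t| `^ q.
Proof.
move=> hW h; apply: lf_Cqnorm_ge => //; move: h.
by rewrite -lee_pdivlMl ?wlen_gt0// EFinM [(_ * A%:E)%E]muleC.
Qed.

Lemma snorm_ball_le W phi (a b : R) : is_leaf W -> 0 <= b ->
  (forall t, W _itv t -> cabs (phi t) <= a) ->
  (forall s t, W _itv s -> W _itv t -> cabs (phi s - phi t) <= b * `|s - t| `^ q) ->
  ((wlen W)%:E * lf_Cqnorm q W phi <= (wlen W * (a + b / speed_lo `^ q))%:E)%E.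
Proof.
move=> hW b0 h1 h2; rewrite EFinM lee_pmul2l ?fin_numE ?lte_fin ?wlen_gt0//.
exact: lf_Cqnorm_le.
Qed.

(** Cost of passing from a Lipschitz bound to exponent [q]: parameter distances are at most
    [2 * ld_r0 D], and the spare power [1 - q] of that length is paid. *)
Definition holder_cst := 2 * speed_hi * (2 * ld_r0 D) `^ (1 - q).

Lemma holder_cst_gt0 : 0 < holder_cst.
Proof.
apply: mulr_gt0; last by apply: powR_gt0; exact: mulr_gt0.
by apply: mulr_gt0; [|exact: speed_hi_gt0].
Qed.

Lemma lip_holder_lf W phi (A : R) : is_leaf W -> 0 <= A -> C1I (lf_I W) phi ->
  (forall t, W _itv t -> cabs (derc (lf_I W) phi t) <= A * speed_hi) ->
  forall s t, W _itv s -> W _itv t -> cabs (phi s - phi t) <= A * holder_cst * `|s - t| `^ q.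
Proof.
move=> hW A0 hphi hA s t sI tI.
rewrite (le_trans (C1I_lip hphi hA sI tI))//.
have -> : A * holder_cst * `|s - t| `^ q =
    2 * (A * speed_hi) * ((2 * ld_r0 D) `^ (1 - q) * `|s - t| `^ q) by rewrite /holder_cst; ring.
rewrite ler_wpM2l//.
  by apply: mulr_ge0 => //; apply: mulr_ge0 => //; exact: ltW speed_hi_gt0.
have hst : 0 <= `|s - t| <= 2 * ld_r0 D by rewrite normr_ge0 (lf_itv_dist hW sI tI).
exact: (lip_holder q01 hst).
Qed.

Lemma cabs_mul_diff (u v x y : R[i]) : cabs (u * x - v * y) <=
  cabs u * cabs (x - y) + cabs y * cabs (u - v).
Proof.
have -> : u * x - v * y = u * (x - y) + y * (u - v) by ring.
by rewrite (le_trans (cabsD _ _))// !cabsM.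
Qed.

End ProbeNorms.

End ProbeNormTheory.
Import ProbeNormTheory.

(** * Products of test functions with C^1 functions *)

Module ProductTheory.

Section Multiplication.
Context {R : realType} {X : surface R} (D : leaf_data X).
Context (hk : 0 < ld_kappa D) (hr0 : 0 < ld_r0 D) (htau : 0 < ld_tau0 D).
Context (hD : forall i, is_lchart (ld_kappa D) (ld_chart (l := D) i)).
Context (q al : R) (hq : 0 < q < 1) (hal : 0 < al).
Implicit Types (W : leaf D) (phi psi : R -> R[i]).
Local Notation speed_lo := (TestFunctionTheory.speed_lo D).
Local Notation speed_hi := (TestFunctionTheory.speed_hi D).
Local Notation speed_lo_gt0 := (TestFunctionTheory.speed_lo_gt0 hk).
Local Notation speed_hi_gt0 := (TestFunctionTheory.speed_hi_gt0 hk htau).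
Local Notation lf_speed_bounds := (TestFunctionTheory.lf_speed_bounds hk htau hD).
Local Notation C1c_lf := (TestFunctionTheory.C1c_lf hD).
Local Notation C1c_lf_bounds := (TestFunctionTheory.C1c_lf_bounds hD).
Local Notation lf_C1norm_ge := (ProbeNormTheory.lf_C1norm_ge hk htau hD).
Local Notation lf_C1norm_le := (ProbeNormTheory.lf_C1norm_le hk htau hD).
Local Notation snorm_ball_ge := (ProbeNormTheory.snorm_ball_ge hk htau hD hq).
Local Notation snorm_ball_le := (ProbeNormTheory.snorm_ball_le hk htau hD al hq).
Local Notation lip_holder_lf := (ProbeNormTheory.lip_holder_lf hk htau hq).
Local Notation wlen_gt0 := (ProbeNormTheory.wlen_gt0 hk htau hD al).
Local Notation wlen_le := (ProbeNormTheory.wlen_le hk htau hD hal).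
Local Notation wlen := (ProbeNormTheory.wlen al).
Local Notation max_wlen := (ProbeNormTheory.max_wlen D al).
Local Notation max_wlen_gt0 := (ProbeNormTheory.max_wlen_gt0 hk hr0 htau al).
Local Notation holder_cst := (ProbeNormTheory.holder_cst D q).
Local Notation holder_cst_gt0 := (ProbeNormTheory.holder_cst_gt0 hk hr0 htau q).
Local Notation "W '_itv' t" := (- lf_r W <= t <= lf_r W) (at level 10).

Lemma d_leaf_ge W1 W2 (eps : R) : is_leaf W1 -> (d_leaf W1 W2 <= eps%:E)%E ->
  [/\ lf_i W1 = lf_i W2, lf_r W1 = lf_r W2 &
   forall t, W1 _itv t -> `|lf_graph W2 t - lf_graph W1 t| <= eps].
Proof.
move=> hW; rewrite /d_leaf; case: asboolP => [[ei er] h|_]; last by rewrite leye_eq.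
split => // t tI; have i0 : lf_I W1 !=set0 := lf_I_nonempty hW.
have n2 : (0 <= supn (lf_I W1) (fun t => `|der (lf_I W1) (fun t => lf_F W1 t - lf_F W2 t) t|%R))%E.
  exact: supn_ge0.
have h1 : ((enorm (lf_x W1 - lf_x W2))%:E + (`|lf_F W1 t - lf_F W2 t|)%:E <= eps%:E)%E.
  apply: le_trans h; rewrite leeD2l// -[leLHS]adde0 leeD//.
  by apply: (supn_ge (fun t => `|lf_F W1 t - lf_F W2 t|)); exact/itvE.
rewrite -EFinD lee_fin in h1.
have -> : lf_graph W2 t - lf_graph W1 t = - ((lf_x W1 - lf_x W2) + (0, lf_F W1 t - lf_F W2 t)).
  by rewrite /lf_graph; apply: plane_eq => /=; ring.
rewrite normrN (le_trans (ler_normD _ _))// (le_trans _ h1)// lerD ?enorm_ge//.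
by rewrite plane_norm_le /= normr0 normr_ge0 lexx.
Qed.

(** One constant for all leaves: there are finitely many charts, and the sum of their constants
    dominates each. A chart with empty domain carries no leaf and gets the constant 1. *)
Lemma lf_comparison : exists2 C : R, 0 < C & forall W1 W2 (eps : R), is_leaf W1 -> is_leaf W2 ->
  0 < eps -> (d_leaf W1 W2 <= eps%:E)%E -> forall (f : X -> R) A, 0 <= A -> C1fun f ->
  (forall x, `|f x| <= A) -> (forall x v, `|dfun f x v| <= A * gnorm x v) ->
  forall t, W1 _itv t -> `|f (lf_G W2 t) - f (lf_G W1 t)| <= C * A * eps.
Proof.
pose c i := ld_chart (l := D) i.
have main i : exists C : R, 0 < C /\ forall (r eps : R) (p1 p2 : R -> R * R), 0 < r -> 0 < eps ->
    {within `[- r, r], continuous p1} -> {within `[- r, r], continuous p2} ->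
    (forall t, - r <= t <= r -> ldom (c i) (p1 t)) -> (forall t, - r <= t <= r -> ldom (c i) (p2 t)) ->
    `|p1 0| <= lrad (c i) / 2 -> `|p2 0| <= lrad (c i) / 2 ->
    (forall t, - r <= t <= r -> `|p2 t - p1 t| <= eps) ->
    forall f A, 0 <= A -> C1fun f -> (forall x, `|f x| <= A) ->
      (forall x v, `|dfun f x v| <= A * gnorm x v) ->
    forall t, - r <= t <= r -> `|f (lmap (c i) (p2 t)) - f (lmap (c i) (p1 t))| <= C * A * eps.
  have hc := hD i; have := hc => -[_ [_ [_ [_ [_ [_ [_ [[j [K [hj [_ hK]]]] _]]]]]]]].
  have [ne|ne] := pselect (exists p, ldom (c i) p).
    have [p pD] := ne; have [YP _] := Psi_image hc hj pD.
    by have [C C0 hC] := leaf_comparison hk hc hj hK (ex_intro _ _ YP); exists C.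
  exists 1; split => // r eps p1 p2 r0 _ _ _ h; exfalso; apply: ne; exists (p1 0); apply: h.
  by rewrite oppr_le0 ltW.
have [C hC] := choice main.
exists (1 + \sum_i C i); first by rewrite ltr_wpDr// sumr_ge0// => i _; have [/ltW] := hC i.
move=> W1 W2 eps h1 h2 eps0 hd f A A0 fC fA dfA t tI.
have [ei er hp] := d_leaf_ge h1 hd.
have [C0 hC1] := hC (lf_i W1).
have cg W : is_leaf W -> {within lf_I W, continuous (lf_graph W)}.
  move=> hW; apply/within_continuousP => s /itvE sI e e0.
  exact: (is_dwithin_continuous (normr_ge0 _) (@scale_le _ _ _) (lf_graph_deriv hW sI)).
have g0 W : is_leaf W -> lf_graph W 0 = lf_x W.
  by move=> [_ _ _ _ [F0 _ _]]; rewrite /lf_graph F0 !addr0 -surjective_pairing.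
have st W : is_leaf W -> `|lf_graph W 0| <= lrad (lf_chart W) / 2.
  by move=> hW; rewrite g0//; have [_ [_ [a b]] _ _ _] := hW; rewrite plane_norm_le !ltW.
have D2 s : W1 _itv s -> ldom (c (lf_i W1)) (lf_graph W2 s).
  by move=> sI; rewrite /c ei; apply: lf_graph_dom => //; rewrite -er.
have c2 : {within lf_I W1, continuous (lf_graph W2)} by rewrite /lf_I er; exact: cg.
have s2 : `|lf_graph W2 0| <= lrad (c (lf_i W1)) / 2 by rewrite /c ei; exact: st.
have := hC1 (lf_r W1) eps (lf_graph W1) (lf_graph W2) (lf_r_gt0 h1) eps0 (cg _ h1) c2
  (fun s => @lf_graph_dom _ _ _ W1 s h1) D2 (st _ h1) s2 hp f A A0 fC fA dfA t tI.
rewrite /lf_G /lf_chart -ei => /le_trans; apply.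
apply: ler_wpM2r; first exact: ltW.
apply: ler_wpM2r => //; rewrite (bigD1 (lf_i W1))//= addrCA lerDl addr_ge0//.
by rewrite sumr_ge0// => i _; have [/ltW] := hC i.
Qed.

Lemma lf_comparison_complex : exists2 C : R, 0 < C & forall W1 W2 (eps : R), is_leaf W1 ->
  is_leaf W2 -> 0 < eps -> (d_leaf W1 W2 <= eps%:E)%E -> forall (f : X -> R[i]) A, 0 <= A -> C1c f ->
  (C1norm f <= A%:E)%E ->
  forall t, W1 _itv t -> cabs (f (lf_G W1 t) - f (lf_G W2 t)) <= C * A * eps.
Proof.
have [C C0 hC] := lf_comparison; exists (2 * C); first by rewrite mulr_gt0.
move=> W1 W2 eps h1 h2 eps0 hd f A A0 [f1 f2] fA t tI; have [k1 k2] := C1norm_ge fA.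
rewrite cabs_distrC (le_trans (cabs_le _))// !(ReD, ImD, ReN, ImN).
have -> : 2 * C * A * eps = C * A * eps + C * A * eps by ring.
apply: lerD.
- apply: (hC W1 W2 eps h1 h2 eps0 hd (cRe f) A A0 f1) => // [x|x v].
    exact: le_trans (Re_le_cabs _) (k1 x).
  exact: le_trans (Re_le_cabs (dfun (cRe f) x v +i* dfun (cIm f) x v)) (k2 x v).
- apply: (hC W1 W2 eps h1 h2 eps0 hd (cIm f) A A0 f2) => // [x|x v].
    exact: le_trans (Im_le_cabs _) (k1 x).
  exact: le_trans (Im_le_cabs (dfun (cRe f) x v +i* dfun (cIm f) x v)) (k2 x v).
Qed.

Definition S_cst := 1 + (speed_hi `^ q + holder_cst) / speed_lo `^ q.

Lemma S_cst_gt0 : 0 < S_cst.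
Proof.
rewrite /S_cst ltr_wpDr// divr_ge0 ?powR_ge0// addr_ge0 ?powR_ge0// ltW//.
exact: holder_cst_gt0.
Qed.

Lemma lf_lip_f W (f : X -> R[i]) (A : R) : is_leaf W -> 0 <= A -> C1c f -> (C1norm f <= A%:E)%E ->
  [/\ forall t, W _itv t -> cabs (f (lf_G W t)) <= A,
      forall t, W _itv t -> cabs (derc (lf_I W) (f \o lf_G W) t) <= A * speed_hi &
      forall s t, W _itv s -> W _itv t ->
        cabs (f (lf_G W s) - f (lf_G W t)) <= A * holder_cst * `|s - t| `^ q].
Proof.
move=> hW A0 fC fA; have h := C1c_lf_bounds hW fC fA.
have hder t : W _itv t -> cabs (derc (lf_I W) (f \o lf_G W) t) <= A * speed_hi.
  move=> tI; have [_ h2] := h t tI; rewrite (le_trans h2)// ler_wpM2l//.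
  by case/andP : (lf_speed_bounds hW tI).
split => //; first by move=> t tI; have [] := h t tI.
exact: (lip_holder_lf hW A0 (C1c_lf hW fC) hder).
Qed.

Lemma mul_sball W (f : X -> R[i]) phi (A B : R) : is_leaf W -> 0 <= A -> C1c f ->
  (C1norm f <= A%:E)%E -> ((wlen W)%:E * lf_Cqnorm q W phi <= B%:E)%E ->
  ((wlen W)%:E * lf_Cqnorm q W (fun t => f (lf_G W t) * phi t)%R <= (A * B * S_cst)%R%:E)%E.
Proof.
move=> hW A0 fC fA /(snorm_ball_ge hW)[h1 h2]; have [k1 _ k2] := lf_lip_f hW A0 fC fA.
have w0 := wlen_gt0 hW; set b := B / wlen W in h1 h2.
have b0 : 0 <= b by rewrite (le_trans (cabs_ge0 _) (h1 0 _))// lf_itv0.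
have hc0 := ltW holder_cst_gt0; have p0 := powR_ge0 speed_hi q.
have H0 : 0 <= A * b * (speed_hi `^ q + holder_cst).
  by apply: mulr_ge0; [exact: mulr_ge0|exact: addr_ge0].
have H1 t : W _itv t -> cabs (f (lf_G W t) * phi t) <= A * b.
  by move=> tI; rewrite cabsM ler_pM ?cabs_ge0 ?k1 ?h1.
have H2 s t : W _itv s -> W _itv t -> cabs (f (lf_G W s) * phi s - f (lf_G W t) * phi t) <=
    A * b * (speed_hi `^ q + holder_cst) * `|s - t| `^ q.
  move=> sI tI; rewrite (le_trans (cabs_mul_diff _ _ _ _))//.
  have st0 := powR_ge0 `|s - t| q.
  have e1 : cabs (f (lf_G W s)) * cabs (phi s - phi t) <= A * (b * speed_hi `^ q * `|s - t| `^ q).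
    by apply: ler_pM; rewrite ?cabs_ge0 ?k1 ?h2.
  have e2 : cabs (phi t) * cabs (f (lf_G W s) - f (lf_G W t)) <= b * (A * holder_cst * `|s - t| `^ q).
    by apply: ler_pM; rewrite ?cabs_ge0 ?h1 ?k2.
  apply: (le_trans (lerD e1 e2)); rewrite le_eqVlt; apply/orP; left; apply/eqP; ring.
have HH := snorm_ball_le hW H0 H1 H2. apply: (le_trans HH); rewrite lee_fin le_eqVlt; apply/orP; left; apply/eqP.
have l0 : speed_lo `^ q != 0 by rewrite gt_eqF// powR_gt0// speed_lo_gt0.
by rewrite /S_cst /b; field; rewrite l0 (gt_eqF w0).
Qed.

Definition C1_cst := 1 + 2 * speed_hi / speed_lo.

Lemma C1_cst_gt0 : 0 < C1_cst.
Proof.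
rewrite /C1_cst ltr_wpDr// divr_ge0 ?(ltW speed_lo_gt0)//.
by apply: mulr_ge0 => //; exact: ltW speed_hi_gt0.
Qed.

(** The product uses [f] along [W1] but is measured on [W2]: in the unstable norm it will be moved
    to the second leaf through the common parameter interval. *)
Lemma mul_c1ball W1 W2 (f : X -> R[i]) phi (A : R) : is_leaf W1 -> is_leaf W2 ->
  lf_r W1 = lf_r W2 -> 0 <= A -> C1c f -> (C1norm f <= A%:E)%E -> C1I (lf_I W1) phi ->
  (lf_C1norm W1 phi <= 1)%E ->
  (lf_C1norm W2 (fun t => f (lf_G W1 t) * phi t)%R <= (A * C1_cst)%R%:E)%E.
Proof.
move=> hW1 hW2 er A0 fC fA hphi /(lf_C1norm_ge hW1) h.
have [k1 k2 _] := lf_lip_f hW1 A0 fC fA; have s0 := ltW speed_hi_gt0.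
have eI : lf_I W2 = lf_I W1 by rewrite /lf_I er.
have [_ hd] := C1I_mul (lf_r_lt hW1) (C1c_lf hW1 fC) hphi.
have H0 : 0 <= 2 * A * speed_hi by apply: mulr_ge0 => //; exact: mulr_ge0.
have H1 t : W2 _itv t -> cabs (f (lf_G W1 t) * phi t) <= A.
  rewrite -er => tI; have [p1 _] := h t tI; rewrite cabsM -[leRHS]mulr1.
  by apply: ler_pM; rewrite ?cabs_ge0 ?k1.
have H2 t : W2 _itv t -> cabs (derc (lf_I W2) (fun t => f (lf_G W1 t) * phi t) t) <= 2 * A * speed_hi.
  rewrite -er eI => tI; have [p1 p2] := h t tI; rewrite hd// (le_trans (cabsD _ _))// !cabsM.
  have e1 : cabs ((f \o lf_G W1) t) * cabs (derc (lf_I W1) phi t) <= A * (1 * speed_hi).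
    by apply: ler_pM; rewrite ?cabs_ge0 ?k1.
  have e2 : cabs (phi t) * cabs (derc (lf_I W1) (f \o lf_G W1) t) <= 1 * (A * speed_hi).
    by apply: ler_pM; rewrite ?cabs_ge0 ?k2.
  apply: (le_trans (lerD e1 e2)); rewrite le_eqVlt; apply/orP; left; apply/eqP; ring.
apply: (le_trans (lf_C1norm_le hW2 H0 H1 H2)); rewrite lee_fin le_eqVlt; apply/orP; left; apply/eqP.
by rewrite /C1_cst; ring.
Qed.

Definition E_cst := max_wlen * (1 + holder_cst / speed_lo `^ q).

Lemma E_cst_gt0 : 0 < E_cst.
Proof.
apply: mulr_gt0; first exact: max_wlen_gt0.
by rewrite ltr_wpDr// divr_ge0 ?powR_ge0// ltW// holder_cst_gt0.
Qed.

(** The derivative bound contained in the C^1 ball gives a Lipschitz, hence a Hoelder bound, with a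
    constant independent of the leaf. *)
Lemma c1ball_holder W phi : is_leaf W -> C1I (lf_I W) phi -> (lf_C1norm W phi <= 1)%E ->
  (forall t, W _itv t -> cabs (phi t) <= 1) /\
  forall s t, W _itv s -> W _itv t -> cabs (phi s - phi t) <= holder_cst * `|s - t| `^ q.
Proof.
move=> hW hphi /(lf_C1norm_ge hW) h; split; first by move=> t tI; have [] := h t tI.
move=> s t sI tI; rewrite -[holder_cst]mul1r; apply: (lip_holder_lf hW _ hphi) => // x xI.
by have [] := h x xI.
Qed.

Lemma c1ball_sball W phi : is_leaf W -> C1I (lf_I W) phi -> (lf_C1norm W phi <= 1)%E ->
  ((wlen W)%:E * lf_Cqnorm q W phi <= E_cst%:E)%E.
Proof.
move=> hW hphi h; have [h1 h2] := c1ball_holder hW hphi h.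
apply: (le_trans (snorm_ball_le hW (ltW holder_cst_gt0) h1 h2)).
rewrite lee_fin /E_cst; apply: ler_wpM2r; last exact: wlen_le.
by rewrite addr_ge0// divr_ge0 ?powR_ge0// ltW// holder_cst_gt0.
Qed.

End Multiplication.

End ProductTheory.
Import ProductTheory.

(** * Differences and multiples of test functions *)

Module ProbeAlgebraTheory.

Section SupScale.
Context {R : realType} {T1 T2 : Type}.

Lemma supn2_scale (A1 : set T1) (A2 : set T2) (f1 g1 : T1 -> R) (f2 g2 : T2 -> R) (s M : R) :
  A1 !=set0 -> A2 !=set0 -> (forall x, A1 x -> 0 <= f1 x) -> (forall x, A2 x -> 0 <= f2 x) ->
  0 <= s -> (forall x, A1 x -> g1 x <= s * f1 x) -> (forall x, A2 x -> g2 x <= s * f2 x) ->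
  (supn A1 f1 + supn A2 f2 <= M%:E)%E -> (supn A1 g1 + supn A2 g2 <= (s * M)%:E)%E.
Proof.
move=> n1 n2 p1 p2 s0 h1 h2 h.
have q1 := supn_ge0 n1 p1; have q2 := supn_ge0 n2 p2.
have u1 := adde_le_l q1 q2 h; have u2 := adde_le_r q1 q2 h.
have [x1 e1] : exists x, supn A1 f1 = x%:E.
  by exists (fine (supn A1 f1)); rewrite fineK// ge0_fin_numE// (le_lt_trans u1)// ltry.
have [x2 e2] : exists x, supn A2 f2 = x%:E.
  by exists (fine (supn A2 f2)); rewrite fineK// ge0_fin_numE// (le_lt_trans u2)// ltry.
rewrite e1 e2 -EFinD lee_fin in h.
apply: (@le_trans _ _ ((s * x1)%:E + (s * x2)%:E)%E); last first.
  by rewrite -EFinD lee_fin -mulrDr ler_wpM2l.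
apply: leeD; apply: supn_le => x Ax.
- rewrite (le_trans (h1 x Ax))// ler_wpM2l//; apply: (supn_leE _ Ax (M := x1)); by rewrite e1.
- rewrite (le_trans (h2 x Ax))// ler_wpM2l//; apply: (supn_leE _ Ax (M := x2)); by rewrite e2.
Qed.

End SupScale.

Section ProbeAlgebra.
Context {R : realType} {X : surface R} (D : leaf_data X).
Context (hk : 0 < ld_kappa D) (hr0 : 0 < ld_r0 D) (htau : 0 < ld_tau0 D).
Context (hD : forall i, is_lchart (ld_kappa D) (ld_chart (l := D) i)).
Context (q al : R) (hq : 0 < q < 1) (hal : 0 < al).
Implicit Types (W : leaf D) (phi psi : R -> R[i]) (p : probe D).
Local Notation speed_lo := (TestFunctionTheory.speed_lo D).
Local Notation speed_hi := (TestFunctionTheory.speed_hi D).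
Local Notation speed_lo_gt0 := (TestFunctionTheory.speed_lo_gt0 hk).
Local Notation speed_hi_gt0 := (TestFunctionTheory.speed_hi_gt0 hk htau).
Local Notation C1c_lf := (TestFunctionTheory.C1c_lf hD).
Local Notation lf_speed_gt0 := (TestFunctionTheory.lf_speed_gt0 hk htau hD).
Local Notation lf_C1norm_le := (ProbeNormTheory.lf_C1norm_le hk htau hD).
Local Notation snorm_ball_le := (ProbeNormTheory.snorm_ball_le hk htau hD al hq).
Local Notation wlen_gt0 := (ProbeNormTheory.wlen_gt0 hk htau hD al).
Local Notation wlen_le := (ProbeNormTheory.wlen_le hk htau hD hal).
Local Notation wlen := (ProbeNormTheory.wlen al).
Local Notation max_wlen := (ProbeNormTheory.max_wlen D al).
Local Notation max_wlen_gt0 := (ProbeNormTheory.max_wlen_gt0 hk hr0 htau al).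
Local Notation holder_cst := (ProbeNormTheory.holder_cst D q).
Local Notation holder_cst_gt0 := (ProbeNormTheory.holder_cst_gt0 hk hr0 htau q).
Local Notation q01 := (ProbeNormTheory.q01 hq).
Local Notation "W '_itv' t" := (- lf_r W <= t <= lf_r W) (at level 10).
Local Notation lf_comparison_complex := (ProductTheory.lf_comparison_complex hk hD).
Local Notation E_cst := (ProductTheory.E_cst D q al).
Local Notation E_cst_gt0 := (ProductTheory.E_cst_gt0 hk hr0 htau q al).
Local Notation lf_lip_f := (ProductTheory.lf_lip_f hk htau hD hq).
Local Notation c1ball_holder := (ProductTheory.c1ball_holder hk htau hD hq).
Local Notation c1ball_sball := (ProductTheory.c1ball_sball hk hr0 htau hD hq hal).

(** The difference of [f] on the two leaves is O(eps) in supremum and O(1) in Lipschitz norm;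
    [interpolate] makes it O(eps^(1-q)) in Hoelder norm. The other terms are O(eps), absorbed
    through eps <= e0^q eps^(1-q). *)
Lemma diff_sball (e0 : R) : 0 < e0 -> exists2 C : R, 0 < C & forall W1 W2 (f : X -> R[i]) phi1 phi2
    (A eps : R), is_leaf W1 -> is_leaf W2 -> 0 < eps <= e0 -> (d_leaf W1 W2 <= eps%:E)%E ->
  0 <= A -> C1c f -> (C1norm f <= A%:E)%E -> C1I (lf_I W1) phi1 -> (lf_C1norm W1 phi1 <= 1)%E ->
  (d_test q W1 phi1 phi2 <= eps%:E)%E ->
  ((wlen W2)%:E * lf_Cqnorm q W2 (fun t => f (lf_G W1 t) * phi1 t - f (lf_G W2 t) * phi2 t)%R <=
    (C * A * eps `^ (1 - q))%R%:E)%E.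
Proof.
move=> e0_0; have [C C0 hC] := lf_comparison_complex.
set K := (4 * speed_hi) `^ q * (2 * C) `^ (1 - q); set E := e0 `^ q.
have K0 : 0 <= K by rewrite mulr_ge0 ?powR_ge0.
have E0 : 0 <= E by rewrite powR_ge0.
have H0 := ltW holder_cst_gt0; have s0 := ltW speed_hi_gt0.
set a := (C + 1) * E; set b := (C * holder_cst + 1 + holder_cst) * E + K.
have a0 : 0 < a by rewrite mulr_gt0 ?powR_gt0// addr_gt0.
have b0 : 0 <= b by rewrite addr_ge0// mulr_ge0// !addr_ge0// mulr_ge0// ltW.
exists (max_wlen * (a + b / speed_lo `^ q)).
  by rewrite mulr_gt0 ?max_wlen_gt0// ltr_wpDr// divr_ge0 ?powR_ge0.
move=> W1 W2 f phi1 phi2 A eps h1 h2 /andP[eps0 epse] hd A0 fC fA hphi1 n1 ht.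
have [ei er hp] := d_leaf_ge h1 hd.
have cmp t : W1 _itv t -> cabs (f (lf_G W1 t) - f (lf_G W2 t)) <= C * A * eps.
  exact: (hC W1 W2 eps h1 h2 eps0 hd f A A0 fC fA).
have [u1 u2] := c1ball_holder h1 hphi1 n1.
have [v1 v2] := d_test_ge h1 ht.
have [f1 f1' f1h] := lf_lip_f h1 A0 fC fA; have [f2 f2' f2h] := lf_lip_f h2 A0 fC fA.
rewrite -er in f2 f2' f2h.
set P := eps `^ (1 - q); have P0 : 0 <= P by rewrite powR_ge0.
have epsE : eps <= E * P.
  rewrite {1}(powR_split q (ltW eps0)) mulrC ler_wpM2r//.
  have [q0 _] := andP hq.
  by apply: ge0_ler_powR; rewrite ?nnegrE ?(ltW eps0) ?(ltW e0_0) ?(ltW q0).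
have CA0 : 0 <= C * A by rewrite mulr_ge0// ltW.
have Kd s t : W1 _itv s -> W1 _itv t ->
    cabs ((f (lf_G W1 s) - f (lf_G W2 s)) - (f (lf_G W1 t) - f (lf_G W2 t))) <= A * K * P * `|s - t| `^ q.
  move=> sI tI.
  have d1 : cabs ((f (lf_G W1 s) - f (lf_G W2 s)) - (f (lf_G W1 t) - f (lf_G W2 t))) <= A * (2 * C) * eps.
    rewrite (le_trans (cabsB _ _))//.
    have -> : A * (2 * C) * eps = C * A * eps + C * A * eps by ring.
    by apply: lerD; exact: cmp.
  have d2 : cabs ((f (lf_G W1 s) - f (lf_G W2 s)) - (f (lf_G W1 t) - f (lf_G W2 t))) <=
      A * (4 * speed_hi) * `|s - t|.
    have -> : (f (lf_G W1 s) - f (lf_G W2 s)) - (f (lf_G W1 t) - f (lf_G W2 t)) =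
      (f (lf_G W1 s) - f (lf_G W1 t)) - (f (lf_G W2 s) - f (lf_G W2 t)) by ring.
    rewrite (le_trans (cabsB _ _))//.
    have l1 := C1I_lip (C1c_lf h1 fC) f1' sI tI.
    have hI : lf_I W2 = lf_I W1 by rewrite /lf_I er.
    have := C1c_lf h2 fC; rewrite hI => k; rewrite hI in f2'.
    have l2 := C1I_lip k f2' sI tI.
    have -> : A * (4 * speed_hi) * `|s - t| = 2 * (A * speed_hi) * `|s - t| + 2 * (A * speed_hi) * `|s - t|.
      by ring.
    exact: lerD l1 l2.
  apply: (le_trans (interpolate q01 (cabs_ge0 _) d2 d1)).
  have -> : A * K * P * `|s - t| `^ q =
     (A `^ (1 - q) * A `^ q) * ((4 * speed_hi) `^ q * (2 * C) `^ (1 - q)) * P * `|s - t| `^ q.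
    by rewrite -powR_split.
  have n1' : 0 <= 4 * speed_hi by exact: mulr_ge0.
  have n2' : 0 <= 2 * C by apply: mulr_ge0 => //; exact: ltW.
  have n3' : 0 <= A * (4 * speed_hi) by exact: mulr_ge0.
  have n4' : 0 <= A * (2 * C) by exact: mulr_ge0.
  rewrite (powRM _ n3' (normr_ge0 _)) (powRM _ A0 n1') (powRM _ n4' (ltW eps0)) (powRM _ A0 n2').
  by rewrite le_eqVlt; apply/orP; left; apply/eqP; rewrite /P; ring.
pose chi t := f (lf_G W1 t) * phi1 t - f (lf_G W2 t) * phi2 t.
have chiE : forall t, chi t = (f (lf_G W1 t) - f (lf_G W2 t)) * phi1 t + f (lf_G W2 t) * (phi1 t - phi2 t).
  by move=> t; rewrite /chi; ring.
have X1 t : W2 _itv t -> cabs (chi t) <= A * a * P.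
  rewrite -er => tI; rewrite chiE (le_trans (cabsD _ _))// !cabsM.
  have e1 : cabs (f (lf_G W1 t) - f (lf_G W2 t)) * cabs (phi1 t) <= C * A * eps * 1.
    by apply: ler_pM; rewrite ?cabs_ge0 ?cmp ?u1.
  have e2 : cabs (f (lf_G W2 t)) * cabs (phi1 t - phi2 t) <= A * eps.
    by apply: ler_pM; rewrite ?cabs_ge0 ?f2 ?v1.
  apply: (le_trans (lerD e1 e2)).
  have -> : C * A * eps * 1 + A * eps = A * (C + 1) * eps by ring.
  have -> : A * a * P = A * (C + 1) * (E * P) by rewrite /a; ring.
  by rewrite ler_wpM2l// mulr_ge0// addr_ge0// ltW.
have X2 s t : W2 _itv s -> W2 _itv t -> cabs (chi s - chi t) <= A * b * P * `|s - t| `^ q.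
  rewrite -er => sI tI; set T := `|s - t| `^ q; have T0 : 0 <= T by rewrite powR_ge0.
  have -> : chi s - chi t =
    ((f (lf_G W1 s) - f (lf_G W2 s)) * phi1 s - (f (lf_G W1 t) - f (lf_G W2 t)) * phi1 t) +
    (f (lf_G W2 s) * (phi1 s - phi2 s) - f (lf_G W2 t) * (phi1 t - phi2 t)).
    by rewrite !chiE; ring.
  rewrite (le_trans (cabsD _ _))//.
  have e1 : cabs (f (lf_G W1 s) - f (lf_G W2 s)) * cabs (phi1 s - phi1 t) <= C * A * eps * (holder_cst * T).
    by apply: ler_pM; rewrite ?cabs_ge0 ?cmp ?u2.
  have e2 : cabs (phi1 t) * cabs ((f (lf_G W1 s) - f (lf_G W2 s)) - (f (lf_G W1 t) - f (lf_G W2 t))) <=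
      1 * (A * K * P * T).
    by apply: ler_pM; rewrite ?cabs_ge0 ?u1 ?Kd.
  have e3 : cabs (f (lf_G W2 s)) * cabs ((phi1 s - phi2 s) - (phi1 t - phi2 t)) <= A * (eps * T).
    by apply: ler_pM; rewrite ?cabs_ge0 ?f2 ?v2.
  have e4 : cabs (phi1 t - phi2 t) * cabs (f (lf_G W2 s) - f (lf_G W2 t)) <= eps * (A * holder_cst * T).
    by apply: ler_pM; rewrite ?cabs_ge0 ?v1 ?f2h.
  apply: (le_trans (lerD (cabs_mul_diff _ _ _ _) (cabs_mul_diff _ _ _ _))).
  apply: (le_trans (lerD (lerD e1 e2) (lerD e3 e4))).
  have -> : C * A * eps * (holder_cst * T) + 1 * (A * K * P * T) + (A * (eps * T) + eps * (A * holder_cst * T)) =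
    A * T * (C * holder_cst + 1 + holder_cst) * eps + A * K * P * T by ring.
  have -> : A * b * P * T = A * T * (C * holder_cst + 1 + holder_cst) * (E * P) + A * K * P * T.
    by rewrite /b; ring.
  rewrite lerD2r ler_wpM2l// mulr_ge0//; first exact: mulr_ge0.
  by rewrite !addr_ge0// mulr_ge0// ltW.
have AbP : 0 <= A * b * P by rewrite !mulr_ge0.
apply: (le_trans (snorm_ball_le h2 AbP X1 X2)); rewrite lee_fin.
have -> : max_wlen * (a + b / speed_lo `^ q) * A * P = max_wlen * ((a + b / speed_lo `^ q) * A * P) by ring.
have -> : A * a * P + A * b * P / speed_lo `^ q = (a + b / speed_lo `^ q) * A * P by ring.
apply: ler_wpM2r; last exact: wlen_le.
by rewrite mulr_ge0// mulr_ge0// addr_ge0 ?divr_ge0 ?powR_ge0// ltW.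
Qed.

Lemma probe_ext p p' : pb_leaf p = pb_leaf p' -> pb_fun p = pb_fun p' -> p = p'.
Proof.
case: p p' => [W f a b] [W' f' a' b'] /= eW ef; subst.
by rewrite (Prop_irrelevance a a') (Prop_irrelevance b b').
Qed.

Definition pscale (z : R[i]) p : probe D :=
  Probe (pb_leafP p) (proj1 (C1I_scale (lf_r_lt (pb_leafP p)) z (pb_funP p))).

Lemma pscale1 p : pscale 1 p = p.
Proof. by apply: probe_ext => //=; apply/funext => t; rewrite mul1r. Qed.

Lemma pscaleA z w p : pscale z (pscale w p) = pscale (z * w) p.
Proof. by apply: probe_ext => //=; apply/funext => t; rewrite mulrA. Qed.

Lemma pscale_C1norm z p (M : R) : (lf_C1norm (pb_leaf p) (pb_fun p) <= M%:E)%E ->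
  (lf_C1norm (pb_leaf (pscale z p)) (pb_fun (pscale z p)) <= (cabs z * M)%:E)%E.
Proof.
have hW := pb_leafP p; have [_ hd] := C1I_scale (lf_r_lt hW) z (pb_funP p).
apply: supn2_scale.
- exact: lf_I_nonempty.
- exact: lf_I_nonempty.
- by move=> x _; exact: cabs_ge0.
- by move=> x /itvE xI; rewrite divr_ge0 ?cabs_ge0// ltW// lf_speed_gt0.
- exact: cabs_ge0.
- by move=> x _; rewrite /= cabsM.
- by move=> x /itvE xI; rewrite /= hd// cabsM mulrA.
Qed.

Lemma pscale_Cqnorm z p (M : R) : (lf_Cqnorm q (pb_leaf p) (pb_fun p) <= M%:E)%E ->
  (lf_Cqnorm q (pb_leaf (pscale z p)) (pb_fun (pscale z p)) <= (cabs z * M)%:E)%E.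
Proof.
have hW := pb_leafP p; apply: supn2_scale.
- exact: lf_I_nonempty.
- exact: lf_I_pair.
- by move=> x _; exact: cabs_ge0.
- by move=> x _; rewrite divr_ge0 ?cabs_ge0 ?powR_ge0.
- exact: cabs_ge0.
- by move=> x _; rewrite /= cabsM.
- by move=> x _; rewrite /= -mulrBr cabsM mulrA.
Qed.

Definition sball p (M : R) := ((wlen (pb_leaf p))%:E * lf_Cqnorm q (pb_leaf p) (pb_fun p) <= M%:E)%E.
Definition c1ball p := (lf_C1norm (pb_leaf p) (pb_fun p) <= 1)%E.

Lemma pscale_sball z p M : sball p M -> sball (pscale z p) (cabs z * M).
Proof.
rewrite /sball -lee_pdivlMl ?wlen_gt0//; last exact: pb_leafP.
rewrite -EFinM => /(pscale_Cqnorm z) h.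
rewrite -lee_pdivlMl ?wlen_gt0//; last exact: pb_leafP.
by rewrite -EFinM mulrCA.
Qed.

Lemma sball_le p M M' : M <= M' -> sball p M -> sball p M'.
Proof. by move=> h; rewrite /sball => /le_trans; apply; rewrite lee_fin. Qed.

Lemma pscale_c1ball z p (M : R) : (lf_C1norm (pb_leaf p) (pb_fun p) <= M%:E)%E ->
  cabs z * M <= 1 -> c1ball (pscale z p).
Proof. by move=> /(pscale_C1norm z) h zM; rewrite /c1ball (le_trans h)// lee_fin. Qed.

(** On a compact interval the C^1 norm of a test function is finite, and a multiple of it dominates
    the weighted Hoelder norm. Small multiples therefore always enter both unit balls. *)
Lemma small_scale p : exists s : R, 0 < s /\ c1ball (pscale s%:C p) /\ sball (pscale s%:C p) 1.
Proof.
have hW := pb_leafP p; have [M M0 hM] := C1I_bounded (pb_funP p).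
have n : (lf_C1norm (pb_leaf p) (pb_fun p) <= (M + M / speed_lo)%:E)%E.
  by apply: lf_C1norm_le => //; [exact: ltW|move=> t /hM[]|move=> t /hM[]].
set N := M + M / speed_lo in n.
have N0 : 0 < N by rewrite addr_gt0// divr_gt0// speed_lo_gt0.
have E1 : 0 < 1 + E_cst by rewrite addr_gt0// E_cst_gt0.
have b1 : c1ball (pscale N^-1%:C p).
  by apply: (pscale_c1ball n); rewrite cabs_real gtr0_norm ?invr_gt0// mulVf// gt_eqF.
have b2 := c1ball_sball hW (pb_funP (pscale N^-1%:C p)) b1.
exists ((1 + E_cst)^-1 * N^-1); split; first by rewrite mulr_gt0 ?invr_gt0.
have -> : pscale ((1 + E_cst)^-1 * N^-1)%:C p = pscale (1 + E_cst)^-1%:C (pscale N^-1%:C p).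
  by rewrite pscaleA rmorphM.
have i1 : (1 + E_cst)^-1 <= 1 by rewrite invf_le1// lerDl ltW// E_cst_gt0.
have i2 : (1 + E_cst)^-1 * E_cst <= 1 by rewrite mulrC ler_pdivrMr// mul1r lerDr.
split.
- apply: (pscale_c1ball b1); rewrite cabs_real gtr0_norm ?invr_gt0// mulr1; exact: i1.
- have b3 : sball (pscale N^-1%:C p) E_cst := b2.
  by apply: sball_le (pscale_sball (1 + E_cst)^-1%:C b3); rewrite cabs_real gtr0_norm ?invr_gt0.
Qed.

End ProbeAlgebra.

End ProbeAlgebraTheory.
Import ProbeAlgebraTheory.

(** * The norms of leaf families *)

Module FamilyNormTheory.

Section FamilyNorms.
Context {R : realType} {X : surface R} (D : leaf_data X) (N : norm_params R).
Context (hk : 0 < ld_kappa D) (hr0 : 0 < ld_r0 D) (htau : 0 < ld_tau0 D).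
Context (hD : forall i, is_lchart (ld_kappa D) (ld_chart (l := D) i)).
Local Notation q := (np_q N).
Local Notation al := (np_al N).
Local Notation be := (np_be N).
Local Notation b := (np_b N).
Local Notation eps0 := (np_eps0 N).
Context (hq : 0 < q < 1) (hal : 0 < al) (hb : 0 < b) (he0 : 0 < eps0) (hbe : be <= 1 - q).
Context (p0 : probe D).
Implicit Types (p : probe D) (H K : fam D).
Local Notation lf_speed_continuous := (TestFunctionTheory.lf_speed_continuous hD).
Local Notation C1c_lf := (TestFunctionTheory.C1c_lf hD).
Local Notation holder_cst := (ProbeNormTheory.holder_cst D q).
Local Notation holder_cst_gt0 := (ProbeNormTheory.holder_cst_gt0 hk hr0 htau q).
Local Notation "W '_itv' t" := (- lf_r W <= t <= lf_r W) (at level 10).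
Local Notation E_cst := (ProductTheory.E_cst D q al).
Local Notation E_cst_gt0 := (ProductTheory.E_cst_gt0 hk hr0 htau q al).
Local Notation c1ball_holder := (ProductTheory.c1ball_holder hk htau hD hq).
Local Notation c1ball_sball := (ProductTheory.c1ball_sball hk hr0 htau hD hq hal).
Local Notation sball := (ProbeAlgebraTheory.sball q al).
Local Notation pscale_sball := (ProbeAlgebraTheory.pscale_sball hk htau hD).
Local Notation pscale_c1ball := (ProbeAlgebraTheory.pscale_c1ball hk htau hD).
Local Notation small_scale := (ProbeAlgebraTheory.small_scale hk hr0 htau hD hq hal).

Definition pairdom (eps : R) p p' :=
  [/\ 0 < eps <= eps0, (d_leaf (pb_leaf p) (pb_leaf p') <= eps%:E)%E,
      (lf_C1norm (pb_leaf p) (pb_fun p) <= 1)%E, (lf_C1norm (pb_leaf p') (pb_fun p') <= 1)%E &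
      (d_test q (pb_leaf p) (pb_fun p) (pb_fun p') <= eps%:E)%E].

Lemma d_leaf_refl (W : leaf D) (eps : R) : is_leaf W -> 0 <= eps -> (d_leaf W W <= eps%:E)%E.
Proof.
move=> hW e0; rewrite /d_leaf; case: asboolP => [_|[]//].
have z : (fun t => lf_F W t - lf_F W t) = fun=> 0 by apply/funext => t; rewrite subrr.
apply: (@le_trans _ _ (0 + (0 + 0))%E); last by rewrite !add0e lee_fin.
rewrite z; apply: leeD; first by rewrite lee_fin subrr /enorm /= expr0n addr0 sqrtr0.
apply: leeD; apply: supn_le => t /itvE tI; first by rewrite normr0.
have d0 : is_dwithin (lf_I W) (fun=> (0 : R)) t (fun s => s *: (0 : R)).
  by apply: is_dwithin_eq (is_dwithin_cst _ _ _) => u; rewrite scaler0.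
by rewrite (derE (lf_r_lt hW) tI d0) normr0.
Qed.

Lemma zero_probe_sball M : 0 <= M -> sball (pscale 0 p0) M.
Proof.
move=> M0; have [s [s0 [_ h]]] := small_scale p0.
have := pscale_sball 0 h; rewrite cabs0 mul0r pscaleA mul0r.
exact: sball_le.
Qed.

Lemma zero_probe_c1ball : c1ball (pscale 0 p0).
Proof.
have [s [s0 [h _]]] := small_scale p0.
have := @ProbeAlgebraTheory.pscale_c1ball _ _ _ hk htau hD (0 : R[i])%R (pscale s%:C p0) (1 : R)%R h.
by rewrite cabs0 mul0r pscaleA mul0r; apply.
Qed.

Lemma d_test_refl (W : leaf D) psi (eps : R) : 0 <= eps -> (d_test q W psi psi <= eps%:E)%E.
Proof.
move=> e0; apply: (@le_trans _ _ (0 + 0)%:E); last by rewrite addr0 lee_fin.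
by apply: d_test_le => // [t _|s t _ _]; rewrite !subrr ?cabs0 ?mul0r.
Qed.

Lemma pairdom_zero : pairdom eps0 (pscale 0 p0) (pscale 0 p0).
Proof.
split; [by rewrite he0 lexx|apply: d_leaf_refl; [exact: pb_leafP|exact: ltW]| | |].
- exact: zero_probe_c1ball.
- exact: zero_probe_c1ball.
- exact: d_test_refl (ltW he0).
Qed.

Definition bb H (x : R) := (bnorm N H <= x%:E)%E.

(** Replaces an inequality between extended reals by two real numbers. The null test function lies
    in the domain of both suprema, so each is nonnegative, and a finite bound on their weighted sum
    makes each finite. *)
Lemma bbP H x : bb H x <-> exists s u : R, [/\ s + b * u <= x, 0 <= s, 0 <= u,
  forall p, sball p 1 -> cabs (H p) <= s &
  forall eps p p', pairdom eps p p' -> eps `^ (- be) * cabs (H p - H p') <= u].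
Proof.
split=> [h|[s [u [sux s0 u0 hs hu]]]]; last first.
  apply: (@le_trans _ _ (s%:E + b%:E * u%:E)%E); last by rewrite -EFinM -EFinD lee_fin.
  apply: leeD; first exact: supn_le hs.
  rewrite lee_pmul2l ?fin_numE ?lte_fin//; apply: supn_le => -[e [p p']] /= h; exact: hu.
have n1 : (0 <= snorm N H)%E.
  apply: supn_ge0 => [|p _]; last exact: cabs_ge0.
  by exists (pscale 0 p0); exact: zero_probe_sball ler01.
have n2 : (0 <= unorm N H)%E.
  apply: supn_ge0 => [|[e [p p']] _]; last by rewrite mulr_ge0 ?powR_ge0 ?cabs_ge0.
  by exists (eps0, (pscale 0 p0, pscale 0 p0)); exact: pairdom_zero.
have n3 : (0 <= b%:E * unorm N H)%E by rewrite mule_ge0// lee_fin ltW.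
have s1 := adde_le_l n1 n3 h; have u1 := adde_le_r n1 n3 h.
have u2 : (unorm N H <= (x / b)%:E)%E by rewrite mulrC EFinM lee_pdivlMl.
have es : snorm N H = (fine (snorm N H))%:E.
  by rewrite fineK// ge0_fin_numE// (le_lt_trans s1)// ltry.
have eu : unorm N H = (fine (unorm N H))%:E.
  by rewrite fineK// ge0_fin_numE// (le_lt_trans u2)// ltry.
exists (fine (snorm N H)), (fine (unorm N H)); split.
- by move: h; rewrite /bb /bnorm es eu -EFinM -EFinD lee_fin.
- exact: fine_ge0.
- exact: fine_ge0.
- move=> p hp; rewrite -lee_fin -es.
  exact: (@supn_ge _ _ [set p : probe D | sball p 1] (fun p => cabs (H p)) p hp).
- move=> e p p' hp; rewrite -lee_fin -eu.
  exact: (@supn_ge _ _ _ (fun z : R * (probe D * probe D) => z.1 `^ (- be) * cabs (H z.2.1 - H z.2.2)) (e, (p, p')) hp).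
Qed.

Lemma bb_le H x y : x <= y -> bb H x -> bb H y.
Proof. by move=> xy; rewrite /bb => /le_trans; apply; rewrite lee_fin. Qed.

Lemma bb_ge0 H x : bb H x -> 0 <= x.
Proof.
move=> /bbP[s [u [sux s0 u0 _ _]]]; apply: le_trans sux; apply: addr_ge0 => //.
by rewrite mulr_ge0// ltW.
Qed.

Lemma bb_s H x p : bb H x -> sball p 1 -> cabs (H p) <= x.
Proof.
move=> /bbP[s [u [sux s0 u0 hs _]]] /hs h; apply: (le_trans h); apply: le_trans sux.
by rewrite lerDl mulr_ge0// ltW.
Qed.

Lemma bb_u H x eps p p' : bb H x -> pairdom eps p p' -> eps `^ (- be) * cabs (H p - H p') <= x / b.
Proof.
move=> /bbP[s [u [sux s0 u0 _ hu]]] /hu h; apply: (le_trans h).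
by rewrite ler_pdivlMr// mulrC; apply: le_trans sux; rewrite lerDr.
Qed.

Lemma bbD H K x y : bb H x -> bb K y -> bb (fadd H K) (x + y).
Proof.
move=> /bbP[s [u [a1 a2 a3 a4 a5]]] /bbP[s' [u' [b1 b2 b3 b4 b5]]]; apply/bbP.
exists (s + s'), (u + u'); split; rewrite ?addr_ge0//.
- by rewrite mulrDr addrACA lerD.
- by move=> p hp; rewrite (le_trans (cabsD _ _))// lerD ?a4 ?b4.
- move=> e p p' hp; rewrite /fadd.
  have -> : H p + K p - (H p' + K p') = (H p - H p') + (K p - K p') by ring.
  apply: (le_trans _ (lerD (a5 e p p' hp) (b5 e p p' hp))).
  by rewrite -mulrDr ler_wpM2l ?powR_ge0 ?cabsD.
Qed.

Lemma bbZ z H x : bb H x -> bb (fscale z H) (cabs z * x).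
Proof.
move=> /bbP[s [u [a1 a2 a3 a4 a5]]]; have z0 := cabs_ge0 z; apply/bbP.
exists (cabs z * s), (cabs z * u); split; rewrite ?mulr_ge0//.
- by rewrite mulrCA -mulrDr ler_wpM2l.
- by move=> p hp; rewrite cabsM ler_wpM2l ?a4.
- move=> e p p' hp; rewrite /fscale -mulrBr cabsM mulrCA ler_wpM2l//; exact: a5.
Qed.

Lemma bb0 : bb (fun=> 0) 0.
Proof.
apply/bbP; exists 0, 0; split => //; first by rewrite mulr0 addr0.
- by move=> p _; rewrite cabs0.
- by move=> e p p' _; rewrite subrr cabs0 mulr0.
Qed.

Lemma fsubE H K : fsub H K = fadd H (fscale (-1) K).
Proof. by apply/funext => p; rewrite /fsub /fadd /fscale mulN1r. Qed.

Lemma pairdom_scale p (s t : R) eps : c1ball p -> 0 <= s <= 1 -> 0 <= t <= 1 ->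
  0 < eps <= eps0 -> `|s - t| * (1 + holder_cst) <= eps -> pairdom eps (pscale s%:C p) (pscale t%:C p).
Proof.
move=> hp /andP[s0 s1] /andP[t0 t1] /andP[e0 e1] st; have hW := pb_leafP p.
have [k1 k2] := c1ball_holder hW (pb_funP p) hp.
have k (z : R) : 0 <= z -> z <= 1 -> (lf_C1norm (pb_leaf (pscale z%:C p)) (pb_fun (pscale z%:C p)) <= 1)%E.
  by move=> z0 z1; apply: (pscale_c1ball hp); rewrite mulr1 cabs_real ger0_norm.
split; [by rewrite e0 e1|by apply: d_leaf_refl => //; exact: ltW|exact: k|exact: k|].
apply: (@le_trans _ _ (`|s - t| + `|s - t| * holder_cst)%:E); last by rewrite lee_fin; move: st; rewrite mulrDr mulr1.
have E x : s%:C * pb_fun p x - t%:C * pb_fun p x = (s - t)%:C * pb_fun p x.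
  by rewrite -mulrBl -rmorphB.
have H0 := ltW holder_cst_gt0.
apply: d_test_le => [|x xI|x y xI yI /=]; first by rewrite mulr_ge0.
  by rewrite /= E cabsM cabs_real ler_piMr// k1.
by rewrite !E -mulrBr cabsM cabs_real -mulrA ler_wpM2l// k2.
Qed.

(** A family of finite norm need not be homogeneous, so a test function of the C^1 ball lying
    outside the stable ball cannot simply be rescaled. It is reached from its multiple by 1/m
    through the multiples by k/m: the stable norm controls the first value, and the unstable norm,
    with the same leaf taken twice, controls each increment. *)
Lemma wnorm_bound : exists2 C : R, 0 < C & forall H x p, bb H x -> c1ball p -> cabs (H p) <= C * x.
Proof.
have H0 := ltW holder_cst_gt0; have E0 := ltW E_cst_gt0.
pose M := E_cst + (1 + holder_cst) / eps0.
have M0 : 0 <= M by rewrite addr_ge0// divr_ge0 ?addr_ge0// ltW.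
(* [m] exceeds [E_cst], which puts [P 1] in the stable unit ball, and [(1 + holder_cst) / eps0],
   which makes consecutive multiples admissible at distance [eps0]. *)
pose m := (Num.truncn M).+1; have mM : M < m%:R by exact: truncnS_gt.
have m0 : 0 < m%:R :> R by rewrite ltr0n.
have pw : 0 < eps0 `^ be by exact: powR_gt0.
exists (1 + m%:R * (eps0 `^ be / b)).
  by rewrite ltr_wpDr// mulr_ge0// divr_ge0 ?ltW.
move=> H x p hx hp; have x0 := bb_ge0 hx; have hW := pb_leafP p.
pose P (k : nat) := pscale (k%:R / m%:R)%:C p.
have P1 : cabs (H (P 1%N)) <= x.
  apply: (bb_s hx); have h := c1ball_sball hW (pb_funP p) hp.
  have h' : sball p E_cst := h.
  apply: sball_le (pscale_sball (1%:R / m%:R)%:C h'); rewrite cabs_real mul1r gtr0_norm ?invr_gt0//.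
  rewrite mulrC ler_pdivrMr// mul1r (le_trans _ (ltW mM))// lerDl divr_ge0 ?addr_ge0// ltW//.
have step k : (k < m)%N -> cabs (H (P k.+1) - H (P k)) <= eps0 `^ be / b * x.
  move=> km; have d : pairdom eps0 (P k.+1) (P k).
    apply: pairdom_scale => //.
    - by rewrite divr_ge0//= ler_pdivrMr// mul1r ler_nat.
    - by rewrite divr_ge0//= ler_pdivrMr// mul1r ler_nat ltnW.
    - by rewrite he0 lexx.
    - rewrite -mulrBl -natrB// subSnn mul1r gtr0_norm ?invr_gt0//.
      rewrite mulrC ler_pdivrMr// -ler_pdivrMl// mulrC (le_trans _ (ltW mM))//.
      by rewrite lerDr.
  have := bb_u hx d; rewrite powRN mulrC ler_pdivrMr// => /le_trans; apply.
  by rewrite le_eqVlt; apply/orP; left; apply/eqP; ring.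
have all k : (0 < k <= m)%N -> cabs (H (P k)) <= x + k%:R * (eps0 `^ be / b * x).
  have c0 : 0 <= eps0 `^ be / b * x by rewrite mulr_ge0// divr_ge0 ?ltW.
  elim: k => [//|[|k] IH] /andP[_ km]; first by rewrite (le_trans P1)// lerDl mulr_ge0.
  have IHk := IH (ltnW km); have s := step _ km.
  have -> : H (P k.+2) = H (P k.+1) + (H (P k.+2) - H (P k.+1)) by ring.
  apply: (le_trans (cabsD _ _)); apply: (le_trans (lerD IHk s)).
  by rewrite -(natr1 k.+1) mulrDl mul1r addrA.
have := all m; rewrite leqnn => /(_ isT).
have -> : P m = p by rewrite /P divff ?gt_eqF// pscale1.
by move=> /le_trans; apply; rewrite le_eqVlt; apply/orP; left; apply/eqP; ring.
Qed.

Lemma leaf_cintegrable (f : X -> R[i]) (W : leaf D) psi : is_leaf W -> C1c f -> C1I (lf_I W) psi ->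
  cintegrable lebesgue_measure (lf_I W) (fun t => f (lf_G W t) * psi t * (lf_speed W t)%:C).
Proof.
move=> hW fC hpsi; have [[c1 c2] _] := C1I_mul (lf_r_lt hW) (C1c_lf hW fC) hpsi.
have cs := lf_speed_continuous hW.
have k (g : R -> R) : CkI 1 (lf_I W) g -> {within lf_I W, continuous (fun t => g t * lf_speed W t)}.
  move=> /CkI1_continuous cg t.
  by apply: cvgM; [exact: cg|exact: cs].
split.
- have -> : EFin \o cRe (fun t => f (lf_G W t) * psi t * (lf_speed W t)%:C) =
     EFin \o (fun t => cRe (fun t => f (lf_G W t) * psi t) t * lf_speed W t).
    by apply/funext => t /=; rewrite /cRe [in LHS]ReM /= mulr0 subr0.
  by apply: within_integrable; exact: (k _ c1).
- have -> : EFin \o cIm (fun t => f (lf_G W t) * psi t * (lf_speed W t)%:C) =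
     EFin \o (fun t => cIm (fun t => f (lf_G W t) * psi t) t * lf_speed W t).
    by apply/funext => t /=; rewrite /cIm [in LHS]ImM /= mulr0 add0r.
  by apply: within_integrable; exact: (k _ c2).
Qed.

Lemma lf_I_measurable (W : leaf D) : measurable (lf_I W).
Proof. exact: measurable_itv. Qed.

Lemma emb_probeD (f : X -> R[i]) p p1 p2 : C1c f -> pb_leaf p1 = pb_leaf p -> pb_leaf p2 = pb_leaf p ->
  (forall t, pb_fun p t = pb_fun p1 t + pb_fun p2 t) -> emb f p = emb f p1 + emb f p2.
Proof.
move=> fC e1 e2 h; have hW := pb_leafP p.
have k1 := pb_funP p1; have k2 := pb_funP p2; rewrite e1 in k1; rewrite e2 in k2.
rewrite /emb /leaf_int e1 e2 -cintD//; [|exact: lf_I_measurable|exact: leaf_cintegrable|exact: leaf_cintegrable].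
by apply: eq_cint => t _; rewrite h; ring.
Qed.

Lemma emb_pscale (f : X -> R[i]) z p : C1c f -> emb f (pscale z p) = z * emb f p.
Proof.
move=> fC; rewrite /emb /leaf_int -cintZ//; [|exact: lf_I_measurable|exact: leaf_cintegrable (pb_leafP p) fC (pb_funP p)].
by apply: eq_cint => t _ /=; ring.
Qed.

Lemma emb_fD (f g : X -> R[i]) : C1c f -> C1c g -> emb (D := D) (fun x => f x + g x) = fadd (emb f) (emb g).
Proof.
move=> fC gC; apply/funext => p; have hW := pb_leafP p; have hp := pb_funP p.
rewrite /fadd /emb /leaf_int -cintD//; [|exact: lf_I_measurable|exact: leaf_cintegrable|exact: leaf_cintegrable].
by apply: eq_cint => t _; ring.
Qed.

Lemma emb_fZ (f : X -> R[i]) z : C1c f -> emb (D := D) (fun x => z * f x) = fscale z (emb f).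
Proof.
move=> fC; apply/funext => p; have hW := pb_leafP p; have hp := pb_funP p.
rewrite /fscale /emb /leaf_int -cintZ//; [|exact: lf_I_measurable|exact: leaf_cintegrable].
by apply: eq_cint => t _; ring.
Qed.

End FamilyNorms.

End FamilyNormTheory.
Import FamilyNormTheory.

(** * Construction of the multiplication operators *)

Module MultiplierConstructionTheory.

Lemma sub_add3 (V : zmodType) (a b c x y z : V) : x = y + z ->
  a - (b + c) = (a - x) - ((b - y) + (c - z)).
Proof. by move=> ->; rewrite addrACA -opprD opprB addrA subrK. Qed.

Section Multipliers.
Context {R : realType} {X : surface R} (D : leaf_data X) (N : norm_params R).
Context (hk : 0 < ld_kappa D) (hr0 : 0 < ld_r0 D) (htau : 0 < ld_tau0 D).
Context (hD : forall i, is_lchart (ld_kappa D) (ld_chart (l := D) i)).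
Local Notation q := (np_q N).
Local Notation al := (np_al N).
Local Notation be := (np_be N).
Local Notation b := (np_b N).
Local Notation eps0 := (np_eps0 N).
Context (hq : 0 < q < 1) (hal : 0 < al) (hb : 0 < b) (he0 : 0 < eps0) (hbe : be <= 1 - q).
Context (p0 : probe D).
Implicit Types (p : probe D) (H K : fam D).
Local Notation C1c_lf := (TestFunctionTheory.C1c_lf hD).
Local Notation "W '_itv' t" := (- lf_r W <= t <= lf_r W) (at level 10).
Local Notation S_cst := (ProductTheory.S_cst D q).
Local Notation C1_cst := (ProductTheory.C1_cst D).
Local Notation S_cst_gt0 := (ProductTheory.S_cst_gt0 hk hr0 htau q).
Local Notation C1_cst_gt0 := (ProductTheory.C1_cst_gt0 hk htau).
Local Notation mul_sball := (ProductTheory.mul_sball hk hr0 htau hD hq).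
Local Notation mul_c1ball := (ProductTheory.mul_c1ball hk htau hD hq).
Local Notation diff_sball := (ProbeAlgebraTheory.diff_sball hk hr0 htau hD hq hal).
Local Notation sball := (ProbeAlgebraTheory.sball q al).
Local Notation pscale_sball := (ProbeAlgebraTheory.pscale_sball hk htau hD).
Local Notation pscale_c1ball := (ProbeAlgebraTheory.pscale_c1ball hk htau hD).
Local Notation small_scale := (ProbeAlgebraTheory.small_scale hk hr0 htau hD hq hal).
Local Notation d_test_refl := (FamilyNormTheory.d_test_refl N).
Local Notation bb := (FamilyNormTheory.bb N).
Local Notation bbP := (FamilyNormTheory.bbP hk hr0 htau hD hq hal hb he0 p0).
Local Notation bb_ge0 := (FamilyNormTheory.bb_ge0 hk hr0 htau hD hq hal hb he0 p0).
Local Notation bb_s := (FamilyNormTheory.bb_s hk hr0 htau hD hq hal hb he0 p0).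
Local Notation bb_u := (FamilyNormTheory.bb_u hk hr0 htau hD hq hal hb he0 p0).
Local Notation bbD := (FamilyNormTheory.bbD hk hr0 htau hD hq hal hb he0 p0).
Local Notation bbZ := (FamilyNormTheory.bbZ hk hr0 htau hD hq hal hb he0 p0).
Local Notation bb0 := (FamilyNormTheory.bb0 hk hr0 htau hD hq hal hb he0 p0).
Local Notation wnorm_bound := (FamilyNormTheory.wnorm_bound hk hr0 htau hD hq hal hb he0 p0).
Local Notation emb_probeD := (FamilyNormTheory.emb_probeD hD).
Local Notation emb_pscale := (FamilyNormTheory.emb_pscale hD).
Local Notation emb_fD := (FamilyNormTheory.emb_fD hD).
Local Notation emb_fZ := (FamilyNormTheory.emb_fZ hD).

Definition sc p : R :=
  xget 1 [set s | 0 < s /\ c1ball (pscale s%:C p) /\ sball (pscale s%:C p) 1].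

Lemma scP p : 0 < sc p /\ c1ball (pscale (sc p)%:C p) /\ sball (pscale (sc p)%:C p) 1.
Proof.
have [s hs] := small_scale p.
exact: (@xgetPex _ (1 : R) [set s | 0 < s /\ c1ball (pscale s%:C p) /\ sball (pscale s%:C p) 1]
  (ex_intro _ s hs)).
Qed.

Lemma scV_ge0 p : 0 <= (sc p)^-1.
Proof. by have [s0 _] := scP p; rewrite ltW// invr_gt0. Qed.

(** The value at [p] extrapolated from a multiple of [p] lying in both unit balls. Outside these
    balls the norm does not constrain the values of an element of [B], whereas [hat] is always
    approximated by genuine integrals of C^1 functions. *)
Definition hat H p : R[i] := ((sc p)^-1)%:C * H (pscale (sc p)%:C p).

Lemma hat_close K x p : bb K x -> cabs (hat K p) <= (sc p)^-1 * x.
Proof.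
have [s0 [_ h]] := scP p; move=> hK; rewrite cabsM cabs_real gtr0_norm ?invr_gt0//.
by rewrite ler_wpM2l ?(bb_s hK)// ltW// invr_gt0.
Qed.

Lemma hat_emb (f : X -> R[i]) p : C1c f -> hat (emb f) p = emb f p.
Proof.
move=> fC; have [s0 _] := scP p; rewrite /hat emb_pscale// mulrA -rmorphM mulVf ?gt_eqF//.
by rewrite rmorph1 mul1r.
Qed.

Lemma hatD H K p : hat (fadd H K) p = hat H p + hat K p.
Proof. by rewrite /hat /fadd mulrDr. Qed.

Lemma hatZ z H p : hat (fscale z H) p = z * hat H p.
Proof. by rewrite /hat /fscale mulrCA. Qed.

Lemma hatB H K p : hat (fsub H K) p = hat H p - hat K p.
Proof. by rewrite fsubE hatD hatZ mulN1r. Qed.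

Lemma vanishing (S : R) (z : R[i]) : 0 <= S -> (forall e, 0 < e -> cabs z <= S * e) -> z = 0.
Proof.
move=> S0 h; apply: cabs_eq0; apply/eqP; rewrite eq_le cabs_ge0 andbT; apply/ler_addgt0Pr => e e0.
rewrite add0r; have S1 : 0 < S + 1 by rewrite ltr_wpDl.
apply: (le_trans (h (e / (S + 1)) _)); first by rewrite divr_gt0.
by rewrite mulrCA ler_piMr ?(ltW e0)// ler_pdivrMr// mul1r lerDl.
Qed.

(** Exact for [emb f]. Replacing [H] by an approximation [emb f] costs at most [e] times a constant
    that depends only on the three probes, and [e] is arbitrary. *)
Lemma hat_probeD H p p1 p2 : inB N H -> pb_leaf p1 = pb_leaf p -> pb_leaf p2 = pb_leaf p ->
  (forall t, pb_fun p t = pb_fun p1 t + pb_fun p2 t) -> hat H p = hat H p1 + hat H p2.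
Proof.
move=> hH e1 e2 hp; apply/eqP; rewrite -subr_eq0; apply/eqP.
apply: (@vanishing ((sc p)^-1 + ((sc p1)^-1 + (sc p2)^-1))) => [|e e0].
  by apply: addr_ge0; [exact: scV_ge0|apply: addr_ge0; exact: scV_ge0].
have [f fC hf] := hH e e0; have {}hf : bb (fsub H (emb f)) e by exact: hf.
have -> : hat H p - (hat H p1 + hat H p2) =
    hat (fsub H (emb f)) p - (hat (fsub H (emb f)) p1 + hat (fsub H (emb f)) p2).
  rewrite !hatB (hat_emb p fC) (hat_emb p1 fC) (hat_emb p2 fC).
  exact: (sub_add3 _ _ _ (emb_probeD fC e1 e2 hp)).
rewrite (le_trans (cabsB _ _))// !mulrDl lerD ?hat_close//.
by rewrite (le_trans (cabsD _ _))// lerD ?hat_close.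
Qed.

Lemma hat_pscale H z p : inB N H -> hat H (pscale z p) = z * hat H p.
Proof.
move=> hH; apply/eqP; rewrite -subr_eq0; apply/eqP.
apply: (@vanishing ((sc (pscale z p))^-1 + cabs z * (sc p)^-1)) => [|e e0].
  by apply: addr_ge0; [exact: scV_ge0|apply: mulr_ge0; [exact: cabs_ge0|exact: scV_ge0]].
have [f fC hf] := hH e e0; have {}hf : bb (fsub H (emb f)) e by exact: hf.
have -> : hat H (pscale z p) - z * hat H p = hat (fsub H (emb f)) (pscale z p) - z * hat (fsub H (emb f)) p.
  by rewrite !hatB (hat_emb _ fC) (hat_emb _ fC) (emb_pscale z p fC) mulrBr opprB addrA subrK.
rewrite (le_trans (cabsB _ _))// mulrDl lerD ?hat_close// cabsM -mulrA.
by rewrite ler_wpM2l ?cabs_ge0 ?hat_close.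
Qed.

Lemma hat_sball H p : inB N H -> sball p 1 -> hat H p = H p.
Proof.
move=> hH hp; apply/eqP; rewrite -subr_eq0; apply/eqP.
apply: (@vanishing ((sc p)^-1 + 1)) => [|e e0].
  by apply: addr_ge0 => //; exact: scV_ge0.
have [f fC hf] := hH e e0; have {}hf : bb (fsub H (emb f)) e by exact: hf.
have -> : hat H p - H p = hat (fsub H (emb f)) p - fsub H (emb f) p.
  by rewrite hatB (hat_emb _ fC) /fsub opprB addrA subrK.
by rewrite (le_trans (cabsB _ _))// mulrDl mul1r lerD ?hat_close// (bb_s hf).
Qed.

(** The same density argument, with [wnorm_bound] in place of the stable norm to control the values
    of the error on the C^1 ball. *)
Lemma hat_c1ball H p : inB N H -> c1ball p -> hat H p = H p.
Proof.
move=> hH hp; have [C C0 hC] := wnorm_bound; apply/eqP; rewrite -subr_eq0; apply/eqP.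
apply: (@vanishing ((sc p)^-1 + C)) => [|e e0].
  by apply: addr_ge0; [exact: scV_ge0|exact: ltW].
have [f fC hf] := hH e e0; have {}hf : bb (fsub H (emb f)) e by exact: hf.
have -> : hat H p - H p = hat (fsub H (emb f)) p - fsub H (emb f) p.
  by rewrite hatB (hat_emb _ fC) /fsub opprB addrA subrK.
by rewrite (le_trans (cabsB _ _))// mulrDl lerD ?hat_close// (hC _ _ _ hf hp).
Qed.

Lemma real_inv_mul (M : R) (z : R[i]) : 0 < M -> M%:C * ((M^-1)%:C * z) = z.
Proof. by move=> M0; rewrite mulrA -rmorphM divff ?gt_eqF// mul1r. Qed.

Lemma hat_sball_le H x p M : inB N H -> bb H x -> 0 < M -> sball p M -> cabs (hat H p) <= M * x.
Proof.
move=> hH hx M0 hp; have h := pscale_sball (M^-1)%:C hp.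
rewrite cabs_real gtr0_norm ?invr_gt0// mulVf ?gt_eqF// in h.
rewrite -(real_inv_mul (hat H p) M0) -hat_pscale// (hat_sball hH h) cabsM cabs_real gtr0_norm//.
by rewrite ler_wpM2l ?(ltW M0)// (bb_s hx h).
Qed.

Lemma hat_pair_le H x p p' M eps : inB N H -> bb H x -> 0 < M -> 0 < eps <= eps0 ->
  (d_leaf (pb_leaf p) (pb_leaf p') <= eps%:E)%E ->
  (lf_C1norm (pb_leaf p) (pb_fun p) <= M%:E)%E -> (lf_C1norm (pb_leaf p') (pb_fun p') <= M%:E)%E ->
  pb_fun p = pb_fun p' -> eps `^ (- be) * cabs (hat H p - hat H p') <= M * x / b.
Proof.
move=> hH hx M0 he hd h1 h2 ef; have Mi : cabs (M^-1)%:C * M <= 1.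
  by rewrite cabs_real gtr0_norm ?invr_gt0// mulVf// gt_eqF.
have k1 := pscale_c1ball h1 Mi; have k2 := pscale_c1ball h2 Mi.
have E r : hat H r = M%:C * hat H (pscale (M^-1)%:C r).
  by rewrite (hat_pscale _ _ hH) real_inv_mul.
rewrite (E p) (E p') (hat_c1ball hH k1) (hat_c1ball hH k2) -mulrBr cabsM cabs_real gtr0_norm//.
rewrite mulrCA -mulrA; apply: ler_wpM2l; first exact: ltW.
apply: (bb_u hx); split; [exact: he|exact: hd|exact: k1|exact: k2|].
by rewrite /= ef; apply: d_test_refl; case/andP : he => /ltW.
Qed.

Definition pmul (f : X -> R[i]) (fC : C1c f) p : probe D :=
  Probe (pb_leafP p)
    (proj1 (C1I_mul (lf_r_lt (pb_leafP p)) (C1c_lf (pb_leafP p) fC) (pb_funP p))).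

(** The product with [f] may push a test function out of its unit ball, where [H] itself is
    meaningless; hence [hat]. *)
Definition Mul (f : X -> R[i]) (fC : C1c f) H : fam D := fun p => hat H (pmul fC p).

(** For two close probes, the product formed on the first leaf is first moved to the second leaf
    with unchanged parametrisation, a step controlled by the unstable norm. What remains is one test
    function on the second leaf, of Hoelder size O(eps^(1-q)) by [diff_sball], controlled by the
    stable norm. The division by eps^be leaves a bounded factor because [be <= 1 - q]. *)
Lemma Mul_bound : exists2 C : R, 0 < C & forall (f : X -> R[i]) (fC : C1c f) A H x, 0 < A ->
  (C1norm f <= A%:E)%E -> inB N H -> bb H x -> bb (Mul fC H) (C * A * x).
Proof.
have [Cd Cd0 hCd] := diff_sball he0.
have S0 := S_cst_gt0; have C10 := C1_cst_gt0; set E := eps0 `^ (1 - q - be).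
have E0 : 0 < E by exact: powR_gt0.
exists (S_cst + C1_cst + b * Cd * E).
  by apply: addr_gt0; [exact: addr_gt0|apply: mulr_gt0 => //; exact: mulr_gt0].
move=> f fC A H x A0 fA hH hx; have x0 := bb_ge0 hx; have A0' := ltW A0.
apply/bbP; exists (A * S_cst * x), (A * C1_cst * x / b + Cd * A * E * x); split.
- rewrite le_eqVlt; apply/orP; left; apply/eqP; field; exact: lt0r_neq0.
- by apply: mulr_ge0 => //; apply: mulr_ge0 => //; exact: ltW.
- apply: addr_ge0.
    by apply: divr_ge0; [apply: mulr_ge0 => //; apply: mulr_ge0 => //; exact: ltW|exact: ltW].
  by apply: mulr_ge0 => //; apply: mulr_ge0; [apply: mulr_ge0 => //; exact: ltW|exact: ltW].
- move=> p hp; have := @ProductTheory.mul_sball _ _ _ hk hr0 htau hD _ al hq _ f (pb_fun p) A 1 (pb_leafP p) A0' fC fA hp.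
  rewrite mulr1 => h; have h' : sball (pmul fC p) (A * S_cst) := h.
  by apply: (hat_sball_le hH hx _ h'); exact: mulr_gt0.
- move=> eps p p' [he hd n1 n2 ht]; have hW := pb_leafP p; have hW' := pb_leafP p'.
  have [_ er _] := d_leaf_ge hW hd.
  have eI : lf_I (pb_leaf p) = lf_I (pb_leaf p') by rewrite /lf_I er.
  have c1 := pb_funP (pmul fC p); rewrite /= eI in c1.
  have c2 := proj1 (C1I_scale (lf_r_lt hW') (-1) (pb_funP (pmul fC p'))).
  have c3 := proj1 (C1I_add (lf_r_lt hW') c1 c2).
  (* [p2] is the product of the first leaf read on the second leaf, and [p3] is [p2] minus the
     product of the second leaf. *)
  pose p2 := Probe hW' c1; pose p3 := Probe hW' c3.
  have e3 : hat H p2 = hat H p3 + hat H (pmul fC p').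
    apply: hat_probeD => // t /=; ring.
  have -> : Mul fC H p - Mul fC H p' = (hat H (pmul fC p) - hat H p2) + hat H p3.
    by rewrite /Mul e3 opprD addrA addrAC subrK.
  have [e0 e1] := andP he.
  have t1 : eps `^ (- be) * cabs (hat H (pmul fC p) - hat H p2) <= A * C1_cst * x / b.
    apply: (hat_pair_le hH hx _ he) => //; first exact: mulr_gt0.
      exact: (mul_c1ball hW hW erefl A0' fC fA (pb_funP p) n1).
    exact: (mul_c1ball hW hW' er A0' fC fA (pb_funP p) n1).
  have t2 : cabs (hat H p3) <= Cd * A * eps `^ (1 - q) * x.
    apply: (hat_sball_le hH hx).
      by rewrite mulr_gt0 ?powR_gt0// mulr_gt0.
    have := hCd _ _ f _ _ A eps hW hW' he hd A0' fC fA (pb_funP p) n1 ht.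
    rewrite /ProbeAlgebraTheory.sball; congr (is_true (_ * lf_Cqnorm _ _ _ <= _)%E).
    by apply/funext => t /=; ring.
  apply: (@le_trans _ _ (eps `^ (- be) * (cabs (hat H (pmul fC p) - hat H p2) + cabs (hat H p3)))).
    by rewrite ler_wpM2l ?powR_ge0 ?cabsD.
  rewrite mulrDr lerD//; apply: (le_trans (ler_wpM2l (powR_ge0 _ _) t2)).
  have -> : eps `^ (- be) * (Cd * A * eps `^ (1 - q) * x) = Cd * A * x * (eps `^ (1 - q) * eps `^ (- be)) by ring.
  have -> : Cd * A * E * x = Cd * A * x * E by ring.
  rewrite ler_wpM2l//; first by apply: mulr_ge0 => //; apply: mulr_ge0 => //; exact: ltW.
  rewrite -powRD; last by rewrite (gt_eqF e0) implybT.
  by apply: ge0_ler_powR; rewrite ?nnegrE ?(ltW e0) ?(ltW he0) ?subr_ge0.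
Qed.

Lemma inB_emb (f : X -> R[i]) : C1c f -> inB N (emb (D := D) f).
Proof.
move=> fC e e0; exists f => //.
have -> : fsub (emb f) (emb f) = (fun=> 0) :> fam D by apply/funext => p; rewrite /fsub subrr.
exact: bb_le (ltW e0) bb0.
Qed.

Lemma C1cD (f h : X -> R[i]) : C1c f -> C1c h -> C1c (fun x => f x + h x).
Proof.
move=> [a1 a2] [b1 b2]; split.
- rewrite (_ : cRe _ = fun x => cRe f x + cRe h x); first exact: C1funD.
  by apply/funext => x; rewrite /cRe ReD.
- rewrite (_ : cIm _ = fun x => cIm f x + cIm h x); first exact: C1funD.
  by apply/funext => x; rewrite /cIm ImD.
Qed.

Lemma C1cM (f h : X -> R[i]) : C1c f -> C1c h -> C1c (fun x => f x * h x).
Proof.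
move=> [a1 a2] [b1 b2]; split.
- rewrite (_ : cRe _ = fun x => cRe f x * cRe h x + (-1) * (cIm f x * cIm h x)).
    by apply: C1funD; [exact: C1funM|apply: C1funZ; exact: C1funM].
  by apply/funext => x; rewrite /cRe /cIm ReM mulN1r.
- rewrite (_ : cIm _ = fun x => cRe f x * cIm h x + cIm f x * cRe h x).
    by apply: C1funD; exact: C1funM.
  by apply/funext => x; rewrite /cRe /cIm ImM.
Qed.

Lemma C1c_cst (z : R[i]) : C1c (fun _ : X => z).
Proof. by split; exact: C1fun_cst. Qed.

Lemma C1cZ (z : R[i]) (f : X -> R[i]) : C1c f -> C1c (fun x => z * f x).
Proof. by move=> fC; apply: (C1cM _ fC); exact: C1c_cst. Qed.

Lemma inBD H K : inB N H -> inB N K -> inB N (fadd H K).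
Proof.
move=> hH hK e e0; have e2 : 0 < e / 2 by rewrite divr_gt0.
have [f fC hf] := hH _ e2; have [h hC hh] := hK _ e2.
exists (fun x => f x + h x); first exact: C1cD.
have -> : fsub (fadd H K) (emb (fun x => f x + h x)) = fadd (fsub H (emb f)) (fsub K (emb h)).
  by rewrite emb_fD//; apply/funext => p; rewrite /fsub /fadd; ring.
by apply: (@FamilyNormTheory.bb_le _ _ _ _ _ (e / 2 + e / 2)); [rewrite -splitr|exact: bbD].
Qed.

Lemma inBZ z H : inB N H -> inB N (fscale z H).
Proof.
move=> hH e e0; have z1 : 0 < cabs z + 1 by rewrite ltr_wpDl ?cabs_ge0.
have [f fC hf] := hH (e / (cabs z + 1)) (divr_gt0 e0 z1).
exists (fun x => z * f x); first exact: C1cZ.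
have -> : fsub (fscale z H) (emb (fun x => z * f x)) = fscale z (fsub H (emb f)).
  by rewrite emb_fZ//; apply/funext => p; rewrite /fsub /fscale; ring.
apply: bb_le (bbZ z hf); rewrite mulrA ler_pdivrMr// mulrC.
by rewrite ler_wpM2l ?(ltW e0)// lerDl.
Qed.

Lemma inBB H K : inB N H -> inB N K -> inB N (fsub H K).
Proof. by move=> hH hK; rewrite fsubE; apply: inBD => //; exact: inBZ. Qed.

Lemma Mul_emb (f : X -> R[i]) (fC : C1c f) (h : X -> R[i]) : C1c h ->
  Mul fC (emb h) = emb (fun x => f x * h x).
Proof.
move=> hC; apply/funext => p; rewrite /Mul hat_emb//.
by apply: eq_cint => t _ /=; ring.
Qed.

Lemma MulD (f : X -> R[i]) (fC : C1c f) H K : Mul fC (fadd H K) = fadd (Mul fC H) (Mul fC K).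
Proof. by apply/funext => p; rewrite /Mul hatD. Qed.

Lemma MulZ (f : X -> R[i]) (fC : C1c f) z H : Mul fC (fscale z H) = fscale z (Mul fC H).
Proof. by apply/funext => p; rewrite /Mul hatZ. Qed.

(** The restriction to the unit balls is genuine: elsewhere [Mul] replaces [H] by its homogeneous
    extension. *)
Lemma Mul_cst z (fC : C1c (fun _ : X => z)) H : inB N H ->
  forall p, sball p 1 \/ c1ball p -> Mul fC H p = fscale z H p.
Proof.
move=> hH p hp; rewrite /Mul; have -> : pmul fC p = pscale z p by exact: probe_ext.
rewrite hat_pscale// /fscale; congr (_ * _).
by case: hp => hp; [exact: hat_sball|exact: hat_c1ball].
Qed.

Lemma Mul_fD (f h : X -> R[i]) (fC : C1c f) (hC : C1c h) (fhC : C1c (fun x => f x + h x)) H :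
  inB N H -> Mul fhC H = fadd (Mul fC H) (Mul hC H).
Proof.
move=> hH; apply/funext => p; rewrite /Mul /fadd; apply: hat_probeD => // t /=; ring.
Qed.

Lemma Mul_fZ z (f : X -> R[i]) (fC : C1c f) (zfC : C1c (fun x => z * f x)) H :
  inB N H -> Mul zfC H = fscale z (Mul fC H).
Proof.
move=> hH; apply/funext => p; rewrite /Mul /fscale -hat_pscale//; congr hat.
by apply: probe_ext => //=; apply/funext => t; ring.
Qed.

Lemma Mul_inB (f : X -> R[i]) (fC : C1c f) A H : (C1norm f <= A%:E)%E -> inB N H ->
  inB N (Mul fC H).
Proof.
move=> fA hH e e0; have [C C0 hC] := Mul_bound.
have B0 : 0 < `|A| + 1 by rewrite ltr_wpDl.
have fB : (C1norm f <= (`|A| + 1)%:E)%E.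
  by rewrite (le_trans fA)// lee_fin (le_trans (ler_norm _))// lerDl.
have CB : 0 < C * (`|A| + 1) by exact: mulr_gt0.
have [h hC1 hh] := hH (e / (C * (`|A| + 1))) (divr_gt0 e0 CB).
exists (fun x => f x * h x); first exact: C1cM.
have -> : fsub (Mul fC H) (emb (fun x => f x * h x)) = Mul fC (fsub H (emb h)).
  by rewrite -(Mul_emb fC hC1) !fsubE MulD MulZ.
have k := inBB hH (inB_emb hC1).
have := hC f fC _ _ _ B0 fB k hh; apply: bb_le.
by rewrite mulrC divfK// gt_eqF.
Qed.

End Multipliers.

End MultiplierConstructionTheory.
Import MultiplierConstructionTheory.

(** * Norms of C^1 functions and of their compositions *)

Module FunctionNormTheory.

Section TrigonometricBounds.
Context {R : realType}.
Implicit Types (x y s A : R).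

(** Applied repeatedly, each bound serving as the bound on the next derivative, it yields the Taylor
    estimates of sine and cosine below, with constants 1 in place of inverse factorials. *)
Lemma mean_value_at0 (F F' : R -> R) (M y : R) : (forall x : R, is_derive x 1 F (F' x)) ->
  F 0 = 0 -> (forall x, `|x| <= `|y| -> `|F' x| <= M) -> `|F y| <= M * `|y|.
Proof.
move=> hF F0 hM.
have cF (a b : R) : {within `[a, b], continuous F}.
  by apply: derivable_within_continuous => x _; exact: (@ex_derive _ _ _ _ _ _ _ (hF x)).
have [y0|y0] := leP 0 y.
- have [c ci] := MVT_segment y0 (fun x _ => hF x) (cF 0 y).
  rewrite F0 !subr0 => ->; rewrite normrM ler_wpM2r// hM//.
  by move: ci; rewrite in_itv/= => /andP[c0 cy]; rewrite !ger0_norm.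
- have [c ci] := MVT_segment (ltW y0) (fun x _ => hF x) (cF y 0).
  rewrite F0 !sub0r => e; rewrite -normrN e normrM normrN ler_wpM2r// hM//.
  by move: ci; rewrite in_itv/= => /andP[c0 cy]; rewrite !ler0_norm// ?lerN2// ltW.
Qed.

Lemma sin_le_abs y : `|sin y| <= `|y|.
Proof.
rewrite -[leRHS]mul1r; apply: (@mean_value_at0 (@sin R) (@cos R) 1 y (@is_derive_sin R)); [exact: sin0|move=> x _].
by rewrite ler_norml cos_geN1 cos_le1.
Qed.

Lemma is_derive_sub_id (F : R -> R) (d x : R) : is_derive x 1 F d ->
  is_derive x 1 (fun y => F y - y) (d - 1).
Proof. by move=> h; exact: (is_deriveB h (is_derive_id x 1)). Qed.

Lemma is_derive_add_cst (F : R -> R) (d c x : R) : is_derive x 1 F d ->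
  is_derive x 1 (fun y => F y + c) d.
Proof. by move=> h; exact: (is_derive_eq (is_deriveD h (is_derive_cst c x 1)) (addr0 d)). Qed.

Lemma is_derive_add_sqr (F : R -> R) (d c x : R) : is_derive x 1 F d ->
  is_derive x 1 (fun y => F y + c * y ^+ 2) (d + 2 * c * x).
Proof.
move=> h; have k : is_derive x 1 (fun y : R => c * y ^+ 2) (c *: (x *: 1 + x *: 1)) :=
  is_deriveZ c (is_deriveM (is_derive_id x 1) (is_derive_id x 1)).
have k' : is_derive x 1 (fun y : R => F y + c * y ^+ 2) (d + c *: (x *: 1 + x *: 1)) := is_deriveD h k.
apply: (is_derive_eq k'); rewrite /GRing.scale /=; ring.
Qed.

Lemma cos_sub1_le y : `|cos y - 1| <= `|y| ^+ 2.
Proof.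
rewrite [leRHS]expr2; have d (x : R) : is_derive x 1 (fun y => cos y - 1) (- sin x).
  by apply: is_derive_add_cst; exact: is_derive_cos.
apply: (mean_value_at0 d).
- by rewrite cos0 subrr.
- by move=> x xy; rewrite normrN (le_trans (sin_le_abs x)).
Qed.

Lemma sin_sub_id_le y : `|sin y - y| <= `|y| ^+ 3.
Proof.
rewrite [leRHS]exprSr; have d (x : R) : is_derive x 1 (fun y => sin y - y) (cos x - 1).
  by apply: is_derive_sub_id; exact: is_derive_sin.
apply: (mean_value_at0 d).
- by rewrite sin0 subrr.
- by move=> x xy; rewrite (le_trans (cos_sub1_le x))// lerXn2r ?nnegrE.
Qed.

Lemma cos_taylor2_le y : `|cos y - 1 + 2^-1 * y ^+ 2| <= `|y| ^+ 4.
Proof.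
rewrite [leRHS]exprSr; have d (x : R) : is_derive x 1 (fun y => cos y - 1 + 2^-1 * y ^+ 2) (- sin x + x).
  have -> : - sin x + x = - sin x + 2 * 2^-1 * x by rewrite divff// mul1r.
  by apply: is_derive_add_sqr; apply: is_derive_add_cst; exact: is_derive_cos.
apply: (mean_value_at0 d).
- by rewrite cos0 expr0n mulr0 subrr addr0.
- by move=> x xy; rewrite addrC -normrN opprB (le_trans (sin_sub_id_le x))// lerXn2r ?nnegrE.
Qed.

Lemma is_derive_dilate (F F' : R -> R) (s x : R) : (forall x : R, is_derive x 1 F (F' x)) ->
  is_derive x 1 (fun y => F (s * y)) (s * F' (s * x)).
Proof.
move=> h; have k := is_deriveZ s (is_derive_id x 1).
have := is_derive1_comp (f := F) (g := fun y => s * y) (h (s * x)) k.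
by move/is_derive_eq; apply; rewrite /GRing.scale /= mulr1 mulrC.
Qed.

End TrigonometricBounds.

Lemma complex_product_rule (R : realType) (z w : R[i]) (a b c d : R) :
  (complex.Re z * a + complex.Re w * b + -1 * (complex.Im z * c + complex.Im w * d)) +i*
  (complex.Re z * c + complex.Im w * b + (complex.Im z * a + complex.Re w * d)) =
  z * (a +i* c) + w * (b +i* d).
Proof.
case: z w => [z1 z2] [w1 w2]; apply/eqP; rewrite eq_complex !(ReD, ImD, ReM, ImM) /=.
by apply/andP; split; apply/eqP; ring.
Qed.

Section FunctionNorms.
Context {R : realType} {X : surface R}.
Implicit Types (f h : X -> R) (x : X).

Lemma dfun_vtrans f j x w : C1fun f -> dom j x ->
  dfun f x (vtrans j x w) = lin2 (jac (crd j @` dom j) (f \o icrd j) (crd j x)) w.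
Proof.
move=> fC jx; set i := chart_at x; have ix : dom i x := chart_atP x.
have dJ := transition_derivative ix jx; rewrite /= in dJ.
set A := crd j @` (dom j `&` dom i) in dJ *.
have oA : relopen A := relopen_crd j (@dom_open R X i).
have Ax : A (crd j x) by exists x.
have [fi _ _] := fC i; have [fj _ _] := fC j.
have hi := fi (crd i x) (ex_intro2 _ _ x ix erefl).
have hj := fj (crd j x) (ex_intro2 _ _ x jx erefl).
have AS : A `<=` crd j @` dom j by move=> _ [y [jy _] <-]; exists y.
have e1 := jacE oA Ax (is_dwithinS AS hj).
set J := jac A _ _ in dJ; set J' := jac _ _ _ in hi.
have e0 : crd i (icrd j (crd j x)) = crd i x by rewrite crdK.
have hc : is_dwithin A ((f \o icrd i) \o (crd i \o icrd j)) (crd j x) (lin2 J' \o lin2 J).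
  have hi' : is_dwithin (crd i @` dom i) (f \o icrd i) ((crd i \o icrd j) (crd j x)) (lin2 J').
    by rewrite /= e0.
  apply: (is_dwithin_comp (lin2_bound_ge0 J) (@lin2_le _ _ J) (lin2_bound_ge0 J') (@lin2_le _ _ J')
    (@lin2B _ _ J') _ dJ hi').
  by exists 1 => // s [y [jy iy] <-] _; exists y => //=; rewrite crdK.
have hc' : is_dwithin A (f \o icrd j) (crd j x) (lin2 (lin2 J' J.1, lin2 J' J.2)).
  have : is_dwithin A ((f \o icrd i) \o (crd i \o icrd j)) (crd j x) (lin2 (lin2 J' J.1, lin2 J' J.2)).
    apply: is_dwithin_eq hc => u; rewrite /comp.
    have -> : lin2 J u = u.1 *: J.1 + u.2 *: J.2 by [].
    by rewrite lin2D !lin2Z.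
  apply: is_dwithin_local; last by rewrite /= crdK// crdK.
  by exists 1 => // s [y [jy iy] <-] _; split; [exists y|rewrite /= !crdK].
have e2 := jacE oA Ax hc'.
rewrite -e1 e2; have -> : vtrans j x w = w.1 *: J.1 + w.2 *: J.2 by [].
by rewrite /dfun -/i -/J' lin2D !lin2Z.
Qed.

Lemma vtrans_surj j x v : dom j x -> exists w, vtrans j x w = v.
Proof.
move=> jx; apply: lin2_surj => w e; apply: contrapT => wn.
have := gnorm_vtrans w jx; rewrite /vtrans e.
have [|h1 h2] := @met_pos R X j (crd j x); first by exists x.
have := qform_gt0 h1 h2 wn; rewrite -sqrtr_gt0 => p0 g0; move: p0; rewrite -g0.
by rewrite /gnorm /qform /= !expr0n /= !mulr0 !addr0 sqrtr0 ltxx.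
Qed.

(** [dfun] depends on the selected chart, which varies without continuity. Every tangent vector is
    carried to the chart [j], where the partial derivatives of [f] are continuous on a compact set
    and the metric is comparable to the coordinate norm. *)
Lemma chart_C1_bound f j (K : set X) : closure K `<=` dom j -> C1fun f ->
  exists2 M : R, 0 < M & forall x v, K x -> `|dfun f x v| <= M * gnorm x v.
Proof.
move=> Kj fC; have cK : compact (closure K).
  by apply: (subclosed_compact (@closed_closure _ _) (@surface_compact R X)).
have [_ c1 c2] := fC j; have [B B1 hB] := metric_bounds Kj.
have B0 : 0 < B by exact: lt_le_trans ltr01 B1.
have [M1 M10 hM1] := compact_bounded_fun cK (continuous_crd_comp Kj c1).
have [M2 M20 hM2] := compact_bounded_fun cK (continuous_crd_comp Kj c2).
exists ((M1 + M2) * B); first by rewrite mulr_gt0// addr_gt0.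
move=> x v Kx; have cx := subset_closure Kx; have jx := Kj _ cx.
have [w <-] := vtrans_surj v jx; rewrite dfun_vtrans// gnorm_vtrans//.
apply: (le_trans (lin2_le _ _)); have [hw _] := hB x w Kx.
rewrite -mulrA; apply: ler_pM; [exact: lin2_bound_ge0|exact: normr_ge0| |exact: hw].
by apply: lerD; [exact: hM1|exact: hM2].
Qed.

Lemma dfunD f h x v : C1fun f -> C1fun h ->
  dfun (fun y => f y + h y) x v = dfun f x v + dfun h x v.
Proof.
move=> fC hC; rewrite /dfun; set i := chart_at x.
have Ax : (crd i @` dom i) (crd i x) by exists x => //; exact: chart_atP.
have [/(_ _ Ax) f1 _ _] := fC i; have [/(_ _ Ax) h1 _ _] := hC i.
set J := jac _ (f \o _) _ in f1 *; set K := jac _ (h \o _) _ in h1 *.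
have k : is_dwithin (crd i @` dom i) ((fun y => f y + h y) \o icrd i) (crd i x) (lin2 (J.1 + K.1, J.2 + K.2)).
  apply: is_dwithin_eq (is_dwithinD f1 h1) => u.
  by rewrite /lin2 /= !scalerDr addrACA.
by rewrite (jacE (relopen_dom i) Ax k) /lin2 /= !scalerDr addrACA.
Qed.

Lemma dfunM f h x v : C1fun f -> C1fun h ->
  dfun (fun y => f y * h y) x v = f x * dfun h x v + h x * dfun f x v.
Proof.
move=> fC hC; rewrite /dfun; set i := chart_at x.
have ix : dom i x := chart_atP x.
have Ax : (crd i @` dom i) (crd i x) by exists x.
have [/(_ _ Ax) f1 _ _] := fC i; have [/(_ _ Ax) h1 _ _] := hC i.
set J := jac _ (f \o _) _ in f1 *; set K := jac _ (h \o _) _ in h1 *.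
have m := is_dwithinM (lin2_bound_ge0 J) (@lin2_le _ _ J) (lin2_bound_ge0 K) (@lin2_le _ _ K) f1 h1.
rewrite /= crdK// in m.
have k : is_dwithin (crd i @` dom i) ((fun y => f y * h y) \o icrd i) (crd i x)
    (lin2 (f x * K.1 + h x * J.1, f x * K.2 + h x * J.2)).
  by apply: is_dwithin_eq m => u; rewrite /lin2 /= /GRing.scale /=; ring.
by rewrite (jacE (relopen_dom i) Ax k) /lin2 /= /GRing.scale /=; ring.
Qed.

Lemma dfun_cst (c : R) x v : dfun (fun=> c) x v = 0.
Proof.
rewrite /dfun; set i := chart_at x.
have Ax : (crd i @` dom i) (crd i x) by exists x => //; exact: chart_atP.
have k : is_dwithin (crd i @` dom i) ((fun _ : X => c) \o icrd i) (crd i x) (lin2 (0, 0)).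
  by apply: is_dwithin_eq (is_dwithin_cst _ _ _) => u; rewrite /lin2 /= !scaler0 addr0.
by rewrite (jacE (relopen_dom i) Ax k) /lin2 /= !scaler0 addr0.
Qed.

Lemma dfunZ (c : R) f x v : C1fun f -> dfun (fun y => c * f y) x v = c * dfun f x v.
Proof. by move=> fC; rewrite (dfunM x v (C1fun_cst c) fC) dfun_cst mulr0 addr0. Qed.

Implicit Types (u w : X -> R[i]).

Lemma C1norm_finite (D : leaf_data X) u :
  (forall i, is_lchart (ld_kappa D) (ld_chart (l := D) i)) ->
  (forall x : X, exists i, limage (ld_chart (l := D) i) x) -> C1c u ->
  exists2 A : R, 0 < A & (C1norm u <= A%:E)%E.
Proof.
move=> hD cov [u1 u2].
have cT : compact [set: X] := @surface_compact R X.
have ct f : C1fun f -> exists2 M : R, 0 < M & forall x, (@setT X) x -> `|f x| <= M.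
  by move=> /C1fun_continuous cf; apply: compact_bounded_fun => //; exact: continuous_subspaceT.
have [M1 M10 hM1] := ct _ u1; have [M2 M20 hM2] := ct _ u2.
have main f : C1fun f -> exists2 M : R, 0 < M & forall x v, `|dfun f x v| <= M * gnorm x v.
  move=> fC; have h i : exists M : R, 0 < M /\
      forall x v, limage (ld_chart (l := D) i) x -> `|dfun f x v| <= M * gnorm x v.
    have [_ [_ [_ [_ [_ [_ [_ [[j [K [hj _]]] _]]]]]]]] := hD i.
    by have [M M0 hM] := chart_C1_bound hj fC; exists M.
  have [M hM] := choice h.
  exists (1 + \sum_i M i).
    by rewrite ltr_wpDr// sumr_ge0// => i _; have [/ltW] := hM i.
  move=> x v; have [i ix] := cov x; have [M0 k] := hM i.
  apply: (le_trans (k x v ix)); apply: ler_wpM2r; first exact: gnorm_ge0.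
  rewrite (bigD1 i)//= addrCA lerDl addr_ge0// sumr_ge0// => l _.
  by have [/ltW] := hM l.
have [N1 N10 hN1] := main _ u1; have [N2 N20 hN2] := main _ u2.
exists ((M1 + M2) + (N1 + N2)); first by rewrite !addr_gt0.
apply: C1norm_le => [x|x v].
  by apply: (le_trans (cabs_le _)); apply: lerD; [exact: hM1|exact: hM2].
by apply: (le_trans (cabs_le _)); rewrite mulrDl; apply: lerD; [exact: hN1|exact: hN2].
Qed.

(** One [A * B] for the values and two for the terms of the product rule. *)
Lemma C1norm_mul u w (A B : R) : C1c u -> C1c w -> 0 <= A -> 0 <= B ->
  (C1norm u <= A%:E)%E -> (C1norm w <= B%:E)%E ->
  (C1norm (fun x => u x * w x)%R <= (3 * (A * B))%R%:E)%E.
Proof.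
move=> [u1 u2] [w1 w2] A0 B0 /C1norm_ge[hA dA] /C1norm_ge[hB dB].
have -> : 3 * (A * B) = A * B + (A * B + A * B) by ring.
apply: C1norm_le => [x|x v].
  by rewrite cabsM ler_pM ?cabs_ge0.
set du := dfun (cRe u) x v +i* dfun (cIm u) x v; set dw := dfun (cRe w) x v +i* dfun (cIm w) x v.
have -> : dfun (cRe (fun x => u x * w x)) x v +i* dfun (cIm (fun x => u x * w x)) x v =
    u x * dw + w x * du.
  have -> : cRe (fun x => u x * w x) = fun y => cRe u y * cRe w y + -1 * (cIm u y * cIm w y).
    by apply/funext => y; rewrite /cRe ReM mulN1r.
  have -> : cIm (fun x => u x * w x) = fun y => cRe u y * cIm w y + cIm u y * cRe w y.
    by apply/funext => y; rewrite /cIm ImM.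
  have c3 := C1funZ (-1) (C1funM u2 w2).
  rewrite (dfunD x v (C1funM u1 w1) c3) (dfunD x v (C1funM u1 w2) (C1funM u2 w1)).
  rewrite (dfunZ (-1) x v (C1funM u2 w2)) (dfunM x v u1 w1) (dfunM x v u2 w2).
  rewrite (dfunM x v u1 w2) (dfunM x v u2 w1) /du /dw.
  move: (dfun _ x v) (dfun _ x v) (dfun _ x v) (dfun _ x v); rewrite /cRe /cIm => a b c d.
  exact: complex_product_rule.
apply: (le_trans (cabsD _ _)); rewrite !cabsM mulrDl; apply: lerD.
- by rewrite -mulrA; apply: ler_pM; rewrite ?cabs_ge0//; exact: dB.
- rewrite [A * B]mulrC -mulrA; apply: ler_pM; rewrite ?cabs_ge0//; exact: dA.
Qed.

Lemma C1norm_post (g : X -> R) (F1 F1' F2 F2' : R -> R) (A a1 a2 d1 d2 : R) : C1fun g -> 0 <= A ->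
  (C1norm (r2c g) <= A%:E)%E ->
  (forall x : R, is_derive x 1 F1 (F1' x)) -> (forall x : R, is_derive x 1 F2 (F2' x)) ->
  continuous F1' -> continuous F2' ->
  (forall y, `|y| <= A -> [/\ `|F1 y| <= a1, `|F2 y| <= a2, `|F1' y| <= d1 & `|F2' y| <= d2]) ->
  C1c (fun x => F1 (g x) +i* F2 (g x)) /\
  (C1norm (fun x => F1 (g x) +i* F2 (g x)) <= (a1 + a2 + (d1 + d2) * A)%R%:E)%E.
Proof.
move=> gC A0 /C1norm_ge[hA dA] h1 h2 c1 c2 hb.
have gA x : `|g x| <= A by have := hA x; rewrite /r2c cabs_real.
have dgA x v : `|dfun g x v| <= A * gnorm x v.
  by apply: le_trans (dA x v); exact: (le_trans _ (Re_le_cabs _)).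
split; first by split; [exact: (C1fun_post gC h1 c1)|exact: (C1fun_post gC h2 c2)].
apply: C1norm_le => [x|x v].
  by have [b1 b2 _ _] := hb _ (gA x); apply: (le_trans (cabs_le _)); apply: lerD.
have [_ _ b3 b4] := hb _ (gA x).
have := dfun_post (F := F1) v gC (h1 (g x)); have := dfun_post (F := F2) v gC (h2 (g x)).
rewrite /comp => e2 e1; rewrite /cRe /cIm /= e1 e2.
apply: (le_trans (cabs_le _)); rewrite /= !normrM -mulrDl -mulrA.
by apply: ler_pM => //; rewrite ?addr_ge0//; exact: lerD.
Qed.

End FunctionNorms.

End FunctionNormTheory.
Import FunctionNormTheory.

(** * Integrals as functionals determined by indicators *)

Module IntegralFunctionalTheory.

Local Open Scope ereal_scope.

Import HBNNSimple.

Section IntegralFunctionals.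
Context d (T : measurableType d) (R : realType).
Implicit Types (f g : T -> \bar R).

(* A functional on nonnegative measurable functions behaving like an integral;
   such functionals are determined by their values on indicator functions. *)
Definition integral_functional (I : (T -> \bar R) -> \bar R) : Prop :=
  [/\ forall f g, measurable_fun setT f -> (forall x, 0 <= f x) ->
        measurable_fun setT g -> (forall x, 0 <= g x) ->
        I (fun x => f x + g x) = I f + I g,
      forall (k : R) f, (0 <= k)%R -> measurable_fun setT f -> (forall x, 0 <= f x) ->
        I (fun x => k%:E * f x) = k%:E * I f &
      forall f_ : (T -> \bar R)^nat, (forall n, measurable_fun setT (f_ n)) ->
        (forall n x, 0 <= f_ n x) -> (forall x, nondecreasing_seq (f_ ^~ x)) ->
        I (fun x => limn (f_ ^~ x)) = limn (fun n => I (f_ n))].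

(** Monotone approximation by simple functions, each a finite nonnegative combination of indicators.
    It replaces repeated approximation arguments for image measures and iterated integrals. *)
Lemma integral_functional_uniq I J : integral_functional I -> integral_functional J ->
  (forall A, measurable A -> I (fun x => (\1_A x)%:E) = J (fun x => (\1_A x)%:E)) ->
  forall f, measurable_fun setT f -> (forall x, 0 <= f x) -> I f = J f.
Proof.
move=> [ID IZ IL] [JD JZ JL] IJ f mf f0.
have f0' x : setT x -> 0 <= f x by [].
pose f_ := nnsfun_approx measurableT mf.
have fE : f = fun x => limn (fun n => (f_ n x)%:E).
  by apply/funext => x; apply/esym/cvg_lim => //; exact: cvg_nnsfun_approx.
have m_ n : measurable_fun setT (fun x => (f_ n x)%:E) by exact/measurable_EFinP/measurable_funP.
have p_ n x : 0 <= (f_ n x)%:E by rewrite lee_fin.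
have n_ x : nondecreasing_seq (fun n => (f_ n x)%:E).
  by move=> m n mn; rewrite lee_fin; exact/lefP/nd_nnsfun_approx.
rewrite fE (IL _ m_ p_ n_) (JL _ m_ p_ n_); congr (limn _); apply/funext => n.
set h := f_ n.
have hE x : h x = (\sum_(k <- finmap.enum_fset (fset_set (range h))) (k * \1_(h @^-1` [set k]) x))%R.
  by rewrite fimfunE fsbig_finite.
have k0 k : k \in finmap.enum_fset (fset_set (range h)) -> (0 <= k)%R.
  move=> kr; have := etrans (esym (in_fset_set (@fimfunP _ _ h) k)) kr.
  by move=> /set_mem[x _ <-]; exact: fun_ge0.
have mi (k : R) : measurable (h @^-1` [set k]) by [].
have mind (k : R) : measurable_fun setT (fun x => (\1_(h @^-1` [set k]) x)%:E : \bar R).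
  by apply/measurable_EFinP; exact: measurable_indic.
have pind (k : R) x : 0 <= ((\1_(h @^-1` [set k]) x)%:E : \bar R) by rewrite lee_fin.
have sumI (K : (T -> \bar R) -> \bar R) : integral_functional K ->
   K (fun x => (h x)%:E) = \sum_(k <- finmap.enum_fset (fset_set (range h))) k%:E * K (fun x => (\1_(h @^-1` [set k]) x)%:E).
  move=> [KD KZ _].
  have K0 : K (fun=> 0) = 0.
    have := KZ 0%R (fun=> 0) (lexx _) (measurable_cst _) (fun=> lexx _).
    by rewrite !mul0e.
  have {1}-> : (fun x => (h x)%:E) =
      fun x => \sum_(k <- finmap.enum_fset (fset_set (range h))) k%:E * (\1_(h @^-1` [set k]) x)%:E.
    by apply/funext => x; rewrite hE -sumEFin; apply: eq_bigr => i _; rewrite EFinM.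
  move: k0; elim: (finmap.enum_fset (fset_set (range h))) => [_|i r IH k0].
    by rewrite big_nil -[RHS]K0; congr K; apply/funext => x; rewrite big_nil.
  have k0r k : k \in r -> (0 <= k)%R by move=> kr; apply: k0; rewrite inE kr orbT.
  have i0 : (0 <= i)%R by apply: k0; rewrite inE eqxx.
  rewrite big_cons -(IH k0r) -KZ// -KD.
  - by congr K; apply/funext => x; rewrite big_cons.
  - exact: measurable_funeM.
  - by move=> x; rewrite mule_ge0// lee_fin.
  - by apply: emeasurable_sum => j; exact: measurable_funeM.
  - move=> x; rewrite big_seq_cond; apply: sume_ge0 => j; rewrite andbT => jr.
    by rewrite mule_ge0// lee_fin k0r.
by rewrite !sumI//; apply: eq_bigr => i _; rewrite IJ.
Qed.

Lemma integral_functional_int (mu : {measure set T -> \bar R}) :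
  integral_functional (fun f => \int[mu]_x f x).
Proof.
split=> [f g mf f0 mg g0|k f k0 mf f0|f_ mf f0 nd].
- exact: ge0_integralD.
- exact: ge0_integralZl_EFin.
- by apply: monotone_convergence => // x _; exact: nd.
Qed.

End IntegralFunctionals.

Section WeightedImage.
Context d1 d2 (T1 : measurableType d1) (T2 : measurableType d2) (R : realType).
Context (mu : {measure set T1 -> \bar R}) (S : T1 -> T2) (F : T1 -> R).
Hypotheses (mS : measurable_fun setT S) (mF : measurable_fun setT F).
Hypotheses (F0 : forall x, (0 <= F x)%R) (iF : \int[mu]_x (F x)%:E < +oo).

(** The image by [S] of the measure of density [F]. It is built as a finite measure, the kind for
    which the duality of transfer operators is available. *)
Lemma weighted_image : exists nu : {finite_measure set T2 -> \bar R},
  forall A, measurable A -> nu A = \int[mu]_x ((F x)%:E * (\1_A (S x))%:E).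
Proof.
have mFE : measurable_fun setT (fun x => (F x)%:E) by exact/measurable_EFinP.
have mpre A : measurable A -> measurable (S @^-1` A) by move=> mA; rewrite -[X in measurable X]setTI; exact: mS.
pose w A : \bar R := \int[mu]_(x in S @^-1` A) (F x)%:E.
have w0 : w set0 = 0 by rewrite /w preimage_set0 integral_set0.
have wge A : 0 <= w A by apply: integral_ge0 => x _; rewrite lee_fin.
have wsa : semi_sigma_additive w.
  move=> /= A mA tA mbA; rewrite /w preimage_bigcup.
  rewrite ge0_integral_bigcup//; first last.
  - by apply/trivIsetP => i j _ _ ij; rewrite -preimage_setI; move/trivIsetP : tA => -> //; rewrite preimage_set0.
  - by move=> x _; rewrite lee_fin.
  - exact: measurable_funTS.
  - by move=> k; exact: mpre.
  by apply: is_cvg_nneseries => n _ _; exact: wge.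
have m1 := isMeasure.Build _ T2 R w w0 wge wsa.
pose nu0 : {measure set T2 -> \bar R} := HB.pack w m1.
have fin : fin_num_fun nu0.
  move=> A mA; rewrite ge0_fin_numE//; apply: le_lt_trans iF; apply: ge0_subset_integral => //.
  - exact: mpre.
  - by move=> x _; rewrite lee_fin.
have m2 := @Measure_isFinite.Build _ T2 R nu0 fin.
pose nu : {finite_measure set T2 -> \bar R} := HB.pack w m1 m2.
exists nu => A mA; rewrite /= /w integral_mkcond; apply: eq_integral => x _.
rewrite patchE; have -> : (x \in S @^-1` A) = (S x \in A) by rewrite -in_setE; apply/idP/idP; rewrite !inE.
by rewrite indicE; case: (S x \in A) => /=; rewrite ?mule1 ?mule0.
Qed.

End WeightedImage.

End IntegralFunctionalTheory.
Import IntegralFunctionalTheory.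

(** * Abstract calculus of multipliers and pairing *)

Module MultiplierCalculusTheory.

Section MultiplierCalculus.
Context {R : realType} {X : surface R} {D : leaf_data X} (N : norm_params R).
Context (pr : fam D -> (X -> R[i]) -> R[i]).
Local Notation bb H x := (bnorm N H%R <= x%R%:E)%E.
Implicit Types (H K : fam D) (f h phi psi : X -> R[i]).

(* Multiplication of elements of B by C^1 functions; it is only determined on the
   unit balls of test functions, whence [mul_one]. *)
Record multipliers := Multipliers {
  mul : (X -> R[i]) -> fam D -> fam D;
  in_add : forall H K, inB N H -> inB N K -> inB N (fadd H K);
  in_scale : forall z H, inB N H -> inB N (fscale z H);
  in_mul : forall f H, C1c f -> inB N H -> inB N (mul f H);
  nm_ge0 : forall H x, bb H x -> 0 <= x;
  nm_add : forall H K x y, bb H x -> bb K y -> bb (fadd H K) (x + y);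
  nm_scale : forall z H x, bb H x -> bb (fscale z H) (cabs z * x);
  nm_zero : bb ((fun=> 0) : fam D) 0;
  mul_add : forall f H K, C1c f -> mul f (fadd H K) = fadd (mul f H) (mul f K);
  mul_scale : forall f z H, C1c f -> mul f (fscale z H) = fscale z (mul f H);
  mul_addf : forall f h H, C1c f -> C1c h -> inB N H ->
    mul (fun x => f x + h x) H = fadd (mul f H) (mul h H);
  mul_scalef : forall z f H, C1c f -> inB N H -> mul (fun x => z * f x) H = fscale z (mul f H);
  mul_one : forall H, inB N H -> bb (fsub (mul (fun=> 1) H) H) 0;
  mul_bound : exists2 C : R, 0 < C & forall f A H x, 0 < A -> C1c f ->
    (C1norm f <= A%:E)%E -> inB N H -> bb H x -> bb (mul f H) (C * A * x);
  pr_mul : forall f H phi, C1c f -> C1c phi -> inB N H ->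
    pr (mul f H) phi = pr H (fun x => f x * phi x);
  pr_add : forall H K phi, inB N H -> inB N K -> C1c phi -> pr (fadd H K) phi = pr H phi + pr K phi;
  pr_scale : forall z H phi, inB N H -> C1c phi -> pr (fscale z H) phi = z * pr H phi;
  pr_addf : forall H phi psi, inB N H -> C1c phi -> C1c psi ->
    pr H (fun x => phi x + psi x) = pr H phi + pr H psi;
  pr_scalef : forall z H phi, inB N H -> C1c phi -> pr H (fun x => z * phi x) = z * pr H phi;
  pr_bound : exists2 C : R, 0 < C & forall H x phi A, inB N H -> bb H x -> C1c phi -> 0 <= A ->
    (C1norm phi <= A%:E)%E -> cabs (pr H phi) <= C * x * A
}.

End MultiplierCalculus.

Section Pairing.
Context {R : realType} {X : surface R} (D : leaf_data X) (N : norm_params R).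
Context (hk : 0 < ld_kappa D) (hr0 : 0 < ld_r0 D) (htau : 0 < ld_tau0 D).
Context (hD : forall i, is_lchart (ld_kappa D) (ld_chart (l := D) i)).
Local Notation q := (np_q N).
Local Notation al := (np_al N).
Local Notation be := (np_be N).
Local Notation b := (np_b N).
Local Notation eps0 := (np_eps0 N).
Context (hq : 0 < q < 1) (hal : 0 < al) (hb : 0 < b) (he0 : 0 < eps0) (hbe : be <= 1 - q).
Context (p0 : probe D).
Implicit Types (p : probe D) (H K : fam D).
Local Notation "W '_itv' t" := (- lf_r W <= t <= lf_r W) (at level 10).
Local Notation sball := (ProbeAlgebraTheory.sball q al).
Local Notation small_scale := (ProbeAlgebraTheory.small_scale hk hr0 htau hD hq hal).
Local Notation bb := (FamilyNormTheory.bb N).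
Local Notation bbP := (FamilyNormTheory.bbP hk hr0 htau hD hq hal hb he0 p0).
Local Notation bb_ge0 := (FamilyNormTheory.bb_ge0 hk hr0 htau hD hq hal hb he0 p0).
Local Notation bbD := (FamilyNormTheory.bbD hk hr0 htau hD hq hal hb he0 p0).
Local Notation bbZ := (FamilyNormTheory.bbZ hk hr0 htau hD hq hal hb he0 p0).
Local Notation bb0 := (FamilyNormTheory.bb0 hk hr0 htau hD hq hal hb he0 p0).
Local Notation wnorm_bound := (FamilyNormTheory.wnorm_bound hk hr0 htau hD hq hal hb he0 p0).
Local Notation Mul := (MultiplierConstructionTheory.Mul N hD).
Local Notation Mul_bound := (MultiplierConstructionTheory.Mul_bound hk hr0 htau hD hq hal hb he0 hbe p0).
Local Notation Mul_inB := (MultiplierConstructionTheory.Mul_inB hk hr0 htau hD hq hal hb he0 hbe p0).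
Local Notation inB_emb := (MultiplierConstructionTheory.inB_emb hk hr0 htau hD hq hal hb he0 p0).
Local Notation inBD := (MultiplierConstructionTheory.inBD hk hr0 htau hD hq hal hb he0 p0).
Local Notation inBZ := (MultiplierConstructionTheory.inBZ hk hr0 htau hD hq hal hb he0 p0).
Local Notation inBB := (MultiplierConstructionTheory.inBB hk hr0 htau hD hq hal hb he0 p0).
Local Notation Mul_emb := (MultiplierConstructionTheory.Mul_emb hk hr0 htau hD hq hal).
Local Notation MulD := (MultiplierConstructionTheory.MulD N hD).
Local Notation MulZ := (MultiplierConstructionTheory.MulZ N hD).
Local Notation Mul_cst := (MultiplierConstructionTheory.Mul_cst hk hr0 htau hD hq hal hb he0 p0).
Local Notation Mul_fD := (MultiplierConstructionTheory.Mul_fD hk hr0 htau hD hq hal hb he0 p0).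
Local Notation Mul_fZ := (MultiplierConstructionTheory.Mul_fZ hk hr0 htau hD hq hal hb he0 p0).
Context (vol : {measure set (borel X) -> \bar R}) (pr : fam D -> (X -> R[i]) -> R[i]).
Context (hpr : is_pairing N vol pr).
Context (cov : forall x : X, exists i, limage (ld_chart (l := D) i) x).

Lemma C1norm_ge0 (phi : X -> R[i]) : (0 <= C1norm phi)%E.
Proof.
apply: adde_ge0; apply: supn_ge0 => [|x _].
- by exists point.
- exact: cabs_ge0.
- by exists (point, (1, 0)) => /= -[/eqP]; rewrite oner_eq0.
- by rewrite divr_ge0 ?cabs_ge0 ?gnorm_ge0.
Qed.

Lemma pairing_bound : exists2 C : R, 0 < C & forall H x phi A, inB N H -> bb H x -> C1c phi ->
  0 <= A -> (C1norm phi <= A%:E)%E -> cabs (pr H phi) <= C * x * A.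
Proof.
have [_ _ _ [C hC]] := hpr; have [Cw Cw0 hw] := wnorm_bound.
exists ((`|C| + 1) * Cw); first by rewrite mulr_gt0// ltr_wpDl.
move=> H x phi A hH hx hphi A0 hA; have x0 := bb_ge0 hx.
have w1 : (wnorm H <= (Cw * x)%:E)%E by apply: supn_le => p hp; exact: hw.
have w0 : (0 <= wnorm H)%E.
  apply: supn_ge0 => [|p _]; last exact: cabs_ge0.
  by have [s [s0 [h _]]] := small_scale p0; exists (pscale s%:C p0).
have := hC H phi hH hphi.
have ew : wnorm H = (fine (wnorm H))%:E.
  by rewrite fineK// ge0_fin_numE// (le_lt_trans w1)// ltry.
have p0' := C1norm_ge0 phi.
have ep : C1norm phi = (fine (C1norm phi))%:E.
  by rewrite fineK// ge0_fin_numE// (le_lt_trans hA)// ltry.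
rewrite ew lee_fin in w0 w1; rewrite ep lee_fin in hA p0'; rewrite ew lee_fin in w1.
rewrite ew ep -!EFinM lee_fin => /le_trans; apply.
have -> : (`|C| + 1) * Cw * x * A = (`|C| + 1) * ((Cw * x) * A) by ring.
have C1 : C <= `|C| + 1 by rewrite (le_trans (ler_norm _))// lerDl.
have C2 : 0 <= `|C| + 1 by rewrite addr_ge0.
rewrite -mulrA; apply: (le_trans (ler_wpM2r (mulr_ge0 w0 p0') C1)).
by apply: ler_wpM2l => //; exact: ler_pM.
Qed.

(** Makes [Mul], which takes a proof of regularity, a total function of [f]. *)
Definition mulf (f : X -> R[i]) H : fam D :=
  match pselect (C1c f) with left fC => Mul fC H | right _ => fun=> 0 end.

Lemma mulfE (f : X -> R[i]) (fC : C1c f) H : mulf f H = Mul fC H.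
Proof. by rewrite /mulf; case: pselect => // fC'; rewrite (Prop_irrelevance fC' fC). Qed.

Lemma fin (f : X -> R[i]) : C1c f -> exists2 A : R, 0 < A & (C1norm f <= A%:E)%E.
Proof. exact: C1norm_finite hD cov. Qed.

Lemma prD H K phi : inB N H -> inB N K -> C1c phi -> pr (fadd H K) phi = pr H phi + pr K phi.
Proof. by have [_ h _ _] := hpr; exact: h. Qed.

Lemma prZ z H phi : inB N H -> C1c phi -> pr (fscale z H) phi = z * pr H phi.
Proof. by have [_ _ h _] := hpr; exact: h. Qed.

Lemma prB H K phi : inB N H -> inB N K -> C1c phi -> pr (fsub H K) phi = pr H phi - pr K phi.
Proof.
move=> hH hK hphi; rewrite fsubE prD//; last exact: inBZ.
by rewrite prZ// mulN1r.
Qed.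

(** An identity between integrals when [H] is [emb h], and both sides are continuous in [H] by
    [Mul_bound] and [pairing_bound]. *)
Lemma pr_Mul (f : X -> R[i]) (fC : C1c f) H phi : C1c phi -> inB N H ->
  pr (Mul fC H) phi = pr H (fun x => f x * phi x).
Proof.
move=> hphi hH; have fphi := C1cM fC hphi.
have [A A0 hA] := fin fC; have [B B0 hB] := fin hphi; have [E E0 hE] := fin fphi.
have [Cm Cm0 hCm] := Mul_bound; have [Cp Cp0 hCp] := pairing_bound.
have hM := Mul_inB fC hA hH.
apply/eqP; rewrite -subr_eq0; apply/eqP; apply: (@vanishing _ (Cp * (Cm * A) * B + Cp * E)) => [|e e0].
  by apply: addr_ge0; do ![apply: mulr_ge0]; exact: ltW.
have [h hC1 hh] := hH e e0; have hI := inB_emb hC1; have hS := inBB hH hI.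
have k1 := hCm f fC A _ e A0 hA hS hh.
have k2 := hCp _ _ phi B (Mul_inB fC hA hS) k1 hphi (ltW B0) hB.
have k3 := hCp _ _ _ E hS hh fphi (ltW E0) hE.
have e1 : pr (Mul fC (emb h)) phi = pr (emb h) (fun x => f x * phi x).
  have [h1 _ _ _] := hpr; rewrite (Mul_emb fC hC1) (h1 _ _ (C1cM fC hC1) hphi) (h1 _ _ hC1 fphi).
  by apply: eq_cint => x _; rewrite [in RHS]mulrCA mulrA.
have e2 : pr (Mul fC (fsub H (emb h))) phi = pr (Mul fC H) phi - pr (Mul fC (emb h)) phi.
  have hMe := Mul_inB fC hA hI.
  rewrite fsubE MulD MulZ prD//; last exact: inBZ.
  by rewrite prZ// mulN1r.
have e3 := prB hH hI fphi.
have -> : pr (Mul fC H) phi - pr H (fun x => f x * phi x) =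
   pr (Mul fC (fsub H (emb h))) phi - pr (fsub H (emb h)) (fun x => f x * phi x).
  by rewrite e2 e3 e1 opprB addrA subrK.
apply: (le_trans (cabsB _ _)); apply: (le_trans (lerD k2 k3)).
by rewrite le_eqVlt; apply/orP; left; apply/eqP; ring.
Qed.

(** The pairing is given as linear in [H]. Linearity in the test function is deduced from it by
    writing [pr H f] as the pairing of f.H with 1 and using additivity of multiplication in [f]. *)
Lemma pr_fD H phi psi : inB N H -> C1c phi -> C1c psi ->
  pr H (fun x => phi x + psi x) = pr H phi + pr H psi.
Proof.
move=> hH h1 h2; have h3 := C1cD h1 h2; have one := C1c_cst (X := X) (1 : R[i]).
have E f (fC : C1c f) : pr (Mul fC H) (fun=> 1) = pr H f.
  by rewrite pr_Mul//; congr pr; apply/funext => x; rewrite mulr1.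
have [A A0 hA] := fin h1; have [B B0 hB] := fin h2.
by rewrite -!E (Mul_fD h1 h2 h3 hH) prD//; [exact: Mul_inB hA hH|exact: Mul_inB hB hH].
Qed.

Lemma pr_fZ z H phi : inB N H -> C1c phi -> pr H (fun x => z * phi x) = z * pr H phi.
Proof.
move=> hH h1; have h3 := C1cZ z h1; have one := C1c_cst (X := X) (1 : R[i]).
have E f (fC : C1c f) : pr (Mul fC H) (fun=> 1) = pr H f.
  by rewrite pr_Mul//; congr pr; apply/funext => x; rewrite mulr1.
have [A A0 hA] := fin h1.
by rewrite -!E (Mul_fZ h1 h3 hH) prZ//; exact: Mul_inB hA hH.
Qed.

Lemma Mul_one H (fC : C1c (fun _ : X => (1 : R[i]))) : inB N H -> bb (fsub (Mul fC H) H) 0.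
Proof.
move=> hH; have z p : sball p 1 \/ c1ball p -> fsub (Mul fC H) H p = 0.
  by move=> hp; rewrite /fsub (Mul_cst fC hH hp) /fscale mul1r subrr.
apply/bbP; exists 0, 0; split => //; first by rewrite mulr0 addr0.
- by move=> p hp; rewrite z ?cabs0//; left.
- move=> e p p' [_ _ n1 n2 _].
  by rewrite (z p (or_intror n1)) (z p' (or_intror n2)) subrr cabs0 mulr0.
Qed.

Lemma multipliers_exist : multipliers N pr.
Proof.
have one := C1c_cst (X := X) (1 : R[i]).
apply: (@Multipliers _ _ _ _ _ mulf).
- exact: inBD.
- exact: inBZ.
- by move=> f H fC hH; rewrite (mulfE fC); have [A A0 hA] := fin fC; exact: Mul_inB hA hH.
- exact: bb_ge0.
- exact: bbD.
- exact: bbZ.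
- exact: bb0.
- by move=> f H K fC; rewrite !(mulfE fC) MulD.
- by move=> f z H fC; rewrite !(mulfE fC) MulZ.
- by move=> f h H fC hC hH; rewrite (mulfE fC) (mulfE hC) (mulfE (C1cD fC hC)) (Mul_fD fC hC).
- by move=> z f H fC hH; rewrite (mulfE fC) (mulfE (C1cZ z fC)) (Mul_fZ fC).
- by move=> H hH; rewrite (mulfE one); exact: Mul_one.
- have [C C0 hC] := Mul_bound; exists C => // f A H x A0 fC hA hH hx.
  by rewrite (mulfE fC); exact: hC.
- by move=> f H phi fC hphi hH; rewrite (mulfE fC) pr_Mul.
- exact: prD.
- exact: prZ.
- exact: pr_fD.
- exact: pr_fZ.
- exact: pairing_bound.
Qed.

End Pairing.

End MultiplierCalculusTheory.
Import MultiplierCalculusTheory.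

(** * Bounded measurable functions and image measures *)

Module BoundedFunctionTheory.

Section BoundedFunctions.
Context d (T : measurableType d) (R : realType).
Implicit Types f g : T -> R.

Definition rbm f := measurable_fun [set: T] f /\ exists M : R, forall x, `|f x| <= M.

Lemma rbm_cst (c : R) : rbm (fun=> c).
Proof. by split; [exact: measurable_cst|exists `|c|]. Qed.

Lemma rbmD f g : rbm f -> rbm g -> rbm (fun x => f x + g x).
Proof.
move=> [mf [M hM]] [mg [N hN]]; split; first exact: measurable_funD.
by exists (M + N) => x; rewrite (le_trans (ler_normD _ _))// lerD.
Qed.

Lemma rbmM f g : rbm f -> rbm g -> rbm (fun x => f x * g x).
Proof.
move=> [mf [M hM]] [mg [N hN]]; split; first exact: measurable_funM.
by exists (M * N) => x; rewrite normrM ler_pM.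
Qed.

Lemma rbmZ (c : R) f : rbm f -> rbm (fun x => c * f x).
Proof. exact: rbmM (rbm_cst c). Qed.

Lemma rbm_sum (I : Type) (r : seq I) (F : I -> T -> R) : (forall i, rbm (F i)) ->
  rbm (fun x => \sum_(i <- r) F i x).
Proof.
move=> hF; elim: r => [|i r IH].
  by rewrite (_ : (fun x => _) = fun=> 0); [exact: rbm_cst|apply/funext => x; rewrite big_nil].
rewrite (_ : (fun x => _) = fun x => F i x + \sum_(j <- r) F j x); first exact: rbmD.
by apply/funext => x; rewrite big_cons.
Qed.

Context (mu : {measure set T -> \bar R}) (hmu : mu setT = 1%E).

Lemma rbm_int f : rbm f -> mu.-integrable [set: T] (EFin \o f).
Proof.
move=> [mf [M hM]]; apply: measurable_bounded_integrable => //.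
  by rewrite hmu ltry.
by exists M; split; [exact: num_real|move=> y My x _; exact: (le_trans (hM x) (ltW My))].
Qed.

Lemma expD f g : rbm f -> rbm g -> \int[mu]_x (f x + g x) = \int[mu]_x f x + \int[mu]_x g x.
Proof. by move=> hf hg; apply: RintegralD => //; exact: rbm_int. Qed.

Lemma expZ c f : rbm f -> \int[mu]_x (c * f x) = c * \int[mu]_x f x.
Proof. by move=> hf; apply: RintegralZl => //; exact: rbm_int. Qed.

Lemma exp_cst (c : R) : \int[mu]_(x in [set: T]) c = c.
Proof. by rewrite Rintegral_cst// hmu mulr1. Qed.

Lemma exp_le f g : rbm f -> rbm g -> (forall x, f x <= g x) -> \int[mu]_x f x <= \int[mu]_x g x.
Proof. by move=> hf hg h; apply: le_Rintegral => //; exact: rbm_int. Qed.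

Lemma exp_abs_le f (M : R) : rbm f -> (forall x, `|f x| <= M) -> `|\int[mu]_x f x| <= M.
Proof.
move=> hf h; have hb x := h x; rewrite ler_norml; apply/andP; split.
- rewrite -[leLHS](exp_cst (- M)); apply: exp_le => // [|x]; first exact: rbm_cst.
  by have := h x; rewrite ler_norml => /andP[].
- rewrite -[leRHS](exp_cst M); apply: exp_le => // [|x]; first exact: rbm_cst.
  by have := h x; rewrite ler_norml => /andP[].
Qed.

Lemma exp_sum (I : Type) (r : seq I) (F : I -> T -> R) : (forall i, rbm (F i)) ->
  \int[mu]_x (\sum_(i <- r) F i x) = \sum_(i <- r) \int[mu]_x F i x.
Proof.
move=> hF; elim: r => [|i r IH].
  by rewrite big_nil -[RHS](exp_cst 0); apply: eq_Rintegral => x _; rewrite big_nil.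
rewrite big_cons -IH -expD//; last exact: rbm_sum.
by apply: eq_Rintegral => x _; rewrite big_cons.
Qed.

End BoundedFunctions.

Section Images.
Context d1 d2 (T1 : measurableType d1) (T2 : measurableType d2) (R : realType).

Lemma rbm_comp (S : T1 -> T2) (f : T2 -> R) : measurable_fun [set: T1] S -> rbm f -> rbm (f \o S).
Proof.
move=> mS [mf [M hM]]; split; first exact: measurableT_comp.
by exists M => x; exact: hM.
Qed.

Lemma exp_invariant (mu : {measure set T1 -> \bar R}) (nu : {measure set T2 -> \bar R})
    (S : T1 -> T2) (f : T2 -> R) : measurable_fun [set: T1] S -> mu setT = 1%E ->
  (forall A, measurable A -> mu (S @^-1` A) = nu A) -> rbm f ->
  \int[mu]_x f (S x) = \int[nu]_x f x.
Proof.
move=> mS mu1 h hf; have mf : measurable_fun [set: T2] (EFin \o f).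
  by apply/measurable_EFinP; case: hf.
have := @integral_pushforward _ _ _ _ _ S mS mu setT (EFin \o f) mf
  (rbm_int mu1 (rbm_comp mS hf)) measurableT.
rewrite preimage_setT /Rintegral => e; congr fine.
transitivity (\int[mu]_x (EFin \o f \o S) x)%E => //; rewrite -e.
by apply: eq_measure_integral => A mA _; exact: h.
Qed.

Context (mu : {measure set T1 -> \bar R}) (S : T1 -> T2) (F : T1 -> R).
Hypotheses (mS : measurable_fun [set: T1] S) (mF : measurable_fun [set: T1] F).
Hypothesis (F0 : forall x, 0 <= F x).

(** On nonnegative functions both sides are integral functionals with the same values on indicators.
    The signed case follows from positive and negative parts, which commute with multiplication by
    [F >= 0]. *)
Lemma weighted_Rintegral (nu : {measure set T2 -> \bar R}) :
  (forall A, measurable A -> nu A = (\int[mu]_x ((F x)%:E * (\1_A (S x))%:E))%E) ->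
  forall f : T2 -> R, measurable_fun [set: T2] f -> \int[nu]_x f x = \int[mu]_x (F x * f (S x)).
Proof.
move=> hnu.
have mFE : measurable_fun [set: T1] (fun x => (F x)%:E) by exact/measurable_EFinP.
have J : integral_functional (fun f : T2 -> \bar R => \int[mu]_x ((F x)%:E * f (S x)))%E.
  split=> [f g mf f0 mg g0|k f k0 mf f0|f_ mf f0 nd].
  - rewrite -ge0_integralD//; first by apply: eq_integral => x _; rewrite ge0_muleDr.
    + by move=> x _; rewrite mule_ge0// lee_fin.
    + by apply: emeasurable_funM => //; exact: measurableT_comp.
    + by move=> x _; rewrite mule_ge0// lee_fin.
    + by apply: emeasurable_funM => //; exact: measurableT_comp.
  - rewrite -ge0_integralZl_EFin//; first by apply: eq_integral => x _; rewrite muleCA.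
    + by move=> x _; rewrite mule_ge0// lee_fin.
    + by apply: emeasurable_funM => //; exact: measurableT_comp.
  - rewrite -monotone_convergence//.
    + apply: eq_integral => x _; rewrite limeMl//.
      by apply: ereal_nondecreasing_is_cvgn; exact: nd.
    + by move=> n; apply: emeasurable_funM => //; exact: measurableT_comp.
    + by move=> n x _; rewrite mule_ge0// lee_fin.
    + by move=> x _ m n mn; rewrite lee_pmul// ?lee_fin//; exact: nd.
have ge0 (f : T2 -> \bar R) : measurable_fun [set: T2] f -> (forall x, 0 <= f x)%E ->
    (\int[nu]_x f x = \int[mu]_x ((F x)%:E * f (S x)))%E.
  move=> mf f0; apply: (integral_functional_uniq (integral_functional_int nu) J) => // A mA.
  by rewrite integral_indic// setIT; exact: hnu.
move=> f mf; rewrite /Rintegral; congr fine.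
rewrite [LHS]integralE [RHS]integralE; congr (_ - _)%E.
- rewrite ge0//; last by apply: measurable_funepos; exact/measurable_EFinP.
  apply: eq_integral => x _; rewrite !funeposE /= -!EFin_max -EFinM.
  by rewrite maxr_pMr// mulr0.
- rewrite ge0//; last by apply: measurable_funeneg; exact/measurable_EFinP.
  apply: eq_integral => x _; rewrite !funenegE /= -?EFinN -!EFin_max -EFinM.
  by rewrite maxr_pMr// mulr0 mulrN.
Qed.

Lemma weighted_image_exp : mu setT = 1%E -> rbm F -> exists nu : {finite_measure set T2 -> \bar R},
  forall f : T2 -> R, measurable_fun [set: T2] f ->
    \int[nu]_x f x = \int[mu]_x (F x * f (S x)).
Proof.
move=> hmu hF; have iF : (\int[mu]_x (F x)%:E < +oo)%E by apply: integrable_lty => //; exact: rbm_int.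
have [nu hnu] := weighted_image mS mF F0 iF; exists nu; exact: weighted_Rintegral.
Qed.

End Images.

End BoundedFunctionTheory.
Import BoundedFunctionTheory.

(** * Elements of B represented by image measures *)

Module SpanTheory.

Section Span.
Context {R : realType} {X : surface R} {D : leaf_data X} {N : norm_params R}.
Context {pr : fam D -> (X -> R[i]) -> R[i]} (cal : multipliers N pr).
Context (mu : {measure set (borel X) -> \bar R}) (hmu : mu setT = 1%E).
Implicit Types (H K : fam D) (F G f phi : X -> R[i]).
Local Notation bX := (borel X).
Local Notation rbX := (@rbm _ (borel X) R).

Lemma C1fun_rbm (f : X -> R) : C1fun f -> rbX f.
Proof.
move=> fC; have cf := C1fun_continuous fC; split.
  apply: (measurability _ (RGenOInfty.measurableE R)) => // _ [_ [a ->] <-].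
  rewrite setTI; apply: sub_sigma_algebra.
  by move/continuousP : cf; apply; rewrite set_itvoy; exact: open_gt.
have [M _ hM] := compact_bounded_fun (@surface_compact R X) (continuous_subspaceT cf).
by exists M => x; exact: hM.
Qed.

Definition crbm F := rbX (cRe F) /\ rbX (cIm F).

Lemma crbm_int F : crbm F -> cintegrable mu [set: bX] F.
Proof. by move=> [h1 h2]; split; exact: rbm_int. Qed.

Lemma crbmD F G : crbm F -> crbm G -> crbm (fun x => F x + G x).
Proof.
move=> [a1 a2] [b1 b2]; split.
- by rewrite (_ : cRe _ = fun x => cRe F x + cRe G x); [exact: rbmD|apply/funext => x; rewrite /cRe ReD].
- by rewrite (_ : cIm _ = fun x => cIm F x + cIm G x); [exact: rbmD|apply/funext => x; rewrite /cIm ImD].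
Qed.

Lemma crbmM F G : crbm F -> crbm G -> crbm (fun x => F x * G x).
Proof.
move=> [a1 a2] [b1 b2]; split.
- rewrite (_ : cRe _ = fun x => cRe F x * cRe G x + -1 * (cIm F x * cIm G x)).
    by apply: rbmD; [exact: rbmM|apply: rbmZ; exact: rbmM].
  by apply/funext => x; rewrite /cRe /cIm ReM mulN1r.
- rewrite (_ : cIm _ = fun x => cRe F x * cIm G x + cIm F x * cRe G x).
    by apply: rbmD; exact: rbmM.
  by apply/funext => x; rewrite /cRe /cIm ImM.
Qed.

Lemma crbm_cst (z : R[i]) : crbm (fun=> z).
Proof. by split; exact: rbm_cst. Qed.

Lemma crbm_r2c (f : X -> R) : rbX f -> crbm (r2c f).
Proof. by move=> hf; split => //; exact: rbm_cst. Qed.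

Lemma C1c_crbm (S : bX -> bX) f : measurable_fun [set: bX] S -> C1c f -> crbm (fun x => f (S x)).
Proof.
move=> mS [h1 h2]; split; [exact: (rbm_comp mS (C1fun_rbm h1))|exact: (rbm_comp mS (C1fun_rbm h2))].
Qed.

Local Notation "\E F" := (cint mu [set: bX] F) (at level 10, F at level 9).

Section OneMap.
Context (S : bX -> bX) (mS : measurable_fun [set: bX] S).

(* Finite combinations of elements of B represented by the images under S of
   finite measures F mu, F >= 0. *)
Inductive span : fam D -> (X -> R[i]) -> Prop :=
| span_pos H (F : X -> R) : inB N H -> rbX F -> (forall x, 0 <= F x) ->
    (forall phi, C1c phi -> pr H phi = \E (fun x => (F x)%:C * phi (S x))) -> span H (r2c F)
| span_add H K F G : span H F -> span K G -> span (fadd H K) (fun x => F x + G x)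
| span_scale z H F : span H F -> span (fscale z H) (fun x => z * F x).

Lemma span_eq H F G : F =1 G -> span H F -> span H G.
Proof. by move=> /funext ->. Qed.

Lemma span_facts H F : span H F -> [/\ inB N H, crbm F &
  forall phi, C1c phi -> pr H phi = \E (fun x => F x * phi (S x))].
Proof.
elim=> [{}H {}F hH hF F0 h|{}H K {}F G _ [h1 h2 h3] _ [k1 k2 k3]|z {}H {}F _ [h1 h2 h3]].
- by split => //; exact: crbm_r2c.
- split; [exact: (in_add cal)|exact: crbmD|move=> phi hphi].
  have cp := C1c_crbm mS hphi.
  rewrite (pr_add cal h1 k1 hphi) h3// k3// -cintD//; last 2 first.
  + by apply: crbm_int; exact: crbmM.
  + by apply: crbm_int; exact: crbmM.
  by apply: eq_cint => x _; rewrite mulrDl.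
- split; [exact: (in_scale cal)|by apply: crbmM => //; exact: crbm_cst|move=> phi hphi].
  have cp := C1c_crbm mS hphi.
  rewrite (pr_scale cal _ h1 hphi) h3// -cintZ//; last by apply: crbm_int; exact: crbmM.
  by apply: eq_cint => x _; rewrite mulrA.
Qed.

Lemma span_one H F : span H F -> pr H (fun=> 1) = \E F.
Proof.
move=> /span_facts[_ _ h]; rewrite h; last by split; exact: C1fun_cst.
by apply: eq_cint => x _; rewrite mulr1.
Qed.

Lemma span_mul_nonneg H (F f : X -> R) : inB N H -> rbX F -> (forall x, 0 <= F x) ->
  (forall phi, C1c phi -> pr H phi = \E (fun x => (F x)%:C * phi (S x))) ->
  C1fun f -> (forall x, 0 <= f x) ->
  span (mul cal (r2c f) H) (fun x => (F x)%:C * (f (S x))%:C).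
Proof.
move=> hH hF F0 h fC f0; have fC' : C1c (r2c f) by split; [exact: fC|exact: C1fun_cst].
apply: (@span_eq _ (r2c (fun x => F x * f (S x)))); first by move=> x; rewrite /r2c rmorphM.
apply: span_pos; first exact: (in_mul cal).
- exact: rbmM hF (rbm_comp mS (C1fun_rbm fC)).
- by move=> x; exact: mulr_ge0.
- move=> phi hphi; rewrite (pr_mul cal fC' hphi hH) h; last exact: C1cM.
  by apply: eq_cint => x _; rewrite /r2c rmorphM mulrA.
Qed.

(** Generators have nonnegative densities, so [f] is written as (p1 - c) + i (p2 - c) with [p1] and
    [p2] nonnegative, and each of the four terms is a scalar multiple of a nonnegative
    multiplier. *)
Lemma span_mul H F f : span H F -> C1c f -> span (mul cal f H) (fun x => F x * f (S x)).
Proof.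
move=> hs fC; elim: hs => [{}H {}F hH hF F0 h|{}H K {}F G _ h _ k|z {}H {}F _ h]; last 2 first.
- rewrite (mul_add cal)//; apply: span_eq (span_add h k) => x; by rewrite mulrDl.
- rewrite (mul_scale cal)//; apply: span_eq (span_scale z h) => x; by rewrite mulrA.
have [f1 f2] := fC; have [_ [M1 hM1]] := C1fun_rbm f1; have [_ [M2 hM2]] := C1fun_rbm f2.
pose c := `|M1| + `|M2|.
have c0 : 0 <= c by rewrite addr_ge0.
have c1C := C1fun_cst (X := X) (1 : R).
pose p1 x := cRe f x + c; pose p2 x := cIm f x + c.
have p1C : C1fun p1 := C1funD f1 (C1fun_cst c).
have p2C : C1fun p2 := C1funD f2 (C1fun_cst c).
have p10 x : 0 <= p1 x.
  have := le_trans (hM1 x) (ler_norm M1); rewrite ler_norml => /andP[k _].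
  by rewrite /p1 /c; have := normr_ge0 M2; move: k; set a := cRe f x; move: a => a; lra.
have p20 x : 0 <= p2 x.
  have := le_trans (hM2 x) (ler_norm M2); rewrite ler_norml => /andP[k _].
  by rewrite /p2 /c; have := normr_ge0 M1; move: k; set a := cIm f x; move: a => a; lra.
have rC (r : X -> R) : C1fun r -> C1c (r2c r) by move=> hr; split; [exact: hr|exact: C1fun_cst].
have q1 := rC _ p1C; have q2 := rC _ p2C; have q3 := rC _ c1C.
have fE : f = fun x => (r2c p1 x + (- c)%:C * r2c (fun=> 1) x) +
    ('i * r2c p2 x + (- ('i * c%:C)) * r2c (fun=> 1) x).
  apply/funext => x; rewrite [LHS]complexRI; have -> : r2c (fun=> 1 : R) x = 1 by [].
  rewrite !mulr1 /r2c /p1 /p2 (rmorphD _ (cRe f x)) (rmorphD _ (cIm f x)) (rmorphN _ c).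
  by rewrite mulrDr !addrK.
have t1 := span_mul_nonneg hH hF F0 h p1C p10; have t2 := span_mul_nonneg hH hF F0 h p2C p20.
have t3 := span_mul_nonneg hH hF F0 h c1C (fun=> ler01).
have -> : mul cal f H = fadd (fadd (mul cal (r2c p1) H) (fscale (- c)%:C (mul cal (r2c (fun=> 1)) H)))
   (fadd (fscale 'i (mul cal (r2c p2) H)) (fscale (- ('i * c%:C)) (mul cal (r2c (fun=> 1)) H))).
  have z1 := C1cZ (- c)%:C q3; have z2 := C1cZ 'i q2; have z3 := C1cZ (- ('i * c%:C)) q3.
  rewrite {1}fE (mul_addf cal (C1cD q1 z1) (C1cD z2 z3) hH).
  rewrite (mul_addf cal q1 z1 hH) (mul_addf cal z2 z3 hH).
  by rewrite (mul_scalef cal _ q3 hH) (mul_scalef cal _ q2 hH) (mul_scalef cal _ q3 hH).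
apply: span_eq (span_add (span_add t1 (span_scale (- c)%:C t3))
  (span_add (span_scale 'i t2) (span_scale (- ('i * c%:C)) t3))) => x.
rewrite fE /r2c; ring.
Qed.

End OneMap.

(** For a generator the pairing is integration against the finite measure [nu], the image of [F mu]
    by [S0]. Duality with finite measures then composes the test function with [S]: the density on
    the initial fibre is unchanged and only the map advances. *)
Lemma span_step (S : pwmap X) (L : fam D -> fam D) (S0 : bX -> bX) H F :
  measurable_fun [set: bX] S0 -> measurable_fun [set: bX] (S : bX -> bX) ->
  is_transfer_operator N pr S L -> span S0 H F -> span (fun x => S (S0 x)) (L H) F.
Proof.
move=> mS0 mS [[LB LD LZ _] _ hL]; elim=> [{}H {}F hH hF F0 h|{}H K {}F G s1 h s2 k|z {}H {}F s h]; last 2 first.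
- have [i1 _ _] := span_facts mS0 s1; have [i2 _ _] := span_facts mS0 s2.
  by rewrite LD//; exact: span_add.
- by have [i1 _ _] := span_facts mS0 s; rewrite LZ//; exact: span_scale.
have [nu hnu] := weighted_image_exp mS0 (proj1 hF) F0 hmu hF.
have hcint f : measurable_fun [set: bX] (cRe f) -> measurable_fun [set: bX] (cIm f) ->
    \E (fun x => (F x)%:C * f (S0 x)) = cint nu setT f.
  move=> m1 m2; rewrite /cint !hnu//; congr (_ +i* _); apply: eq_Rintegral => x _.
    by rewrite /cRe ReM /= mul0r subr0.
  by rewrite /cIm ImM /= mul0r addr0.
have rep : represents pr H nu.
  move=> phi hphi; rewrite h//; have [[m1 _] [m2 _]] := (C1fun_rbm (proj1 hphi), C1fun_rbm (proj2 hphi)).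
  exact: hcint.
apply: span_pos => //; first exact: LB.
move=> phi hphi; rewrite (hL H nu phi hH rep hphi).
have [[m1 _] [m2 _]] := C1c_crbm mS hphi.
by rewrite -(hcint (phi \o S) m1 m2).
Qed.

End Span.

End SpanTheory.
Import SpanTheory.

(** * Second-order expansion of the perturbed cocycle on one fibre *)

Module FibreCocycleTheory.

Lemma pad_le (R : realType) (a b c d e : R) : a <= d -> 0 <= c -> 0 <= e ->
  [/\ 2 * a + 2 * b <= 2 * b + 2 * d + 2 * c + 2 * e,
      2 * a + 2 * b <= 2 * c + 2 * b + 2 * d + 2 * e &
      2 * a + 2 * b <= 2 * c + 2 * e + 2 * b + 2 * d].
Proof. by move=> *; split; lra. Qed.

Section RemainderNorms.
Context {R : realType} {X : surface R} (g : X -> R) (A th : R).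
Context (gC : C1fun g) (A0 : 0 < A) (gA : (C1norm (r2c g) <= A%:E)%E) (th1 : `|th| <= 1).

(** Differentiating [G (th * g x)] brings out a factor [th]. Hence a remainder whose supremum has
    some order in [th] keeps that order in C^1 norm, although its derivative as a function of
    [th * g] is one order lower. *)
Lemma dilated_norm (G1 G1' G2 G2' : R -> R) (a1 a2 d1 d2 : R) :
  (forall x : R, is_derive x 1 G1 (G1' x)) -> (forall x : R, is_derive x 1 G2 (G2' x)) ->
  continuous G1' -> continuous G2' ->
  (forall z, `|z| <= `|th| * A -> [/\ `|G1 z| <= a1, `|G2 z| <= a2, `|G1' z| <= d1 & `|G2' z| <= d2]) ->
  C1c (fun x => G1 (th * g x) +i* G2 (th * g x)) /\
  (C1norm (fun x => G1 (th * g x)%R +i* G2 (th * g x)%R) <=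
    (a1 + a2 + (`|th| * d1 + `|th| * d2) * A)%R%:E)%E.
Proof.
move=> h1 h2 c1 c2 hb.
have cd (G : R -> R) : continuous G -> continuous (fun y => th * G (th * y)).
  move=> cG y; apply: cvgM; first exact: cvg_cst.
  by apply: (cvg_comp (fun y => th * y) G); [apply: cvgM; [exact: cvg_cst|exact: cvg_id]|exact: cG].
apply: (C1norm_post gC (ltW A0) gA (fun x => is_derive_dilate th x h1)
  (fun x => is_derive_dilate th x h2) (cd _ c1) (cd _ c2)) => y yA.
have [|b1 b2 b3 b4] := hb (th * y); first by rewrite normrM ler_wpM2l.
by split; rewrite ?normrM//; apply: ler_wpM2l.
Qed.

(** One constant for the three remainders: when [|th| <= 1], each norm uses only two of the four
    powers of [A], and [pad_le] adds the others. *)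
Definition KA := 2 * (A + A ^+ 2 + A ^+ 3 + A ^+ 4).

Lemma KA_gt0 : 0 < KA.
Proof. by rewrite /KA mulr_gt0// !addr_gt0// exprn_gt0. Qed.

Definition rem1 (x : X) : R[i] := (cos (th * g x) - 1) +i* sin (th * g x).
Definition rem2 (x : X) : R[i] := (cos (th * g x) - 1) +i* (sin (th * g x) - th * g x).
Definition rem3 (x : X) : R[i] :=
  (cos (th * g x) - 1 + 2^-1 * (th * g x) ^+ 2) +i* (sin (th * g x) - th * g x).

(** Derivatives of the components of the remainders. With y = th g(x), the functions [rem1], [rem2]
    and [rem3] are e^(iy) minus 1, minus 1 + iy, and minus 1 + iy - y^2 / 2. *)
Let dcos1 (x : R) : is_derive x 1 (fun y => cos y - 1) (- sin x).
Proof. by apply: is_derive_add_cst; exact: is_derive_cos. Qed.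
Let dsin1 (x : R) : is_derive x 1 (fun y => sin y - y) (cos x - 1).
Proof. by apply: is_derive_sub_id; exact: is_derive_sin. Qed.
Let dcos2 (x : R) : is_derive x 1 (fun y => cos y - 1 + 2^-1 * y ^+ 2) (- sin x + x).
Proof.
have -> : - sin x + x = - sin x + 2 * 2^-1 * x by rewrite divff// mul1r.
by apply: is_derive_add_sqr; exact: dcos1.
Qed.
Let csin : continuous (fun x : R => - sin x).
Proof. by move=> x; apply: cvgN; exact: continuous_sin. Qed.
Let ccos1 : continuous (fun x : R => cos x - 1).
Proof. by move=> x; apply: cvgB; [exact: continuous_cos|exact: cvg_cst]. Qed.
Let csin2 : continuous (fun x : R => - sin x + x).
Proof. by move=> x; apply: cvgD; [exact: csin|exact: cvg_id]. Qed.

Let pw (z : R) (n : nat) : `|z| <= `|th| * A -> `|z| ^+ n <= `|th| ^+ n * A ^+ n.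
Proof.
move=> h; rewrite -exprMn; apply: lerXn2r; rewrite ?nnegrE//.
by apply: mulr_ge0 => //; exact: ltW.
Qed.

Lemma rem1_norm : C1c rem1 /\ (C1norm rem1 <= (KA * `|th|)%R%:E)%E.
Proof.
have [|h1 h2] := dilated_norm (a1 := `|th| ^+ 2 * A ^+ 2) (a2 := `|th| * A) (d1 := `|th| * A) (d2 := 1)
  dcos1 (@is_derive_sin R) csin (@continuous_cos R).
  move=> z hz; split.
  - exact: (le_trans (cos_sub1_le z) (pw 2 hz)).
  - exact: (le_trans (sin_le_abs z) hz).
  - by rewrite normrN; exact: (le_trans (sin_le_abs z) hz).
  - by rewrite ler_norml cos_geN1 cos_le1.
split => //; apply: (le_trans h2); rewrite lee_fin /KA.
have t0 := normr_ge0 th; have A2 := exprn_ge0 2 (ltW A0).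
have A3 := exprn_ge0 3 (ltW A0); have A4 := exprn_ge0 4 (ltW A0).
have k1 : `|th| ^+ 2 * A ^+ 2 <= `|th| * A ^+ 2 by rewrite ler_wpM2r// expr2 ler_piMr.
have k2 : 0 <= `|th| * A ^+ 3 by exact: mulr_ge0.
have k3 : 0 <= `|th| * A ^+ 4 by exact: mulr_ge0.
have -> : `|th| ^+ 2 * A ^+ 2 + `|th| * A + (`|th| * (`|th| * A) + `|th| * 1) * A =
  2 * (`|th| ^+ 2 * A ^+ 2) + 2 * (`|th| * A) by ring.
have -> : 2 * (A + A ^+ 2 + A ^+ 3 + A ^+ 4) * `|th| = 2 * (`|th| * A) + 2 * (`|th| * A ^+ 2) +
  2 * (`|th| * A ^+ 3) + 2 * (`|th| * A ^+ 4) by ring.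
by have [h3 _ _] := pad_le (`|th| * A) k1 k2 k3.
Qed.

Lemma rem2_norm : C1c rem2 /\ (C1norm rem2 <= (KA * `|th| ^+ 2)%R%:E)%E.
Proof.
have [|h1 h2] := dilated_norm (a1 := `|th| ^+ 2 * A ^+ 2) (a2 := `|th| ^+ 3 * A ^+ 3) (d1 := `|th| * A)
  (d2 := `|th| ^+ 2 * A ^+ 2) dcos1 dsin1 csin ccos1.
  move=> z hz; split.
  - exact: (le_trans (cos_sub1_le z) (pw 2 hz)).
  - exact: (le_trans (sin_sub_id_le z) (pw 3 hz)).
  - by rewrite normrN; exact: (le_trans (sin_le_abs z) hz).
  - exact: (le_trans (cos_sub1_le z) (pw 2 hz)).
split => //; apply: (le_trans h2); rewrite lee_fin /KA.
have t0 := normr_ge0 th; have A2 := exprn_ge0 2 (ltW A0); have t2 := exprn_ge0 2 t0.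
have A3 := exprn_ge0 3 (ltW A0); have A4 := exprn_ge0 4 (ltW A0).
have k1 : `|th| ^+ 3 * A ^+ 3 <= `|th| ^+ 2 * A ^+ 3 by rewrite ler_wpM2r// exprSr ler_piMr.
have k2 : 0 <= `|th| ^+ 2 * A by apply: mulr_ge0 => //; exact: ltW.
have k3 : 0 <= `|th| ^+ 2 * A ^+ 4 by exact: mulr_ge0.
have -> : `|th| ^+ 2 * A ^+ 2 + `|th| ^+ 3 * A ^+ 3 + (`|th| * (`|th| * A) + `|th| * (`|th| ^+ 2 * A ^+ 2)) * A =
  2 * (`|th| ^+ 3 * A ^+ 3) + 2 * (`|th| ^+ 2 * A ^+ 2) by ring.
have -> : 2 * (A + A ^+ 2 + A ^+ 3 + A ^+ 4) * `|th| ^+ 2 = 2 * (`|th| ^+ 2 * A) + 2 * (`|th| ^+ 2 * A ^+ 2) +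
  2 * (`|th| ^+ 2 * A ^+ 3) + 2 * (`|th| ^+ 2 * A ^+ 4) by ring.
by have [_ h3 _] := pad_le (`|th| ^+ 2 * A ^+ 2) k1 k2 k3.
Qed.

Lemma rem3_norm : C1c rem3 /\ (C1norm rem3 <= (KA * `|th| ^+ 3)%R%:E)%E.
Proof.
have [|h1 h2] := dilated_norm (a1 := `|th| ^+ 4 * A ^+ 4) (a2 := `|th| ^+ 3 * A ^+ 3)
  (d1 := `|th| ^+ 3 * A ^+ 3) (d2 := `|th| ^+ 2 * A ^+ 2) dcos2 dsin1 csin2 ccos1.
  move=> z hz; split.
  - exact: (le_trans (cos_taylor2_le z) (pw 4 hz)).
  - exact: (le_trans (sin_sub_id_le z) (pw 3 hz)).
  - by rewrite addrC -normrN opprB; exact: (le_trans (sin_sub_id_le z) (pw 3 hz)).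
  - exact: (le_trans (cos_sub1_le z) (pw 2 hz)).
split => //; apply: (le_trans h2); rewrite lee_fin /KA.
have t0 := normr_ge0 th; have A2 := exprn_ge0 2 (ltW A0); have t3 := exprn_ge0 3 t0.
have A3 := exprn_ge0 3 (ltW A0); have A4 := exprn_ge0 4 (ltW A0).
have k1 : `|th| ^+ 4 * A ^+ 4 <= `|th| ^+ 3 * A ^+ 4 by rewrite ler_wpM2r// exprSr ler_piMr.
have k2 : 0 <= `|th| ^+ 3 * A by apply: mulr_ge0 => //; exact: ltW.
have k3 : 0 <= `|th| ^+ 3 * A ^+ 2 by exact: mulr_ge0.
have -> : `|th| ^+ 4 * A ^+ 4 + `|th| ^+ 3 * A ^+ 3 +
    (`|th| * (`|th| ^+ 3 * A ^+ 3) + `|th| * (`|th| ^+ 2 * A ^+ 2)) * A =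
  2 * (`|th| ^+ 4 * A ^+ 4) + 2 * (`|th| ^+ 3 * A ^+ 3) by ring.
have -> : 2 * (A + A ^+ 2 + A ^+ 3 + A ^+ 4) * `|th| ^+ 3 = 2 * (`|th| ^+ 3 * A) + 2 * (`|th| ^+ 3 * A ^+ 2) +
  2 * (`|th| ^+ 3 * A ^+ 3) + 2 * (`|th| ^+ 3 * A ^+ 4) by ring.
by have [_ _ h3] := pad_le (`|th| ^+ 3 * A ^+ 3) k1 k2 k3.
Qed.

End RemainderNorms.

Section Cocycle.
Context {R : realType} {X : surface R} {D : leaf_data X} {N : norm_params R}.
Context {pr : fam D -> (X -> R[i]) -> R[i]} (cal : multipliers N pr).
Context (mu : {measure set (borel X) -> \bar R}) (hmu : mu setT = 1%E).
Context (T : nat -> pwmap X) (L : nat -> fam D -> fam D) (h : nat -> fam D) (g : nat -> X -> R).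
Context (mT : forall k, measurable_fun [set: borel X] (T k : borel X -> borel X)).
Context (hL : forall k, is_transfer_operator N pr (T k) (L k)).
Local Notation bb H x := (bnorm N H%R <= x%R%:E)%E.
Local Notation one := (fun=> 1 : R[i]).
Implicit Types (H K : fam D) (F : X -> R[i]).

Fixpoint Lc (j n : nat) H : fam D := if n is m.+1 then L (j + m) (Lc j m H) else H.
Fixpoint Tk (k : nat) (x : borel X) : borel X := if k is m.+1 then T m (Tk m x) else x.
Definition Sk (k : nat) (x : X) : R := \sum_(0 <= i < k) g i (Tk i x).

Context (A Kh Dc r : R) (A0 : 0 < A) (gC : forall k, C1fun (g k))
  (gA : forall k, (C1norm (r2c (g k)) <= A%:E)%E)
  (hB : forall k, inB N (h k)) (hK : forall k, bb (h k) Kh) (hS : forall k, L k (h k) = h k.+1)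
  (h1 : forall k, pr (h k) one = 1) (hg : forall k, pr (h k) (r2c (g k)) = 0)
  (h0 : represents pr (h 0%N) mu) (Dc0 : 0 < Dc) (r0 : 0 < r) (r1 : r < 1)
  (decay : forall j n H x, inB N H -> pr H one = 0 -> bb H x -> bb (Lc j n H) (Dc * r ^+ n * x)).

Lemma bb_mono H x y : x <= y -> bb H x -> bb H y.
Proof. by move=> xy hx; apply: (le_trans hx); rewrite lee_fin. Qed.

Lemma L_inB k H : inB N H -> inB N (L k H). Proof. by case: (hL k) => -[hl _ _ _] _ _; exact: hl. Qed.

Lemma L_add k H K : inB N H -> inB N K -> L k (fadd H K) = fadd (L k H) (L k K).
Proof. by case: (hL k) => -[_ hl _ _] _ _; exact: hl. Qed.

Lemma L_scale k z H : inB N H -> L k (fscale z H) = fscale z (L k H).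
Proof. by case: (hL k) => -[_ _ hl _] _ _; exact: hl. Qed.

Lemma LcS j n H : Lc j.+1 n (L j H) = Lc j n.+1 H.
Proof.
elim: n => [|n IH]; first by rewrite /= addn0.
by rewrite [LHS]/= IH [RHS]/= addnS addSn.
Qed.

Lemma Lc_inB j n H : inB N H -> inB N (Lc j n H).
Proof. by move=> hH; elim: n => [//|n IH]; exact: L_inB. Qed.

Lemma Lc_add j n H K : inB N H -> inB N K -> Lc j n (fadd H K) = fadd (Lc j n H) (Lc j n K).
Proof.
move=> hH hK'; elim: n => [//|n IH]; rewrite [LHS]/= IH L_add//; exact: Lc_inB.
Qed.

Lemma C1c_one : C1c (one : X -> R[i]). Proof. exact: C1c_cst. Qed.

Lemma zero_fam : (fun=> 0) = fscale 0 (h 0%N) :> fam D.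
Proof. by apply/funext => p; rewrite /fscale mul0r. Qed.

Lemma inB_zero : inB N ((fun=> 0) : fam D).
Proof. by rewrite zero_fam; exact: (in_scale cal). Qed.

Lemma pr_zero phi : C1c phi -> pr (fun=> 0) phi = 0.
Proof. by move=> hp; rewrite zero_fam (pr_scale cal _ (hB 0) hp) mul0r. Qed.

Lemma inB_sub H K : inB N H -> inB N K -> inB N (fsub H K).
Proof. by move=> hH hK'; rewrite fsubE; apply: (in_add cal) => //; exact: (in_scale cal). Qed.

Lemma pr_sub H K phi : inB N H -> inB N K -> C1c phi -> pr (fsub H K) phi = pr H phi - pr K phi.
Proof.
move=> hH hK' hp; have k := in_scale cal (-1) hK'.
by rewrite fsubE (pr_add cal hH k hp) (pr_scale cal _ hK' hp) mulN1r.
Qed.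

Lemma bb_sub H K x y : bb H x -> bb K y -> bb (fsub H K) (x + y).
Proof.
move=> hx hy; rewrite fsubE; apply: (nm_add cal hx).
by have := nm_scale cal (-1) hy; rewrite cabsN cabs1 mul1r.
Qed.

(** The sum of r^n over n >= 1. *)
Definition Q := r / (1 - r).

Lemma Q_ge0 : 0 <= Q. Proof. by apply: divr_ge0; [exact: ltW|rewrite subr_ge0 ltW]. Qed.

Lemma QE : (Q + 1) * r = Q.
Proof. by rewrite /Q; field; rewrite subr_eq0 eq_sym lt_eqF. Qed.

(* Geometric decay of the propagated errors, summed along the orbit. *)
Lemma propagate (v s : nat -> fam D) (W : R) : v 0%N = (fun=> 0) ->
  (forall k, v k.+1 = L k (fadd (v k) (s k))) -> (forall k, inB N (s k)) ->
  (forall k, pr (s k) one = 0) -> 0 <= W -> forall k, (forall j, (j < k)%N -> bb (s j) W) ->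
  inB N (v k) /\ forall n, bb (Lc k n (v k)) (W * Dc * Q * r ^+ n).
Proof.
move=> v0 vS sB s1 W0; have Q0 := Q_ge0.
elim=> [_|k IH hs].
  rewrite v0; split=> [|n]; first exact: inB_zero.
  apply: bb_mono (decay 0 n inB_zero (pr_zero C1c_one) (nm_zero cal)); rewrite mulr0.
  by apply: mulr_ge0; [apply: mulr_ge0 => //; apply: mulr_ge0 => //; exact: ltW|apply: exprn_ge0; exact: ltW].
have [|vB IHn] := IH; first by move=> j jk; apply: hs; exact: ltnW.
split=> [|n]; first by rewrite vS; apply: L_inB; exact: (in_add cal).
rewrite vS LcS Lc_add//; have d := decay k n.+1 (sB k) (s1 k) (hs k (ltnSn k)).
apply: bb_mono (nm_add cal (IHn n.+1) d).
have -> : W * Dc * Q * r ^+ n.+1 + Dc * r ^+ n.+1 * W = W * Dc * ((Q + 1) * r) * r ^+ n.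
  by rewrite exprS; ring.
by rewrite QE.
Qed.

Lemma mTk k : measurable_fun [set: borel X] (Tk k).
Proof.
elim: k => [|k IH]; first exact: measurable_id.
exact: (measurableT_comp (mT k) IH).
Qed.

Lemma SkS k x : Sk k.+1 x = Sk k x + g k (Tk k x).
Proof. by rewrite /Sk big_nat_recr. Qed.

Definition expi (y : R) : R[i] := cos y +i* sin y.

Lemma expiD y z : expi (y + z) = expi y * expi z.
Proof.
apply/eqP; rewrite eq_complex ReM ImM /= cosD sinD eqxx /=; apply/eqP; ring.
Qed.

Lemma gr2c k : C1c (r2c (g k)). Proof. by split; [exact: gC|exact: C1fun_cst]. Qed.

Local Notation span k := (span (N := N) (pr := pr) mu (Tk k)).

(** Equivariance along the orbit: each [h k] is represented by the image of the initial measure,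
    with density 1. It is the starting point for every representation below. *)
Lemma span_h k : span k (h k) one.
Proof.
elim: k => [|k IH].
  apply: (@span_eq _ _ _ _ _ _ _ _ (r2c (fun=> 1))) => //.
  apply: span_pos => //; first exact: rbm_cst.
  by move=> phi hp; rewrite h0//; apply: eq_cint => x _; rewrite mul1r.
by rewrite -hS; exact: (span_step cal hmu (mTk k) (mT k) (hL k) IH).
Qed.

Fixpoint yy (k : nat) : fam D :=
  if k is m.+1 then L m (fadd (yy m) (mul cal (r2c (g m)) (h m))) else fun=> 0.

Lemma span_ymid k : span k (yy k) (r2c (Sk k)) ->
  span k (fadd (yy k) (mul cal (r2c (g k)) (h k))) (r2c (Sk k.+1)).
Proof.
move=> IH; have s := span_add IH (span_mul cal (mTk k) (span_h k) (gr2c k)).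
apply: span_eq s => x; by rewrite mul1r /r2c SkS rmorphD.
Qed.

Lemma span_y k : span k (yy k) (r2c (Sk k)).
Proof.
elim: k => [|k IH].
  rewrite /= zero_fam; apply: span_eq (span_scale 0 (span_h 0)) => x.
  by rewrite mul0r /r2c /Sk big_geq.
exact: (span_step cal hmu (mTk k) (mT k) (hL k) (span_ymid IH)).
Qed.

Lemma mgh_inB k : inB N (mul cal (r2c (g k)) (h k)).
Proof. exact: (in_mul cal (gr2c k) (hB k)). Qed.

Lemma mgh_one k : pr (mul cal (r2c (g k)) (h k)) one = 0.
Proof.
rewrite (pr_mul cal (gr2c k) C1c_one (hB k)) -(hg k); congr (pr _ _).
by apply/funext => x; rewrite mulr1.
Qed.

Lemma y_one k : inB N (yy k) /\ pr (yy k) one = 0.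
Proof.
elim: k => [|k [yB y1]]; first by split; [exact: inB_zero|exact: pr_zero C1c_one].
have [B' _ _] := span_facts cal hmu (mTk k.+1) (span_y k.+1).
split => //; rewrite (span_one cal hmu (mTk k.+1) (span_y k.+1)).
rewrite -(span_one cal hmu (mTk k) (span_ymid (span_y k))) (pr_add cal yB (mgh_inB k) C1c_one).
by rewrite y1 mgh_one addr0.
Qed.

Section Theta.
Context (th : R) (th1 : `|th| <= 1).

Definition EE (k : nat) (x : X) : R[i] := expi (th * g k x).
Fixpoint uu (k : nat) : fam D := if k is m.+1 then L m (mul cal (EE m) (uu m)) else h 0%N.

Local Notation R1 k := (rem1 (g k) th).
Local Notation R2 k := (rem2 (g k) th).
Local Notation R3 k := (rem3 (g k) th).
Local Notation ith := ('i * th%:C).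

Lemma EE_R1 k : EE k = fun x => 1 + R1 k x.
Proof. by apply/funext => x; apply/eqP; rewrite eq_complex ReD ImD /= subrKC add0r !eqxx. Qed.

Lemma R1_R2 k : R1 k = fun x => R2 k x + ith * r2c (g k) x.
Proof.
apply/funext => x; apply/eqP; rewrite eq_complex !(ReD, ImD, ReM, ImM) /=.
by apply/andP; split; apply/eqP; ring.
Qed.

Lemma R2_R3 k : R2 k = fun x => R3 k x + (- (2^-1 * th ^+ 2))%:C * (r2c (g k) x * r2c (g k) x).
Proof.
apply/funext => x; apply/eqP; rewrite eq_complex !(ReD, ImD, ReM, ImM) /=.
by apply/andP; split; apply/eqP; ring.
Qed.

Lemma R1C k : C1c (R1 k). Proof. by have [] := rem1_norm (gC k) A0 (gA k) th1. Qed.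
Lemma R2C k : C1c (R2 k). Proof. by have [] := rem2_norm (gC k) A0 (gA k) th1. Qed.
Lemma R3C k : C1c (R3 k). Proof. by have [] := rem3_norm (gC k) A0 (gA k) th1. Qed.
Lemma EEC k : C1c (EE k).
Proof. rewrite EE_R1; apply: C1cD; [exact: C1c_one|exact: R1C]. Qed.

Lemma span_umid k : span k (uu k) (fun x => expi (th * Sk k x)) ->
  span k (mul cal (EE k) (uu k)) (fun x => expi (th * Sk k.+1 x)).
Proof.
move=> IH; apply: span_eq (span_mul cal (mTk k) IH (EEC k)) => x.
by rewrite SkS mulrDr expiD.
Qed.

Lemma span_u k : span k (uu k) (fun x => expi (th * Sk k x)).
Proof.
elim: k => [|k IH].
  apply: span_eq (span_h 0) => x; rewrite /Sk big_geq// mulr0 /expi cos0 sin0.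
  by apply/eqP; rewrite eq_complex /= !eqxx.
exact: (span_step cal hmu (mTk k) (mT k) (hL k) (span_umid IH)).
Qed.

Lemma uB k : inB N (uu k). Proof. by have [] := span_facts cal hmu (mTk k) (span_u k). Qed.

Definition cc (k : nat) : R[i] := pr (uu k) one.

Lemma ccE k : cc k = cint mu [set: borel X] (fun x => expi (th * Sk k x)).
Proof. exact: (span_one cal hmu (mTk k) (span_u k)). Qed.

(** The modulus is bounded crudely by adding real and imaginary parts; only a uniform bound is used
    later. *)
Lemma cc_le k : cabs (cc k) <= 2.
Proof.
rewrite ccE; have [_ [m1 m2] _] := span_facts cal hmu (mTk k) (span_u k).
apply: (le_trans (cabs_le _)); rewrite (_ : 2 = 1 + 1 :> R)//; apply: lerD.
- by apply: (exp_abs_le hmu m1) => x; rewrite ler_norml cos_geN1 cos_le1.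
- by apply: (exp_abs_le hmu m2) => x; exact: sin_max.
Qed.

Lemma ccS k : cc k.+1 = pr (uu k) (EE k).
Proof.
rewrite /cc (span_one cal hmu (mTk k.+1) (span_u k.+1)) -(span_one cal hmu (mTk k) (span_umid (span_u k))).
rewrite (pr_mul cal (EEC k) C1c_one (uB k)); congr (pr _ _).
by apply/funext => x; rewrite mulr1.
Qed.

Lemma cc_diff k : cc k.+1 - cc k = pr (uu k) (R1 k).
Proof. by rewrite ccS EE_R1 (pr_addf cal (uB k) C1c_one (R1C k)) addrC addKr. Qed.

(** [vv] is [uu] freed of its mass, and [zz] is [vv] freed of its first-order part. The families
    [ww] and [ss] are the increments that drive them; all have mass 0, so the contraction of the
    cocycle applies. *)
Definition vv k : fam D := fsub (uu k) (fscale (cc k) (h k)).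
Definition ww k : fam D :=
  fsub (fsub (mul cal (EE k) (uu k)) (uu k)) (fscale (cc k.+1 - cc k) (h k)).

Lemma chB z k : inB N (fscale z (h k)). Proof. exact: (in_scale cal). Qed.
Lemma vB k : inB N (vv k). Proof. by apply: inB_sub; [exact: uB|exact: chB]. Qed.
Lemma muB k : inB N (mul cal (EE k) (uu k)). Proof. exact: (in_mul cal (EEC k) (uB k)). Qed.
Lemma wB k : inB N (ww k).
Proof. by apply: inB_sub; [apply: inB_sub; [exact: muB|exact: uB]|exact: chB]. Qed.

Lemma v0 : vv 0 = fun=> 0.
Proof. by apply/funext => p; rewrite /vv /fsub /fscale /cc h1 mul1r subrr. Qed.

Lemma vS k : vv k.+1 = L k (fadd (vv k) (ww k)).
Proof.
have -> : fadd (vv k) (ww k) = fadd (mul cal (EE k) (uu k)) (fscale (- cc k.+1) (h k)).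
  by apply/funext => p; rewrite /fadd /vv /ww /fsub /fscale; ring.
rewrite (L_add k (muB k) (chB _ k)) (L_scale _ _ (hB k)) hS.
by apply/funext => p; rewrite /vv /fsub /fadd /fscale mulNr.
Qed.

Lemma w_one k : pr (ww k) one = 0.
Proof.
have c1 := C1c_one; rewrite (pr_sub (inB_sub (muB k) (uB k)) (chB _ k) c1).
rewrite (pr_sub (muB k) (uB k) c1) (pr_scale cal _ (hB k) c1) h1 mulr1.
rewrite (pr_mul cal (EEC k) c1 (uB k)).
have -> : (fun x => EE k x * 1) = EE k by apply/funext => x; rewrite mulr1.
by rewrite -ccS subrr.
Qed.

Lemma u_decomp k : uu k = fadd (vv k) (fscale (cc k) (h k)).
Proof. by apply/funext => p; rewrite /fadd /vv /fsub subrK. Qed.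

Definition zz k : fam D := fsub (vv k) (fscale (ith * cc k) (yy k)).
Definition ss k : fam D :=
  fsub (fsub (ww k) (fscale (ith * cc k) (mul cal (r2c (g k)) (h k))))
    (fscale (ith * (cc k.+1 - cc k)) (fadd (yy k) (mul cal (r2c (g k)) (h k)))).

Lemma ymB k : inB N (fadd (yy k) (mul cal (r2c (g k)) (h k))).
Proof. by apply: (in_add cal); [case: (y_one k)|exact: mgh_inB]. Qed.

Lemma sB k : inB N (ss k).
Proof.
apply: inB_sub; first by apply: inB_sub; [exact: wB|exact: (in_scale cal _ (mgh_inB k))].
exact: (in_scale cal _ (ymB k)).
Qed.

Lemma s_one k : pr (ss k) one = 0.
Proof.
have c1 := C1c_one; have [yB y1] := y_one k; have i1 := in_scale cal (ith * cc k) (mgh_inB k).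
rewrite (pr_sub (inB_sub (wB k) i1) (in_scale cal _ (ymB k)) c1).
rewrite (pr_sub (wB k) i1 c1) (pr_scale cal _ (mgh_inB k) c1) (pr_scale cal _ (ymB k) c1).
by rewrite (pr_add cal yB (mgh_inB k) c1) w_one mgh_one y1 addr0 !mulr0 !subr0.
Qed.

Lemma z0 : zz 0 = fun=> 0.
Proof. by rewrite /zz v0; apply/funext => p; rewrite /fsub /fscale /= mulr0 subrr. Qed.

Lemma zS k : zz k.+1 = L k (fadd (zz k) (ss k)).
Proof.
have -> : fadd (zz k) (ss k) = fadd (fadd (vv k) (ww k))
    (fscale (- (ith * cc k.+1)) (fadd (yy k) (mul cal (r2c (g k)) (h k)))).
  apply/funext => p; rewrite /zz /ss /fadd /fsub /fscale.
  move: (vv k p) (ww k p) (yy k p) (mul _ _ _ p) (cc k) (cc k.+1) => a b c d e f; ring.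
rewrite (L_add k (in_add cal (vB k) (wB k)) (in_scale cal _ (ymB k))) (L_scale _ _ (ymB k)) -vS.
by apply/funext => p; rewrite /zz /fsub /fadd /fscale /= mulNr.
Qed.

(* [mul 1 u - u] only vanishes on the unit balls of test functions. *)
Lemma s_decomp k : ss k = fadd (fadd (fadd (fsub (mul cal one (uu k)) (uu k)) (mul cal (R1 k) (vv k)))
    (fsub (fscale (cc k) (mul cal (R2 k) (h k))) (fscale (cc k.+1 - cc k) (h k))))
    (fscale (- (ith * (cc k.+1 - cc k))) (fadd (yy k) (mul cal (r2c (g k)) (h k)))).
Proof.
have e1 : mul cal (EE k) (uu k) = fadd (mul cal one (uu k)) (fadd (mul cal (R1 k) (vv k))
    (fscale (cc k) (fadd (mul cal (R2 k) (h k)) (fscale ith (mul cal (r2c (g k)) (h k)))))).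
  rewrite EE_R1 (mul_addf cal C1c_one (R1C k) (uB k)); congr (fadd _ _).
  rewrite {1}u_decomp (mul_add cal _ _ (R1C k)) (mul_scale cal _ _ (R1C k)); congr (fadd _ (fscale _ _)).
  rewrite {1}R1_R2 (mul_addf cal (R2C k) (C1cZ ith (gr2c k)) (hB k)).
  by rewrite (mul_scalef cal _ (gr2c k) (hB k)).
apply/funext => p; rewrite /ss /ww e1 /fadd /fsub /fscale.
move: (mul _ one _ p) (mul _ (R1 k) _ p) (mul _ (R2 k) _ p) (mul _ (r2c (g k)) _ p) (uu k p) (h k p) (yy k p)
  (cc k) (cc k.+1) => a b c d e f m n q; ring.
Qed.

(** An exact identity. The left side is the recursion; each term on the right will turn out to be
    O(th^3). The centring of [g] removes the first-order term, and the coefficient of [yy] comes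
    from i th times the first-order part i th c_k y_k of [vv], with i^2 = -1. *)
Lemma cc_main k : cc k.+1 - cc k + (th ^+ 2)%:C * cc k *
    ((2^-1)%:C * pr (h k) (fun x => r2c (g k) x * r2c (g k) x) + pr (yy k) (r2c (g k))) =
  pr (vv k) (R2 k) + ith * pr (zz k) (r2c (g k)) + cc k * pr (h k) (R3 k).
Proof.
have [yB _] := y_one k; have gg := C1cM (gr2c k) (gr2c k).
have e1 : pr (uu k) (R1 k) = pr (vv k) (R1 k) + cc k * pr (h k) (R1 k).
  by rewrite {1}u_decomp (pr_add cal (vB k) (chB _ k) (R1C k)) (pr_scale cal _ (hB k) (R1C k)).
have e2 : pr (vv k) (R1 k) = pr (vv k) (R2 k) + ith * pr (vv k) (r2c (g k)).
  by rewrite {1}R1_R2 (pr_addf cal (vB k) (R2C k) (C1cZ ith (gr2c k))) (pr_scalef cal _ (vB k) (gr2c k)).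
have e3 : pr (h k) (R1 k) = pr (h k) (R2 k).
  by rewrite {1}R1_R2 (pr_addf cal (hB k) (R2C k) (C1cZ ith (gr2c k))) (pr_scalef cal _ (hB k) (gr2c k)) hg mulr0 addr0.
have e4 : pr (h k) (R2 k) = pr (h k) (R3 k) + (- (2^-1 * th ^+ 2))%:C * pr (h k) (fun x => r2c (g k) x * r2c (g k) x).
  by rewrite {1}R2_R3 (pr_addf cal (hB k) (R3C k) (C1cZ _ gg)) (pr_scalef cal _ (hB k) gg).
have e5 : pr (zz k) (r2c (g k)) = pr (vv k) (r2c (g k)) - ith * cc k * pr (yy k) (r2c (g k)).
  by rewrite (pr_sub (vB k) (in_scale cal _ yB) (gr2c k)) (pr_scale cal _ yB (gr2c k)).
rewrite cc_diff e1 e2 e3 e4 e5.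
set a := pr (vv k) (R2 k); set b := pr (vv k) (r2c (g k)); set c := pr (h k) (R3 k).
set d := pr (h k) (fun x => _); set e := pr (yy k) _; set f := cc k.
have -> : (- (2^-1 * th ^+ 2))%:C = - ((2^-1)%:C * (th ^+ 2)%:C) :> R[i] by rewrite rmorphN rmorphM.
have i2 : 'i * 'i = -1 :> R[i] by rewrite -expr2 sqr_i.
have t2 : (th ^+ 2)%:C = th%:C * th%:C :> R[i] by rewrite -rmorphM expr2.
have -> : ith * (b - ith * f * e) = ith * b - ('i * 'i) * (th%:C * th%:C) * f * e by ring.
by rewrite i2 -t2; ring.
Qed.

Context (thp : 0 < `|th|) (Cm Cp : R) (Cm0 : 0 < Cm) (Cp0 : 0 < Cp).
Context (hCm : forall f A H x, 0 < A -> C1c f -> (C1norm f <= A%:E)%E -> inB N H -> bb H x ->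
    bb (mul cal f H) (Cm * A * x))
  (hCp : forall H x phi A, inB N H -> bb H x -> C1c phi -> 0 <= A -> (C1norm phi <= A%:E)%E ->
    cabs (pr H phi) <= Cp * x * A).

Local Notation KA := (KA A).
Local Notation al := `|th|.
(** Coefficients of powers of [|th|]: [uK] and [yK] bound [uu] and [yy] at order 0, [wK] and [vK]
    bound [ww] and [vv] at order 1, [dK], [sK] and [zK] bound the increments of [cc], [ss] and [zz]
    at order 2, and [eK] the error at order 3. The factor [Dc * Q] is the geometric sum of
    [propagate]. *)
Definition uK := 1 + 2 * Kh.
Definition wK := Cm * KA * uK + Cp * uK * KA * Kh.
Definition vK := wK * Dc * Q.
Definition yK := Cm * A * Kh * Dc * Q.
Definition dK := Cp * KA * (vK + 2 * Kh).
Definition sK := Cm * KA * vK + 2 * (Cm * KA * Kh) + dK * Kh + dK * (yK + Cm * A * Kh).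
Definition zK := sK * Dc * Q.
Definition eK := Cp * vK * KA + Cp * zK * A + 2 * (Cp * Kh * KA).

Lemma Kh0 : 0 <= Kh. Proof. exact: (nm_ge0 cal (hK 0)). Qed.
Let k0 : 0 <= KA. Proof. exact: ltW (KA_gt0 A0). Qed.
Let m0 : 0 <= Cm. Proof. exact: ltW. Qed.
Let p0 : 0 <= Cp. Proof. exact: ltW. Qed.
Let d0 : 0 <= Dc. Proof. exact: ltW. Qed.
Let a0 : 0 <= A. Proof. exact: ltW. Qed.
Let q0 : 0 <= Q. Proof. exact: Q_ge0. Qed.
Let kh0 := Kh0.
Let u0 : 0 <= uK. Proof. by apply: addr_ge0 => //; exact: mulr_ge0. Qed.
Let w0 : 0 <= wK.
Proof. by apply: addr_ge0; [apply: mulr_ge0 => //; exact: mulr_ge0|apply: mulr_ge0 => //; apply: mulr_ge0 => //; exact: mulr_ge0]. Qed.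
Let v0' : 0 <= vK. Proof. by apply: mulr_ge0 => //; exact: mulr_ge0. Qed.
Let y0 : 0 <= yK.
Proof. by apply: mulr_ge0 => //; apply: mulr_ge0 => //; apply: mulr_ge0 => //; exact: mulr_ge0. Qed.
Let dK0 : 0 <= dK.
Proof. by apply: mulr_ge0; [exact: mulr_ge0|apply: addr_ge0 => //; exact: mulr_ge0]. Qed.
Let sK0 : 0 <= sK.
Proof.
have e1 : 0 <= Cm * KA by exact: mulr_ge0.
apply: addr_ge0; last by apply: mulr_ge0 => //; apply: addr_ge0 => //; apply: mulr_ge0 => //; exact: mulr_ge0.
apply: addr_ge0; last exact: mulr_ge0.
by apply: addr_ge0; [exact: mulr_ge0|apply: mulr_ge0 => //; exact: mulr_ge0].
Qed.

Let ka1 : 0 < KA * al. Proof. by apply: mulr_gt0 => //; exact: KA_gt0. Qed.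
Let ka2 : 0 < KA * al ^+ 2. Proof. by apply: mulr_gt0; [exact: KA_gt0|exact: exprn_gt0]. Qed.

Lemma u_le k x : bb (vv k) x -> bb (uu k) (x + 2 * Kh).
Proof.
move=> hv; rewrite u_decomp; apply: (nm_add cal hv).
by apply: bb_mono (nm_scale cal (cc k) (hK k)); apply: ler_wpM2r => //; exact: cc_le.
Qed.

Lemma diff_le k : bb (vv k) 1 -> cabs (cc k.+1 - cc k) <= Cp * uK * (KA * al).
Proof.
move=> hv; rewrite cc_diff; have [rC rN] := rem1_norm (gC k) A0 (gA k) th1.
exact: (hCp (uB k) (u_le hv) rC (ltW ka1) rN).
Qed.

Lemma w_le k : bb (vv k) 1 -> bb (ww k) (al * wK).
Proof.
move=> hv; have [rC rN] := rem1_norm (gC k) A0 (gA k) th1.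
have e : fsub (mul cal (EE k) (uu k)) (uu k) = fadd (fsub (mul cal one (uu k)) (uu k)) (mul cal (R1 k) (uu k)).
  rewrite EE_R1 (mul_addf cal C1c_one rC (uB k)).
  by apply/funext => p; rewrite /fadd /fsub addrAC.
have b1 := nm_add cal (mul_one cal (uB k)) (hCm ka1 rC rN (uB k) (u_le hv)).
have b2 := nm_scale cal (cc k.+1 - cc k) (hK k).
apply: bb_mono (bb_sub _ b2); last by rewrite e; exact: b1.
have h2 := ler_wpM2r kh0 (diff_le hv).
have -> : al * wK = 0 + Cm * (KA * al) * (1 + 2 * Kh) + Cp * uK * (KA * al) * Kh.
  by rewrite /wK /uK; ring.
by rewrite lerD2l.
Qed.

(** The bound on [ww] presupposes that [vv] is at most 1, and the bound on [vv] sums the earlier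
    [ww]. Strong induction closes the loop as soon as [|th| * vK <= 1]. *)
Lemma v_small : al * vK <= 1 -> forall k, bb (vv k) (al * vK) /\ bb (ww k) (al * wK).
Proof.
move=> small; elim/ltn_ind => k IH.
have [|_ hv] := propagate v0 vS wB w_one (mulr_ge0 (ltW thp) w0) (k := k).
  by move=> j jk; case: (IH j jk).
have hv' : bb (vv k) (al * vK).
  have := hv 0%N; rewrite expr0 mulr1 /=; have -> : al * wK * Dc * Q = al * vK by rewrite /vK; ring.
  by [].
split; first exact: hv'.
by apply: w_le; exact: bb_mono small hv'.
Qed.

Lemma y_le k : bb (yy k) yK.
Proof.
have mg j : bb (mul cal (r2c (g j)) (h j)) (Cm * A * Kh) := hCm A0 (gr2c j) (gA j) (hB j) (hK j).
have W0 : 0 <= Cm * A * Kh by apply: mulr_ge0 => //; exact: mulr_ge0.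
have [_ hy] := propagate (v := yy) (s := fun j => mul cal (r2c (g j)) (h j)) erefl (fun=> erefl) mgh_inB mgh_one W0
  (k := k) (fun j _ => mg j).
by have := hy 0%N; rewrite expr0 mulr1.
Qed.

Context (small : al * vK <= 1).

(** One order better than [diff_le]: [vv] is now known to be of order [th], and [h k] does not see
    the linear term because [g] is centred. *)
Lemma diff2_le k : cabs (cc k.+1 - cc k) <= dK * al ^+ 2.
Proof.
have [hv _] := v_small small k; have [rC rN] := rem1_norm (gC k) A0 (gA k) th1.
have [rC2 rN2] := rem2_norm (gC k) A0 (gA k) th1.
have e1 : pr (uu k) (R1 k) = pr (vv k) (R1 k) + cc k * pr (h k) (R1 k).
  by rewrite {1}u_decomp (pr_add cal (vB k) (chB _ k) rC) (pr_scale cal _ (hB k) rC).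
have e3 : pr (h k) (R1 k) = pr (h k) (R2 k).
  by rewrite {1}R1_R2 (pr_addf cal (hB k) rC2 (C1cZ ith (gr2c k))) (pr_scalef cal _ (hB k) (gr2c k)) hg mulr0 addr0.
rewrite cc_diff e1 e3; apply: (le_trans (cabsD _ _)); rewrite cabsM.
have b1 := hCp (vB k) hv rC (ltW ka1) rN.
have b2 := hCp (hB k) (hK k) rC2 (ltW ka2) rN2.
have b3 := ler_pM (cabs_ge0 _) (cabs_ge0 _) (cc_le k) b2.
apply: (le_trans (lerD b1 b3)); rewrite le_eqVlt; apply/orP; left; apply/eqP.
by rewrite /dK; ring.
Qed.

Lemma s_le k : bb (ss k) (sK * al ^+ 2).
Proof.
have [hv _] := v_small small k; have [rC rN] := rem1_norm (gC k) A0 (gA k) th1.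
have [rC2 rN2] := rem2_norm (gC k) A0 (gA k) th1; have dl := diff2_le k.
have b1 := mul_one cal (uB k).
have b2 := hCm ka1 rC rN (vB k) hv.
have b3 := nm_scale cal (cc k) (hCm ka2 rC2 rN2 (hB k) (hK k)).
have b4 := nm_scale cal (cc k.+1 - cc k) (hK k).
have b5 := nm_scale cal (- (ith * (cc k.+1 - cc k))) (nm_add cal (y_le k) (hCm A0 (gr2c k) (gA k) (hB k) (hK k))).
rewrite s_decomp; apply: bb_mono (nm_add cal (nm_add cal (nm_add cal b1 b2) (bb_sub b3 b4)) b5).
rewrite cabsN !cabsM cabs_i mul1r cabs_real.
have c1 : cabs (cc k) * (Cm * (KA * al ^+ 2) * Kh) <= 2 * (Cm * (KA * al ^+ 2) * Kh).
  by apply: ler_wpM2r; [apply: mulr_ge0 => //; apply: mulr_ge0 => //; exact: ltW|exact: cc_le].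
have c2 := ler_wpM2r kh0 dl.
have y1 : 0 <= yK + Cm * A * Kh by apply: addr_ge0 => //; apply: mulr_ge0 => //; exact: mulr_ge0.
have c3 : al * cabs (cc k.+1 - cc k) <= 1 * (dK * al ^+ 2).
  by apply: ler_pM => //; exact: cabs_ge0.
have c4 := ler_wpM2r y1 c3.
have -> : sK * al ^+ 2 = 0 + Cm * (KA * al) * (al * vK) + (2 * (Cm * (KA * al ^+ 2) * Kh) + dK * al ^+ 2 * Kh) +
   1 * (dK * al ^+ 2) * (yK + Cm * A * Kh) by rewrite /sK; ring.
by apply: lerD => //; apply: lerD => //; exact: lerD.
Qed.

Lemma z_le k : bb (zz k) (zK * al ^+ 2).
Proof.
have a2 : 0 <= al ^+ 2 by exact: sqr_ge0.
have [_ hz] := propagate z0 zS sB s_one (mulr_ge0 sK0 a2) (k := k) (fun j _ => s_le j).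
have := hz 0%N; rewrite expr0 mulr1 /=.
by have -> : sK * al ^+ 2 * Dc * Q = zK * al ^+ 2 by rewrite /zK; ring.
Qed.

Lemma expansion_error k : cabs (cc k.+1 - cc k + (th ^+ 2)%:C * cc k *
    ((2^-1)%:C * pr (h k) (fun x => r2c (g k) x * r2c (g k) x) + pr (yy k) (r2c (g k)))) <=
  eK * al ^+ 3.
Proof.
have [hv _] := v_small small k.
have [rC2 rN2] := rem2_norm (gC k) A0 (gA k) th1; have [rC3 rN3] := rem3_norm (gC k) A0 (gA k) th1.
have ka3 : 0 <= KA * al ^+ 3 by apply: mulr_ge0 => //; exact: exprn_ge0.
have zB : inB N (zz k) by apply: inB_sub; [exact: vB|apply: (in_scale cal); case: (y_one k)].
have b1 := hCp (vB k) hv rC2 (ltW ka2) rN2.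
have b2 := hCp zB (z_le k) (gr2c k) a0 (gA k).
have b3 := hCp (hB k) (hK k) rC3 ka3 rN3.
have b4 := ler_pM (cabs_ge0 _) (cabs_ge0 _) (cc_le k) b3.
have b5 := ler_wpM2l (ltW thp) b2.
rewrite cc_main; apply: (le_trans (cabsD _ _)); rewrite cabsM.
apply: (le_trans (lerD (cabsD _ _) b4)); rewrite !cabsM cabs_i mul1r cabs_real.
apply: (le_trans (lerD (lerD b1 b5) (lexx _))); rewrite le_eqVlt; apply/orP; left; apply/eqP.
by rewrite /eK; ring.
Qed.

End Theta.

Definition bcoef k : R := 2^-1 * (\int[mu]_x (g k (Tk k x) * g k (Tk k x))) +
  \int[mu]_x (Sk k x * g k (Tk k x)).

Lemma rbm_gT k : @rbm _ (borel X) R (fun x => g k (Tk k x)).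
Proof. exact: (rbm_comp (mTk k) (C1fun_rbm (gC k))). Qed.

Lemma rbm_Sk k : @rbm _ (borel X) R (Sk k).
Proof. by rewrite /Sk; apply: rbm_sum => i; exact: rbm_gT. Qed.

Lemma cint_r2c (f : X -> R) : cint mu [set: borel X] (fun x => (f x)%:C) = (\int[mu]_x f x)%:C.
Proof.
rewrite /cint /cRe /cIm /=; congr (_ +i* _).
exact: (exp_cst hmu 0).
Qed.

Lemma bcoefE k : (bcoef k)%:C =
  (2^-1)%:C * pr (h k) (fun x => r2c (g k) x * r2c (g k) x) + pr (yy k) (r2c (g k)).
Proof.
have [_ _ hh] := span_facts cal hmu (mTk k) (span_h k).
have [_ _ hy] := span_facts cal hmu (mTk k) (span_y k).
rewrite (hh _ (C1cM (gr2c k) (gr2c k))) (hy _ (gr2c k)).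
have -> : (fun x : X => 1 * (r2c (g k) (Tk k x) * r2c (g k) (Tk k x))) =
    fun x => (g k (Tk k x) * g k (Tk k x))%:C.
  by apply/funext => x; rewrite mul1r /r2c rmorphM.
have -> : (fun x : X => r2c (Sk k) x * r2c (g k) (Tk k x)) = fun x => (Sk k x * g k (Tk k x))%:C.
  by apply/funext => x; rewrite /r2c rmorphM.
by rewrite !cint_r2c /bcoef rmorphD rmorphM.
Qed.

(** Expanding (S_n + g_n)^2 shows that [bcoef n] is half the increment of the second moment. *)
Lemma second_moment n : \int[mu]_x (Sk n x * Sk n x) = 2 * \sum_(0 <= k < n) bcoef k.
Proof.
elim: n => [|n IH].
  rewrite big_geq// mulr0 -[RHS](exp_cst hmu 0); apply: eq_Rintegral => x _.
  by rewrite /Sk big_geq// mulr0.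
rewrite big_nat_recr//= mulrDr -IH.
have rS := rbm_Sk n; have rg := rbm_gT n; have rSg := rbmM rS rg; have rgg := rbmM rg rg.
transitivity (\int[mu]_x (Sk n x * Sk n x + (2 * (Sk n x * g n (Tk n x)) + g n (Tk n x) * g n (Tk n x)))).
  by apply: eq_Rintegral => x _; rewrite SkS; ring.
rewrite (expD hmu (rbmM rS rS) (rbmD (rbmZ 2 rSg) rgg)) (expD hmu (rbmZ 2 rSg) rgg) (expZ hmu 2 rSg).
by rewrite /bcoef; field.
Qed.

Theorem expansion : exists C th0 : R, [/\ 0 < C, 0 < th0 <= 1, forall k, `|bcoef k| <= C &
  forall th, 0 < `|th| -> `|th| <= th0 -> forall k,
    cabs (cc th k.+1 - cc th k + (th ^+ 2)%:C * cc th k * (bcoef k)%:C) <= C * `|th| ^+ 3].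
Proof.
have [Cm Cm0 hCm] := mul_bound cal; have [Cp Cp0 hCp] := pr_bound cal.
have kh0 := Kh0; have q0 := Q_ge0.
pose v := vK Cm Cp; pose e := eK Cm Cp; pose bd := 2^-1 * (Cp * Kh * (3 * (A * A))) + Cp * yK Cm * A.
have bb0 k : `|bcoef k| <= bd.
  rewrite -cabs_real bcoefE; apply: (le_trans (cabsD _ _)); rewrite cabsM cabs_real ger0_norm ?invr_ge0//.
  have a0 := ltW A0; have a2 : 0 <= 3 * (A * A) by apply: mulr_ge0 => //; exact: mulr_ge0.
  have n2 := C1norm_mul (gr2c k) (gr2c k) a0 a0 (gA k) (gA k).
  have b1 := hCp _ _ _ _ (hB k) (hK k) (C1cM (gr2c k) (gr2c k)) a2 n2.
  have [yB _] := y_one k; have b2 := hCp _ _ _ _ yB (y_le Cm0 hCm k) (gr2c k) a0 (gA k).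
  by apply: lerD => //; apply: ler_wpM2l => //; rewrite invr_ge0.
have v1 : 0 < 1 + `|v| by rewrite ltr_wpDr.
(* The threshold makes [|th| <= 1] and [|th| * vK <= 1] at the same time. *)
exists (1 + `|e| + `|bd|), (1 + `|v|)^-1; split.
- by rewrite ltr_wpDr// ltr_wpDr.
- by rewrite invr_gt0 v1 /= invf_le1// lerDl.
- by move=> k; rewrite (le_trans (bb0 k))// (le_trans (ler_norm _))// lerDr addr_ge0.
move=> th thp ths k.
have i1 : (1 + `|v|)^-1 <= 1 by rewrite invf_le1// lerDl.
have th1 : `|th| <= 1 by exact: le_trans ths i1.
have small : `|th| * v <= 1.
  have h3 : `|th| * `|v| <= (1 + `|v|)^-1 * (1 + `|v|) by apply: ler_pM => //; rewrite lerDr.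
  rewrite mulVf ?gt_eqF// in h3; apply: le_trans h3; apply: ler_wpM2l => //; exact: ler_norm.
rewrite bcoefE; apply: (le_trans (expansion_error th1 thp Cm0 Cp0 hCm hCp small k)).
by apply: ler_wpM2r; [exact: exprn_ge0|rewrite (le_trans (ler_norm _))// addrAC lerDr addr_ge0].
Qed.

End Cocycle.

End FibreCocycleTheory.
Import FibreCocycleTheory.

(** * The pointwise ergodic theorem for bounded functions *)

Module ErgodicAverageTheory.

Section ErgodicTheorem.
Context d (T : measurableType d) (R : realType) (P : probability T R) (sg : T -> T).
Hypotheses (msg : measurable_fun [set: T] sg)
  (Pinv : forall A : set T, measurable A -> P (sg @^-1` A) = P A)
  (Perg : forall A : set T, measurable A -> sg @^-1` A = A -> P A = 0%E \/ P A = 1%E).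
Implicit Types f : T -> R.

Let P1 : P setT = 1%E := probability_setT P.

Definition bsum f (n : nat) (w : T) : R := \sum_(0 <= i < n) f (iter i sg w).

Lemma bsumS f n w : bsum f n.+1 w = f w + bsum f n (sg w).
Proof.
rewrite /bsum big_nat_recl//=; congr (_ + _); apply: eq_bigr => i _.
by rewrite -iterSr.
Qed.

(** The maximum of the Birkhoff sums of lengths 0 to [n], in the recursive form on which the maximal
    inequality rests. *)
Fixpoint maxsum f (n : nat) (w : T) : R :=
  if n is m.+1 then Num.max 0 (f w + maxsum f m (sg w)) else 0.

Lemma maxsum_ge0 f n w : 0 <= maxsum f n w.
Proof. by case: n => [|n]//=; rewrite le_max lexx. Qed.

Lemma maxsum_nd f n w : maxsum f n w <= maxsum f n.+1 w.
Proof.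
elim: n w => [|n IH] w; first exact: maxsum_ge0.
have h := IH (sg w); rewrite [leLHS]/= [leRHS]/= ge_max le_max lexx /= le_max.
by apply/orP; right; rewrite lerD2l.
Qed.

Lemma bsum_le_maxsum f n w : bsum f n w <= maxsum f n w.
Proof.
elim: n w => [|n IH] w; first by rewrite /bsum big_geq.
by rewrite bsumS /= le_max; apply/orP; right; rewrite lerD2l.
Qed.

Lemma rbm_maxsum f n : rbm f -> rbm (maxsum f n).
Proof.
move=> hf; elim: n => [|n [mM [M hM]]]; first exact: rbm_cst.
have [mf [K hK]] := rbmD hf (rbm_comp msg (conj mM (ex_intro _ M hM))).
split; first by apply: measurable_maxr => //; exact: measurable_cst.
exists K => w; have := hK w; rewrite /= => h.
have k0 : 0 <= K by apply: le_trans h.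
by rewrite /Num.max; case: ifP => // _; rewrite normr0.
Qed.

Definition maxset f n : set T := [set w | 0 < maxsum f n w].

Lemma maxset_measurable f n : rbm f -> measurable (maxset f n).
Proof.
move=> /(rbm_maxsum n)[mM _]; rewrite /maxset -[X in measurable X]setTI.
have := measurable_fun_ltr (measurable_cst (0 : R)) mM.
by move=> /(_ measurableT [set true]%classic); rewrite !setTI => h; exact: h.
Qed.

Lemma rbm_indic (A : set T) : measurable A -> rbm (\1_A : T -> R).
Proof.
move=> mA; split; first exact: measurable_indic.
by exists 1 => x; rewrite indicE; case: (x \in A); rewrite ?normr1 ?normr0.
Qed.

(* Garsia's pointwise inequality: f 1_{M_n > 0} >= M_n - M_n o sg. *)
Lemma maximal_ergodic f n : rbm f -> 0 <= \int[P]_w (f w * \1_(maxset f n) w).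
Proof.
move=> hf; have hM := rbm_maxsum n hf; have hS := rbm_comp msg hM.
have hI := rbm_indic (maxset_measurable n hf).
have e : \int[P]_w (maxsum f n w + -1 * (maxsum f n \o sg) w) = 0.
  rewrite (expD P1 hM (rbmZ _ hS)) (expZ P1 _ hS).
  have := exp_invariant msg P1 (Pinv) hM; rewrite /comp => ->.
  by rewrite mulN1r subrr.
rewrite -e; apply: (exp_le P1) => [||w]; first exact: rbmD hM (rbmZ _ hS).
  exact: rbmM.
rewrite /= mulN1r indicE; case: (boolP (w \in maxset f n)) => /=.
  rewrite inE /maxset /= mulr1 lerBlDr => M0.
  have {M0} : maxsum f n w <= f w + maxsum f n (sg w).
    case: n M0 {hM hS hI e} => [|n]; first by rewrite /= ltxx.
    have h := maxsum_nd f n (sg w).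
    rewrite [X in 0 < X -> _]/= lt_max ltxx /= => fM; rewrite [leLHS]/= max_r ?(ltW fM)//.
    by rewrite lerD2l.
  by [].
move=> /negP; rewrite inE /maxset /= => /negP; rewrite -leNgt => M0.
by rewrite mulr0 subr_le0 (le_trans M0)// maxsum_ge0.
Qed.

Definition unbounded_sums f : set T := [set w | forall m : nat, exists n, m%:R < maxsum f n w].

(** One step along the orbit changes the sums by at most the bound of [f], so it suffices to raise
    the threshold by an integer above [M]. *)
Lemma unbounded_sums_invariant f : rbm f -> sg @^-1` unbounded_sums f = unbounded_sums f.
Proof.
move=> [_ [M hM]]; have h w := hM w; apply/seteqP; split => w /= hw m.
- have [n hn] := hw (m + (Num.truncn M).+1)%N; exists n.+1 => /=; rewrite lt_max; apply/orP; right.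
  have := h w; rewrite ler_norml => /andP[h1 _]; rewrite natrD in hn.
  have := truncnS_gt M; lra.
- have [n hn] := hw (m + (Num.truncn M).+1)%N; case: n hn => [|n] /=; first by rewrite ltNge ler0n.
  rewrite lt_max ltNge ler0n /= => hn; exists n.
  have := h w; rewrite ler_norml => /andP[_ h1]; rewrite natrD in hn.
  have := truncnS_gt M; lra.
Qed.

Lemma unbounded_sums_measurable f : rbm f -> measurable (unbounded_sums f).
Proof.
move=> hf; have -> : unbounded_sums f = (\bigcap_(m in @setT nat) \bigcup_(n in @setT nat) [set w : T | m%:R < maxsum f n w])%classic.
  by apply/seteqP; split => w hw m; [move=> _; have [n hn] := hw m; exists n|have [n _ hn] := hw m I; exists n].
apply: bigcapT_measurable => m; apply: bigcupT_measurable => n.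
have [mM _] := rbm_maxsum n hf.
have := measurable_fun_ltr (measurable_cst (m%:R : R)) mM.
by move=> /(_ measurableT [set true]%classic); rewrite !setTI => h; exact: h.
Qed.

(** By ergodicity the alternative is that the maxima are unbounded almost surely. Then the sets
    [maxset f n] increase to full measure and the maximal inequality forces a nonnegative mean. *)
Lemma bounded_sums f : rbm f -> \int[P]_w f w < 0 ->
  {ae P, forall w, exists K : nat, forall n, bsum f n w <= K%:R}.
Proof.
move=> hf f0; have mU := unbounded_sums_measurable hf.
have [U0|U1] := Perg mU (unbounded_sums_invariant hf).
  exists (unbounded_sums f); split => // w /= hw; apply: contrapT => nu.
  apply: hw; move/existsNP: nu => [m /forallNP hm]; exists m => n.
  by apply: (le_trans (bsum_le_maxsum f n w)); rewrite leNgt; apply/negP; exact: hm.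
exfalso; have [mf [M hM]] := hf.
have M0 : 0 <= M by apply: le_trans (hM point).
have cvgP : P \o maxset f @ \oo --> P (\bigcup_(n in @setT nat) maxset f n)%classic.
  apply: nondecreasing_cvg_mu => [n||]; first exact: maxset_measurable.
    by apply: bigcupT_measurable => n; exact: maxset_measurable.
  apply: homo_leq => [A|B A C|n]; rewrite ?subsetEset//; first exact: subset_trans.
  by move=> w; rewrite /maxset /= => /lt_le_trans; apply; exact: maxsum_nd.
have PU : P (\bigcup_(n in @setT nat) maxset f n)%classic = 1%E.
  apply/eqP; rewrite eq_le -{1}P1 le_measure ?inE//=; last first.
    by apply: bigcupT_measurable => n; exact: maxset_measurable.
  rewrite -U1 le_measure ?inE//; first by apply: bigcupT_measurable => n; exact: maxset_measurable.
  by move=> w /(_ 0%N)[n hn]; exists n.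
rewrite PU in cvgP.
have key n : - M * (1 - fine (P (maxset f n))) <= \int[P]_w f w.
  have mS := maxset_measurable n hf; have hI := rbm_indic mS.
  have h1 := maximal_ergodic n hf.
  have e : \int[P]_w (\1_(maxset f n) w : R) = fine (P (maxset f n)).
    by rewrite /Rintegral integral_indic// setIT.
  have -> : \int[P]_w f w = \int[P]_w (f w * \1_(maxset f n) w) +
      \int[P]_w (f w * (1 + -1 * \1_(maxset f n) w)).
    rewrite -expD//; first by apply: eq_Rintegral => w _; ring.
      exact: rbmM.
    by apply: rbmM => //; apply: rbmD; [exact: rbm_cst|exact: rbmZ].
  apply: (le_trans _ (lerD h1 (lexx _))); rewrite add0r.
  have h2 : rbm (fun w => 1 + -1 * (\1_(maxset f n) w : R)) by apply: rbmD; [exact: rbm_cst|exact: rbmZ].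
  have <- : \int[P]_w (- M * (1 + -1 * (\1_(maxset f n) w : R))) = - M * (1 - fine (P (maxset f n))).
    rewrite (expZ P1 _ h2) (expD P1 (rbm_cst _ _) (rbmZ _ hI)) (exp_cst P1) (expZ P1 _ hI) e.
    by rewrite mulN1r.
  apply: (exp_le P1) => [||w]; [exact: rbmZ|exact: rbmM|].
  apply: ler_wpM2r; last by have := hM w; rewrite ler_norml => /andP[].
  by rewrite indicE; case: (w \in maxset f n); rewrite /= ?mulr1 ?mulr0 ?addr0 ?subrr.
have : 0 <= \int[P]_w f w.
  have c : (fun n => - M * (1 - fine (P (maxset f n)))) @ \oo --> - M * (1 - 1).
    apply: cvgM; first exact: cvg_cst.
    apply: cvgB; first exact: cvg_cst.
    by apply/fine_cvg; exact: cvgP.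
  rewrite subrr mulr0 in c; apply: (cvgr_to_le c); by near=> n; exact: key.
by rewrite leNgt f0.
Unshelve. all: by end_near. Qed.

Lemma ae_seq (Q : nat -> T -> Prop) : (forall k, {ae P, forall w, Q k w}) ->
  {ae P, forall w, forall k, Q k w}.
Proof.
move=> h; have : P.-negligible (\bigcup_(k in @setT nat) ~` [set w | Q k w])%classic.
  by apply: negligible_bigcup => k; exact: h.
apply: negligibleS => w /= /existsNP[k hk]; by exists k.
Qed.

Lemma ae_orbit (Q : T -> Prop) : {ae P, forall w, Q w} ->
  {ae P, forall w, forall n, Q (iter n sg w)}.
Proof.
move=> h; apply: ae_seq => n; elim: n => [//|n [N [mN N0 sub]]].
exists (sg @^-1` N); split; [|by rewrite Pinv|].
  by rewrite -[X in measurable X]setTI; exact: msg.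
by move=> w hw; apply: sub => k; apply: hw; rewrite /= -iterS iterSr.
Qed.

(** The function [f] minus its mean minus [e] has negative mean, so its sums are bounded above and,
    divided by [n], contribute at most [e] in the end. The values 1/(k+1) of [e] keep the
    exceptional sets countable in number. *)
Lemma birkhoff_upper f : rbm f ->
  {ae P, forall w, forall e : R, 0 < e ->
    \forall n \near \oo, bsum f n w / n%:R <= \int[P]_w f w + e}.
Proof.
move=> hf; set a := \int[P]_w f w.
have step k : {ae P, forall w, \forall n \near \oo, bsum f n w / n%:R <= a + 2 * k.+1%:R^-1}.
  have k0 : 0 < k.+1%:R^-1 :> R by rewrite invr_gt0.
  set e := k.+1%:R^-1 in k0 *.
  pose f' w := f w + - (a + e).
  have hf' : rbm f' by apply: rbmD => //; exact: rbm_cst.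
  have neg : \int[P]_w f' w < 0.
    by rewrite (expD P1 hf (rbm_cst _ _)) (exp_cst P1) -/a opprD addrA subrr add0r oppr_lt0.
  apply: filterS (bounded_sums hf' neg) => w [K hK].
  near=> n; have n0 : 0 < n%:R :> R by near: n; exists 1%N => // n /=; rewrite ltr0n.
  have Kn : K%:R <= e * n%:R.
    near: n; exists (Num.truncn (K%:R / e)).+1 => // n /= hn.
    rewrite mulrC -ler_pdivrMr// (le_trans (ltW (truncnS_gt _)))// ler_nat//.
  rewrite ler_pdivrMr//; have := hK n.
  have -> : bsum f' n w = bsum f n w - (a + e) * n%:R.
    rewrite /bsum /f' big_split /=; congr (_ + _).
    by rewrite sumr_const_nat subn0 -[LHS]mulr_natr mulNr.
  move: Kn; set x := bsum f n w; set y := n%:R; move: x y; move=> x y; lra.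
apply: filterS (ae_seq step) => w h e e0.
pose k := Num.truncn (2 / e).
have ke : 2 * k.+1%:R^-1 <= e.
  rewrite ler_pdivrMr// mulrC -ler_pdivrMr//; exact: ltW (truncnS_gt _).
have := h k; apply: filterS => n /le_trans; apply; by rewrite lerD2l.
Unshelve. all: by end_near. Qed.

Theorem pointwise_ergodic f : rbm f ->
  {ae P, forall w, bsum f n w / n%:R @[n --> \oo] --> \int[P]_w f w}.
Proof.
move=> hf; have hN := rbmZ (-1) hf.
apply: filterS2 (birkhoff_upper hf) (birkhoff_upper hN) => w h1 h2.
rewrite (expZ P1 _ hf) in h2.
apply/cvgrPdist_le => e e0; have := h1 e e0; have := h2 e e0.
apply: filterS2 => n.
have -> : bsum (fun x => -1 * f x) n w = - bsum f n w.
  by rewrite /bsum -sumrN; apply: eq_bigr => i _; rewrite mulN1r.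
rewrite mulNr mulN1r => k1 k2; rewrite ler_norml; move: k1 k2.
set x := _ / _; set y := \int[P]_w f w; move: x y => x y; lra.
Qed.

End ErgodicTheorem.

End ErgodicAverageTheory.
Import ErgodicAverageTheory.

(** * Characteristic function and tails of the normal law *)

Module NormalLawTheory.

Section NormalCharacteristicFunction.
Context {R : realType} (s : R) (s0 : 0 < s).
Local Notation p := (normal_pdf 0 s).
Local Notation leb := (@lebesgue_measure R).

Lemma s_neq0 : s != 0. Proof. by rewrite gt_eqF. Qed.

Lemma p_ge0 x : 0 <= p x. Proof. exact: normal_pdf_ge0. Qed.

Lemma normal_Rintegral (f : R -> R) : measurable_fun [set: R] f ->
  \int[normal_prob 0 s]_y f y = \int[leb]_y (p y * f y).
Proof.
move=> mf; apply: (@weighted_Rintegral _ _ _ _ _ leb id p) => //.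
- exact: measurable_normal_pdf.
- exact: p_ge0.
move=> A mA; rewrite /normal_prob [LHS]integral_mkcond.
apply: eq_integral => x _.
by rewrite patchE indicE; case: (x \in A); rewrite /= ?mule1 ?mule0.
Qed.

Lemma is_derive_p (x : R) : is_derive x 1 p (- (x / s ^+ 2) * p x).
Proof.
have s2 : s ^+ 2 != 0 by rewrite expf_neq0// s_neq0.
have e : p = fun y => normal_peak s * expR (- (2 * s ^+ 2)^-1 * y ^+ 2).
  apply/funext => y; rewrite (normal_pdfE 0 s_neq0) /normal_fun subr0; congr (_ * expR _).
  by rewrite !mulNr; congr (- _); rewrite mulrC; congr (_^-1 * _); rewrite -mulr_natl.
have d1 : is_derive x 1 (fun y : R => - (2 * s ^+ 2)^-1 * y ^+ 2) (- (x / s ^+ 2)).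
  have k : is_derive x 1 (fun y : R => 0 + - (2 * s ^+ 2)^-1 * y ^+ 2) (0 + 2 * - (2 * s ^+ 2)^-1 * x).
    by apply: is_derive_add_sqr; exact: is_derive_cst.
  have -> : (fun y : R => - (2 * s ^+ 2)^-1 * y ^+ 2) = fun y => 0 + - (2 * s ^+ 2)^-1 * y ^+ 2.
    by apply/funext => y; rewrite add0r.
  by apply: (is_derive_eq k); field; rewrite ?s_neq0//.
have d2 := is_derive1_comp (f := expR) (g := fun y : R => - (2 * s ^+ 2)^-1 * y ^+ 2)
  (is_derive_expR _) d1.
have d3 : is_derive x 1 (fun y => normal_peak s * expR (- (2 * s ^+ 2)^-1 * y ^+ 2))
  (normal_peak s *: (expR (- (2 * s ^+ 2)^-1 * x ^+ 2) * - (x / s ^+ 2))) := is_deriveZ _ d2.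
rewrite {2}e; rewrite e; apply: (is_derive_eq d3); rewrite /GRing.scale /=; ring.
Qed.

Lemma expR_ge_id (z : R) : z <= expR z.
Proof. by rewrite (le_trans _ (expR_ge1Dx z))// lerDr. Qed.

(* y^2 p(y) is dominated by a multiple of the density of N(0, 2 s^2). *)
Lemma sqr_p_integrable : leb.-integrable [set: R] (fun y => (y ^+ 2 * p y)%:E).
Proof.
pose s' := s * Num.sqrt 2.
have s2 : s ^+ 2 != 0 by rewrite expf_neq0// s_neq0.
have s'0 : s' != 0 by rewrite mulf_neq0 ?s_neq0// gt_eqF// sqrtr_gt0.
have s'2 : s' ^+ 2 = 2 * s ^+ 2 by rewrite exprMn sqr_sqrtr// mulrC.
(* With z = y^2 / (4 s^2) the density is a multiple of e^(-2z). One factor e^(-z) absorbs y^2, since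
   [z * expR (- z) <= 1], and the other is the Gaussian of deviation [s']. *)
pose C := 4 * s ^+ 2 * (normal_peak s / normal_peak s').
have := integrableZl measurableT C (integrable_normal_pdf 0 s').
apply: le_integrable => //.
  apply/measurable_EFinP; apply: measurable_funM; last exact: measurable_normal_pdf.
  by apply: measurable_funX; exact: measurable_id.
move=> y _; rewrite -EFinM /= lee_fin.
have pk := normal_peak_gt0 s_neq0; have pk' := normal_peak_gt0 s'0.
have C0 : 0 <= C by rewrite /C; apply: mulr_ge0; [apply: mulr_ge0 => //; exact: sqr_ge0|apply: divr_ge0; exact: ltW].
rewrite !ger0_norm; last 2 first.
- by apply: mulr_ge0; [exact: C0|exact: normal_pdf_ge0].
- by apply: mulr_ge0; [exact: sqr_ge0|exact: p_ge0].
rewrite (normal_pdfE 0 s_neq0) (normal_pdfE 0 s'0) /normal_fun !subr0 s'2.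
set z := y ^+ 2 / (4 * s ^+ 2).
have z0 : 0 <= z by apply: divr_ge0; [exact: sqr_ge0|apply: mulr_ge0; [by []|exact: sqr_ge0]].
have -> : - y ^+ 2 / (s ^+ 2 *+ 2) = - z - z by rewrite /z -mulr_natl; field; rewrite ?s_neq0//.
have -> : - y ^+ 2 / (2 * s ^+ 2 *+ 2) = - z by rewrite /z -mulr_natl; field; rewrite ?s_neq0//.
have -> : y ^+ 2 = 4 * s ^+ 2 * z by rewrite /z; field; rewrite ?s_neq0//.
have -> : C * (normal_peak s' * expR (- z)) = 4 * s ^+ 2 * normal_peak s * expR (- z).
  by rewrite /C; field; rewrite ?s_neq0 ?(lt0r_neq0 pk')//.
rewrite expRD.
have k : z * expR (- z) <= 1 by rewrite expRN ler_pdivrMr ?expR_gt0// mul1r expR_ge_id.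
have -> : 4 * s ^+ 2 * z * (normal_peak s * (expR (- z) * expR (- z))) =
  4 * s ^+ 2 * normal_peak s * expR (- z) * (z * expR (- z)) by ring.
rewrite ler_piMr//; apply: mulr_ge0; [apply: mulr_ge0; [apply: mulr_ge0 => //; exact: sqr_ge0|exact: ltW]|exact: expR_ge0].
Qed.

Lemma sqr_p_le y : y ^+ 2 * p y <= 2 * s ^+ 2 * normal_peak s.
Proof.
have s2 : s ^+ 2 != 0 by rewrite expf_neq0// s_neq0.
have pk := normal_peak_gt0 s_neq0.
rewrite (normal_pdfE 0 s_neq0) /normal_fun subr0.
set z := y ^+ 2 / (2 * s ^+ 2).
have -> : - y ^+ 2 / (s ^+ 2 *+ 2) = - z by rewrite /z -mulr_natl; field; rewrite ?s_neq0//.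
have -> : y ^+ 2 * (normal_peak s * expR (- z)) = 2 * s ^+ 2 * normal_peak s * (z * expR (- z)).
  by rewrite /z; field; rewrite ?s_neq0//.
rewrite ler_piMr//; first by apply: mulr_ge0; [apply: mulr_ge0 => //; exact: sqr_ge0|exact: ltW].
by rewrite expRN ler_pdivrMr ?expR_gt0// mul1r expR_ge_id.
Qed.

Lemma p_decay (n y c : R) : 1 <= n -> n ^+ 2 * p y <= c -> p y <= c * n^-1.
Proof.
move=> n1 h; have n0 : 0 < n by exact: lt_le_trans ltr01 n1.
rewrite ler_pdivlMr//; apply: le_trans h; rewrite mulrC ler_wpM2r ?p_ge0//.
by rewrite expr2 ler_peMr// ltW.
Qed.

Let mcos (t a : R) : measurable_fun [set: R] (fun y : R => cos (t * y + a)).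
Proof.
apply: continuous_measurable_fun => y.
apply: (cvg_comp (fun y : R => t * y + a) (@cos R)); last exact: continuous_cos.
by apply: cvgD; [apply: cvgM; [exact: cvg_cst|exact: cvg_id]|exact: cvg_cst].
Qed.

Lemma p_integrable_dom (f : R -> R) (a b : R) : measurable_fun [set: R] f -> 0 <= a -> 0 <= b ->
  (forall y, `|f y| <= a + b * y ^+ 2) -> leb.-integrable [set: R] (EFin \o (fun y => p y * f y)).
Proof.
move=> mf a0 b0 h.
have i1 := integrableZl measurableT a (integrable_normal_pdf 0 s).
have i2 := integrableZl measurableT b sqr_p_integrable.
have := integrableD measurableT i1 i2; apply: le_integrable => //.
  apply/measurable_EFinP; apply: measurable_funM => //; exact: measurable_normal_pdf.
move=> y _; rewrite /= lee_fin normrM (ger0_norm (p_ge0 y)).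
rewrite (le_trans _ (ler_norm _))//.
have -> : a * p y + b * (y ^+ 2 * p y) = p y * (a + b * y ^+ 2) by ring.
exact: (ler_wpM2l (p_ge0 y) (h y)).
Qed.

(** With the phase [a], real integrals carry the whole characteristic function, the sine being a
    cosine of shifted phase. *)
Definition chi (a t : R) : R := \int[leb]_y (p y * cos (t * y + a)).
Definition chi' (a t : R) : R := \int[leb]_y (p y * (- (y * sin (t * y + a)))).

Let mysin (t a : R) : measurable_fun [set: R] (fun y : R => - (y * sin (t * y + a))).
Proof.
apply: continuous_measurable_fun => y; apply: cvgN; apply: cvgM; first exact: cvg_id.
apply: (cvg_comp (fun y : R => t * y + a) (@sin R)); last exact: continuous_sin.
by apply: cvgD; [apply: cvgM; [exact: cvg_cst|exact: cvg_id]|exact: cvg_cst].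
Qed.

Let icos t a : leb.-integrable [set: R] (EFin \o (fun y => p y * cos (t * y + a))).
Proof.
apply: (p_integrable_dom (a := 1) (b := 0)) => // y.
by rewrite mul0r addr0 ler_norml cos_geN1 cos_le1.
Qed.

Let isin t a : leb.-integrable [set: R] (EFin \o (fun y => p y * (- (y * sin (t * y + a))))).
Proof.
apply: (p_integrable_dom (a := 1) (b := 1)) => // y; rewrite normrN normrM mul1r.
have k1 : `|y| * `|sin (t * y + a)| <= `|y| by rewrite ler_piMr// sin_max.
apply: (le_trans k1); rewrite -(real_normK (num_real y)); have := sqr_ge0 (`|y| - 2^-1).
have := normr_ge0 y; move: `|y| => z z0 h; nra.
Qed.

Lemma cos_increment (x h : R) : `|cos (x + h) - cos x + h * sin x| <= h ^+ 2 *+ 2.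
Proof.
have -> : cos (x + h) - cos x + h * sin x = cos x * (cos h - 1) - sin x * (sin h - h).
  by rewrite cosD; ring.
have key (y : R) : `|sin y - y| <= `|y| ^+ 2.
  rewrite [leRHS]expr2; have d (z : R) : is_derive z 1 (fun y => sin y - y) (cos z - 1).
    by apply: is_derive_sub_id; exact: is_derive_sin.
  apply: (mean_value_at0 d); first by rewrite sin0 subrr.
  move=> z zy; apply: le_trans zy; rewrite -[leRHS]mul1r.
  have d2 (w : R) : is_derive w 1 (fun y => cos y - 1) (- sin w).
    by apply: is_derive_add_cst; exact: is_derive_cos.
  apply: (mean_value_at0 d2); first by rewrite cos0 subrr.
  by move=> w _; rewrite normrN sin_max.
have c1 : `|cos x| <= 1 by rewrite ler_norml cos_geN1 cos_le1.
have n2 : `|h| ^+ 2 = h ^+ 2 by rewrite real_normK// num_real.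
rewrite (le_trans (ler_normB _ _))// !normrM mulr2n -n2; apply: lerD.
- by rewrite -[leRHS]mul1r; apply: ler_pM => //; exact: cos_sub1_le.
- by rewrite -[leRHS]mul1r; apply: ler_pM => //; first [exact: sin_max|exact: key].
Qed.

(** Differentiation under the integral by a direct estimate: the quadratic remainder of the cosine
    is dominated by a multiple of the second moment of the Gaussian. *)
Lemma is_derive_chi (a t : R) : is_derive t 1 (chi a) (chi' a t).
Proof.
pose C := \int[leb]_y (p y * (2 * y ^+ 2)).
have iC : leb.-integrable [set: R] (EFin \o (fun y => p y * (2 * y ^+ 2))).
  apply: (p_integrable_dom (a := 0) (b := 2)) => // [|y].
    by apply: measurable_funM; [exact: measurable_cst|apply: measurable_funX; exact: measurable_id].
  by rewrite add0r ger0_norm// mulr_ge0// sqr_ge0.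
have C0 : 0 <= C.
  rewrite /C /Rintegral fine_ge0//; apply: integral_ge0 => y _.
  by rewrite lee_fin mulr_ge0 ?p_ge0// mulr_ge0// sqr_ge0.
have main (h : R) : `|chi a (t + h) - chi a t - h * chi' a t| <= C * h ^+ 2.
  have j1 : leb.-integrable [set: R] (EFin \o (fun y => p y * cos ((t + h) * y + a) -
      p y * cos (t * y + a))) by exact: (integrableB measurableT (icos _ _) (icos _ _)).
  have j2 : leb.-integrable [set: R] (EFin \o (fun y => h * (p y * (- (y * sin (t * y + a)))))).
      exact: (integrableZl measurableT h (isin _ _)).
  have e : chi a (t + h) - chi a t - h * chi' a t = \int[leb]_y
     (p y * cos ((t + h) * y + a) - p y * cos (t * y + a) - h * (p y * (- (y * sin (t * y + a))))).
    by rewrite (RintegralB measurableT j1 j2) (RintegralB measurableT (icos _ _) (icos _ _))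
      (RintegralZl h measurableT (isin _ _)).
  rewrite e; have ie : leb.-integrable [set: R] (EFin \o (fun y => p y * cos ((t + h) * y + a) -
      p y * cos (t * y + a) - h * (p y * (- (y * sin (t * y + a)))))).
    exact: (integrableB measurableT j1 j2).
  apply: (le_trans (le_normr_Rintegral measurableT ie)).
  rewrite /C [leRHS]mulrC -RintegralZl//; apply: le_Rintegral => //.
  - exact: integrable_abse ie.
  - exact: (integrableZl measurableT (h ^+ 2) iC).
  move=> y _; have -> : p y * cos ((t + h) * y + a) - p y * cos (t * y + a) - h * (p y * - (y * sin (t * y + a))) =
     p y * (cos ((t * y + a) + h * y) - cos (t * y + a) + (h * y) * sin (t * y + a)).
    have -> : (t + h) * y + a = (t * y + a) + h * y by ring.
    by ring.
  rewrite normrM (ger0_norm (p_ge0 y)) [leRHS]mulrCA; apply: ler_wpM2l; first exact: p_ge0.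
  apply: (le_trans (cos_increment _ _)); rewrite exprMn -mulr_natl.
  by rewrite le_eqVlt; apply/orP; left; apply/eqP; ring.
apply: (@is_dwithin_is_derive _ _ (t - 1) (t + 1)); first by apply/andP; split; lra.
move=> e e0; rewrite near_withinE; near=> u => _.
have := main (u - t); rewrite (addrC t (u - t)) subrK => /le_trans; apply.
rewrite -(real_normK (num_real (u - t))) expr2 mulrA; apply: ler_wpM2r => //.
near: u; have C1 : 0 < C + 1 by lra.
have d0 : 0 < e / (C + 1) by exact: divr_gt0.
exists (e / (C + 1)) => //= u /= hu; have : `|u - t| <= e / (C + 1) by rewrite distrC ltW.
move=> /(ler_wpM2l C0) /le_trans; apply; rewrite mulrCA ler_piMr ?(ltW e0)//.
by rewrite ler_pdivrMr// mul1r; lra.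
Unshelve. all: by end_near. Qed.

(* Integration by parts: y p(y) = - s^2 p'(y). *)
Lemma chi_ode (a t : R) : chi' a t = - (s ^+ 2 * t) * chi a t.
Proof.
pose F y := p y * sin (t * y + a).
pose f y := s ^- 2 * (p y * (- (y * sin (t * y + a)))) + t * (p y * cos (t * y + a)).
have s2 : s ^+ 2 != 0 by rewrite expf_neq0// s_neq0.
have dF (y : R) : is_derive y 1 F (f y).
  have d1 : is_derive y 1 (fun y : R => t * y + a) t.
    apply: is_derive_add_cst; have := is_deriveZ t (is_derive_id y 1).
    by move/is_derive_eq; apply; rewrite /GRing.scale /= mulr1.
  have d2 := is_derive1_comp (f := @sin R) (g := fun y : R => t * y + a) (is_derive_sin _) d1.
  have d3 : is_derive y 1 F (p y *: (cos (t * y + a) * t) + sin (t * y + a) *: (- (y / s ^+ 2) * p y)) :=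
    is_deriveM (is_derive_p y) d2.
  by apply: (is_derive_eq d3); rewrite /f /GRing.scale /=; field; rewrite ?s_neq0//.
have cF : continuous F by move=> y; apply: differentiable_continuous; apply/derivable1_diffP; exact: (@ex_derive _ _ _ _ _ _ _ (dF y)).
have i1 := integrableZl measurableT (s ^- 2) (isin t a).
have i2 := integrableZl measurableT t (icos t a).
have if_ : leb.-integrable [set: R] (EFin \o f) by exact: (integrableD measurableT i1 i2).
have cp : continuous p by exact: continuous_normal_pdf s_neq0.
have clin : continuous (fun y : R => t * y + a).
  by move=> y; apply: cvgD; [apply: cvgM; [exact: cvg_cst|exact: cvg_id]|exact: cvg_cst].
have csn : continuous (fun y : R => sin (t * y + a)).
  by move=> y; apply: (cvg_comp (fun y : R => t * y + a) (@sin R)); [exact: clin|exact: continuous_sin].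
have ccs : continuous (fun y : R => cos (t * y + a)).
  by move=> y; apply: (cvg_comp (fun y : R => t * y + a) (@cos R)); [exact: clin|exact: continuous_cos].
have cf : continuous f.
  move=> y; apply: cvgD; apply: cvgM; try exact: cvg_cst; apply: cvgM; try exact: cp.
  - by apply: cvgN; apply: cvgM; [exact: cvg_id|exact: csn].
  - exact: ccs.
(* The integral of [f] over the line is the limit of the differences of [F] at the ends of growing
   intervals, and these vanish because [p] decays at least like the inverse of the distance. *)
have ftc n : (\int[leb]_(y in `[(- n.+1%:R : R)%R, (n.+1%:R : R)%R]) (f y)%:E = (F n.+1%:R - F (- n.+1%:R))%R%:E)%E.
  have n0 : - n.+1%:R < n.+1%:R :> R by rewrite gtrN.
  rewrite (@continuous_FTC2 _ f F)//.
  - exact: continuous_subspaceT.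
  - split; first by move=> y _; exact: (@ex_derive _ _ _ _ _ _ _ (dF y)).
      by apply: cvg_at_right_filter; exact: cF.
    by apply: cvg_at_left_filter; exact: cF.
  - by move=> y _; rewrite derive1E; exact: (@derive_val _ _ _ _ _ _ _ (dF y)).
have lim1 : (fun n => \int[leb]_(y in `[(- n.+1%:R : R)%R, (n.+1%:R : R)%R]) (f y)%:E)%E @ \oo --> (\int[leb]_y (f y)%:E)%E.
  pose f_ n y := ((f y)%:E * (\1_(`[(- n.+1%:R : R)%R, (n.+1%:R : R)%R]%classic : set R) y)%:E)%E.
  have -> : (fun n => \int[leb]_(y in `[(- n.+1%:R : R)%R, (n.+1%:R : R)%R]) (f y)%:E)%E = (fun n => \int[leb]_y f_ n y)%E.
    apply/funext => n; rewrite integral_mkcond; apply: eq_integral => y _.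
    by rewrite patchE /f_ indicE; case: (y \in _); rewrite /= ?mule1 ?mule0.
  have [] // := @dominated_convergence _ _ _ leb setT measurableT f_ (fun y => (f y)%:E) (fun y => `|(f y)%:E|%E).
  - move=> n; apply: emeasurable_funM; first by apply/measurable_EFinP; exact: continuous_measurable_fun.
    by apply/measurable_EFinP; exact: measurable_indic.
  - by apply/measurable_EFinP; exact: continuous_measurable_fun.
  - apply: aeW => y _; apply: cvg_near_cst; exists (Num.truncn `|y|).+1 => // n /= hn.
    rewrite /f_ indicE mem_set ?mule1//=; rewrite in_itv/= -ler_norml.
    by rewrite (le_trans (ltW (truncnS_gt _)))// ler_nat (leq_trans hn).
  - exact: integrable_abse.
  - apply: aeW => y n _; rewrite /f_ indicE; case: (y \in _); rewrite /= ?mulr1 ?mulr0 ?normr0 lee_fin//.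
have pb y : `|F y| <= p y.
  by rewrite normrM (ger0_norm (p_ge0 y)) ler_piMr ?p_ge0// sin_max.
have lim2 : (fun n => (F n.+1%:R - F (- n.+1%:R))) @ \oo --> (0 : R).
  pose c := 2 * (2 * s ^+ 2 * normal_peak s).
  apply: (@squeeze_cvgr _ _ _ _ (fun n => - (c * n.+1%:R^-1)) (fun n => c * n.+1%:R^-1)).
  - apply: nearW => n; rewrite -ler_norml (le_trans (ler_normB _ _))//.
    have n1 : 1 <= n.+1%:R :> R by rewrite ler1n.
    have n0 : 0 < n.+1%:R :> R by rewrite ltr0n.
    have b1 := sqr_p_le n.+1%:R; have b2 := sqr_p_le (- n.+1%:R).
    have q1 := p_decay n1 b1; rewrite sqrrN in b2; have q2 := p_decay n1 b2.
    have -> : c * n.+1%:R^-1 = 2 * s ^+ 2 * normal_peak s * n.+1%:R^-1 + 2 * s ^+ 2 * normal_peak s * n.+1%:R^-1.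
      by rewrite /c; ring.
    by apply: lerD; [exact: le_trans (pb _) q1|exact: le_trans (pb _) q2].
  - rewrite -[0]oppr0 -[0 in X in _ --> X](mulr0 c); apply: cvgN; apply: cvgM; first exact: cvg_cst.
    exact: cvg_harmonic.
  - rewrite -[0](mulr0 c); apply: cvgM; first exact: cvg_cst.
    exact: cvg_harmonic.
have int0 : (\int[leb]_y (f y)%:E = 0)%E.
  have lim3 : (fun n => \int[leb]_(y in `[(- n.+1%:R : R)%R, (n.+1%:R : R)%R]) (f y)%:E)%E @ \oo --> (0 : \bar R)%E.
    rewrite (_ : (fun n => _) = (fun n => (F n.+1%:R - F (- n.+1%:R))%R%:E)); last by apply/funext => n; exact: ftc.
    by apply: cvg_EFin; [exact: nearW|exact: lim2].
  exact: (cvg_unique _ lim1 lim3).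
have : \int[leb]_y f y = 0 by rewrite /Rintegral int0.
have -> : \int[leb]_y f y = s ^- 2 * chi' a t + t * chi a t.
  rewrite /f (RintegralD measurableT i1 i2) (RintegralZl _ _ (isin t a))// (RintegralZl _ _ (icos t a))//.
move=> /eqP; rewrite addr_eq0 => /eqP e.
have -> : chi' a t = s ^+ 2 * (s ^- 2 * chi' a t) by rewrite mulrA divff// mul1r.
by rewrite e; ring.
Qed.

(** By [chi_ode], multiplying [chi a] by the inverse Gaussian factor gives a function of zero
    derivative; its value at 0 is [cos a]. *)
Lemma chiE (a t : R) : chi a t = cos a * expR (- (s ^+ 2 * t ^+ 2 / 2)).
Proof.
pose psi (u : R) := chi a u * expR (s ^+ 2 / 2 * u ^+ 2).
have d (u : R) : is_derive u 1 psi 0.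
  have k : is_derive u 1 (fun y : R => 0 + s ^+ 2 / 2 * y ^+ 2) (0 + 2 * (s ^+ 2 / 2) * u).
    by apply: is_derive_add_sqr; exact: is_derive_cst.
  have k1 : is_derive u 1 (fun y : R => s ^+ 2 / 2 * y ^+ 2) (s ^+ 2 * u).
    have -> : (fun y : R => s ^+ 2 / 2 * y ^+ 2) = fun y => 0 + s ^+ 2 / 2 * y ^+ 2.
      by apply/funext => y; rewrite add0r.
    by apply: (is_derive_eq k); field; rewrite ?s_neq0//.
  have k2 := is_derive1_comp (f := expR) (g := fun y : R => s ^+ 2 / 2 * y ^+ 2) (is_derive_expR _) k1.
  have k3 : is_derive u 1 psi (chi a u *: (expR (s ^+ 2 / 2 * u ^+ 2) * (s ^+ 2 * u)) +
      expR (s ^+ 2 / 2 * u ^+ 2) *: chi' a u) := is_deriveM (is_derive_chi a u) k2.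
  by apply: (is_derive_eq k3); rewrite chi_ode /GRing.scale /=; ring.
have := is_derive_0_is_cst t 0 d; rewrite /psi expr0n /= mulr0 expR0 mulr1.
have -> : chi a 0 = cos a.
  rewrite /chi; have -> : \int[leb]_y (p y * cos (0 * y + a)) = \int[leb]_y (cos a * p y).
    by apply: eq_Rintegral => y _; rewrite mul0r add0r mulrC.
  rewrite RintegralZl//; last exact: integrable_normal_pdf.
  by rewrite /Rintegral integral_normal_pdf mulr1.
move=> <-; rewrite -mulrA -expRD; have -> : s ^+ 2 / 2 * t ^+ 2 + - (s ^+ 2 * t ^+ 2 / 2) = 0 by field; rewrite ?s_neq0//.
by rewrite expR0 mulr1.
Qed.

Theorem normal_cos (t a : R) :
  \int[normal_prob 0 s]_y cos (t * y + a) = cos a * expR (- (s ^+ 2 * t ^+ 2 / 2)).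
Proof. by rewrite normal_Rintegral// -chiE. Qed.

(** Chebyshev's inequality, stated for any function below (y / K)^2 so that a continuous cut-off can
    replace an indicator. *)
Lemma normal_tail (K : R) : 0 < K -> forall f : R -> R, measurable_fun [set: R] f ->
  (forall y, 0 <= f y <= (y / K) ^+ 2) ->
  \int[normal_prob 0 s]_y f y <= (\int[leb]_y (y ^+ 2 * p y)) / K ^+ 2.
Proof.
move=> K0 f mf hf; rewrite normal_Rintegral// mulrC -RintegralZl//; last exact: sqr_p_integrable.
have K2 : 0 < K ^+ 2 by exact: exprn_gt0.
apply: le_Rintegral => //.
- apply: (p_integrable_dom (a := 0) (b := K ^- 2)) => // [|y]; first by rewrite invr_ge0 ltW.
  by have /andP[f0 f1] := hf y; rewrite ger0_norm// add0r (le_trans f1)// exprMn exprVn mulrC.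
- exact: (integrableZl measurableT (K ^- 2) sqr_p_integrable).
- move=> y _; have /andP[f0 f1] := hf y; rewrite mulrA [leRHS]mulrC.
  by apply: ler_wpM2l; [exact: p_ge0|rewrite (le_trans f1)// exprMn exprVn mulrC].
Qed.

End NormalCharacteristicFunction.

End NormalLawTheory.
Import NormalLawTheory.

(** * From characteristic functions to weak convergence *)

Module WeakLimitTheory.

Section TrigonometricPolynomials.
Context {R : realType}.
Implicit Types (f g : R -> R).

(** Cosines with phases are enough: their products linearise, and the limits of their integrals are
    exactly what the characteristic functions give. *)
Inductive trigpoly : (R -> R) -> Prop :=
| trigpoly0 : trigpoly (fun=> 0)
| trigpolyS a t b f : trigpoly f -> trigpoly (fun x => a * cos (t * x + b) + f x).

Lemma trigpoly_eq f g : f =1 g -> trigpoly f -> trigpoly g.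
Proof. by move=> /funext ->. Qed.

Lemma trigpolyD f g : trigpoly f -> trigpoly g -> trigpoly (fun x => f x + g x).
Proof.
move=> hf hg; elim: hf => [|a t b {}f _ IH].
  by apply: trigpoly_eq hg => x; rewrite add0r.
by apply: trigpoly_eq (trigpolyS a t b IH) => x; rewrite addrA.
Qed.

Lemma trigpolyZ c f : trigpoly f -> trigpoly (fun x => c * f x).
Proof.
elim=> [|a t b {}f _ IH]; first by apply: trigpoly_eq trigpoly0 => x; rewrite mulr0.
by apply: trigpoly_eq (trigpolyS (c * a) t b IH) => x; rewrite mulrDr mulrA.
Qed.

Lemma trigpoly_mul_cos t b f : trigpoly f -> trigpoly (fun x => cos (t * x + b) * f x).
Proof.
elim=> [|a u c {}f _ IH]; first by apply: trigpoly_eq trigpoly0 => x; rewrite mulr0.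
apply: trigpoly_eq (trigpolyS (a / 2) (t + u) (b + c) (trigpolyS (a / 2) (t - u) (b - c) IH)) => x.
have -> : (t + u) * x + (b + c) = (t * x + b) + (u * x + c) by ring.
have -> : (t - u) * x + (b - c) = (t * x + b) - (u * x + c) by ring.
by rewrite cosD cosB; field.
Qed.

Lemma trigpoly_cst c : trigpoly (fun=> c).
Proof.
apply: trigpoly_eq (trigpolyS c 0 0 trigpoly0) => x.
by rewrite mul0r !addr0 cos0 mulr1.
Qed.

(* Expectation of [f] under a random walk on the integers: the Bernstein
   polynomial in [u], in a form suited to induction. *)
Fixpoint walk (f : nat -> R) (m j : nat) (u : R) : R :=
  if m is n.+1 then u * walk f n j.+1 u + (1 - u) * walk f n j u else f j.

Definition usin (c x : R) : R := 2^-1 + 2^-1 * sin (c * x).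

Lemma usin_01 c x : 0 <= usin c x <= 1.
Proof. by have h1 := sin_geN1 (c * x); have h2 := sin_le1 (c * x); rewrite /usin; apply/andP; split; lra. Qed.

Lemma trigpoly_walk (f : nat -> R) c m j : trigpoly (fun x => walk f m j (usin c x)).
Proof.
elim: m j => [|m IH] j; first exact: trigpoly_cst.
have us h : trigpoly h -> trigpoly (fun x => usin c x * h x).
  move=> hh; apply: trigpoly_eq (trigpolyD (trigpolyZ 2^-1 hh) (trigpolyZ 2^-1 (trigpoly_mul_cos c (- (pi / 2)) hh))) => x.
  by rewrite cosB cos_pihalf sin_pihalf mulr0 mulr1 add0r /usin; ring.
apply: trigpoly_eq (trigpolyD (us _ (IH j.+1)) (trigpolyD (IH j) (trigpolyZ (-1) (us _ (IH j))))) => x /=.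
by ring.
Qed.

Lemma walk_le (f g : nat -> R) m j u : 0 <= u <= 1 -> (forall k, f k <= g k) ->
  walk f m j u <= walk g m j u.
Proof.
move=> /andP[u0 u1] h; elim: m j => [//|m IH] j /=.
by apply: lerD; apply: ler_wpM2l => //; rewrite subr_ge0.
Qed.

(** Started at [j], the walk has mean j + m u and variance m u (1 - u) after [m] steps. *)
Lemma walk_quadratic (al be c u : R) m j :
  walk (fun k => al + be * (k%:R - c) ^+ 2) m j u =
  al + be * ((j%:R + m%:R * u - c) ^+ 2 + m%:R * (u * (1 - u))).
Proof.
elim: m j => [|m IH] j /=; first by ring.
by rewrite !IH -(natr1 j) -(natr1 m); ring.
Qed.

(** The quadratic majorant is centred at the mean of the walk, so its expectation is [al] plus [be]
    times the variance. *)
Lemma walk_close (f : nat -> R) (v al be u : R) m : 0 <= u <= 1 ->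
  (forall k, `|f k - v| <= al + be * (k%:R - m%:R * u) ^+ 2) ->
  `|walk f m 0 u - v| <= al + be * (m%:R * (u * (1 - u))).
Proof.
move=> u01 h.
have h1 := walk_le m 0 u01 (g := fun k => (v + al) + be * (k%:R - m%:R * u) ^+ 2) (f := f).
have h2 := walk_le m 0 u01 (f := fun k => (v - al) + (- be) * (k%:R - m%:R * u) ^+ 2) (g := f).
rewrite walk_quadratic add0r subrr expr0n add0r in h1.
rewrite walk_quadratic add0r subrr expr0n add0r in h2.
rewrite ler_norml lerBlDl lerBrDl; apply/andP; split.
- have -> : v - (al + be * (m%:R * (u * (1 - u)))) = v - al + - be * (m%:R * (u * (1 - u))) by ring.
  apply: h2 => k; have := h k; rewrite ler_norml => /andP[k1 _].
  by move: k1; move: (_ ^+ 2) => q; rewrite lerBrDl => k1; rewrite (le_trans _ k1)// le_eqVlt; apply/orP; left; apply/eqP; ring.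
- rewrite addrA; apply: h1 => k; have := h k; rewrite ler_norml => /andP[_ k1].
  by move: k1; rewrite lerBlDl addrA.
Qed.

Lemma sin_expand (a b : R) : `|a| <= 2^-1 -> `|b| <= 2^-1 -> a <= b -> b - a <= 2 * (sin b - sin a).
Proof.
move=> ha hb ab.
have cs : {within `[a, b], continuous (@sin R)}.
  by apply: derivable_within_continuous => x _; exact: (@ex_derive _ _ _ _ _ _ _ (is_derive_sin x)).
have [c ci ->] := MVT_segment ab (fun x _ => is_derive_sin x) cs.
have cb : `|c| <= 2^-1.
  move: ci ha hb; rewrite in_itv/= !ler_norml => /andP[c1 c2] /andP[a1 a2] /andP[b1 b2].
  by rewrite (le_trans a1 c1) (le_trans c2 b2).
have ch : 1 <= 2 * cos c.
  have := cos_sub1_le c; have c2 : `|c| ^+ 2 <= 2^-1 ^+ 2 by apply: lerXn2r; rewrite ?nnegrE ?invr_ge0.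
  move=> /le_trans/(_ c2); rewrite ler_norml => /andP[k _]; have : (2^-1 : R) ^+ 2 = 4^-1 by field.
  by move: k; move: (_ ^+ 2) => q k e2; rewrite e2 in k; lra.
by rewrite mulrA ler_peMl// subr_ge0.
Qed.

Lemma sin_inverse_lipschitz (a b : R) : `|a| <= 2^-1 -> `|b| <= 2^-1 -> `|a - b| <= 2 * `|sin a - sin b|.
Proof.
wlog ab : a b / a <= b.
  move=> h ha hb; have [ab|ab] := leP a b; first exact: h.
  by rewrite distrC [X in _ * X]distrC; apply: h => //; exact: ltW.
move=> ha hb; have h := sin_expand ha hb ab; rewrite distrC [X in _ * X]distrC ger0_norm ?subr_ge0//.
by apply: (le_trans h); apply: ler_wpM2l => //; exact: ler_norm.
Qed.

(** [y] is an approximate inverse of the change of variable [usin (2 * K)^-1] at [v]. The argument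
    of the sine stays in [-1/2, 1/2], where the cosine is at least 1/2, and values [v] outside the
    range are sent to an end point of [-K, K]. *)
Lemma sin_grid (K : R) : 0 < K -> forall v, exists y, `|y| <= K /\
  forall x, `|x| <= K -> `|x - y| <= 8 * K * `|usin (2 * K)^-1 x - v|.
Proof.
move=> K0 v; set w := 2 * v - 1; have K2 : 0 < 2 * K by rewrite mulr_gt0.
have hh : 0 <= 2^-1 :> R by rewrite invr_ge0.
have nh : `|2^-1 : R| <= 2^-1 by rewrite ger0_norm.
have nh' : `|- 2^-1 : R| <= 2^-1 by rewrite normrN.
have scale x : `|x| <= K -> `|(2 * K)^-1 * x| <= 2^-1.
  move=> xK; rewrite normrM ger0_norm ?invr_ge0 ?(ltW K2)// mulrC ler_pdivrMr//.
  by rewrite mulrA mulVf// mul1r.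
have core b : `|b| <= 2^-1 -> (forall a, `|a| <= 2^-1 -> `|sin a - sin b| <= `|sin a - w|) ->
    exists y, `|y| <= K /\ forall x, `|x| <= K -> `|x - y| <= 8 * K * `|usin (2 * K)^-1 x - v|.
  move=> hb hw; exists (2 * K * b); split.
    rewrite normrM (gtr0_norm K2); apply: (le_trans (ler_wpM2l (ltW K2) hb)).
    by rewrite mulrAC divff// mul1r.
  move=> x xK; have sx := scale x xK; set a := (2 * K)^-1 * x in sx *.
  have -> : x - 2 * K * b = 2 * K * (a - b) by rewrite /a mulrBr mulrA divff ?gt_eqF// mul1r.
  rewrite normrM (gtr0_norm K2).
  have -> : usin (2 * K)^-1 x - v = 2^-1 * (sin a - w) by rewrite /usin /w -/a; field.
  rewrite normrM (ger0_norm hh).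
  have l1 := sin_inverse_lipschitz sx hb; have l2 := hw a sx.
  have -> : 8 * K * (2^-1 * `|sin a - w|) = 2 * K * (2 * `|sin a - w|) by field.
  by apply: ler_wpM2l; [exact: ltW|apply: (le_trans l1); exact: ler_wpM2l].
have mono (a b : R) : `|a| <= 2^-1 -> `|b| <= 2^-1 -> a <= b -> sin a <= sin b.
  move=> ha hb ab; have l := sin_expand ha hb ab.
  by rewrite -subr_ge0 -(pmulr_rge0 _ (ltr0n R 2)) (le_trans _ l)// subr_ge0.
have rng (a : R) : `|a| <= 2^-1 -> - 2^-1 <= a /\ a <= 2^-1 by rewrite ler_norml => /andP[].
have [w1|w1] := leP (sin 2^-1) w.
  apply: (core 2^-1 nh) => a ha; have [_ r2] := rng a ha; have k := mono _ _ ha nh r2.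
  by rewrite !ler0_norm ?subr_le0// ?(le_trans k)// lerN2 lerB.
have [w2|w2] := leP w (sin (- 2^-1)).
  apply: (core (- 2^-1) nh') => a ha; have [r1' _] := rng a ha; have k := mono _ _ nh' ha r1'.
  by rewrite !ger0_norm ?subr_ge0// ?(le_trans w2)// lerB.
have le1 : - 2^-1 <= 2^-1 :> R by rewrite (le_trans _ hh)// oppr_le0.
have cs : {within `[- 2^-1, 2^-1], continuous (@sin R)}.
  by apply: derivable_within_continuous => x _; exact: (@ex_derive _ _ _ _ _ _ _ (is_derive_sin x)).
have [|b bi hb] := IVT le1 cs (v := w).
  by rewrite ge_min le_max (ltW w2) (ltW w1) orbT.
have nb : `|b| <= 2^-1 by move: bi; rewrite in_itv/= ler_norml.
by apply: (core b nb) => a ha; rewrite hb.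
Qed.

(** The approximant is the Bernstein polynomial, in the variable [usin (2 * K)^-1 x], of [phi]
    composed with the approximate inverse of that variable. Being an average of values of [phi], it
    is bounded by [M] on the whole line, and this global bound is what controls the tails later. *)
Lemma trigpoly_approx (phi : R -> R) (M K e : R) : continuous phi -> (forall x, `|phi x| <= M) ->
  0 < K -> 0 < e -> exists2 B, trigpoly B &
    (forall x, `|B x| <= M) /\ forall x, `|x| <= K -> `|phi x - B x| <= e.
Proof.
move=> cphi hM K0 e0; have M0 : 0 <= M by apply: le_trans (hM 0).
have e2 : 0 < e / 2 by exact: divr_gt0.
have cK : compact `[- K, K] by exact: segment_compact.
have inK x : `|x| <= K -> `[- K, K]%classic x by rewrite /= in_itv/= -ler_norml.
have [d d0 hd] : exists2 d, 0 < d & forall x z, `[- K, K]%classic x -> `[- K, K]%classic z ->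
    `|z - x| < d -> `|phi z - phi x| < e / 2.
  have unif : \forall d \near (0 : R)^'+, `[- K, K]%classic `<=`
      [set x | forall z, `|z - x| < d -> `|phi z - phi x| < e / 2].
    apply: (proj1 (compact_near_coveringP _) cK) => x _.
    have e4 : 0 < e / 4 by exact: divr_gt0.
    have /cvgrPdist_lt /(_ _ e4) /nbhs_ballP[c /= c0 hc] := cphi x.
    have c2 : 0 < c / 2 by exact: divr_gt0.
    exists (ball x (c / 2), [set d | d < c / 2]%classic) => /=.
      by split; [exact: nbhsx_ballx|exact: nbhs_right_lt].
    move=> [x' d] /= [hx hd] z hz; have {}hx : `|x - x'| < c / 2 by exact: hx.
    have h1 : `|phi x - phi x'| < e / 4 by apply: hc; apply: (lt_trans hx); lra.
    have h2 : `|phi x - phi z| < e / 4.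
      apply: hc; rewrite /ball /= -(subrKA x') (le_lt_trans (ler_normD _ _))//.
      have := lt_trans hz hd; rewrite (distrC z) => hz'; lra.
    rewrite -(subrKA (phi x)) (le_lt_trans (ler_normD _ _))// distrC.
    move: h1 h2; lra.
  have [d [hd d0]] := filter_ex (filterI unif (nbhs_right_gt (0 : R))).
  by exists d => // x z xK _; exact: hd.
have [y hy] := choice (sin_grid K0).
(* If the grid point lies at distance at least [d] from [x], the ratio [8 * K * |u - k / m| / d] is
   at least 1, so [2 * M] times its square dominates the oscillation of [phi]. *)
pose C := 2 * M * (8 * K / d) ^+ 2; have C0 : 0 <= C by apply: mulr_ge0; [exact: mulr_ge0|exact: sqr_ge0].
pose m := (Num.truncn (C / (e / 2))).+1.
have m0 : 0 < m%:R :> R by rewrite ltr0n.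
have mC : C <= m%:R * (e / 2) by rewrite -ler_pdivrMr// ltW// truncnS_gt.
pose f (k : nat) := phi (y (k%:R / m%:R)).
exists (fun x => walk f m 0 (usin (2 * K)^-1 x)); first exact: trigpoly_walk.
split=> [x|x xK].
  have := walk_close (f := f) (v := 0) (al := M) (be := 0) (m := m) (usin_01 (2 * K)^-1 x).
  by rewrite subr0 mul0r addr0; apply => k; rewrite subr0 mul0r addr0; exact: hM.
set u := usin (2 * K)^-1 x; have u01 := usin_01 (2 * K)^-1 x; rewrite -/u in u01.
rewrite distrC; have := walk_close (f := f) (v := phi x) (al := e / 2) (be := C / m%:R ^+ 2) (m := m) u01.
have fin : e / 2 + C / m%:R ^+ 2 * (m%:R * (u * (1 - u))) <= e.
  have uu : u * (1 - u) <= 1.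
    by have /andP[u0 u1] := u01; rewrite -[leRHS]mulr1; apply: ler_pM => //; lra.
  have -> : C / m%:R ^+ 2 * (m%:R * (u * (1 - u))) = C / m%:R * (u * (1 - u)) by field; exact: lt0r_neq0.
  have Cm : C / m%:R <= e / 2 by rewrite ler_pdivrMr// mulrC.
  rewrite {2}[e]splitr lerD2l; apply: le_trans Cm; rewrite ler_piMr// divr_ge0// ltW//.
move=> h; apply: (le_trans _ fin); apply: h => k; rewrite /f.
have [yK hyk] := hy (k%:R / m%:R); set z := y _ in yK hyk *; have hx := hyk x xK; rewrite -/u in hx.
have sq0 : 0 <= C / m%:R ^+ 2 * (k%:R - m%:R * u) ^+ 2.
  by apply: mulr_ge0; [apply: divr_ge0 => //; exact: sqr_ge0|exact: sqr_ge0].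
have [near_|far] := ltP `|z - x| d.
  have := hd x z (inK x xK) (inK z yK) near_ => /ltW h1.
  by apply: (le_trans h1); rewrite lerDl.
have b1 : `|phi z - phi x| <= 2 * M.
  by rewrite (le_trans (ler_normB _ _))// mulrDl mul1r lerD.
apply: (le_trans b1); apply: (@le_trans _ _ (C / m%:R ^+ 2 * (k%:R - m%:R * u) ^+ 2)); last by rewrite lerDr ltW.
have -> : C / m%:R ^+ 2 * (k%:R - m%:R * u) ^+ 2 = 2 * M * (8 * K * `|u - k%:R / m%:R| / d) ^+ 2.
  have -> : (8 * K * `|u - k%:R / m%:R| / d) ^+ 2 = (8 * K / d) ^+ 2 * (u - k%:R / m%:R) ^+ 2.
    by rewrite -[in RHS](real_normK (num_real (u - _))); ring.
  by rewrite /C; field; rewrite (lt0r_neq0 m0) (lt0r_neq0 d0).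
rewrite ler_peMr//; first exact: mulr_ge0.
rewrite -[leLHS](expr1n _ 2); apply: lerXn2r; rewrite ?nnegrE//.
  by apply: divr_ge0; [apply: mulr_ge0 => //; apply: mulr_ge0 => //; exact: ltW|exact: ltW].
by rewrite ler_pdivlMr// mul1r (le_trans far)// distrC.
Qed.

End TrigonometricPolynomials.

Section WeakConvergence.
Context {R : realType} d (T : measurableType d) (mu : {measure set T -> \bar R}) (hmu : mu setT = 1%E).
Context (nu : probability (measurableTypeR R) R) (Y : nat -> T -> R) (V V' : R).
Hypotheses (rY : forall n, rbm (Y n)) (hV : forall n, \int[mu]_x (Y n x * Y n x) <= V).
Hypothesis htail : forall K, 0 < K -> forall f : R -> R, measurable_fun [set: R] f ->
  (forall y, 0 <= f y <= (y / K) ^+ 2) -> \int[nu]_y f y <= V' / K ^+ 2.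
Hypothesis hcos : forall t a, \int[mu]_x cos (t * Y n x + a) @[n --> \oo] --> \int[nu]_y cos (t * y + a).

Local Notation rbmR := (@rbm _ (measurableTypeR R) R).

Let nu1 : nu setT = 1%E := probability_setT nu.

Lemma rbm_continuous (f : R -> R) (M : R) : continuous f -> (forall x, `|f x| <= M) -> rbmR f.
Proof. by move=> cf hf; split; [exact: continuous_measurable_fun|exists M]. Qed.

Lemma rbm_cos t a : rbmR (fun y : R => cos (t * y + a)).
Proof.
apply: (@rbm_continuous _ 1) => [y|y]; last by rewrite ler_norml cos_geN1 cos_le1.
apply: (cvg_comp (fun y : R => t * y + a) (@cos R)); last exact: continuous_cos.
by apply: cvgD; [apply: cvgM; [exact: cvg_cst|exact: cvg_id]|exact: cvg_cst].
Qed.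

Lemma trigpoly_cvg f : trigpoly f -> rbmR f /\
  \int[mu]_x f (Y n x) @[n --> \oo] --> \int[nu]_y f y.
Proof.
elim=> [|a t b {}f _ [hf cf]].
  split; first exact: rbm_cst.
  by rewrite (exp_cst nu1); under eq_fun do rewrite (exp_cst hmu); exact: cvg_cst.
have hc := rbm_cos t b; split; first by apply: rbmD => //; exact: rbmZ.
rewrite (expD nu1 (rbmZ a hc) hf) (expZ nu1 a hc).
have -> : (fun n => \int[mu]_x (a * cos (t * Y n x + b) + f (Y n x))) =
    fun n => a * \int[mu]_x cos (t * Y n x + b) + \int[mu]_x f (Y n x).
  apply/funext => n; have h1 := rbm_comp (proj1 (rY n)) hc; have h2 := rbm_comp (proj1 (rY n)) hf.
  by rewrite (expD hmu (rbmZ a h1) h2) (expZ hmu a h1).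
by apply: cvgD => //; apply: cvgM; [exact: cvg_cst|exact: hcos].
Qed.

Theorem weak_convergence (phi : R -> R) (M : R) : continuous phi -> (forall x, `|phi x| <= M) ->
  \int[mu]_x phi (Y n x) @[n --> \oo] --> \int[nu]_y phi y.
Proof.
move=> cphi hM; have M0 : 0 <= M by apply: le_trans (hM 0).
have rphi := rbm_continuous cphi hM.
apply/cvgrPdist_le => e e0.
have e5 : 0 < e / 5 by exact: divr_gt0.
pose W := `|V| + `|V'| + 1; have W0 : 0 < W by rewrite ltr_wpDl// addr_ge0.
(* Radius beyond which second moments make the tails smaller than [e / 5]; adding 1 ensures
   [D <= D ^+ 2]. *)
pose D := 2 * M * W / (e / 5) + 1.
have D1 : 1 <= D by rewrite lerDr divr_ge0 ?(ltW e5)// mulr_ge0 ?(ltW W0)// mulr_ge0.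
have D0 : 0 < D by exact: lt_le_trans ltr01 D1.
have DE : 2 * M * W <= e / 5 * D ^+ 2.
  have : 2 * M * W / (e / 5) <= D ^+ 2.
    by apply: (@le_trans _ _ D); [rewrite lerDl|rewrite expr2 ler_peMl// ltW].
  by rewrite ler_pdivrMr// (mulrC (D ^+ 2)).
have [B tB [BM hB]] := trigpoly_approx cphi hM D0 e5.
have [rB cB] := trigpoly_cvg tB.
(* A continuous cut-off, equal to 1 outside [-D, D] and below (y / D)^2, hence controlled by second
   moments both before and at the limit. *)
pose w (y : R) := Num.min 1 ((y / D) ^+ 2).
have w0 y : 0 <= w y by rewrite le_min ler01 sqr_ge0.
have cw : continuous w.
  have c2 : continuous (fun y : R => (y / D) ^+ 2).
    by move=> y; apply: cvgM; (apply: cvgM; [exact: cvg_id|exact: cvg_cst]).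
  have -> : w = fun y => (1 + (y / D) ^+ 2 - `|1 - (y / D) ^+ 2|) / 2.
    by apply/funext => y; exact: minr_absE.
  move=> y; apply: cvgM; last exact: cvg_cst.
  apply: cvgB; first by apply: cvgD; [exact: cvg_cst|exact: c2].
  by apply: cvg_norm; apply: cvgB; [exact: cvg_cst|exact: c2].
have w1 y : `|w y| <= 1 by rewrite ger0_norm// ge_min lexx.
have rw := rbm_continuous cw w1.
have close y : `|phi y - B y| <= e / 5 + 2 * M * w y.
  have [yD|yD] := leP `|y| D; first by rewrite (le_trans (hB y yD))// lerDl mulr_ge0// mulr_ge0.
  have -> : w y = 1.
    rewrite /w min_l//; rewrite -(real_normK (num_real (y / D))) -[leLHS](expr1n _ 2).
    by apply: lerXn2r; rewrite ?nnegrE// normrM normfV (gtr0_norm D0) ler_pdivlMr// mul1r ltW.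
  rewrite mulr1 (le_trans (ler_normB _ _))// (@le_trans _ _ (M + M))//; first exact: lerD.
  by move: e5 M0; set z := e / 5; move: z => z; lra.
have bound (m : {measure set (measurableTypeR R) -> \bar R}) : m setT = 1%E -> \int[m]_y w y <= W / D ^+ 2 ->
    `|\int[m]_y phi y - \int[m]_y B y| <= e / 5 + e / 5.
  move=> m1 hw; have rd : rbmR (fun y => phi y + -1 * B y) by apply: rbmD => //; exact: rbmZ.
  have -> : \int[m]_y phi y - \int[m]_y B y = \int[m]_y (phi y + -1 * B y).
    by rewrite (expD m1 rphi (rbmZ _ rB)) (expZ m1 _ rB) mulN1r.
  have re : rbmR (fun y => e / 5 + 2 * M * w y) by apply: rbmD; [exact: rbm_cst|exact: rbmZ].
  have I : \int[m]_y (e / 5 + 2 * M * w y) <= e / 5 + e / 5.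
    rewrite (expD m1 (rbm_cst _ _) (rbmZ _ rw)) (exp_cst m1) (expZ m1 _ rw) lerD2l.
    have M2 : 0 <= 2 * M by exact: mulr_ge0.
    apply: (le_trans (ler_wpM2l M2 hw)); rewrite mulrA ler_pdivrMr//; exact: exprn_gt0.
  rewrite ler_norml; apply/andP; split.
  - have ez : \int[m]_y (-1 * (phi y + -1 * B y)) = -1 * \int[m]_y (phi y + -1 * B y).
      exact: (expZ m1 (-1) rd).
    rewrite lerNl -[leLHS]mulN1r -ez; apply: le_trans I; apply: (exp_le m1 (rbmZ (-1) rd) re) => y.
    by have := close y; rewrite ler_norml => /andP[k _]; move: k; set z := e / 5 + _; move: z => z; lra.
  - apply: le_trans I; apply: (exp_le m1 rd re) => y.
    by have := close y; rewrite ler_norml => /andP[_ k]; rewrite mulN1r.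
have wle y : w y <= (y / D) ^+ 2 by rewrite ge_min lexx orbT.
have D2 : 0 < D ^+ 2 by exact: exprn_gt0.
have bnu : `|\int[nu]_y phi y - \int[nu]_y B y| <= e / 5 + e / 5.
  apply: (bound nu nu1); apply: (le_trans (htail D0 (proj1 rw) _)) => [y|]; first by rewrite w0 wle.
  rewrite ler_pM2r ?invr_gt0// (le_trans (ler_norm _))// /W addrAC lerDr.
  by rewrite addr_ge0.
have bmu n : `|\int[mu]_x phi (Y n x) - \int[mu]_x B (Y n x)| <= e / 5 + e / 5.
  have mY := proj1 (rY n).
  pose Y' : T -> measurableTypeR R := Y n.
  have mY' : measurable_fun [set: T] Y' by exact: mY.
  pose m0 : {measure set (measurableTypeR R) -> \bar R} := pushforward mu Y'.
  pose m : {measure set (measurableTypeR R) -> \bar R} := m0 mY'.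
  have tr (f : R -> R) : rbmR f -> \int[mu]_x f (Y n x) = \int[m]_y f y by move=> hf; exact: (@exp_invariant _ _ _ (measurableTypeR R) _ mu m Y' f mY' hmu _ hf).
  have m1 : m setT = 1%E by rewrite /m /m0 /= /pushforward preimage_setT.
  rewrite (tr phi rphi) (tr B rB); apply: (bound m m1); rewrite -(tr w rw).
  have rYY := rbmM (rY n) (rY n).
  apply: (@le_trans _ _ (\int[mu]_x (D ^- 2 * (Y n x * Y n x)))).
    apply: (exp_le hmu) => [||x]; [exact: rbm_comp mY rw|exact: rbmZ|].
    by rewrite (le_trans (wle _))// exprMn exprVn mulrC expr2.
  rewrite (expZ hmu _ rYY) mulrC ler_pM2r ?invr_gt0//.
  by rewrite (le_trans (hV n))// (le_trans (ler_norm _))// /W -addrA lerDl addr_ge0.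
move/cvgrPdist_le : cB => /(_ _ e5); apply: filterS => n hn.
have -> : \int[nu]_y phi y - \int[mu]_x phi (Y n x) =
  (\int[nu]_y phi y - \int[nu]_y B y) + (\int[nu]_y B y - \int[mu]_x B (Y n x)) -
  (\int[mu]_x phi (Y n x) - \int[mu]_x B (Y n x)) by ring.
apply: (le_trans (ler_normB _ _)); apply: (le_trans (lerD (le_trans (ler_normD _ _) (lerD bnu hn)) (bmu n))).
by rewrite le_eqVlt; apply/orP; left; apply/eqP; field.
Qed.

End WeakConvergence.

End WeakLimitTheory.
Import WeakLimitTheory.

(** * Disintegration and measurability of the skew product *)

Module DisintegrationTheory.

Section Disintegration.
Context d1 d2 (O : measurableType d1) (Y : measurableType d2) (R : realType).
Context (P : probability O R) (k : R.-pker O ~> Y) (mu : probability (O * Y)%type R).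
Hypothesis hmu : forall A B, measurable A -> measurable B ->
  mu (A `*` B)%classic = (\int[P]_(w in A) k w B)%E.

(** Both sides are measures, and they agree on rectangles, which generate the product sigma-algebra
    and are stable under intersection. *)
Lemma kernel_disintegration A : measurable A -> (mu A = \int[P]_x k x (xsection A x))%E.
Proof.
pose w (A : set (O * Y)) : \bar R := (\int[P]_x k x (xsection A x))%E.
have w0 : w set0 = 0%E by apply: integral0_eq => x _; rewrite xsection0 measure0.
have wge B : (0 <= w B)%E by apply: integral_ge0.
have wsa : semi_sigma_additive w.
  move=> F mF tF mUF; rewrite [X in (_ --> X)%classic](_ : _ = \sum_(n <oo) w (F n))%E.
    by apply: is_cvg_nneseries => n _ _; exact: wge.
  rewrite -integral_nneseries//; last first.
    by move=> n; apply: measurable_fun_xsection_finite_kernel; exact/mem_set.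
  apply: eq_integral => x _; apply/esym/cvg_lim => //=; rewrite xsection_bigcup.
  apply: (measure_sigma_additive _ (trivIset_xsection tF)).
  by move=> n; exact: measurable_xsection.
pose nu : {measure set (O * Y) -> \bar R} := HB.pack w (isMeasure.Build _ (O * Y)%type R w w0 wge wsa).
move=> mA; change (mu A = nu A).
pose C : set (set (O * Y)) :=
  [set C | exists A, measurable A /\ exists B, measurable B /\ C = A `*` B]%classic.
apply: (measure_unique C (fun n => setT)) => //.
- rewrite measurable_prod_measurableType //; congr (<<s _ >>)%classic.
  rewrite predeqE; split => [[B mB [B' mB' <-]]|[B [mB [B' [mB' ->]]]]].
    by exists B; split => //; exists B'.
  by exists B => //; exists B'.
- move=> /= _ _ [X1 [mX1 [X2 [mX2 ->]]]] [Y1 [mY1 [Y2 [mY2 ->]]]].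
  rewrite -setXI; exists (X1 `&` Y1)%classic; split; first exact: measurableI.
  by exists (X2 `&` Y2)%classic; split => //; exact: measurableI.
- by move=> n; exists setT; split => //; exists setT; split => //; rewrite setXTT.
- by rewrite bigcup_const.
- move=> B [A1 [mA1 [A2 [mA2 ->]]]]; 
  transitivity (\int[P]_(w in A1) k w A2)%E; first exact: hmu.
  change ((\int[P]_(w in A1) k w A2)%E = w (A1 `*` A2)%classic); rewrite /w integral_mkcond.
  apply: eq_integral => x _; rewrite patchE; case: ifPn => xA.
    by rewrite in_xsectionX.
  by rewrite notin_xsectionX// measure0.
- by move=> n; change (mu setT < +oo)%E; rewrite probability_setT ltry.
Qed.

Let inner f x := (\int[k x]_y f (x, y))%E.

Lemma iterated_functional : integral_functional (fun f : O * Y -> \bar R => \int[P]_x inner f x)%E.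
Proof.
have m2 f x : measurable_fun [set: O * Y] (f : O * Y -> \bar R) -> measurable_fun [set: Y] (fun y => f (x, y)).
  by move=> mf; exact: measurable_fun_pair2.
have mi (f : O * Y -> \bar R) : measurable_fun setT f -> (forall z, 0 <= f z)%E -> measurable_fun setT (inner f).
  by move=> mf f0; exact: (measurable_fun_integral_finite_kernel f k f0 mf).
have i0 (f : O * Y -> \bar R) x : (forall z, 0 <= f z)%E -> (0 <= inner f x)%E.
  by move=> f0; exact: integral_ge0.
split=> [f g mf f0 mg g0|c f c0 mf f0|f_ mf f0 nd].
- rewrite -ge0_integralD//; [|by move=> x _; exact: i0|exact: mi|by move=> x _; exact: i0|exact: mi].
  by apply: eq_integral => x _; rewrite /inner ge0_integralD//; exact: m2.
- rewrite -ge0_integralZl_EFin//; [|by move=> x _; exact: i0|exact: mi].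
  by apply: eq_integral => x _; rewrite /inner ge0_integralZl_EFin//; exact: m2.
- rewrite -monotone_convergence//; last first.
  + by move=> x _ m n mn; apply: ge0_le_integral => //; [exact: m2|exact: m2|move=> y _; exact: nd].
  + by move=> n x _; exact: i0.
  + by move=> n; exact: mi.
  apply: eq_integral => x _; rewrite /inner monotone_convergence//; first by move=> n; exact: m2.
Qed.

Lemma disintegrate_ge0 (f : O * Y -> \bar R) : measurable_fun setT f -> (forall z, 0 <= f z)%E ->
  (\int[mu]_z f z = \int[P]_x \int[k x]_y f (x, y))%E.
Proof.
move=> mf f0; apply: (integral_functional_uniq (integral_functional_int mu) iterated_functional) => // A mA.
transitivity (mu A); first by rewrite integral_indic// setIT.
transitivity (\int[P]_x k x (xsection A x))%E; first exact: kernel_disintegration.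
apply: eq_integral => x _.
rewrite /inner (_ : (fun y => _) = fun y => (\1_(xsection A x) y)%:E); last first.
  by apply/funext => y; rewrite !indicE mem_xsection.
by rewrite integral_indic ?setIT//; exact: measurable_xsection.
Qed.

Lemma rbm_section (f : O * Y -> R) x : rbm f -> rbm (fun y => f (x, y)).
Proof. by move=> [mf [M hM]]; split; [exact: measurable_fun_pair2|exists M]. Qed.

(** The nonnegative case comes first; a bounded function becomes nonnegative after adding its bound,
    which both sides integrate to the same constant. *)
Lemma disintegrate (f : O * Y -> R) : rbm f ->
  rbm (fun x => \int[k x]_y f (x, y)) /\ \int[mu]_z f z = \int[P]_x \int[k x]_y f (x, y).
Proof.
have k1 x : k x setT = 1%E by exact: prob_kernel.
have mu1 : mu setT = 1%E := probability_setT mu; have P1 : P setT = 1%E := probability_setT P.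
have nonneg (h : O * Y -> R) : rbm h -> (forall z, 0 <= h z) ->
    rbm (fun x => \int[k x]_y h (x, y)) /\ \int[mu]_z h z = \int[P]_x \int[k x]_y h (x, y).
  move=> hh h0; have [mh [M hM]] := hh.
  have mh' : measurable_fun setT (EFin \o h) by exact/measurable_EFinP.
  have h0' z : (0 <= (EFin \o h) z)%E by rewrite lee_fin.
  have fE x : (\int[k x]_y h (x, y))%:E = (\int[k x]_y (EFin \o h) (x, y))%E.
    by rewrite fineK//; apply: integrable_fin_num => //; exact: (rbm_int (k1 x) (rbm_section x hh)).
  split; last first.
    rewrite {1}/Rintegral (disintegrate_ge0 mh' h0') /Rintegral; congr fine.
    by apply: eq_integral => x _; rewrite -fE.
  split; last by exists M => x; apply: (exp_abs_le (k1 x) (rbm_section x hh)) => y; exact: hM.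
  apply/measurable_EFinP; rewrite (_ : EFin \o _ = fun x => \int[k x]_y (EFin \o h) (x, y))%E.
    exact: (measurable_fun_integral_finite_kernel (EFin \o h) k h0' mh').
  by apply/funext => x; rewrite /= fE.
move=> hf; have [_ [M hM]] := hf.
have [] := nonneg (fun z => f z + M); first by apply: rbmD => //; exact: rbm_cst.
  by move=> z; have := hM z; rewrite ler_norml => /andP[+ _]; rewrite -subr_ge0 opprK.
have e : (fun x => \int[k x]_y (f (x, y) + M)) = fun x => \int[k x]_y f (x, y) + M.
  by apply/funext => x; rewrite (expD (k1 x) (rbm_section x hf) (rbm_cst _ M)) (exp_cst (k1 x)).
rewrite e => r; have {}r : rbm (fun x => \int[k x]_y f (x, y)).
  have := rbmD r (rbm_cst _ (- M)); congr rbm; apply/funext => x; exact: addrK.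
rewrite (expD mu1 hf (rbm_cst _ M)) (exp_cst mu1) (expD P1 r (rbm_cst _ M)) (exp_cst P1).
by move=> /addIr.
Qed.

End Disintegration.

(** The countable range replaces a measurable structure on the space of maps: each preimage is a
    countable union of rectangles. *)
Lemma measurable_countable_family d1 d2 d3 (O : measurableType d1) (Y : measurableType d2)
    (Z : measurableType d3) (I : Type) (c : O -> I) (G : I -> Y -> Z) :
  countable (range c) -> (forall i, measurable (c @^-1` [set i])%classic) ->
  (forall w, measurable_fun [set: Y] (G (c w))) ->
  measurable_fun [set: O * Y] (fun z => G (c z.1) z.2).
Proof.
move=> /countable_injP[f finj] mc mG _ B mB; rewrite setTI.
pose C n : set (O * Y) := [set z | f (c z.1) = n /\ B (G (c z.1) z.2)]%classic.
have -> : ((fun z => G (c z.1) z.2) @^-1` B = \bigcup_(n in @setT nat) C n)%classic.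
  by rewrite predeqE => z; split=> [hz|[n _ [_ hz]] //]; exists (f (c z.1)).
apply: bigcup_measurable => n _.
have [[w hw]|none] := pselect (exists w, f (c w) = n); last first.
  by rewrite (_ : C n = set0)//; rewrite predeqE => z; split=> // -[hz _]; apply: none; exists z.1.
have -> : C n = ((c @^-1` [set c w]) `*` (G (c w) @^-1` B))%classic.
  rewrite predeqE => z; split=> [[h1 h2]|[h1 h2]].
    have e : c z.1 = c w by apply: finj; rewrite ?hw// inE; [exists z.1|exists w].
    by split; [exact: e|rewrite /preimage /= -e].
  have e : c z.1 = c w by exact: h1.
  by split; rewrite e//; exact: h2.
by apply: measurableX => //; rewrite -[X in measurable X]setTI; exact: mG.
Qed.

End DisintegrationTheory.
Import DisintegrationTheory.

(** * Asymptotics of the recursion and of the variance *)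

Module RecursionTheory.

Section CharacteristicRecursion.
Context {R : realType}.

Lemma expR_taylor2 (C y : R) : `|y| <= C -> `|expR y - 1 - y| <= expR C * y ^+ 2.
Proof.
move=> yC; have n2 : y ^+ 2 = `|y| ^+ 2 by rewrite real_normK// num_real.
have d1 (z : R) : is_derive z 1 (fun z => expR z - 1) (expR z).
  by apply: is_derive_add_cst; exact: is_derive_expR.
have d2 (z : R) : is_derive z 1 (fun z => expR z - 1 - z) (expR z - 1).
  by apply: is_derive_sub_id.
rewrite n2 expr2 mulrA; apply: (mean_value_at0 d2); first by rewrite expR0 subrr subr0.
move=> z zy; apply: (@le_trans _ _ (expR C * `|z|)); last by apply: ler_wpM2l => //; exact: expR_ge0.
apply: (mean_value_at0 d1); first by rewrite expR0 subrr.
move=> w wz; rewrite ger0_norm ?expR_ge0// ler_expR (le_trans (ler_norm _))//.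
by rewrite (le_trans wz)// (le_trans zy).
Qed.

(** Discrete Gronwall argument against the exponential solution: at each step the error is
    multiplied by at most [expR (s * C)] and increased by the given defect and by the second-order
    Taylor defect of the exponential. *)
Lemma linear_recursion (x b : nat -> R) (a C s dl : R) n : 0 <= C -> 0 <= s <= 1 -> `|a| <= 1 -> 0 <= dl ->
  x 0%N = a -> (forall k, `|b k| <= C) -> (forall k, `|x k.+1 - x k + s * x k * b k| <= dl) ->
  forall k, (k <= n)%N -> `|x k - a * expR (- (s * \sum_(0 <= j < k) b j))| <=
    k%:R * (dl + expR (s * C * n%:R) * (expR C * (s * C) ^+ 2)) * expR (s * C * k%:R).
Proof.
move=> C0 /andP[s0 s1] a1 dl0 x0 hb hx.
set E := expR (s * C * n%:R); set W := dl + _.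
have sC : 0 <= s * C by exact: mulr_ge0.
have W0 : 0 <= W by rewrite addr_ge0// mulr_ge0 ?expR_ge0// mulr_ge0 ?expR_ge0// sqr_ge0.
elim=> [_|k IH kn]; first by rewrite big_geq// mulr0 oppr0 expR0 mulr1 x0 subrr normr0 !mul0r.
set B := \sum_(0 <= j < k) b j in IH *.
have {}IH := IH (ltnW kn).
rewrite big_nat_recr//= -/B mulrDr opprD expRD.
set e := x k - a * expR (- (s * B)) in IH *.
set G := expR (- (s * B)) in e IH *.
have -> : x k.+1 - a * (G * expR (- (s * b k))) = (x k.+1 - x k + s * x k * b k) +
    ((1 - s * b k) * e - a * G * (expR (- (s * b k)) - 1 - (- (s * b k)))).
  by rewrite /e; ring.
have sb : `|s * b k| <= s * C by rewrite normrM (ger0_norm s0) ler_wpM2l.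
have h1 : `|1 - s * b k| <= expR (s * C).
  apply: le_trans (expR_ge1Dx _); rewrite (le_trans (ler_normB _ _))// normr1 lerD2l//.
have BC : `|B| <= C * k%:R.
  rewrite /B; elim: (k) => [|j IHj]; first by rewrite big_geq// normr0 mulr0.
  by rewrite big_nat_recr//= (le_trans (ler_normD _ _))// -natr1 mulrDr mulr1 lerD.
have GE : `|G| <= E.
  rewrite ger0_norm ?expR_ge0// ler_expR (le_trans (ler_norm _))// normrN normrM (ger0_norm s0) -mulrA.
  apply: ler_wpM2l => //; rewrite (le_trans BC)//; apply: ler_wpM2l => //; rewrite ler_nat; exact: ltnW.
have h2 : `|expR (- (s * b k)) - 1 - (- (s * b k))| <= expR C * (s * C) ^+ 2.
  have le1 : `|- (s * b k)| <= C by rewrite normrN (le_trans sb)// ler_piMl.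
  apply: (le_trans (expR_taylor2 le1)); apply: ler_wpM2l; first exact: expR_ge0.
  rewrite sqrrN -(real_normK (num_real (s * b k))); apply: lerXn2r => //; rewrite nnegrE//.
have h3 : `|a * G * (expR (- (s * b k)) - 1 - (- (s * b k)))| <= E * (expR C * (s * C) ^+ 2).
  rewrite normrM; apply: ler_pM => //; rewrite normrM -[leRHS]mul1r; exact: ler_pM.
have h4 : `|(1 - s * b k) * e| <= expR (s * C) * (k%:R * W * expR (s * C * k%:R)).
  by rewrite normrM; apply: ler_pM.
apply: (le_trans (ler_normD _ _)); apply: (le_trans (lerD (hx k) (le_trans (ler_normB _ _) (lerD h4 h3)))).
have -> : expR (s * C) * (k%:R * W * expR (s * C * k%:R)) = k%:R * W * expR (s * C * k.+1%:R).
  by rewrite mulrCA -expRD; congr (_ * expR _); rewrite -(natr1 k); ring.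
have p1 : 1 <= expR (s * C * k.+1%:R) by rewrite -expR0 ler_expR; exact: mulr_ge0.
set Z := expR (s * C * k.+1%:R) in p1 *; rewrite -(natr1 k).
have -> : (k%:R + 1) * W * Z = k%:R * W * Z + W * Z by ring.
by rewrite addrCA lerD2l -/W ler_peMr.
Qed.

Lemma inv_sqrt_cvg0 : (Num.sqrt (n%:R : R))^-1 @[n --> \oo] --> (0 : R).
Proof.
apply/cvgrPdist_le => e e0; near=> n; rewrite sub0r normrN ger0_norm ?invr_ge0 ?sqrtr_ge0//.
have h : (e^-1) ^+ 2 <= n%:R.
  near: n; exists (Num.truncn (e^-1 ^+ 2)).+1 => // n /= hn.
  by rewrite (le_trans (ltW (truncnS_gt _)))// ler_nat.
rewrite -[leRHS]invrK lef_pV2 ?posrE ?invr_gt0// ?sqrtr_gt0; last first.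
  by apply: lt_le_trans h; rewrite exprn_gt0// invr_gt0.
by rewrite -[leLHS]ger0_norm ?invr_ge0 ?(ltW e0)// -sqrtr_sqr ler_wsqrtr.
Unshelve. all: by end_near. Qed.

(** With th = t / sqrt n, the [n] defects of orders th^3 and th^4 add up to O(n^(-1/2)), while th^2
    times the sum of the b_k is t^2 / 2 times the normalised variance. *)
Lemma recursion_limit (x : R -> nat -> R) (b : nat -> R) (a C th0 s2 t : R) :
  0 < C -> 0 < th0 <= 1 -> `|a| <= 1 -> (forall th, x th 0%N = a) -> (forall k, `|b k| <= C) ->
  (forall th, 0 < `|th| -> `|th| <= th0 -> forall k,
     `|x th k.+1 - x th k + th ^+ 2 * x th k * b k| <= C * `|th| ^+ 3) ->
  (2 * \sum_(0 <= k < n) b k) / n%:R @[n --> \oo] --> s2 -> t != 0 ->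
  x (t / Num.sqrt n%:R) n @[n --> \oo] --> a * expR (- (2^-1 * t ^+ 2 * s2)).
Proof.
move=> C0 /andP[th00 th01] a1 x0 hb hx hV t0.
pose u n : R := (Num.sqrt n%:R)^-1; have u_0 : u n @[n --> \oo] --> (0 : R) := inv_sqrt_cvg0.
have u0 n : 0 <= u n by rewrite invr_ge0 sqrtr_ge0.
pose V n := (2 * \sum_(0 <= k < n) b k) / n%:R.
have main : a * expR (- (2^-1 * t ^+ 2 * V n)) @[n --> \oo] --> a * expR (- (2^-1 * t ^+ 2 * s2)).
  apply: cvgM; first exact: cvg_cst.
  apply: (cvg_comp _ (@expR R)); last exact: continuous_expR.
  by apply: cvgN; apply: cvgM => //; exact: cvg_cst.
pose M := expR (t ^+ 2 * C).
pose err n := M * (C * `|t| ^+ 3 * u n + M * (expR C * (t ^+ 2 * C) ^+ 2) * (u n * u n)).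
have err0 : err n @[n --> \oo] --> (0 : R).
  have -> : (0 : R) = M * (C * `|t| ^+ 3 * 0 + M * (expR C * (t ^+ 2 * C) ^+ 2) * (0 * 0)) by ring.
  apply: cvgM; first exact: cvg_cst.
  by apply: cvgD; (apply: cvgM; first exact: cvg_cst) => //; exact: cvgM.
have close : \forall n \near \oo, `|x (t / Num.sqrt n%:R) n - a * expR (- (2^-1 * t ^+ 2 * V n))| <= err n.
  have small : \forall n \near \oo, `|t| * u n <= th0.
    have c : `|t| * u n @[n --> \oo] --> (`|t| * 0 : R) by apply: cvgM => //; exact: cvg_cst.
    rewrite mulr0 in c; move/cvgrPdist_le : c => /(_ _ th00); apply: filterS => n.
    by rewrite sub0r normrN ger0_norm// mulr_ge0.
  near=> n; have n0 : (0 < n)%N by near: n; exists 1%N.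
  have nr : 0 < n%:R :> R by rewrite ltr0n.
  have uu : u n * u n = n%:R^-1 by rewrite -expr2 exprVn sqr_sqrtr// ler0n.
  have up : 0 < u n by rewrite invr_gt0 sqrtr_gt0.
  have nu : n%:R * (u n * u n) = 1 by rewrite uu divff// lt0r_neq0.
  set th := t / _; have thE : `|th| = `|t| * u n by rewrite normrM (ger0_norm (u0 n)).
  have thp : 0 < `|th| by rewrite thE mulr_gt0// normr_gt0.
  have thl : `|th| <= th0 by rewrite thE; near: n; exact: small.
  have s1 : 0 <= th ^+ 2 <= 1.
    rewrite sqr_ge0 -(real_normK (num_real th)) exprn_ile1//; exact: le_trans th01.
  have s2E : th ^+ 2 = t ^+ 2 * (u n * u n) by rewrite exprMn expr2 (expr2 (_^-1)).
  have d0 : 0 <= C * `|th| ^+ 3 by apply: mulr_ge0; [exact: ltW|exact: exprn_ge0].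
  have := linear_recursion (ltW C0) s1 a1 d0 (x0 th) hb (hx th thp thl) (leqnn n).
  have -> : th ^+ 2 * \sum_(0 <= j < n) b j = 2^-1 * t ^+ 2 * V n.
    by rewrite s2E uu /V; set z := \sum_(_ <= _ < _) _; move: z => z; field; rewrite lt0r_neq0.
  have -> : th ^+ 2 * C * n%:R = t ^+ 2 * C.
    by transitivity (t ^+ 2 * C * (n%:R * (u n * u n))); [rewrite s2E; ring|rewrite nu mulr1].
  move/le_trans; apply; rewrite -/M /err thE s2E.
  have e3 : n%:R * (C * (`|t| * u n) ^+ 3) = C * `|t| ^+ 3 * u n * (n%:R * (u n * u n)) by ring.
  have e4 : n%:R * (M * (expR C * (t ^+ 2 * (u n * u n) * C) ^+ 2)) =
     M * (expR C * (t ^+ 2 * C) ^+ 2) * (u n * u n) * (n%:R * (u n * u n)) by ring.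
  by rewrite mulrDr e3 e4 nu !mulr1 mulrC.
have diff : x (t / Num.sqrt n%:R) n - a * expR (- (2^-1 * t ^+ 2 * V n)) @[n --> \oo] --> (0 : R).
  apply: (@squeeze_cvgr _ _ _ _ (fun n => - err n) err) => //; last by rewrite -oppr0; exact: cvgN.
  by apply: filterS close => n; rewrite ler_norml.
have c := cvgD diff main; rewrite add0r in c.
rewrite (_ : (fun n => x (t / Num.sqrt n%:R) n) = fun n => (x (t / Num.sqrt n%:R) n -
  a * expR (- (2^-1 * t ^+ 2 * V n))) + a * expR (- (2^-1 * t ^+ 2 * V n))); first exact: c.
by apply/funext => n; rewrite subrK.
Unshelve. all: by end_near. Qed.

End CharacteristicRecursion.

Section VarianceLimit.
Context {R : realType}.

(** Delaying by [p] removes at most [p] bounded terms from the sum. *)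
Lemma shifted_average (a : nat -> R) (K l : R) p : (forall i, `|a i| <= K) ->
  (\sum_(0 <= i < n) a i) / n%:R @[n --> \oo] --> l ->
  (\sum_(0 <= k < n) (if (p <= k)%N then a (k - p)%N else 0)) / n%:R @[n --> \oo] --> l.
Proof.
move=> aK ha; pose u n := \sum_(0 <= k < n) (if (p <= k)%N then a (k - p)%N else 0).
pose v n := \sum_(0 <= i < n) a i.
have K0 : 0 <= K by apply: le_trans (aK 0%N).
have vK m n : `|\sum_(m <= i < n) a i| <= (n - m)%:R * K.
  apply: (le_trans (ler_norm_sum _ _ _)); by rewrite mulr_natl -sumr_const_nat ler_sum.
have u0 n : (n <= p)%N -> u n = 0.
  move=> np; rewrite /u big_nat_cond big1// => k; rewrite andbT => /andP[_ kn].
  by rewrite leqNgt (leq_trans kn np).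
have uS m : u (m + p)%N = v m.
  elim: m => [|m IH]; first by rewrite add0n u0// /v big_geq.
  by rewrite addSn /u big_nat_recr//= -/(u (m + p)%N) IH leq_addl addnK /v [RHS]big_nat_recr.
have uv n : `|u n - v n| <= p%:R * K.
  have [np|pn] := leqP n p.
    rewrite u0// sub0r normrN (le_trans (vK _ _))// subn0 ler_wpM2r// ler_nat//.
  rewrite -(subnK (ltnW pn)) uS; set m := (n - p)%N.
  rewrite /v (big_cat_nat (n := m) (p := m + p))//= ?leq_addr// opprD addrA subrr sub0r normrN.
  by rewrite (le_trans (vK _ _))// addKn.
have inv0 : n%:R^-1 @[n --> \oo] --> (0 : R).
  have c : (Num.sqrt (n%:R : R))^-1 * (Num.sqrt n%:R)^-1 @[n --> \oo] --> (0 * 0 : R).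
    by apply: cvgM; exact: inv_sqrt_cvg0.
  rewrite mul0r in c; apply: cvg_trans c; apply: near_eq_cvg; apply: nearW => n.
  by rewrite /= -expr2 exprVn sqr_sqrtr// ler0n.
have diff : (u n - v n) / n%:R @[n --> \oo] --> (0 : R).
  have c : p%:R * K * n%:R^-1 @[n --> \oo] --> (p%:R * K * 0 : R) by apply: cvgM => //; exact: cvg_cst.
  rewrite mulr0 in c.
  apply: (@squeeze_cvgr _ _ _ _ (fun n => - (p%:R * K * n%:R^-1)) (fun n => p%:R * K * n%:R^-1)) => //.
    apply: nearW => n; rewrite -ler_norml normrM (ger0_norm (x := _^-1))// ?invr_ge0 ?ler0n//.
    by apply: ler_wpM2r; rewrite ?invr_ge0 ?ler0n.
  by rewrite -oppr0; exact: cvgN.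
have c := cvgD diff ha; rewrite add0r in c.
rewrite (_ : (fun n => _) = fun n => (u n - v n) / n%:R + v n / n%:R); first exact: c.
by apply/funext => n; rewrite -mulrDl subrK.
Qed.

Context (K r : R) (K0 : 0 <= K) (r0 : 0 < r) (r1 : r < 1).

Lemma geometric_tail (y : nat -> R) M n : (forall j, `|y j| <= K * r ^+ j.+1) ->
  `|\sum_(M <= j < n) y j| <= K * r ^+ M / (1 - r).
Proof.
move=> hy; have q0 : 0 < 1 - r by rewrite subr_gt0.
have key : `|\sum_(M <= j < n) y j| <= K * (r ^+ M - r ^+ (maxn M n)) / (1 - r).
  elim: n => [|n IH]; first by rewrite big_geq// normr0 maxn0 subrr mulr0 mul0r.
  have [Mn|nM] := leqP M n; last by rewrite big_geq// normr0 (maxn_idPl nM) subrr mulr0 mul0r.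
  rewrite (maxn_idPr Mn) in IH; rewrite (maxn_idPr (leqW Mn)) big_nat_recr//= (le_trans (ler_normD _ _))//.
  apply: (le_trans (lerD IH (hy n))); rewrite -subr_ge0.
  have -> : K * (r ^+ M - r ^+ n.+1) / (1 - r) - (K * (r ^+ M - r ^+ n) / (1 - r) + K * r ^+ n.+1) =
    K * r ^+ n * (1 - r).
    by rewrite exprS; field; rewrite lt0r_neq0.
  by rewrite mulr_ge0 ?(ltW q0)// mulr_ge0// exprn_ge0// ltW.
apply: (le_trans key); rewrite ler_pM2r ?invr_gt0//; apply: ler_wpM2l => //.
by rewrite gerBl exprn_ge0// ltW.
Qed.

(** Only correlations of lag at most [M] are kept. For fixed [M] their averages converge by
    assumption, the neglected part is O(r^M) uniformly in [n], and [M] is then taken large. *)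
Lemma variance_limit (cor : nat -> nat -> R) (cm b : nat -> R) :
  (forall i m, `|cor i m| <= K * r ^+ m) ->
  (forall m, (\sum_(0 <= i < n) cor i m) / n%:R @[n --> \oo] --> cm m) ->
  (forall k, b k = 2^-1 * cor k 0%N + \sum_(0 <= j < k) cor (k - j.+1)%N j.+1) ->
  (2 * \sum_(0 <= k < n) b k) / n%:R @[n --> \oo] -->
    cm 0%N + 2 * limn (fun n => \sum_(1 <= k < n) cm k).
Proof.
move=> hcor hcm hb; have q0 : 0 < 1 - r by rewrite subr_gt0.
have rp m : 0 <= r ^+ m by rewrite exprn_ge0// ltW.
have cmK m : `|cm m| <= K * r ^+ m.
  apply: (cvgr_to_le (cvg_norm (hcm m))); near=> n.
  have n0 : 0 < n%:R :> R by near: n; exists 1%N => // n /=; rewrite ltr0n.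
  rewrite normrM (ger0_norm (x := _^-1)) ?invr_ge0 ?(ltW n0)// ler_pdivrMr//.
  apply: (le_trans (ler_norm_sum _ _ _)); apply: (@le_trans _ _ (\sum_(0 <= i < n) (K * r ^+ m))).
    by apply: ler_sum.
  by rewrite sumr_const_nat subn0 mulr_natr.
pose z n := \sum_(0 <= j < n) cm j.+1.
have cz : cvgn z.
  apply: (@normed_cvg _ _ (fun j => cm j.+1)).
  apply: (@series_le_cvg _ _ (geometric (K * r) r)) => [j|j|j|].
  - exact: normr_ge0.
  - by rewrite /geometric /= mulr_ge0// mulr_ge0// ltW.
  - by rewrite /geometric /= -mulrA -exprS.
  - by apply: is_cvg_geometric_series; rewrite ger0_norm// ltW.
set l := limn z; have zl : z n @[n --> \oo] --> l by exact: cz.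
have -> : limn (fun n => \sum_(1 <= k < n) cm k) = l.
  apply/cvg_lim => //; rewrite -cvg_shiftS.
  have -> : (fun n => \sum_(1 <= k < n.+1) cm k) = z by apply/funext => n; rewrite big_add1.
  exact: zl.
pose H M k := \sum_(0 <= j < M) (if (j.+1 <= k)%N then cor (k - j.+1)%N j.+1 else 0).
have HM M : (\sum_(0 <= k < n) (cor k 0%N + 2 * H M k)) / n%:R @[n --> \oo] --> cm 0%N + 2 * z M.
  have e n : (\sum_(0 <= k < n) (cor k 0%N + 2 * H M k)) / n%:R = (\sum_(0 <= k < n) cor k 0%N) / n%:R +
     2 * \sum_(0 <= j < M) ((\sum_(0 <= k < n) (if (j.+1 <= k)%N then cor (k - j.+1)%N j.+1 else 0)) / n%:R).
    rewrite big_split /= mulrDl; congr (_ + _); rewrite -mulr_sumr -mulrA; congr (2 * _).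
    by rewrite /H exchange_big /= mulr_suml.
  under eq_fun do rewrite e.
  apply: cvgD; first exact: hcm.
  apply: cvgM; first exact: cvg_cst.
  rewrite /z {e}; elim: M => [|M IH].
    by rewrite big_geq//; under eq_fun do rewrite big_geq//; exact: cvg_cst.
  rewrite big_nat_recr//=; under eq_fun do rewrite big_nat_recr//=.
  apply: cvgD => //; apply: (@shifted_average (fun i => cor i M.+1) (K * r ^+ M.+1)) => //.
pose Kr := K / (1 - r); have Kr0 : 0 <= Kr by rewrite divr_ge0// ltW.
have tail M k : `|\sum_(0 <= j < k) cor (k - j.+1)%N j.+1 - H M k| <= Kr * r ^+ M.
  have [kM|Mk] := leqP k M.
    have -> : H M k = \sum_(0 <= j < k) cor (k - j.+1)%N j.+1.
      rewrite /H (big_cat_nat (n := k) (p := M))//= [X in _ + X]big_nat_cond [X in _ + X]big1; last first.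
        by move=> j; rewrite andbT => /andP[kj _]; rewrite ltnNge kj.
      by rewrite addr0; apply: eq_big_nat => j /andP[_ ->].
    by rewrite subrr normr0 mulr_ge0.
  rewrite /H (big_cat_nat (n := M) (p := k))//=; last exact: ltnW.
  rewrite (_ : \sum_(0 <= j < M) (if _ then _ else _) = \sum_(0 <= j < M) cor (k - j.+1)%N j.+1); last first.
    by apply: eq_big_nat => j /andP[_ jM]; rewrite (leq_trans jM (ltnW Mk)).
  rewrite addrAC subrr add0r /Kr mulrAC; exact: (@geometric_tail (fun j => cor (k - j.+1)%N j.+1)).
have close M n : `|(2 * \sum_(0 <= k < n) b k) / n%:R - (\sum_(0 <= k < n) (cor k 0%N + 2 * H M k)) / n%:R| <=
    2 * (Kr * r ^+ M).
  have [->|n0] := posnP n; first by rewrite mulr0n invr0 !mulr0 subrr normr0 mulr_ge0// mulr_ge0.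
  have nr : 0 < n%:R :> R by rewrite ltr0n.
  rewrite -mulrBl normrM (ger0_norm (x := _^-1)) ?invr_ge0 ?(ltW nr)// ler_pdivrMr// mulr_sumr -sumrB.
  apply: (le_trans (ler_norm_sum _ _ _)).
  apply: (@le_trans _ _ (\sum_(0 <= i < n) (2 * (Kr * r ^+ M)))); last first.
    by rewrite sumr_const_nat subn0 mulr_natr.
  apply: ler_sum => k _; rewrite hb.
  have -> : 2 * (2^-1 * cor k 0%N + \sum_(0 <= j < k) cor (k - j.+1)%N j.+1) - (cor k 0%N + 2 * H M k) =
     2 * (\sum_(0 <= j < k) cor (k - j.+1)%N j.+1 - H M k).
    by set y := \sum_(_ <= _ < _) _; move: y => y; field.
  by rewrite normrM ger0_norm//; apply: ler_wpM2l.
have rM : 2 * (Kr * r ^+ M) @[M --> \oo] --> (0 : R).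
  have -> : (0 : R) = 2 * (Kr * 0) by rewrite !mulr0.
  apply: cvgM; first exact: cvg_cst.
  apply: cvgM; first exact: cvg_cst.
  by apply: cvg_expr; rewrite ger0_norm// ltW.
have lM : cm 0%N + 2 * z M @[M --> \oo] --> cm 0%N + 2 * l.
  by apply: cvgD; [exact: cvg_cst|apply: cvgM => //; exact: cvg_cst].
apply/cvgrPdist_le => e e0; have e3 : 0 < e / 3 by exact: divr_gt0.
have [M [h1 h2]] : exists M, 2 * (Kr * r ^+ M) <= e / 3 /\ `|cm 0%N + 2 * l - (cm 0%N + 2 * z M)| <= e / 3.
  move/cvgrPdist_le : lM => /(_ _ e3) k1; move/cvgrPdist_le : rM => /(_ _ e3) k2.
  have [M [h1 h2]] := filter_ex (filterI k1 k2); exists M; split=> //.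
  by apply: le_trans h2; rewrite sub0r normrN ler_norm.
have /cvgrPdist_le /(_ _ e3) := HM M; apply: filterS => n h3.
have h4 := le_trans (close M n) h1.
set A := _ / n%:R in h4 *; set B := _ / n%:R in h3 h4.
have -> : cm 0%N + 2 * l - A = (cm 0%N + 2 * l - (cm 0%N + 2 * z M)) + (cm 0%N + 2 * z M - B) - (A - B) by ring.
apply: (le_trans (ler_normB _ _)); apply: (le_trans (lerD (le_trans (ler_normD _ _) (lerD h2 h3)) h4)).
by rewrite le_eqVlt; apply/orP; left; apply/eqP; field.
Unshelve. all: by end_near. Qed.

End VarianceLimit.

End RecursionTheory.
Import RecursionTheory.

(** * The central limit theorem on one fibre *)

Module FibreLimitTheory.

Section FibreLimit.
Context {R : realType} {X : surface R} {D : leaf_data X} {N : norm_params R}.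
Context {pr : fam D -> (X -> R[i]) -> R[i]} (cal : multipliers N pr).
Context (mu : {measure set (borel X) -> \bar R}) (hmu : mu setT = 1%E).
Context (T : nat -> pwmap X) (L : nat -> fam D -> fam D) (h : nat -> fam D) (g : nat -> X -> R).
Context (mT : forall k, measurable_fun [set: borel X] (T k : borel X -> borel X)).
Context (hL : forall k, is_transfer_operator N pr (T k) (L k)).
Local Notation bb H x := (bnorm N H%R <= x%R%:E)%E.
Local Notation one := (fun=> 1 : R[i]).
Context (A Kh Dc r : R) (A0 : 0 < A) (gC : forall k, C1fun (g k))
  (gA : forall k, (C1norm (r2c (g k)) <= A%:E)%E)
  (hB : forall k, inB N (h k)) (hK : forall k, bb (h k) Kh) (hS : forall k, L k (h k) = h k.+1)
  (h1 : forall k, pr (h k) one = 1) (hg : forall k, pr (h k) (r2c (g k)) = 0)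
  (h0 : represents pr (h 0%N) mu) (Dc0 : 0 < Dc) (r0 : 0 < r) (r1 : r < 1)
  (decay : forall j n H x, inB N H -> pr H one = 0 -> bb H x -> bb (Lc L j n H) (Dc * r ^+ n * x)).
Local Notation Tk := (Tk T).
Local Notation Sk := (Sk T g).
Local Notation rbX := (@rbm _ (borel X) R).

Definition cor (i m : nat) : R := \int[mu]_x (g i (Tk i x) * g (i + m)%N (Tk (i + m) x)).

Lemma g_C1c k : C1c (r2c (g k)). Proof. by split; [exact: gC|exact: C1fun_cst]. Qed.

(** Propagating the product of [g i] and [h i] for [m] steps keeps the density g_i o T_i on the
    initial fibre while the map advances to time [i + m]. *)
Lemma corE i m : (cor i m)%:C = pr (Lc L i m (mul cal (r2c (g i)) (h i))) (r2c (g (i + m)%N)).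
Proof.
have sp : span (N := N) (pr := pr) mu (Tk (i + m)) (Lc L i m (mul cal (r2c (g i)) (h i)))
    (fun x => r2c (g i) (Tk i x)).
  elim: m => [|m IH].
    rewrite addn0; have s := span_mul cal (mTk mT i) (span_h cal hmu mT hL hB hS h0 i) (g_C1c i).
    by apply: span_eq s => x; rewrite mul1r.
  rewrite addnS; exact: (span_step cal hmu (mTk mT (i + m)) (mT (i + m)) (hL (i + m)) IH).
have [_ _ ->] := span_facts cal hmu (mTk mT (i + m)) sp; last exact: g_C1c.
by rewrite /cor -(cint_r2c hmu); apply: eq_cint => x _; rewrite /r2c rmorphM.
Qed.

(** The product of [g i] and [h i] has mass 0 by centring, so the cocycle contracts it
    geometrically. *)
Lemma cor_bound : exists2 K, 0 <= K & forall i m, `|cor i m| <= K * r ^+ m.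
Proof.
have [Cm Cm0 hCm] := mul_bound cal; have [Cp Cp0 hCp] := pr_bound cal.
have Kh0 : 0 <= Kh := nm_ge0 cal (hK 0).
exists (Cp * (Dc * (Cm * A * Kh)) * A).
  have := ltW A0; have := ltW Dc0; have := ltW Cm0; have := ltW Cp0 => a1 a2 a3 a4.
  by apply: mulr_ge0 => //; apply: mulr_ge0 => //; apply: mulr_ge0 => //; apply: mulr_ge0 => //; exact: mulr_ge0.
move=> i m; rewrite -cabs_real corE.
have mB := in_mul cal (g_C1c i) (hB i).
have m1 : pr (mul cal (r2c (g i)) (h i)) one = 0.
  rewrite (pr_mul cal (g_C1c i) (C1c_cst 1) (hB i)) -(hg i); congr (pr _ _).
  by apply/funext => x; rewrite mulr1.
have d := decay i m mB m1 (hCm _ _ _ _ A0 (g_C1c i) (gA i) (hB i) (hK i)).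
have := hCp _ _ _ _ (Lc_inB hL i m mB) d (g_C1c (i + m)) (ltW A0) (gA (i + m)).
have -> : Cp * (Dc * r ^+ m * (Cm * A * Kh)) * A = Cp * (Dc * (Cm * A * Kh)) * A * r ^+ m by ring.
exact.
Qed.

Lemma bcoef_cor k : bcoef mu T g k = 2^-1 * cor k 0 + \sum_(0 <= j < k) cor (k - j.+1) j.+1.
Proof.
have rg i := rbm_gT mT gC i.
rewrite /bcoef /cor addn0; congr (_ + _).
transitivity (\sum_(0 <= i < k) \int[mu]_x (g i (Tk i x) * g k (Tk k x))).
  rewrite -(exp_sum hmu _ (fun i => rbmM (rg i) (rg k))); apply: eq_Rintegral => x _.
  by rewrite /Sk mulr_suml.
rewrite big_nat_rev add0n; apply: eq_big_nat => j /andP[_ jk].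
by rewrite subnK.
Qed.

Lemma rbm_cos_comp (f : R -> R) (y : X -> R) : continuous f -> (forall z, `|f z| <= 1) -> rbX y ->
  rbX (fun x => f (y x)).
Proof.
move=> cf f1 [my _]; apply: (@rbm_comp _ _ (borel X) _ R y f my).
by split; [exact: continuous_measurable_fun|exists 1].
Qed.

Theorem fibre_clt (s2 : R) : 0 < s2 ->
  (2 * \sum_(0 <= k < n) bcoef mu T g k) / n%:R @[n --> \oo] --> s2 ->
  forall (phi : R -> R) (M : R), continuous phi -> (forall y, `|phi y| <= M) ->
  \int[mu]_x phi (Sk n x / Num.sqrt n%:R) @[n --> \oo] -->
    \int[normal_prob 0 (Num.sqrt s2)]_y phi y.
Proof.
move=> s20 hV phi M cphi hM.
have [C [th0 [C0 th01 bC exp]]] := expansion cal hmu mT hL A0 gC gA hB hK hS h1 hg h0 Dc0 r0 r1 decay.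
have s0 : 0 < Num.sqrt s2 by rewrite sqrtr_gt0.
have rS n := rbm_Sk mT gC n.
have cosb (z : R) : `|cos z| <= 1 by rewrite ler_norml cos_geN1 cos_le1.
have rth th n : rbX (fun x => th * Sk n x) by exact: rbmZ.
have rcos th n := rbm_cos_comp (@continuous_cos R) cosb (rth th n).
have rsin th n := rbm_cos_comp (@continuous_sin R) (@sin_max R) (rth th n).
(* The coefficients [bcoef] are real, so real and imaginary parts obey the recursion separately,
   with initial values 1 and 0; the imaginary part therefore tends to 0. *)
pose xR th n := \int[mu]_x cos (th * Sk n x).
pose xI th n := \int[mu]_x sin (th * Sk n x).
have ccRI th n : `|th| <= 1 -> cc cal L h g th n = xR th n +i* xI th n.
  by move=> th1; rewrite (ccE cal hmu mT hL A0 gC gA hB hS h0 th1).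
have S0 x : Sk 0 x = 0 by rewrite /Sk big_geq.
have step th : 0 < `|th| -> `|th| <= th0 -> forall k,
   `|xR th k.+1 - xR th k + th ^+ 2 * xR th k * bcoef mu T g k| <= C * `|th| ^+ 3 /\
   `|xI th k.+1 - xI th k + th ^+ 2 * xI th k * bcoef mu T g k| <= C * `|th| ^+ 3.
  move=> thp thl k; have th1 : `|th| <= 1 by case/andP: th01 => _; exact: le_trans.
  have := exp th thp thl k; rewrite !ccRI// => b.
  have bR := le_trans (Re_le_cabs _) b; have bI := le_trans (Im_le_cabs _) b.
  split.
    by move: bR; rewrite ReD ReM /= !(mul0r, mulr0, subr0, addr0).
  by move: bI; rewrite ImD ImM /= !(mul0r, mulr0, subr0, addr0, add0r).
have limR (t : R) : t != 0 -> xR (t / Num.sqrt n%:R) n @[n --> \oo] --> expR (- (2^-1 * t ^+ 2 * s2)).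
  move=> t0; rewrite -[expR _]mul1r; apply: (@recursion_limit _ xR (bcoef mu T g) 1 C th0) => //.
  - by rewrite normr1.
  - move=> th; rewrite /xR -[RHS](exp_cst hmu 1); apply: eq_Rintegral => x _.
    by rewrite S0 mulr0 cos0.
  - by move=> th h2 h3 k; have [] := step th h2 h3 k.
have limI (t : R) : t != 0 -> xI (t / Num.sqrt n%:R) n @[n --> \oo] --> (0 : R).
  move=> t0; rewrite -[0](mul0r (expR (- (2^-1 * t ^+ 2 * s2)))).
  apply: (@recursion_limit _ xI (bcoef mu T g) 0 C th0) => //.
  - by rewrite normr0.
  - move=> th; rewrite /xI -[RHS](exp_cst hmu 0); apply: eq_Rintegral => x _.
    by rewrite S0 mulr0 sin0.
  - by move=> th h2 h3 k; have [] := step th h2 h3 k.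
pose Y n (x : borel X) : R := Sk n x / Num.sqrt n%:R.
have rY n : rbX (Y n) by rewrite /Y; apply: rbmM => //; exact: rbm_cst.
have YV n : \int[mu]_x (Y n x * Y n x) <= 2 * C.
  have -> : \int[mu]_x (Y n x * Y n x) = (Num.sqrt n%:R)^-2 * \int[mu]_x (Sk n x * Sk n x).
    rewrite -(expZ hmu _ (rbmM (rS n) (rS n))); apply: eq_Rintegral => x _.
    by rewrite /Y -exprVn; ring.
  rewrite (second_moment hmu mT gC) sqr_sqrtr//; have [->|n0] := posnP n.
    by rewrite big_geq// !mulr0 mulr_ge0// ltW.
  have nr : 0 < n%:R :> R by rewrite ltr0n.
  rewrite mulrCA ler_pM2l// mulrC ler_pdivrMr// (le_trans (ler_norm _))// (le_trans (ler_norm_sum _ _ _))//.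
  apply: (@le_trans _ _ (\sum_(0 <= i < n) C)); first by apply: ler_sum.
  by rewrite sumr_const_nat subn0 mulr_natr.
have hcos (t a : R) : \int[mu]_x cos (t * Y n x + a) @[n --> \oo] -->
    \int[normal_prob 0 (Num.sqrt s2)]_y cos (t * y + a); last first.
  pose nu : probability (measurableTypeR R) R := normal_prob 0 (Num.sqrt s2).
  exact: (@weak_convergence _ _ (borel X) mu hmu nu Y (2 * C) _ rY YV (@normal_tail _ _ s0) hcos phi M cphi hM).
rewrite (normal_cos s0) sqr_sqrtr ?ltW//.
(* The expansion is stated for nonzero [th], hence the separate case. *)
have [->|t0] := eqVneq t 0.
  rewrite expr0n /= mulr0 mul0r oppr0 expR0 mulr1.
  rewrite (_ : (fun n => _) = fun=> cos a); first exact: cvg_cst.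
  apply/funext => n; rewrite -[RHS](exp_cst hmu (cos a)); apply: eq_Rintegral => x _.
  by rewrite mul0r add0r.
rewrite (_ : (fun n => _) = fun n => cos a * xR (t / Num.sqrt n%:R) n - sin a * xI (t / Num.sqrt n%:R) n).
  have -> : cos a * expR (- (s2 * t ^+ 2 / 2)) = cos a * expR (- (2^-1 * t ^+ 2 * s2)) - sin a * 0.
    by rewrite mulr0 subr0; congr (_ * expR (- _)); ring.
  by apply: cvgB; (apply: cvgM; first exact: cvg_cst); [exact: limR|exact: limI].
apply/funext => n; set th := t / _.
have i1 := rcos th n; have i2 := rsin th n.
rewrite /xR /xI -(expZ hmu _ i1) -mulNr -(expZ hmu _ i2) -(expD hmu (rbmZ _ i1) (rbmZ _ i2)).
apply: eq_Rintegral => x _.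
have -> : t * Y n x + a = th * Sk n x + a by rewrite /Y /th mulrA mulrAC.
by rewrite cosD; ring.
Qed.

End FibreLimit.

End FibreLimitTheory.
Import FibreLimitTheory.

(** * Orbits of the base and conclusion for almost every fibre *)

Lemma continuous_borel (E F : ptopologicalType) (f : E -> F) : continuous f ->
  measurable_fun [set: borel E] (f : borel E -> borel F).
Proof.
move=> cf _ B mB; rewrite setTI.
apply: (mB [set B | measurable (f @^-1` B : set (borel E))]%classic); split.
  split=> [|C /= mC|C mC] /=.
  - by rewrite preimage_set0; exact: measurable0.
  - by rewrite setTD preimage_setC; exact: measurableC.
  - by rewrite preimage_bigcup; apply: bigcup_measurable => k _; exact: mC.
by move=> U oU /=; apply: sub_sigma_algebra; move/continuousP : cf => cf; exact: cf.
Qed.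

Section CocycleOrbits.
Context {R : realType} {X : surface R} {Om : Type} (sg : Om -> Om).

Lemma cocycle_Tk (Tw : Om -> pwmap X) k w x :
  cocycle sg (fun w => pm_fun (Tw w)) k w x = Tk (fun j => Tw (iter j sg w)) k x.
Proof. by elim: k => [//|k IH] /=; rewrite IH. Qed.

Lemma cocycle_Lc {D : leaf_data X} (LL : Om -> fam D -> fam D) w j n H :
  Lc (fun k => LL (iter k sg w)) j n H = cocycle sg LL n (iter j sg w) H.
Proof. by elim: n => [//|n IH]; rewrite [LHS]/= IH (addnC j n) iterD. Qed.

Lemma skew_iter (f : Om -> X -> X) m (w : Om) (x : X) :
  iter m (Defs.skew sg f) (w, x) = (iter m sg w, cocycle sg f m w x).
Proof. by elim: m => [//|m IH]; rewrite iterS IH. Qed.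

End CocycleOrbits.


Theorem theorem5 (R : realType)
  (* the surface and its Riemannian area *)
  (X : surface R) (vol : {measure set (borel X) -> \bar R})
  (hvol : is_area vol)
  (* the piecewise hyperbolic map T *)
  (T : pwmap X) (Cs Cu : X -> set (R * R)) (al0 : R) (n0 : nat)
  (hT : piecewise_hyperbolic al0 n0 T Cs Cu)
  (* admissible leaves, norms, the pairing h(phi) *)
  (D : leaf_data X) (hD : admissible_leaf_data D T Cs)
  (N : norm_params R) (hN : admissible_params al0 N)
  (pr : fam D -> (X -> R[i]) -> R[i]) (hpr : is_pairing N vol pr)
  (* spectral assumption on T *)
  (LT : fam D -> fam D) (hLT : is_transfer_operator N pr T LT)
  (hqc : quasicompact N LT) (hsimple : one_simple_dominant N LT)
  (* the base system *)
  (Om : ptopologicalType) (hOm : borel_subset_of_polish (R := R) Om)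
  (P : probability (borel Om) R) (sg : Om -> Om)
  (hsg : homeomorphism sg) (herg : ergodic_pmp P sg)
  (* the cocycle of maps in X_eps *)
  (U : class_consts R) (hTU : in_class D al0 n0 U T Cs Cu)
  (eps : R) (heps : 0 < eps)
  (Tw : Om -> pwmap X) (hTw : forall w, X_eps D al0 n0 U T eps (Tw w))
  (hcount : countable (range Tw))
  (hmeas : forall S : pwmap X, measurable (Tw @^-1` [set S] : set (borel Om)))
  (LL : Om -> fam D -> fam D)
  (hLL : forall w, is_transfer_operator N pr (Tw w) (LL w))
  (* consequences of the choice of eps *)
  (hcompact : unit_ball_relatively_compact D N)
  (hunif : uniform_estimates N sg pr LL)
  (* the equivariant family and the measure mu *)
  (h0 : Om -> fam D) (hh0 : equivariant_family N P sg pr LL h0)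
  (muw : R.-pker (borel Om) ~> (borel X))
  (hmuw : {ae P, forall w : borel Om, represents pr (h0 w) (muw w)})
  (mu : probability (borel Om * borel X)%type R)
  (hmu : forall (A : set (borel Om)) (B : set (borel X)),
    measurable A -> measurable B ->
    mu (A `*` B) = (\int[P]_(w in A) muw w B)%E)
  (* the observable *)
  (g : Om -> X -> R) (hg : observable P pr h0 g)
  (hvar : 0 < asymptotic_variance mu sg (fun w => pm_fun (Tw w)) g)
  (phi : R -> R) (hphi : continuous phi)
  (hphib : exists M : R, forall x, `|phi x| <= M) :
  {ae P, forall w : borel Om,
    (\int[muw w]_x phi (birkhoff sg (fun w => pm_fun (Tw w)) g n w x / Num.sqrt n%:R))
      @[n --> \oo] -->
    (\int[normal_prob 0 (Num.sqrt (asymptotic_variance mu sg (fun w => pm_fun (Tw w)) g))]_y phi y : R)}.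
Proof.
have [[hk hr0 htau _] hch hcov _] := hD.
have [[_ _ hq] [hbe0 hbeal halq _] [hb he0]] := hN.
have hal := lt_le_trans hbe0 hbeal; have hbe := le_trans hbeal halq.
have cov (x : X) : exists i, limage (ld_chart (l := D) i) x.
  by have [i [p [k1 _ k3]]] := hcov x; exists i, p.
have [h0B _ hequi hpos [Kh hKh]] := hh0.
have [mg gC [K0 hgK] hcent] := hg.
have mTw w : measurable_fun [set: borel X] (Tw w : borel X -> borel X).
  have [[Cs' [Cu' [[ps _ _ _ _] _ _ _ _]]] _ _ _] := hTw w.
  (* Measurability is the thirteenth and last clause of [piecewise_smooth]. *)
  by do 12! (case: ps => _ ps).
(* Without probes all families coincide, so [h0 w] equals 0 times itself and has mass 0, against its
   mass 1. *)
have [[p0 _]|nop] := pselect (exists p : probe D, True); last first.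
  apply: filterS hpos => w [_ k1]; exfalso; have [_ _ hsc _] := hpr.
  have e : h0 w = fscale 0 (h0 w) by apply/funext => p; case: nop; exists p.
  have := hsc 0 (h0 w) (fun=> 1) (h0B w) (C1c_cst 1).
  by rewrite -e k1 mul0r => /eqP; rewrite oner_eq0.
have cal := multipliers_exist hk hr0 htau hch hq hal hb he0 hbe p0 hpr cov.
have [Dc [lam [Bc [a0 [Dc0 lam0 _ _ est]]]]] := hunif.
pose r := expR (- lam); have r0 : 0 < r by exact: expR_gt0.
have r1 : r < 1 by rewrite -[ltRHS]expR0 ltr_expR oppr_lt0.
have rn n : expR (- lam * n%:R) = r ^+ n by first [by rewrite expRM_natr|by rewrite mulrC expRM_natl].
pose A := `|K0| + 1; have A0 : 0 < A by rewrite ltr_wpDl.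
have hgA : {ae P, forall w : borel Om, (C1norm (r2c (g w)) <= A%:E)%E}.
  apply: filterS hgK => w /le_trans; apply; rewrite lee_fin (le_trans (ler_norm _))// lerDl ler01//.
have aeI (A1 A2 : borel Om -> Prop) : {ae P, forall w, A1 w} -> {ae P, forall w, A2 w} ->
    {ae P, forall w, A1 w /\ A2 w}.
  by move=> k1 k2; apply: filterS2 k1 k2 => w; split.
(* Gathers the almost sure hypotheses at one base point; invariance of [P] then gives them along the
   whole orbit of almost every point. *)
pose Q (w : borel Om) := [/\ LL w (h0 w) = h0 (sg w), pr (h0 w) (fun=> 1) = 1,
  (bnorm N (h0 w) <= Kh%:E)%E, represents pr (h0 w) (muw w) &
  (C1norm (r2c (g w)) <= A%:E)%E /\ pr (h0 w) (r2c (g w)) = 0].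
have hQ : {ae P, forall w, Q w}.
  by apply: filterS (aeI _ _ (aeI _ _ hequi hpos) (aeI _ _ (aeI _ _ hKh hmuw) (aeI _ _ hgA hcent))) =>
    w [[a1 [_ a2]] [[a3 a4] [a5 a6]]]; split.
have msg : measurable_fun [set: borel Om] (sg : borel Om -> borel Om).
  by case: hsg => sg' [_ _ csg _]; exact: continuous_borel.
have [Pinv Perg] := herg.
have orb := ae_orbit msg Pinv hQ.
pose f (w : Om) := pm_fun (Tw w).
pose sk : borel Om * borel X -> borel Om * borel X := Defs.skew sg f.
have msk : measurable_fun setT sk.
  apply: measurable_fun_pair; first exact: (measurableT_comp msg measurable_fst).
  exact: (@measurable_countable_family _ _ _ (borel Om) (borel X) (borel X) (pwmap X) Tw
    (fun S => S : borel X -> borel X) hcount hmeas mTw).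
have msk_iter m : measurable_fun setT (iter m sk).
  by elim: m => [|m IH]; [exact: measurable_id|exact: (measurableT_comp msk IH)].
(* The bound on [g] holds only for almost every base point. Truncation at [A] yields a function
   bounded everywhere that coincides with [g] along good orbits. *)
pose cl (y : R) := Num.max (- A) (Num.min A y).
have clE y : `|y| <= A -> cl y = y.
  by rewrite ler_norml => /andP[k1 k2]; rewrite /cl min_r// max_r.
have nA : - A <= A by move: A0; clear; move: A => a; lra.
have cl_le y : `|cl y| <= A by rewrite ler_norml /cl le_max lexx /= ge_max nA ge_min lexx.
have mcl : measurable_fun [set: R] cl.
  have m1 : measurable_fun [set: R] (fun _ : R => - A) by exact: measurable_cst.
  have m2 : measurable_fun [set: R] (fun _ : R => A) by exact: measurable_cst.
  have m3 : measurable_fun [set: R] (fun y : R => y) by exact: measurable_id.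
  by first [exact: (measurable_maxr m1 (measurable_minr m2 m3))|
    apply: (measurable_maxr m1); exact: (measurable_minr m2 m3)|
    apply: measurable_maxr => //; exact: measurable_minr].
pose G (z : borel Om * borel X) := cl (g z.1 z.2).
have rG : rbm G by split; [exact: (measurableT_comp mcl mg)|exists A => z; exact: cl_le].
pose F m z := G z * G (iter m sk z).
have rF m : rbm (F m) by apply: rbmM => //; exact: (rbm_comp (msk_iter m) rG).
(* The fibrewise correlation as a function of the base point; the ergodic theorem is applied to it
   for each lag [m]. *)
pose Cm m w := \int[muw w]_x F m (w, x).
have disF m := disintegrate hmu (rF m).
have muw1 w : muw w setT = 1%E by exact: prob_kernel.
have gb w : (C1norm (r2c (g w)) <= A%:E)%E -> forall x, `|g w x| <= A.
  by move=> /C1norm_ge[k _] x; have := k x; rewrite cabs_real.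
(* Good orbits carry full [mu]-measure, since every fibre measure is a probability; this allows [g]
   to be replaced by its truncation in the terms of the variance. *)
have orb_mu : {ae mu, forall z : borel Om * borel X, forall n, Q (iter n sg z.1)}.
  have [Z [mZ Z0 sub]] := orb.
  exists (Z `*` setT)%classic; split; [exact: measurableX| |by move=> z hz; split=> //; exact: sub].
  transitivity (\int[P]_(w in Z) muw w setT)%E; first exact: hmu.
  rewrite (eq_integral (cst 1%E)); last by move=> w _; exact: muw1.
  by rewrite integral_cst// mul1e; exact: Z0.
have corF m : \int[mu]_z (g z.1 z.2 * g (iter m sk z).1 (iter m sk z).2) = \int[mu]_z F m z.
  rewrite /Rintegral; congr fine; apply: ae_eq_integral => //.
  - apply/measurable_EFinP; apply: measurable_funM; first exact: mg.
    exact: (measurableT_comp mg (msk_iter m)).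
  - by apply/measurable_EFinP; case: (rF m).
  - apply: filterS orb_mu => -[w x] hz _; rewrite /F /G /sk skew_iter /=.
    have [_ _ _ _ [b1 _]] := hz 0%N; have [_ _ _ _ [b2 _]] := hz m.
    by rewrite !clE//; exact: gb.
set s2 := asymptotic_variance _ _ _ _ in hvar *.
have s2E : s2 = \int[mu]_z F 0%N z + 2 * limn (fun n => \sum_(1 <= k < n) \int[mu]_z F k z).
  have e0 : \int[mu]_z F 0%N z = \int[mu]_z (g z.1 z.2 ^+ 2).
    by rewrite -(corF 0%N); apply: eq_Rintegral => z _; rewrite expr2.
  have e1 : (fun n => \sum_(1 <= k < n) \int[mu]_z F k z) = fun n => \sum_(1 <= k < n)
      \int[mu]_z (g z.1 z.2 * g (iter k sk z).1 (iter k sk z).2).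
    by apply/funext => n; apply: eq_big_nat => k _; exact/esym/corF.
  by rewrite e0 e1.
have erg := ae_seq (fun m => pointwise_ergodic msg Pinv Perg (proj1 (disF m))).
pose Ts (w : Om) k := Tw (iter k sg w); pose Ls (w : Om) k := LL (iter k sg w).
pose hs (w : Om) k := h0 (iter k sg w); pose gs (w : Om) k := g (iter k sg w).
have mTs w k : measurable_fun [set: borel X] (Ts w k : borel X -> borel X) by exact: mTw.
have hLs w k : is_transfer_operator N pr (Ts w k) (Ls w k) by exact: hLL.
have gCs w k : C1fun (gs w k) by exact: gC.
have hBs w k : inB N (hs w k) by exact: h0B.
have hSs w : (forall n, Q (iter n sg w)) -> forall k, Ls w k (hs w k) = hs w k.+1.
  by move=> hw k; have [e _ _ _ _] := hw k.
have hrs w : (forall n, Q (iter n sg w)) -> represents pr (hs w 0%N) (muw w).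
  by move=> hw; have [_ _ _ e _] := hw 0%N.
have Qi w i : (forall n, Q (iter n sg w)) -> forall n, Q (iter n sg (iter i sg w)).
  by move=> hw n; rewrite -iterD.
(* Through [corE] both correlations are the same pairing, read from time [i] along the orbit of [w],
   or from time 0 along the orbit of its [i]-th image. *)
have stat w i m : (forall n, Q (iter n sg w)) ->
    cor (muw w) (Ts w) (gs w) i m = cor (muw (iter i sg w)) (Ts (iter i sg w)) (gs (iter i sg w)) 0 m.
  move=> hw; have hwi := Qi w i hw.
  have e1 := corE cal (muw1 w) (mTs w) (hLs w) (gCs w) (hBs w) (hSs w hw) (hrs w hw) i m.
  have e2 := corE cal (muw1 (iter i sg w)) (mTs (iter i sg w)) (hLs (iter i sg w)) (gCs (iter i sg w))
    (hBs (iter i sg w)) (hSs _ hwi) (hrs _ hwi) 0%N m.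
  suff e : pr (Lc (Ls w) i m (mul cal (r2c (gs w i)) (hs w i))) (r2c (gs w (i + m)%N)) =
      pr (Lc (Ls (iter i sg w)) 0 m (mul cal (r2c (gs (iter i sg w) 0%N)) (hs (iter i sg w) 0%N)))
         (r2c (gs (iter i sg w) (0 + m)%N)).
    by have := congr1 (@complex.Re R) (etrans e1 (etrans e (esym e2))).
  by rewrite /Ls !cocycle_Lc /gs add0n (addnC i m) iterD.
have CmE w m : (forall n, Q (iter n sg w)) -> Cm m w = cor (muw w) (Ts w) (gs w) 0 m.
  move=> hw; apply: eq_Rintegral => x _; rewrite /F /G /sk skew_iter /=.
  have [_ _ _ _ [b1 _]] := hw 0%N; have [_ _ _ _ [b2 _]] := hw m.
  by rewrite !clE ?gb// add0n /f cocycle_Tk.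
apply: filterS (aeI _ _ orb erg) => w [hw hE].
have gAs k : (C1norm (r2c (gs w k)) <= A%:E)%E by have [_ _ _ _ [e _]] := hw k.
have hgs k : pr (hs w k) (r2c (gs w k)) = 0 by have [_ _ _ _ [_ e]] := hw k.
have hKs k : (bnorm N (hs w k) <= Kh%:E)%E by have [_ _ e _ _] := hw k.
have h1s k : pr (hs w k) (fun=> 1) = 1 by have [_ e _ _ _] := hw k.
have decay j n H x : inB N H -> pr H (fun=> 1) = 0 -> (bnorm N H <= x%:E)%E ->
    (bnorm N (Lc (Ls w) j n H) <= (Dc * r ^+ n * x)%:E)%E.
  move=> hH p1 hx; rewrite /Ls cocycle_Lc; have [/(_ p1) k _ _] := est (iter j sg w) n H hH.
  rewrite rn in k; apply: (le_trans k); rewrite (EFinM _ x); apply: lee_wpmul2l => //.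
  by rewrite lee_fin mulr_ge0 ?exprn_ge0// ltW.
have hmu1 := muw1 w; have hSw := hSs w hw; have hrw := hrs w hw.
have [K K_ge0 hK] := cor_bound cal hmu1 (mTs w) (hLs w) A0 (gCs w) gAs (hBs w) hKs hSw hgs hrw Dc0 decay.
(* By [stat] the averages of correlations along the orbit are Birkhoff averages of [Cm m], and
   disintegration identifies their limit with the term of lag [m] in the variance. *)
have hV : (2 * \sum_(0 <= k < n) bcoef (muw w) (Ts w) (gs w) k) / n%:R @[n --> \oo] --> s2.
  rewrite s2E; apply: (variance_limit (cm := fun m => \int[mu]_z F m z) K_ge0 r0 r1 hK).
    move=> m; have := hE m; rewrite -(proj2 (disF m)).
    rewrite (_ : (fun n => bsum _ _ _ _ / _) = fun n => (\sum_(0 <= i < n) cor (muw w) (Ts w) (gs w) i m) / n%:R) //.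
    apply/funext => n; congr (_ / _); apply: eq_bigr => i _.
    by rewrite stat// -CmE//; exact: Qi.
  exact: (bcoef_cor hmu1 (mTs w) (gCs w)).
have [M hM] := hphib.
have := fibre_clt cal hmu1 (mTs w) (hLs w) A0 (gCs w) gAs (hBs w) hKs hSw h1s hgs hrw Dc0 r0 r1 decay
  hvar hV hphi hM.
rewrite (_ : (fun n => \int[muw w]_x phi (birkhoff _ _ _ n w x / _)) =
  fun n => \int[muw w]_x phi (Sk (Ts w) (gs w) n x / Num.sqrt n%:R)) //.
apply/funext => n; apply: eq_Rintegral => x _; congr (phi (_ / _)).
by apply: eq_bigr => i _; rewrite cocycle_Tk.
Qed.
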